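(* Let $W:\mathbb{R}^d\to\mathbb{R}$ be of class $C^2$, symmetric ($W(z)=W(-z)$), with $\sup_{z,v\in\mathbb{R}^d,|v|=1}|v\cdot\nabla^2W(z)\cdot v|<+\infty$, and let $\mu^{\mathrm{in}},\mu^{\mathrm{fin}}\in\mathcal{P}_2(\mathbb{R}^d)$ satisfy $\tilde{\mathcal F}(\mu^{\mathrm{in}})<+\infty$ and $\tilde{\mathcal F}(\mu^{\mathrm{fin}})<+\infty$. Let $P$ be an optimizer for (MFSP), $\Psi$ its corrector, and set $\mu_t=P_t$ for $t\in[0,T]$. If $(t,x)\mapsto\mu_t(x)$ is everywhere positive and of class $C^{1,2}([0,T]\times\mathbb R^d;\mathbb R)$ and $(t,x)\mapsto\Psi_t(x)$ is of class $C^{1,2}([0,T]\times\mathbb R^d;\mathbb R^d)$, then there exists $\psi:[0,T]\times\mathbb R^d\to\mathbb R$ such that $\Psi_t(x)=\nabla\psi_t(x)$ for all $(t,x)\in[0,T]\times\mathbb R^d$ and such that $(\psi,\mu)$ is a classical solution of $$\begin{cases}\partial_t\psi_t(x)+\frac12\Delta\psi_t(x)+\frac12|\nabla\psi_t(x)|^2=\int_{\mathbb R^d}\nabla W(x-\tilde x)\cdot(\nabla\psi_t(x)-\nabla\psi_t(\tilde x))\,\mu_t(d\tilde x),\\ \partial_t\mu_t(x)-\frac12\Delta\mu_t(x)+\nabla\cdot\big((-\nabla W*\mu_t(x)+\nabla\psi_t(x))\mu_t(x)\big)=0,\\ \mu_0(x)=\mu^{\mathrm{in}}(x),\quad \mu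_T(x)=\mu^{\mathrm{fin}}(x).\end{cases}$$
   Context: Fix $d\ge1$, $T>0$. $\Omega=C([0,T];\mathbb{R}^d)$ with the uniform topology; $X=(X_t)_{t\in[0,T]}$ is the canonical process. $P_t$ is the law of $X_t$ under $P$; $\mathcal P_1(\Omega)$ is the set of Borel probability measures $P$ on $\Omega$ with $\mathbb E_P[\sup_{t\le T}|X_t|]<\infty$; $\mathcal P_2(\mathbb R^d)$ is the set of Borel probability measures on $\mathbb R^d$ with finite second moment. A measure and its Lebesgue density are denoted by the same symbol. $\mathcal H(P|Q)=\mathbb E_P[\log\frac{dP}{dQ}]$ if $P\ll Q$ and $+\infty$ otherwise. $\nabla W*\mu(x)=\int\nabla W(x-y)\,\mu(dy)$, similarly $W*\mu$. $\tilde{\mathcal F}(\mu)=\int\log\mu(x)\,\mu(dx)+\int W*\mu(x)\,\mu(dx)$ if $\mu$ is absolutely continuous with respect to Lebesgue measure, and $+\infty$ otherwise. For $P\in\mathcal P_1(\Omega)$, $\Gamma(P)$ is the law of the unique strong solution of $dZ_t=-\nabla W*P_t(Z_t)\,dt+dB_t$, $Z_0\sim\mu^{\mathrm{in}}$, with $B$ a Brownian motion. (MFSP) is the problem $\inf\{\mathcal H(P|\Gamma(P)): P\in\mathcal P_1(\Omega), P_0=\mu^{\mathrm{in}},P_T=\mu^{\mathrm{fin}}\}$. $\mathrm H_{-1}((\mu_t)_{t\in[0,T]})$ is the closure in $L^2([0,T]\times\mathbb R^d,\mu_t(dx)dt;\mathbb R^d)$ of $\{\nabla\psi:\psi\in C_c^\infty([0,T]\times\mathbb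 R^d)\}$. The corrector of an optimizer $P$ of (MFSP) is the vector field $\Psi\in\mathrm H_{-1}((P_t)_{t\in[0,T]})$ such that $X_t-\int_0^t(-\nabla W*P_s(X_s)+\Psi_s(X_s))ds$ is a Brownian motion under $P$ with initial law $\mu^{\mathrm{in}}$, and such that, with $\tilde X$ an independent copy of $X$ on $(\tilde\Omega,\tilde{\mathcal F},\tilde P)$, $\Psi_t(X_t)-\int_0^t\tilde{\mathbb E}_{\tilde P}[\nabla^2W(X_s-\tilde X_s)\cdot(\Psi_s(X_s)-\Psi_s(\tilde X_s))]ds$ is a continuous martingale under $P$ on $[0,T[$. $C^{1,2}$ denotes one continuous time derivative and two continuous space derivatives; $\nabla,\Delta$ act in space only. *)

(* Defs.v *)
From HB Require Import structures.
From mathcomp Require Import all_boot all_order all_algebra.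
From mathcomp Require Import all_classical all_reals all_analysis.
From mathcomp Require Import measurable_realfun.

Set Implicit Arguments.
Unset Strict Implicit.
Unset Printing Implicit Defensive.

Import Order.TTheory GRing.Theory Num.Theory.
Import numFieldNormedType.Exports.

Local Open Scope classical_set_scope.
Local Open Scope ring_scope.

(* Borel sigma-algebra. *)
HB.instance Definition _ (R : realType) (m n : nat) :=
  Measurable.copy 'M[R]_(m, n) (g_sigma_algebraType (@open 'M[R]_(m, n))).

Section borel_rV.
Context {R : realType}.

Lemma open_measurable_rV n (A : set 'rV[R]_n) : open A -> measurable A.
Proof. exact: sub_sigma_algebra. Qed.

Lemma measurable_coord n (i : 'I_n) :
  measurable_fun setT (fun x : 'rV[R]_n => x ord0 i).
Proof.
apply: (@measurability _ _ _ _ _ _ _ (measurable_realfun.RGenOpens.measurableE R)).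
move=> _ [B [a [b ->]] <-]; rewrite setTI; apply: open_measurable_rV.
apply: open_comp; last exact: interval_open.
by move=> x _; exact: coord_continuous.
Qed.

Lemma measurable_rV d (T : measurableType d) n (f : T -> 'rV[R]_n) :
  (forall i, measurable_fun setT (fun x => f x ord0 i)) ->
  measurable_fun setT f.
Proof.
move=> mf; apply: (@measurability _ _ _ _ _ _ (@open 'rV[R]_n)) => //.
move=> _ [A oA <-]; rewrite setTI.
pose B (p : 'rV[rat]_n * nat) : set 'rV[R]_n :=
  [set x | forall i, `|ratr (p.1 ord0 i) - x ord0 i| < p.2.+1%:R^-1].
have -> : A = \bigcup_(p in [set p | B p `<=` A]) B p.
  rewrite eqEsubset; split=> [x Ax|x [p BA /BA]//].
  have /nbhs_ballP[e /= e0 xeA] : nbhs x A by exact: open_nbhs_nbhs.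
  pose k := Num.truncn (2 / e).
  have ke : k.+1%:R^-1 * 2 < e.
    by rewrite mulrC ltr_pdivrMr// mulrC -ltr_pdivrMr// truncnS_gt.
  have q_ i : {q : rat | `|ratr q - x ord0 i| < k.+1%:R^-1}.
    apply: cid.
    have [|q] := @rat_in_itvoo R (x ord0 i - k.+1%:R^-1) (x ord0 i + k.+1%:R^-1).
      by rewrite ltrBlDr -addrA ltrDl addr_gt0.
    by rewrite in_itv/= -ltr_distl => ?; exists q.
  exists (\row_i sval (q_ i), k); last first.
    by move=> i /=; rewrite mxE; exact: (svalP (q_ i)).
  move=> y Byk; apply: xeA; split => // i j.
  rewrite (ord1 i) /ball/=.
  have := Byk j; rewrite /= mxE; have /= := svalP (q_ j).
  move: (ratr _ : R) => q h1 h2.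
  apply: le_lt_trans ke; rewrite (_ : x 0 j - y 0 j =
    (x ord0 j - q) + (q - y ord0 j)); last by rewrite addrA subrK.
  rewrite (le_trans (ler_normD _ _))// mulr_natr mulr2n lerD//.
    by rewrite distrC ltW.
  exact: ltW.
rewrite preimage_bigcup bigcup_mkcond.
apply: countable_bigcupT_measurable => //= p; case: ifPn => // _.
rewrite (_ : _ @^-1` _ =
  \big[setI/setT]_i [set x | `|ratr (p.1 ord0 i) - f x ord0 i| < p.2.+1%:R^-1]).
  apply: bigsetI_measurable => i _.
  rewrite -[X in measurable X]setTI.
  apply: (@measurable_fun_ltr _ _ _ setT _ (cst p.2.+1%:R^-1)) => //.
  by apply: measurableT_comp => //; apply: measurable_funB.
rewrite -bigcap_seq; apply/seteqP; split => x /=; first by move=> H i _; exact: H.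
by move=> H i; apply: H; rewrite /= mem_index_enum.
Qed.

End borel_rV.

Section lebesgue_rV.
Context {R : realType}.

Definition rV_cons n (p : R * 'rV[R]_n) : 'rV[R]_n.+1 :=
  \row_i oapp (fun j => p.2 ord0 j) p.1 (unlift ord0 i).

Definition rV_uncons n (x : 'rV[R]_n.+1) : R * 'rV[R]_n :=
  (x ord0 ord0, \row_j x ord0 (lift ord0 j)).

Lemma rV_consK n : cancel (@rV_cons n) (@rV_uncons n).
Proof.
case=> a x; congr (_, _); first by rewrite mxE unlift_none.
by apply/rowP => j; rewrite !mxE liftK.
Qed.

Lemma measurable_rV_cons n : measurable_fun setT (@rV_cons n).
Proof.
apply: measurable_rV => i; under eq_fun do rewrite mxE.
case: (unlift ord0 i) => [j|] /=; last exact: measurable_fst.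
exact: (measurableT_comp (measurable_coord j) measurable_snd).
Qed.

Lemma measurable_rV_uncons n : measurable_fun setT (@rV_uncons n).
Proof.
apply/measurable_fun_pairP; split; first exact: measurable_coord.
apply: measurable_rV => j; rewrite /comp /=; under eq_fun do rewrite mxE.
exact: measurable_coord.
Qed.

HB.instance Definition _ n :=
  isMeasurableFun.Build _ _ _ _ (@rV_cons n) (@measurable_rV_cons n).

Section lebesgue_rV_succ.
Variables (n : nat) (mu : {sigma_finite_measure set 'rV[R]_n -> \bar R}).

Definition lebesgue_succ : set 'rV[R]_n.+1 -> \bar R :=
  pushforward (@lebesgue_measure R \x mu)%E (@rV_cons n).

Let m : {measure set 'rV[R]_n.+1 -> \bar R} :=
  measure_function_pushforward__canonical__measure_function_Measure
    (@lebesgue_measure R \x mu)%E (@measurable_rV_cons n).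

Let lebesgue_succ0 : lebesgue_succ set0 = 0%E.
Proof. by rewrite /lebesgue_succ /pushforward preimage_set0 measure0. Qed.

Let lebesgue_succ_ge0 A : (0 <= lebesgue_succ A)%E.
Proof. exact: (@measure_ge0 _ _ _ m). Qed.

Let lebesgue_succ_sigma_additive : semi_sigma_additive lebesgue_succ.
Proof. exact: (@measure_semi_sigma_additive _ _ _ m). Qed.

HB.instance Definition _ := isMeasure.Build _ _ _ lebesgue_succ
  lebesgue_succ0 lebesgue_succ_ge0 lebesgue_succ_sigma_additive.

Let lebesgue_succ_sigma_finite : sigma_finite setT lebesgue_succ.
Proof.
have /sigma_finiteP[F [FT ndF Foo]] := sigma_finiteT (@lebesgue_measure R).
have /sigma_finiteP[G [GT ndG Goo]] := sigma_finiteT mu.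
exists (fun k => @rV_uncons n @^-1` (F k `*` G k)).
  rewrite -preimage_bigcup -[LHS](preimage_setT (@rV_uncons n)); congr (_ @^-1` _).
  rewrite -setXTT FT GT predeqE => -[x y]; split.
    move=> [/= [i _ Fix] [j _ Gjy]]; exists (maxn i j) => //; split.
    - by move: x Fix; exact/subsetPset/ndF/leq_maxl.
    - by move: y Gjy; exact/subsetPset/ndG/leq_maxr.
  by move=> [i _ []/= ? ?]; split; exists i.
move=> k; have [? ?] := Foo k; have [? ?] := Goo k; split.
  rewrite -[X in measurable X]setTI; apply: measurable_rV_uncons => //.
  exact: measurableX.
rewrite /lebesgue_succ /pushforward -comp_preimage.
rewrite (_ : _ \o _ = id); last by apply/funext => x; exact: rV_consK.
by rewrite preimage_id product_measure1E// lte_mul_pinfty// ge0_fin_numE.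
Qed.

HB.instance Definition _ := Measure_isSigmaFinite.Build _ _ _ lebesgue_succ
  lebesgue_succ_sigma_finite.

End lebesgue_rV_succ.

(* Lebesgue measure on R^n, as the n-fold product of the one-dimensional one. *)
Fixpoint lebesgue_rV n : {sigma_finite_measure set 'rV[R]_n -> \bar R} :=
  if n is n'.+1 then lebesgue_succ (lebesgue_rV n') else \d_(0 : 'rV[R]_0).

End lebesgue_rV.

Section vector_calculus.
Context {R : realType} {d : nat}.
Implicit Types (f : 'rV[R]_d -> R) (F : 'rV[R]_d -> 'rV[R]_d).

Definition dotv (u v : 'rV[R]_d) : R := \sum_i u ord0 i * v ord0 i.

(* Euclidean norm; the library norm on matrices is the sup norm. *)
Definition enorm (u : 'rV[R]_d) : R := Num.sqrt (dotv u u).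

Definition partial (i : 'I_d) f (x : 'rV[R]_d) : R := 'D_(delta_mx ord0 i) f x.

Definition grad f (x : 'rV[R]_d) : 'rV[R]_d := \row_i partial i f x.

Definition hess f (x : 'rV[R]_d) : 'M[R]_d :=
  \matrix_(i, j) partial i (partial j f) x.

Definition laplacian f (x : 'rV[R]_d) : R := \sum_i partial i (partial i f) x.

Definition divergence F (x : 'rV[R]_d) : R :=
  \sum_i partial i (fun y => F y ord0 i) x.

Definition pderivable (i : 'I_d) f (x : 'rV[R]_d) : Prop :=
  derivable f x (delta_mx ord0 i).

Definition time_quot (f : R -> 'rV[R]_d -> R) (t : R) (x : 'rV[R]_d) (s : R) : R :=
  (s - t)^-1 * (f s x - f t x).

(* Time derivative relative to the time set [I] (one-sided at an end point). *)
Definition dt (I : set R) (f : R -> 'rV[R]_d -> R) (t : R) (x : 'rV[R]_d) : R :=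
  lim (time_quot f t x @ within I t^').

Definition continuous_tx (I : set R) (f : R -> 'rV[R]_d -> R) : Prop :=
  {within I `*` setT, continuous (fun p : R * 'rV[R]_d => f p.1 p.2)}.

Definition C12 (I : set R) (f : R -> 'rV[R]_d -> R) : Prop :=
  [/\ forall t x, I t ->
        [/\ cvg (time_quot f t x @ within I t^'),
            forall i, pderivable i (f t) x &
            forall i j, pderivable j (partial i (f t)) x],
      continuous_tx I f /\ continuous_tx I (dt I f),
      forall i, continuous_tx I (fun t => partial i (f t)) &
      forall i j, continuous_tx I (fun t => partial j (partial i (f t)))].

End vector_calculus.

(* On a finite-dimensional space this is the class C^n: the iterated
   directional derivatives up to order n exist everywhere and are continuous. *)
Fixpoint class_C {R : realType} {V : normedModType R} (n : nat) (f : V -> R)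
    : Prop :=
  continuous f /\
  if n is k.+1 then
    forall v, (forall x, derivable f x v) /\ class_C k (fun x => 'D_v f x)
  else True.

Definition vint {R : realType} {d : nat} {dS : measure_display}
    {S : measurableType dS} (mu : {measure set S -> \bar R}) (D : set S)
    (F : S -> 'rV[R]_d) : 'rV[R]_d :=
  \row_i \int[mu]_(x in D) (F x ord0 i).

Section functionals.
Context {R : realType} {d : nat}.
Implicit Types (m : probability 'rV[R]_d R) (W : 'rV[R]_d -> R).

Definition conv W m (x : 'rV[R]_d) : R := \int[m]_y W (x - y).

Definition convgrad W m (x : 'rV[R]_d) : 'rV[R]_d :=
  vint m setT (fun y => grad W (x - y)).

Definition finite_second_moment m : Prop :=
  (\int[m]_x (enorm x ^+ 2)%:E < +oo)%E.

Definition has_density m (f : 'rV[R]_d -> R) : Prop :=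
  measurable_fun setT f /\
  forall A, measurable A -> m A = (\int[lebesgue_rV d]_(x in A) (f x)%:E)%E.

(* [Radon_Nikodym] is the Lebesgue density of [m]; for [m] with finite second
   moment and [W] of at most quadratic growth, the second integral is finite and
   the first one does not take the value -oo. *)
Definition free_energy W m : \bar R :=
  if `[< m `<< @lebesgue_rV R d >] then
    (\int[m]_x
       (ln (fine (Radon_Nikodym (charge_of_finite_measure m) (lebesgue_rV d) x)))%:E
     + \int[m]_x (conv W m x)%:E)%E
  else +oo%E.

End functionals.

Definition rel_entropy {R : realType} {dS : measure_display}
    {S : measurableType dS} (P Q : probability S R) : \bar R :=
  if `[< P `<< Q >] then
    (\int[P]_w (ln (fine (Radon_Nikodym (charge_of_finite_measure P) Q w)))%:E)%E
  else +oo%E.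

(* C([0,T]; R^d): a path is represented by its unique extension to R that is
   constant on ]-oo, 0] and on [T, +oo[. *)
Section path_space.
Context {R : realType}.

Definition clamp (T t : R) : R := Num.max 0 (Num.min t T).

Record path_space (d : nat) (T : R) := MkPath {
  path_fun :> R -> 'rV[R]_d ;
  path_continuous : continuous path_fun ;
  path_clamp : forall t, path_fun t = path_fun (clamp T t) }.

Definition path0 d T : path_space d T :=
  @MkPath d T (fun=> 0) (fun t => cvg_cst _) (fun=> erefl).

HB.instance Definition _ d T := gen_eqMixin (path_space d T).
HB.instance Definition _ d T := gen_choiceMixin (path_space d T).
HB.instance Definition _ d T := isPointed.Build (path_space d T) (path0 d T).

(* Open sets of the uniform topology. *)
Definition uniform_open d T (A : set (path_space d T)) : Prop :=
  forall w, A w -> exists2 e : R, 0 < e &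
    forall w' : path_space d T, (forall t, enorm (w' t - w t) < e) -> A w'.

HB.instance Definition _ d T :=
  Measurable.copy (path_space d T) (g_sigma_algebraType (@uniform_open d T)).

Definition coordp {d T} (t : R) (w : path_space d T) : 'rV[R]_d := w t.

Lemma measurable_coordp d T t : measurable_fun setT (@coordp d T t).
Proof.
apply: measurable_rV => i.
apply: (@measurability _ _ _ _ _ _ _ (measurable_realfun.RGenOpens.measurableE R)).
move=> _ [B [a [b ->]] <-]; rewrite setTI; apply: sub_sigma_algebra.
move=> w /= Bw.
have /nbhs_ballP[e /= e0 eB] : nbhs (w t ord0 i) `]a, b[%classic.
  by apply: open_nbhs_nbhs; split => //; exact: interval_open.
exists e => // w' ww'; apply: eB; rewrite /ball /= distrC.
apply: le_lt_trans (ww' t); rewrite /enorm /dotv.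
rewrite -sqrtr_sqr ler_wsqrtr// (bigD1 i)//= !mxE -expr2 lerDl.
by apply: sumr_ge0 => j _; rewrite -expr2 sqr_ge0.
Qed.

HB.instance Definition _ d T t :=
  isMeasurableFun.Build _ _ _ _ (@coordp d T t) (@measurable_coordp d T t).

Definition marg {d T} (P : probability (path_space d T) R) (t : R)
    : probability 'rV[R]_d R :=
  distribution P (@coordp d T t).

Definition P1 {d T} (P : probability (path_space d T) R) : Prop :=
  (\int[P]_w ereal_sup [set (enorm (coordp t w))%:E | t in [set` `[0%R, T%R]]] < +oo)%E.

End path_space.

Arguments path_space R d T : clear implicits.

Section processes.
Context {R : realType} {d : nat} {dS : measure_display} {S : measurableType dS}.
Implicit Types (Pr : probability S R) (F : R -> set (set S)).
Implicit Types (Y M : R -> S -> 'rV[R]_d) (I : set R).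

(* sigma(xi, Y_s : 0 <= s <= t); [natural_filtration] omits xi. *)
Definition initial_filtration (xi : S -> 'rV[R]_d) Y (t : R) : set (set S) :=
  <<s preimage_set_system setT xi measurable `|`
      \bigcup_(s in `[0, t]%classic) preimage_set_system setT (Y s) measurable >>.

Definition natural_filtration Y (t : R) : set (set S) :=
  <<s \bigcup_(s in `[0, t]%classic) preimage_set_system setT (Y s) measurable >>.

Definition adapted F I Y : Prop :=
  forall t, I t -> forall B, measurable B -> F t (Y t @^-1` B).

Definition augmentation Pr F (t : R) : set (set S) :=
  [set A | measurable A /\ exists2 B, F t B & Pr.-negligible (A `+` B)].

(* d-dimensional Brownian motion on [0,T] with initial law [nu], relative to the
   filtration [F]: the increments over [s,t] are independent of F_s, with
   independent N(0, t - s) coordinates ([normal_prob] takes the standard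
   deviation). *)
Definition brownian_motion Pr F (T : R) (nu : set 'rV[R]_d -> \bar R) Y : Prop :=
  [/\ adapted F `[0, T]%classic Y,
      forall B, measurable B -> Pr (Y 0 @^-1` B) = nu B,
      {ae Pr, forall w, {within `[0, T], continuous (Y ^~ w)}} &
      forall (s t : R) (A : set S) (B : 'I_d -> set R),
        0 <= s -> s < t -> t <= T -> F s A -> (forall i, measurable (B i)) ->
        fine (Pr (A `&` [set w | forall i, B i ((Y t w - Y s w) ord0 i)])) =
        fine (Pr A) * \prod_i fine (normal_prob 0 (Num.sqrt (t - s)) (B i))].

Definition continuous_martingale Pr F I M : Prop :=
  [/\ adapted F I M,
      {ae Pr, forall w, {within I, continuous (M ^~ w)}},
      forall t i, I t -> Pr.-integrable setT (fun w => (M t w ord0 i)%:E) &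
      forall s t A i, I s -> I t -> s <= t -> F s A ->
        \int[Pr]_(w in A) (M t w ord0 i) = \int[Pr]_(w in A) (M s w ord0 i)].

End processes.

Section mean_field_schroedinger.
Context {R : realType} {d : nat} {T : R}.
Implicit Types (W : 'rV[R]_d -> R) (mu_in mu_fin : probability 'rV[R]_d R).
Implicit Types (P Q : probability (path_space R d T) R).
Implicit Types (Psi : R -> 'rV[R]_d -> 'rV[R]_d).

Local Notation leb := (@lebesgue_measure R).

(* [Z] is a strong solution on (S, Pr) of dZ_t = - (grad W * P_t)(Z_t) dt + dB_t
   with Z_0 = xi ~ mu_in: it is adapted to the augmented filtration of (xi, B). *)
Definition strong_solution W mu_in P (dS : measure_display)
    (S : measurableType dS) (Pr : probability S R) (xi : S -> 'rV[R]_d)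
    (B : R -> S -> 'rV[R]_d) (Z : S -> path_space R d T) : Prop :=
  let G := initial_filtration xi B in
  [/\ measurable_fun setT xi /\ (forall t, measurable_fun setT (B t)),
      forall A, measurable A -> Pr (xi @^-1` A) = mu_in A,
      brownian_motion Pr G T (\d_(0 : 'rV[R]_d)) B,
      measurable_fun setT Z /\
        adapted (augmentation Pr G) `[0, T]%classic (fun t w => Z w t) &
      {ae Pr, forall w, forall t : R, 0 <= t <= T ->
        Z w t = xi w + vint leb `[0, t] (fun s => - convgrad W (marg P s) (Z w s))
                + B t w}].

Definition law_of_strong_solution W mu_in P : set (probability (path_space R d T) R) :=
  [set Q | exists (dS : measure_display) (S : measurableType dS)
      (Pr : probability S R) (xi : S -> 'rV[R]_d) (B : R -> S -> 'rV[R]_d)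
      (Z : S -> path_space R d T),
    strong_solution W mu_in P Pr xi B Z /\
    forall A, measurable A -> Q A = Pr (Z @^-1` A)].

(* The drift is Lipschitz in space, so that the law is unique. *)
Definition Gamma W mu_in P : probability (path_space R d T) R :=
  get (law_of_strong_solution W mu_in P).

Definition admissible mu_in mu_fin P : Prop :=
  [/\ P1 P,
      forall A, measurable A -> marg P 0 A = mu_in A &
      forall A, measurable A -> marg P T A = mu_fin A].

Definition MFSP_optimizer W mu_in mu_fin P : Prop :=
  admissible mu_in mu_fin P /\
  forall Q, admissible mu_in mu_fin Q ->
    (rel_entropy P (Gamma W mu_in P) <= rel_entropy Q (Gamma W mu_in Q))%E.

(* Elements of C_c^oo([0,T] x R^d), as restrictions of elements of
   C_c^oo(R x R^d). *)
Definition test_function (phi : R * 'rV[R]_d -> R) : Prop :=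
  (forall n, class_C n phi) /\
  exists2 K : set (R * 'rV[R]_d), compact K & forall p, ~ K p -> phi p = 0.

Definition L2_dist2 (m : R -> probability 'rV[R]_d R)
    (F G : R -> 'rV[R]_d -> 'rV[R]_d) : \bar R :=
  (\int[leb]_(t in [set` `[0%R, T%R]]) \int[m t]_x (enorm (F t x - G t x) ^+ 2)%:E)%E.

Definition H_minus1 (m : R -> probability 'rV[R]_d R) Psi : Prop :=
  [/\ measurable_fun (`[0, T] `*` [set: 'rV[R]_d])
        (fun p : R * 'rV[R]_d => Psi p.1 p.2),
      (L2_dist2 m Psi (fun _ _ => 0%R) < +oo)%E &
      forall e : R, 0 < e -> exists2 phi, test_function phi &
        (L2_dist2 m Psi (fun t => grad (fun x => phi (t, x))) < e%:E)%E].

Definition corrector W mu_in P Psi : Prop :=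
  [/\ H_minus1 (marg P) Psi,
      brownian_motion P (natural_filtration coordp) T mu_in
        (fun t w => coordp t w - vint leb `[0, t]
           (fun s => - convgrad W (marg P s) (coordp s w) + Psi s (coordp s w))) &
      continuous_martingale P (natural_filtration coordp) `[0, T[%classic
        (fun t w => Psi t (coordp t w) - vint leb `[0, t]
           (fun s => vint P setT (fun w' =>
              (Psi s (coordp s w) - Psi s (coordp s w')) *m hess W (coordp s w - coordp s w'))))].

(* Pitfall: at t = T the nonlocal term of the first equation need not be an
   absolutely convergent integral, since the martingale property of the corrector
   holds on [0,T[ only.  Hence the first equation is stated for 0 <= t < T, with
   psi of class C^{1,2} there and continuous up to T; the second one is stated on
   [0,T].  Integrability and differentiability of the terms are part of the
   notion of solution. *)
Definition classical_solution W mu_in mu_fin (m : R -> probability 'rV[R]_d R)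
    (psi mu : R -> 'rV[R]_d -> R) : Prop :=
  let V t x y := dotv (grad W (x - y)) (grad (psi t) x - grad (psi t) y) in
  let flux t x := mu t x *: (- convgrad W (m t) x + grad (psi t) x) in
  [/\ C12 `[0, T[%classic psi /\ continuous_tx `[0, T]%classic psi,
      C12 `[0, T]%classic mu,
      forall (t : R) x, 0 <= t < T ->
        (m t).-integrable setT (fun y => (V t x y)%:E) /\
        dt `[0, T]%classic psi t x + 2^-1 * laplacian (psi t) x
          + 2^-1 * enorm (grad (psi t) x) ^+ 2 = \int[m t]_y V t x y,
      forall (t : R) x, 0 <= t <= T ->
        [/\ forall i, (m t).-integrable setT (fun y => (grad W (x - y) ord0 i)%:E),
            forall i, pderivable i (fun y => flux t y ord0 i) x &
            dt `[0, T]%classic mu t x - 2^-1 * laplacian (mu t) x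
              + divergence (flux t) x = 0] &
      has_density mu_in (mu 0) /\ has_density mu_fin (mu T)].

End mean_field_schroedinger.

Arguments classical_solution {R d} T W mu_in mu_fin m psi mu.

(* Main.v *)
(* Taking expectations in a local Ito expansion over short intervals and chaining
   the errors gives, for the drift b = - grad W * mu + Psi, the weak Fokker-Planck
   equation, hence the classical one since mu is C^{1,2}. The same expansion of
   phi(X_u) (Psi^j(v, X_v) - Psi^j(u, X_u)), compared with the martingale property
   of the corrector, yields the equation
     d_t Psi^j + b . grad Psi^j + (1/2) Delta Psi^j
       = E[(Hess W (x - X_t) (Psi_t(x) - Psi_t(X_t)))_j],
   where mu > 0 turns almost sure identities into pointwise ones. Being an L^2 limit
   of gradients, the C^1 field Psi is curl-free, so this equation reads
   d_t Psi = grad Theta, and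
     psi_t(x) = int_0^1 Psi_t(r x) . x dr + int_0^t Theta_r(0) dr
   is the required potential: fixing its value at the origin absorbs the constant
   of integration in time. *)
Require Import Defs.
From HB Require Import structures.
From mathcomp Require Import all_boot all_order all_algebra.
From mathcomp Require Import all_classical all_reals all_analysis.
From mathcomp Require Import measurable_realfun ring lra.

Set Implicit Arguments.
Unset Strict Implicit.
Unset Printing Implicit Defensive.

Import Order.TTheory GRing.Theory Num.Theory.
Import numFieldNormedType.Exports.

Local Open Scope classical_set_scope.
Local Open Scope ring_scope.

(** Three obstacles shape the proof. The corrector is unbounded, and [H_minus1] makes its second
    moment finite at almost every time only; a martingale bound carried back from a later good time
    gives a second moment at every [t < T], uniformly on [[0, S]] with [S < T], but nothing at [T]
    itself. The drift contains [grad W], of linear growth, while the supremum of the path is only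
    integrable; the energy of the drift is obtained path by path from Gronwall's inequality.
    Finally, the drift is only square integrable along paths, so that local errors of size [h^2] on
    intervals of length [h] are out of reach. What holds is a local error at most [e] times a
    control that is additive over adjacent intervals: the length plus the energy of the drift, to
    which the corrector adds the increment of [E(M_t^2)], with [M] its martingale. An additive
    quantity bounded in this way for every [e] vanishes. Fields on [[0, T]] are extended to all
    times by clamping the time, so that one-sided notions at the end points become ordinary
    continuity. *)

Lemma cvg_sum_fin {R : realType} {T I : Type} (F : set_system T) (FF : Filter F)
    (r : seq I) (f : I -> T -> R) (l : I -> R) :
  (forall i, f i @ F --> l i) -> (fun x => \sum_(i <- r) f i x) @ F --> \sum_(i <- r) l i.
Proof.
move=> H; apply: cvg_big => //; move=> p /=.
exact: (cvgD cvg_fst cvg_snd).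
Qed.

Section pointwise_limits.
Context {R : realType} {X : Type} {F : set_system X} {FF : Filter F}.
Implicit Types (f g : X -> R) (a b : R).

Lemma cvgD_fun f g a b : f @ F --> a -> g @ F --> b -> (fun x => f x + g x) @ F --> a + b.
Proof. exact: cvgD. Qed.

Lemma cvgB_fun f g a b : f @ F --> a -> g @ F --> b -> (fun x => f x - g x) @ F --> a - b.
Proof. exact: cvgB. Qed.

Lemma cvgM_fun f g a b : f @ F --> a -> g @ F --> b -> (fun x => f x * g x) @ F --> a * b.
Proof. exact: cvgM. Qed.

Lemma cvg_sqr f a : f @ F --> a -> (fun x => f x ^+ 2) @ F --> a ^+ 2.
Proof. by move=> fa; exact: (cvg_comp _ _ fa (@exprn_continuous R 2 a)). Qed.

End pointwise_limits.

Lemma continuous_snd {X Y Z : topologicalType} (f : Y -> Z) : continuous f -> continuous (fun p : X * Y => f p.2).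
Proof. by move=> cf p; apply: (@continuous_comp _ _ _ snd f); [exact: cvg_snd|exact: cf]. Qed.

Lemma continuous_snd_coord {R : realType} {X : topologicalType} {n : nat} (i : 'I_n) :
  continuous (fun p : X * 'rV[R]_n => p.2 ord0 i).
Proof. apply: (continuous_snd (f := fun x : 'rV[R]_n => x ord0 i)); exact: coord_continuous. Qed.

(** * Partial derivatives and Taylor expansions *)

Section calculus.
Context {R : realType} {d : nat}.
Implicit Types (f : 'rV[R]_d -> R) (x v : 'rV[R]_d).

Lemma is_derive_line f x v (r : R) : (forall y, derivable f y v) ->
  is_derive r 1 (fun h : R => f (x + h *: v)) ('D_v f (x + r *: v)).
Proof.
move=> df.
have E : (fun h : R => h^-1 *: (f (x + (h *: (1 : R) + r) *: v) - f (x + r *: v)))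
    = (fun h : R => h^-1 *: (f (h *: v + (x + r *: v)) - f (x + r *: v))).
  apply/funext => h; congr (_ *: (f _ - _)).
  by rewrite [_%:A]mulr1 scalerDl addrCA.
apply: DeriveDef.
- by rewrite /derivable /=; rewrite E; exact: df.
- by rewrite /derive /= E.
Qed.

Lemma continuous_line x v : continuous (fun h : R => x + h *: v).
Proof.
move=> r; apply: cvgD; first exact: cvg_cst.
by apply: cvgZr_tmp; exact: cvg_id.
Qed.

Lemma mvt01 (g g' : R -> R) : (forall r : R, is_derive r 1 g (g' r)) ->
  exists2 c : R, 0 <= c <= 1 & g 1 - g 0 = g' c.
Proof.
move=> dg; have cg : {within `[0 : R, 1], continuous g}.
  apply: continuous_subspaceT => x.
  by apply/differentiable_continuous/derivable1_diffP; have [] := dg x.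
have [c] := @MVT_segment R g g' 0 1 ler01 (fun r _ => dg r) cg.
by rewrite in_itv/= subr0 mulr1 => ?; exists c.
Qed.

Lemma mvt_line f x v : (forall y, derivable f y v) ->
  exists2 c : R, 0 <= c <= 1 & f (x + v) - f x = 'D_v f (x + c *: v).
Proof.
move=> df; have [c c01] := @mvt01 (fun h : R => f (x + h *: v))
    (fun r => 'D_v f (x + r *: v)) (fun r => @is_derive_line f x v r df).
by rewrite scale1r scale0r addr0 => ?; exists c.
Qed.

(** The product form, with [|c| <= |b|], covers both signs of [b] and the case [b = 0]; in most uses
    [b] is a coordinate or an increment of unknown sign. *)
Lemma mvt_scaled (g g' : R -> R) (b : R) : (forall r : R, is_derive r 1 g (g' r)) ->
  exists2 c : R, `|c| <= `|b| & g b - g 0 = g' c * b.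
Proof.
move=> dg; have cg : continuous g.
  move=> x.
  by apply/differentiable_continuous/derivable1_diffP; have [] := dg x.
have [b0|b0] := leP 0 b.
  have [c] := @MVT_segment R g g' 0 b b0 (fun r _ => dg r) (continuous_subspaceT cg).
  rewrite in_itv/= subr0 => /andP[c0 cb] ->; exists c => //.
  by rewrite !ger0_norm.
have [c] := @MVT_segment R g g' b 0 (ltW b0) (fun r _ => dg r) (continuous_subspaceT cg).
rewrite in_itv/= sub0r => /andP[c0 cb] E; exists c; last first.
  by apply: oppr_inj; rewrite opprB E mulrN.
by rewrite !ler0_norm ?lerN2// ltW.
Qed.

Lemma norm_delta (i : 'I_d) : `|delta_mx ord0 i : 'rV[R]_d| <= 1.
Proof.
rewrite /Num.norm/= mx_normrE; apply: bigmax_le => //= -[a j] _ /=.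
by rewrite !mxE normr_nat; case: (_ && _).
Qed.

Lemma coord_norm x (i : 'I_d) : `|x ord0 i| <= `|x|.
Proof.
rewrite [leRHS]/Num.norm/= mx_normrE.
by apply/bigmax_geP; right; exists (ord0, i).
Qed.

Lemma norm_le_coord x (r : R) : 0 <= r -> (forall i, `|x ord0 i| <= r) -> `|x| <= r.
Proof.
move=> r0 H; rewrite /Num.norm/= mx_normrE; apply: bigmax_le => //= -[a j] _ /=.
by rewrite (ord1 a).
Qed.

(** Class C^1 through partial derivatives only, the form in which [C12] provides regularity;
    [pC1_is_diff] recovers the differential. *)
Definition pC1 f := (forall i x, pderivable i f x) /\ forall i, continuous (partial i f).

(** The coordinates of [x] are changed into those of [x + v] one at a time. Each change is a
    one-dimensional mean value at a point within [|v|] of [x], where the partial derivatives have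
    moved by at most [e']. *)
Lemma pC1_approx f x (e : R) : pC1 f -> 0 < e ->
  exists2 del : R, 0 < del & forall v, `|v| < del ->
    `|f (x + v) - f x - \sum_i v ord0 i * partial i f x| <= e * `|v|.
Proof.
(* [d.+1] keeps the quotient meaningful for [d = 0]; the [d] changes of coordinate cost at most
   [e * |v|] together. *)
move=> [df cf] e0; pose e' := e / d.+1%:R.
have e'0 : 0 < e' by rewrite divr_gt0.
have [del del0 H] : exists2 del : R, 0 < del & forall v, `|v| < del -> forall i,
    `|partial i f (x + v) - partial i f x| <= e'.
  have : \forall y \near x, forall i, `|partial i f y - partial i f x| <= e'.
    have H i : \forall y \near x, `|partial i f y - partial i f x| <= e'.
      have /cvgrPdist_le /(_ _ e'0) := cf i x.
      by apply: filterS => y; rewrite distrC.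
    exact: (@filter_forall _ _ _ (nbhs x) (nbhs_filter x) H).
  move=> /nbhs_ballP[del /= del0 H]; exists del => // v vd; apply: H.
  by rewrite -ball_normE /= opprD addrA subrr add0r normrN.
exists del => // v vd.
(* [s k] keeps the first [k] coordinates of [v], so that [s 0 = 0] and [s d = v]. *)
pose s k := \sum_(i < d | (i < k)%N) (v ord0 i *: delta_mx ord0 i) : 'rV[R]_d.
have sE k j : s k ord0 j = if (j < k)%N then v ord0 j else 0.
  rewrite /s summxE; case: ifPn => jk.
    rewrite (bigD1 j)//= !mxE !eqxx mulr1 big1 ?addr0// => i /andP[_ ij].
    by rewrite !mxE eqxx /= eq_sym (negbTE ij) mulr0.
  rewrite big1// => i ik; rewrite !mxE eqxx /=.
  by case: eqP => [ji|]; rewrite ?mulr0//; rewrite ji ik in jk.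
have step k : (k <= d)%N -> `|f (x + s k) - f x - \sum_(i < d | (i < k)%N) v ord0 i * partial i f x|
   <= k%:R * (e' * `|v|).
  elim: k => [_|k IH kd].
    by rewrite /s !big_pred0 ?addr0 ?subrr ?mul0r ?normr0 ?subr0 ?normr0.
  pose k' := Ordinal kd.
  have sS (F : 'I_d -> R) : \sum_(i < d | (i < k.+1)%N) F i = \sum_(i < d | (i < k)%N) F i + F k'.
    rewrite (bigD1 k')//= addrC; congr (_ + _); apply: eq_bigl => i.
    rewrite ltnS [RHS]ltn_neqAle andbC; congr (_ && _).
  have ssE : s k.+1 = s k + v ord0 k' *: delta_mx ord0 k'.
    apply/rowP => j; rewrite mxE !sE !mxE eqxx/= ltnS leq_eqVlt.
    have [->|jk] := eqVneq j k'; first by rewrite /= eqxx ltnn mulr1 add0r.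
    rewrite mulr0 addr0 (_ : (nat_of_ord j == k) = false)//.
    by apply: contra_neqF jk => /eqP jk; apply/val_inj.
  have [c cv] := @mvt_scaled (fun h : R => f (x + s k + h *: delta_mx ord0 k')) _ (v ord0 k')
    (fun r => @is_derive_line f _ _ r (df k')).
  rewrite scale0r addr0 -addrA -ssE => E.
  rewrite sS (_ : _ - _ - _ = (f (x + s k) - f x - \sum_(i < d | (i < k)%N) v ord0 i * partial i f x)
     + (f (x + s k.+1) - f (x + s k) - v ord0 k' * partial k' f x)); last by ring.
  rewrite (le_trans (ler_normD _ _))// -natr1 mulrDl mul1r lerD//.
    exact/IH/ltnW.
  rewrite E mulrC -mulrBr normrM mulrC ler_pM//; last exact: coord_norm.
  rewrite -addrA; apply: H; rewrite (le_lt_trans _ vd)//.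
  apply: norm_le_coord => // j; rewrite !mxE sE eqxx/=.
  have [->|jk] := eqVneq j k'.
    by rewrite /= ltnn mulr1 add0r (le_trans cv)// coord_norm.
  by rewrite mulr0 addr0; case: ifPn => _; rewrite ?normr0// coord_norm.
have := step d (leqnn d).
have bT (M : nmodType) (F : 'I_d -> M) : \sum_(i < d | (i < d)%N) F i = \sum_i F i.
  by apply: eq_bigl => i; rewrite ltn_ord.
rewrite bT (_ : s d = v); last by apply/rowP => j; rewrite sE ltn_ord.
move=> /le_trans; apply; rewrite mulrA ler_wpM2r//.
rewrite /e' mulrA ler_pdivrMr// mulrC ler_wpM2l// ?ltW// ?ltr_nat//.
Qed.

Definition lin_form (a : 'I_d -> R) (v : 'rV[R]_d) : R := \sum_i v ord0 i * a i.

Lemma lin_form_is_linear a : linear (lin_form a).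
Proof.
move=> k u v; rewrite /lin_form scaler_sumr -big_split; apply: eq_bigr => i _ /=.
by rewrite !mxE mulrDl -mulrA.
Qed.

HB.instance Definition _ a :=
  GRing.isLinear.Build R 'rV[R]_d R _ (lin_form a) (lin_form_is_linear a).

Lemma continuous_lin_form a : continuous (lin_form a).
Proof.
move=> v; rewrite /lin_form.
apply: (cvg_sum_fin (nbhs_filter v)) => i; apply: cvgMr_tmp; exact: coord_continuous.
Qed.

Lemma pC1_is_diff f x : pC1 f ->
  differentiable f x /\ forall v, 'd f x v = \sum_i v ord0 i * partial i f x.
Proof.
move=> C1; pose df := lin_form (fun i => partial i f x).
have cdf : continuous df by exact: continuous_lin_form.
have E : f \o shift x = cst (f x) + df +o_ 0 id.
  apply/eqaddoP => e e0; have [del del0 H] := pC1_approx x C1 e0.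
  near=> v.
  have : `|f (x + v) - f x - df v| <= e * `|v|.
    apply: H; near: v; apply/nbhs_ballP; exists del => //= v.
    by rewrite -ball_normE /= sub0r normrN.
  by rewrite [x + v]addrC -addrA -opprD.
have dE := diff_unique cdf E; split; last by move=> v; rewrite dE.
by apply/diff_locallyP; rewrite dE; split.
Unshelve. all: by end_near. Qed.

Lemma pC1_derive f x v : pC1 f ->
  derivable f x v /\ 'D_v f x = \sum_i v ord0 i * partial i f x.
Proof.
move=> /(@pC1_is_diff _ x)[df dE]; split; first exact: diff_derivable.
by rewrite deriveE.
Qed.

Lemma pC1_continuous f : pC1 f -> continuous f.
Proof. by move=> C1 x; apply/differentiable_continuous; have [] := pC1_is_diff x C1. Qed.

Lemma pC1_is_derive_line f x v (r : R) : pC1 f ->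
  is_derive r 1 (fun h : R => f (x + h *: v))
    (\sum_i v ord0 i * partial i f (x + r *: v)).
Proof.
move=> C1; have [_ <-] := pC1_derive (x + r *: v) v C1.
by apply: is_derive_line => y; have [] := pC1_derive y v C1.
Qed.

Definition pC2 f := pC1 f /\ forall i, pC1 (partial i f).

(** The oscillation [e] of the second derivatives on the segment is left free, so that either a
    uniform bound or a modulus of continuity can be inserted later. *)
Lemma pC2_taylor f x v (e : R) : pC2 f ->
  (forall (c : R) i j, `|c| <= 1 ->
    `|partial j (partial i f) (x + c *: v) - partial j (partial i f) x| <= e) ->
  `|f (x + v) - f x - \sum_i v ord0 i * partial i f x
     - 2^-1 * \sum_i v ord0 i * \sum_j v ord0 j * partial j (partial i f) x|
   <= e * (\sum_i `|v ord0 i|) ^+ 2.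
Proof.
move=> [C1 C2] He.
pose D (r : R) := \sum_i v ord0 i * partial i f (x + r *: v).
pose D' (r : R) := \sum_i v ord0 i * \sum_j v ord0 j * partial j (partial i f) (x + r *: v).
have dD (r : R) : is_derive r 1 D (D' r).
  rewrite /D (_ : (fun _ => _) = \sum_i (fun r => v ord0 i * partial i f (x + r *: v))); last first.
    by apply/funext => u; rewrite fct_sumE.
  apply: is_derive_sum => i.
  have H := pC1_is_derive_line x v r (C2 i).
  exact: (is_deriveZ (v ord0 i) H).
have x0 : x + (0 : R) *: v = x by rewrite scale0r addr0.
(* [F] subtracts the quadratic Taylor polynomial along the segment. Its derivative
   [D r - D 0 - D' 0 * r] is the first-order remainder of [D], so a second mean value finishes. *)
pose F (r : R) := f (x + r *: v) - r * D 0 - 2^-1 * D' 0 * r ^+ 2.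
have dF (r : R) : is_derive r 1 F (D r - D 0 - D' 0 * r).
  have H := pC1_is_derive_line x v r C1.
  rewrite /F; apply: is_derive_eq.
  rewrite /= /GRing.scale/= /D; by field.
have [c c01 E] := mvt01 dF.
have {E} : f (x + v) - f x - D 0 - 2^-1 * D' 0 = D c - D 0 - D' 0 * c.
  by rewrite -E /F scale1r x0; ring.
rewrite {1}/D {1}/D' x0 => ->.
have [c' c'c DE] := mvt_scaled c dD.
have c1 : `|c| <= 1 by have /andP[? ?] := c01; rewrite ger0_norm.
rewrite DE -mulrBl normrM.
apply: (@le_trans _ _ (`|D' c' - D' 0|)).
  by rewrite ler_piMr.
rewrite /D' x0 -sumrB (le_trans (ler_norm_sum _ _ _))//.
rewrite expr2 mulrA mulr_sumr ler_sum// => i _.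
rewrite -mulrBr normrM mulrC ler_wpM2r// -sumrB (le_trans (ler_norm_sum _ _ _))//.
rewrite mulr_sumr ler_sum// => j _.
rewrite -mulrBr normrM mulrC ler_wpM2r// He// (le_trans c'c)//.
Qed.

End calculus.

Lemma second_difference_regroup {R : realType} (a b c e : R) : a - b - (c - e) = a - c - (b - e).
Proof. by ring. Qed.

(** * Symmetry of second derivatives and bounds on the Hessian *)

Section second_order.
Context {R : realType} {d : nat}.
Implicit Types (f W : 'rV[R]_d -> R) (x v : 'rV[R]_d).
Local Notation e_ i := (delta_mx ord0 i : 'rV[R]_d).

Lemma second_difference f x (i j : 'I_d) (h : R) : pC2 f ->
  exists2 p : 'rV[R]_d, `|p - x| <= `|h| + `|h| &
  f (x + h *: e_ i + h *: e_ j) - f (x + h *: e_ i) - (f (x + h *: e_ j) - f x) =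
   h * (h * partial j (partial i f) p).
Proof.
move=> [[df cf] C2].
pose g (s : R) := f (x + h *: e_ j + s *: e_ i) - f (x + s *: e_ i).
have dg (s : R) : is_derive s 1 g (partial i f (x + h *: e_ j + s *: e_ i) - partial i f (x + s *: e_ i)).
  have H1 := @is_derive_line R d f (x + h *: e_ j) (e_ i) s (df i).
  have H2 := @is_derive_line R d f x (e_ i) s (df i).
  exact: (is_deriveB H1 H2).
have [c ch] := mvt_scaled h dg.
rewrite /g !scale0r !addr0 => E.
have [c' c'h E'] := @mvt_scaled R (fun s => partial i f (x + c *: e_ i + s *: e_ j)) _ h
  (fun s => @is_derive_line R d (partial i f) (x + c *: e_ i) (e_ j) s (fun y => (C2 i).1 j y)).
exists (x + c *: e_ i + c' *: e_ j).
  have -> (a b : 'rV[R]_d) : x + a + b - x = a + b by rewrite addrAC [x + a]addrC addrK.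
  rewrite (le_trans (ler_normD _ _))// lerD// normrZ.
    by rewrite (le_trans (ler_piMr _ (norm_delta i))).
  by rewrite (le_trans (ler_piMr _ (norm_delta j))).
move: E'; rewrite scale0r addr0 => E'.
rewrite [x + h *: e_ i + _]addrAC E mulrC; congr (_ * _).
by rewrite addrAC E' mulrC.
Qed.

(** A second difference does not depend on the order of the two increments, so the two mixed
    derivatives agree at two points [p] and [q] within [2 h] of [x]; continuity brings both to
    [x]. *)
Lemma schwarz f x (i j : 'I_d) : pC2 f ->
  partial j (partial i f) x = partial i (partial j f) x.
Proof.
move=> C2; apply/eqP; rewrite -subr_eq0 -normr_le0; apply/ler_addgt0Pl => e e0.
have e20 : 0 < e / 2 by rewrite divr_gt0.
have := (C2.2 i).2 j x => /cvgrPdist_le /(_ _ e20) /nbhs_ballP[d1 /= d10 H1].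
have := (C2.2 j).2 i x => /cvgrPdist_le /(_ _ e20) /nbhs_ballP[d2 /= d20 H2].
pose h := Num.min d1 d2 / 4.
have h0 : 0 < h by rewrite divr_gt0// lt_min d10.
have hh : `|h| + `|h| < Num.min d1 d2.
  rewrite gtr0_norm// /h; have : 0 < Num.min d1 d2 by rewrite lt_min d10.
  lra.
have [p px Ep] := second_difference x i j h C2.
have [q qx Eq] := second_difference x j i h C2.
have E : partial j (partial i f) p = partial i (partial j f) q.
  have : h * (h * partial j (partial i f) p) = h * (h * partial i (partial j f) q).
    have Ef : f (x + h *: e_ i + h *: e_ j) = f (x + h *: e_ j + h *: e_ i) := congr1 f (addrAC _ _ _).
    exact: (etrans (esym Ep) (etrans (etrans (congr1 (fun a => a - _ - _) Ef) (second_difference_regroup _ _ _ _)) Eq)).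
  by move=> /(mulfI (lt0r_neq0 h0)) /(mulfI (lt0r_neq0 h0)).
have A1 : `|partial j (partial i f) x - partial j (partial i f) p| <= e / 2.
  have B1 : ball x d1 p.
    rewrite -ball_normE /=.
    rewrite distrC.
    apply: (le_lt_trans px).
    apply: (lt_le_trans hh).
    by rewrite ge_min lexx.
  exact: (H1 _ B1).
have A2 : `|partial i (partial j f) x - partial i (partial j f) q| <= e / 2.
  have B2 : ball x d2 q.
    rewrite -ball_normE /=.
    rewrite distrC.
    apply: (le_lt_trans qx).
    apply: (lt_le_trans hh).
    by rewrite ge_min lexx orbT.
  exact: (H2 _ B2).
rewrite addr0 (splitr e).
apply: (le_trans (ler_distD (partial j (partial i f) p) _ _)); apply: (lerD A1).
by rewrite E distrC; exact: A2.
Qed.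

Lemma class_C2_pC2 W : class_C 2 W -> pC2 W.
Proof.
move=> [_ CW].
have C1 : pC1 W by split=> [i x|i]; [exact: (CW (e_ i)).1 | exact: (CW (e_ i)).2.1].
split=> // i; split=> [j x|j]; first exact: ((CW (e_ i)).2.2 (e_ j)).1.
exact: ((CW (e_ i)).2.2 (e_ j)).2.1.
Qed.

(** Polarization: the unit vectors [e_ i] and [(e_ i + e_ j) / sqrt 2] give the diagonal entries and
    half the sum of four entries. By symmetry of the Hessian, the entry [(i, j)] is a difference of
    two quantities bounded by [C]. *)
Lemma hess_bounded W (C : R) : pC2 W ->
  (forall z v : 'rV[R]_d, enorm v = 1 -> `|dotv v (v *m hess W z)| <= C) ->
  forall z i j, `|hess W z i j| <= 2 * C.
Proof.
move=> C2 H z i j.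
have D v : dotv v (v *m hess W z) = \sum_a v ord0 a * \sum_b v ord0 b * hess W z b a.
  by apply: eq_bigr => a _; rewrite mxE.
have S (k : 'I_d) (F : 'I_d -> R) : \sum_a (e_ k) ord0 a * F a = F k.
  rewrite (bigD1 k)//= !mxE !eqxx mul1r big1 ?addr0// => a ak.
  by rewrite !mxE (negbTE ak) andbF mul0r.
have dd k : `|hess W z k k| <= C.
  have := H z (e_ k); rewrite D S S; apply.
  by rewrite /enorm /dotv S !mxE !eqxx sqrtr1.
have C0 : 0 <= C by rewrite (le_trans _ (dd i)).
have [->|ij] := eqVneq i j; first by rewrite (le_trans (dd j))//; lra.
pose c : R := (Num.sqrt 2)^-1.
have cc : c * c = 2^-1 by rewrite -expr2 exprVn sqr_sqrtr.
have S2 (F : 'I_d -> R) : \sum_a (c *: (e_ i + e_ j)) ord0 a * F a = c * (F i + F j).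
  rewrite -(S i F) -(S j F) -big_split mulr_sumr; apply: eq_bigr => a _ /=.
  by rewrite !mxE; ring.
have := H z (c *: (e_ i + e_ j)); rewrite D !S2 => /(_ _)/wrap[].
  rewrite /enorm /dotv S2 !mxE !eqxx (negbTE ij) eq_sym (negbTE ij) /=.
  rewrite addr0 add0r !mulr1 mulrDr cc (_ : _ + _ = 1) ?sqrtr1//; lra.
rewrite (_ : c * _ = (hess W z i i + hess W z j j + hess W z i j + hess W z j i) / 2); last first.
  rewrite -cc; ring.
have -> : hess W z j i = hess W z i j by rewrite !mxE schwarz.
have := dd i; have := dd j; rewrite !ler_norml.
move=> /andP[? ?] /andP[? ?] /andP[? ?]; apply/andP; split; lra.
Qed.

(** Together with the bounded Hessian this gives the growth [|partial i W z| <= L |z|], so that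
    [grad W] can be integrated against a law with finite first moment. *)
Lemma even_partial0 W i : pC1 W -> (forall z, W z = W (- z)) -> partial i W 0 = 0.
Proof.
move=> C1 ev.
have H1 := @is_derive_line R d W 0 (e_ i) 0 (C1.1 i).
have H2 := @is_derive_line R d W 0 (- e_ i) 0 (fun y => (pC1_derive y (- e_ i) C1).1).
have E : (fun h : R => W (0 + h *: e_ i)) = (fun h : R => W (0 + h *: - e_ i)).
  by apply/funext => h; rewrite !add0r scalerN; exact: ev.
rewrite E in H1.
have := @derive_val _ _ _ _ _ _ _ H1.
rewrite (@derive_val _ _ _ _ _ _ _ H2) !scale0r !addr0.
rewrite (pC1_derive _ _ C1).2 -/(partial i W 0) (bigD1 i)//= big1 => [|j ji].
  by rewrite !mxE !eqxx /= mulN1r addr0 => F; move: F; lra.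
by rewrite !mxE eqxx /= (negbTE ji) oppr0 mul0r.
Qed.

Lemma pC1_lipschitz f (C : R) : pC1 f -> (forall i x, `|partial i f x| <= C) ->
  forall x y, `|f x - f y| <= C * d%:R * `|x - y|.
Proof.
move=> C1 H x y.
have [c _] := @mvt_line R d f y (x - y) (fun z => (pC1_derive z (x - y) C1).1).
rewrite (_ : y + (x - y) = x) => [->|]; last by rewrite addrC subrK.
rewrite (pC1_derive _ _ C1).2.
rewrite (le_trans (ler_norm_sum _ _ _))//.
apply: (@le_trans _ _ (\sum_(i < d) `|x - y| * C)).
  by apply: ler_sum => i _; rewrite normrM ler_pM// coord_norm.
by rewrite sumr_const card_ord -mulr_natr; lra.
Qed.

End second_order.

(** * Continuity in time and space, and extension of fields beyond [[0, T]] *)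

Section epsilon_delta.
Context {R : realType} {d : nat}.
Implicit Types (F : R * 'rV[R]_d -> R).

Lemma cts_txP F p : {for p, continuous F} <->
  forall e : R, 0 < e -> exists2 del : R, 0 < del &
    forall s y, `|s - p.1| < del -> `|y - p.2| < del -> `|F (s, y) - F p| <= e.
Proof.
split=> [/cvgrPdist_le H e e0|H].
  have [del /= del0 {}H] := (nbhs_ballP _ _).1 (H _ e0).
  exists del => // s y sp yp; rewrite distrC; apply: H; split.
    by rewrite -ball_normE /= distrC.
  by rewrite -ball_normE /= distrC.
apply/cvgrPdist_le => e e0; have [del del0 {}H] := H _ e0.
apply: (proj2 (nbhs_ballP p _)); exists del => //= -[s y] [/= sp yp]; rewrite distrC; apply: H.
  by move: sp; rewrite -ball_normE /= distrC.
by move: yp; rewrite -ball_normE /= distrC.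
Qed.

Lemma clamp_itv (T t : R) : 0 <= T -> 0 <= clamp T t <= T.
Proof.
by move=> T0; rewrite /clamp le_max lexx /= ge_max T0 /= ge_min lexx orbT.
Qed.

Lemma clamp_id (T t : R) : 0 <= t <= T -> clamp T t = t.
Proof.
move=> /andP[t0 tT]; rewrite /clamp (min_idPl tT); exact/max_idPr.
Qed.

Lemma clamp_lip (T s t : R) : `|clamp T s - clamp T t| <= `|s - t|.
Proof.
rewrite /clamp; have N (a b : R) : a - b <= `|a - b| /\ b - a <= `|a - b|.
  by rewrite ler_norm distrC ler_norm.
have H (a b c : R) : `|Num.max c a - Num.max c b| <= `|a - b|.
  have [n1 n2] := N a b; rewrite ler_norml !maxEle.
  by case: (leP c a) => ?; case: (leP c b) => ?; apply/andP; split; lra.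
have K (a b c : R) : `|Num.min a c - Num.min b c| <= `|a - b|.
  have [n1 n2] := N a b; rewrite ler_norml !minEle.
  by case: (leP a c) => ?; case: (leP b c) => ?; apply/andP; split; lra.
exact: (le_trans (H _ _ _) (K _ _ _)).
Qed.

(** Freezing the time outside [[0, T]] turns continuity relative to [[0, T]] into continuity on the
    whole space, so compactness and measurability arguments need no one-sided versions. *)
Definition clamped (T : R) (f : R -> 'rV[R]_d -> R) (p : R * 'rV[R]_d) : R :=
  f (clamp T p.1) p.2.

Lemma continuous_txP (I : set R) (f : R -> 'rV[R]_d -> R) :
  continuous_tx I f <-> forall t x, I t -> forall e : R, 0 < e ->
    exists2 del : R, 0 < del & forall s y, I s -> `|s - t| < del -> `|y - x| < del ->
      `|f s y - f t x| <= e.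
Proof.
split=> [/subspace_continuousP H t x It e e0|H].
  have /cvgrPdist_le /(_ _ e0) := H (t, x) (conj It Logic.I).
  rewrite near_withinE => /nbhs_ballP[del /= del0 {}H].
  exists del => // s y Is st yx; rewrite distrC.
  have := H (s, y); apply => //=; split => /=; by rewrite -ball_normE /= distrC.
apply/subspace_continuousP => -[t x] [/= It _]; apply/cvgrPdist_le => e e0.
have [del del0 {}H] := H t x It e e0.
rewrite near_withinE; apply: (proj2 (nbhs_ballP (t, x) _)); exists del => //= -[s y] [/= st yx] [/= Is _].
rewrite distrC; apply: H => //.
  by move: st; rewrite -ball_normE /= distrC.
by move: yx; rewrite -ball_normE /= distrC.
Qed.

Lemma clamped_continuous (T : R) f : 0 <= T -> continuous_tx `[0, T] f ->
  continuous (clamped T f).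
Proof.
move=> T0 /continuous_txP H [t x]; apply/cts_txP => e e0 /=.
have cI u : `[0, T]%classic (clamp T u) by rewrite /= in_itv/= clamp_itv.
have [del del0 {}H] := H (clamp T t) x (cI _) e e0.
exists del => // s y st yx; rewrite /clamped /=; apply: H => //.
exact: (le_lt_trans (clamp_lip _ _ _) st).
Qed.

Lemma compact_box (T N : R) :
  compact (`[0, T]%classic `*` [set v : 'rV[R]_d | forall i, `[- N, N]%classic (v ord0 i)]).
Proof.
apply: compact_setX; first exact: segment_compact.
exact: (@rV_compact _ d (fun=> `[- N, N]%classic) (fun i => @segment_compact R (- N) N)).
Qed.

Lemma box_norm (N : R) (v : 'rV[R]_d) : `|v| <= N -> forall i, `[- N, N]%classic (v ord0 i).
Proof.
by move=> vN i; rewrite /= in_itv/= -ler_norml (le_trans _ vN)// coord_norm.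
Qed.

Lemma bounded_on_box F (T N : R) : continuous F ->
  exists2 C : R, 0 <= C & forall t x, 0 <= t <= T -> `|x| <= N -> `|F (t, x)| <= C.
Proof.
move=> cF; have := proj1 (compact_near_coveringP _) (@compact_box T N).
move=> /(_ nat \oo (fun n p => `|F p| <= n%:R) _) /(_ _)/wrap[].
  move=> p Kp; have /cvgrPdist_le /(_ _ ltr01) H := cF p.
  near=> q n => /=.
  apply: (@le_trans _ _ (`|F p| + 1)).
    rewrite -lerBlDl (le_trans (lerB_dist _ _))// distrC; near: q; exact: H.
  near: n; exact: nbhs_infty_ger.
move=> [n _ /(_ n (leqnn n)) H]; exists n%:R => // t x tT xN; apply: H.
by split => /=; [rewrite in_itv/=|exact: box_norm].
Unshelve. all: by end_near. Qed.

(** Only [(t, x)] is confined to the box and [(s, y)] may leave it; the compactness of the box is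
    used as a covering property, with neighbourhoods of half the radius of continuity. *)
Lemma unif_on_box F (T N e : R) : continuous F -> 0 < e ->
  exists2 del : R, 0 < del & forall t x s y, 0 <= t <= T -> `|x| <= N ->
    `|s - t| < del -> `|y - x| < del -> `|F (s, y) - F (t, x)| <= e.
Proof.
move=> cF e0; have := proj1 (compact_near_coveringP _) (@compact_box T N).
move=> /(_ R (at_right 0) (fun del p => forall s y, `|s - p.1| < del -> `|y - p.2| < del ->
   `|F (s, y) - F p| <= e) _) /(_ _)/wrap[].
  move=> p Kp; have e20 : 0 < e / 2 by rewrite divr_gt0.
  have /cts_txP /(_ _ e20)[del del0 H] := cF p.
  exists (ball p (del / 2), [set x | x < del / 2]).
    split; first by apply: nbhsx_ballx; rewrite divr_gt0.
    by apply: nbhs_right_lt; rewrite divr_gt0.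
  move=> [q r] [/= [q1 q2] rd] s y sq yq.
  have {}q1 : `|q.1 - p.1| < del / 2 by move: q1; rewrite -ball_normE /= distrC.
  have {}q2 : `|q.2 - p.2| < del / 2 by move: q2; rewrite -ball_normE /= distrC.
  rewrite (splitr e) (le_trans (ler_distD (F p) _ _))// lerD//.
    apply: H; rewrite (splitr del).
      by rewrite (le_lt_trans (ler_distD q.1 _ _))// ltrD// (lt_trans sq).
    by rewrite (le_lt_trans (ler_distD q.2 _ _))// ltrD// (lt_trans yq).
  rewrite distrC (surjective_pairing q); apply: H.
    by rewrite (lt_trans q1)// ltr_pdivrMr// mulr_natr mulr2n ltrDl.
  by rewrite (lt_trans q2)// ltr_pdivrMr// mulr_natr mulr2n ltrDl.
move=> /nbhs_right0P[del /= del0 H]; have d20 : 0 < del / 2 by rewrite divr_gt0.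
have K : `|0 - del / 2| < del by rewrite sub0r normrN gtr0_norm// ltr_pdivrMr// mulr_natr mulr2n ltrDl.
exists (del / 2) => // t x s y tT xN st yx; apply: (H _ K d20 (t, x)); rewrite ?add0r//.
by split => /=; [rewrite in_itv/=|exact: box_norm].
Qed.

(* Two points a small distance apart are handled by uniform continuity, and
   otherwise the quadratic term dominates. *)
Lemma quadratic_modulus F (T N e : R) : 0 <= T -> continuous F ->
  (forall t x, 0 <= t <= T -> N < `|x| -> F (t, x) = 0) -> 0 < e ->
  exists2 K : R, 0 <= K & forall t x s y, 0 <= t <= T -> 0 <= s <= T ->
    `|F (s, y) - F (t, x)| <= e + K * (`|s - t| + `|y - x| ^+ 2).
Proof.
move=> T0 cF F0 e0.
have [C C0 HC] := bounded_on_box T N cF.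
have {}HC t x : 0 <= t <= T -> `|F (t, x)| <= C.
  by move=> tT; have [/HC|/F0 ->//] := leP `|x| N; [exact|rewrite normr0].
have [del del0 Hd] := @unif_on_box F T N e cF e0.
pose K := 2 * C / del + 2 * C / del ^+ 2.
have d2 : 0 < del ^+ 2 by rewrite exprn_gt0.
have A0 : 0 <= 2 * C / del by rewrite divr_ge0 ?mulr_ge0// ltW.
have B0 : 0 <= 2 * C / del ^+ 2 by rewrite divr_ge0 ?mulr_ge0// ltW.
have K0 : 0 <= K by exact: addr_ge0.
exists K => // t x s y tT sT.
have S0 : 0 <= `|s - t| + `|y - x| ^+ 2 by rewrite addr_ge0// sqr_ge0.
have KS0 : 0 <= K * (`|s - t| + `|y - x| ^+ 2) by rewrite mulr_ge0.
have small : `|s - t| < del -> `|y - x| < del -> `|F (s, y) - F (t, x)| <= e.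
  move=> st yx; have [xN|xN] := leP `|x| N; first exact: Hd.
  have [yN|yN] := leP `|y| N; last by rewrite !F0// subrr normr0 ltW.
  by rewrite distrC; apply: Hd => //; rewrite distrC.
have big : `|F (s, y) - F (t, x)| <= 2 * C.
  by rewrite (le_trans (ler_normB _ _))// mulr2n mulrDl mul1r lerD// HC.
have [st|st] := ltP `|s - t| del; last first.
  apply: (le_trans big); apply: (@le_trans _ _ (2 * C / del * `|s - t|)).
    by rewrite mulrAC ler_pdivlMr// ler_wpM2l// mulr_ge0.
  apply: (@le_trans _ _ (K * (`|s - t| + `|y - x| ^+ 2))); last by rewrite lerDr ltW.
  by apply: ler_pM => //; rewrite /K lerDl// sqr_ge0.
have [yx|yx] := ltP `|y - x| del; last first.
  apply: (le_trans big); apply: (@le_trans _ _ (2 * C / del ^+ 2 * `|y - x| ^+ 2)).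
    rewrite mulrAC ler_pdivlMr// ler_wpM2l// ?mulr_ge0// lerXn2r// nnegrE ltW//.
    exact: lt_le_trans del0 yx.
  apply: (@le_trans _ _ (K * (`|s - t| + `|y - x| ^+ 2))); last by rewrite lerDr ltW.
  by apply: ler_pM => //; rewrite ?sqr_ge0// /K lerDr.
by apply: (le_trans (small st yx)); rewrite lerDl.
Qed.

Lemma cts_rVP n (f : 'rV[R]_n -> R) (x : 'rV[R]_n) : {for x, continuous f} <->
  forall e : R, 0 < e -> exists2 del : R, 0 < del &
    forall y, `|y - x| < del -> `|f y - f x| <= e.
Proof.
have P := cvgrPdist_le (FF := nbhs_filter x) f (f x).
split=> [/P H e e0|H].
  have [del /= del0 {}H] := (nbhs_ballP _ _).1 (H _ e0).
  by exists del => // y yx; rewrite distrC; apply: H; rewrite -ball_normE /= distrC.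
apply/P => e e0; have [del del0 {}H] := H _ e0.
apply: (proj2 (nbhs_ballP x _)); exists del => //= y yx; rewrite distrC; apply: H.
by move: yx; rewrite -ball_normE /= distrC.
Qed.

Lemma continuous_slice (F : R * 'rV[R]_d -> R) x : continuous F -> continuous (fun r => F (r, x)).
Proof.
move=> cF r; apply/cvgrPdist_le => e e0.
have /cts_txP /(_ e e0)[del del0 H] := cF (r, x).
apply: (proj2 (nbhs_ballP r _)); exists del => //= s; rewrite -ball_normE /= => rs.
by rewrite distrC; apply: H => //=; rewrite ?subrr ?normr0 1?distrC.
Qed.

Lemma continuous_slice2 (F : R * 'rV[R]_d -> R) t : continuous F -> continuous (fun x => F (t, x)).
Proof.
move=> cF x; apply/cts_rVP => e e0; have /cts_txP /(_ e e0)[del del0 H] := cF (t, x).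
by exists del => // y yx; apply: H => //=; rewrite subrr normr0.
Qed.

Lemma clamped_slice (T : R) (f : R -> 'rV[R]_d -> R) t : 0 <= t <= T -> continuous (clamped T f) -> continuous (f t).
Proof.
move=> tT cf; rewrite (_ : f t = fun x => clamped T f (t, x)); first exact: continuous_slice2.
by apply/funext => x; rewrite /clamped /= clamp_id.
Qed.

End epsilon_delta.

(** * One-sided time derivatives *)

Section time_derivative.
Context {R : realType} {d : nat}.
Implicit Types (I : set R) (f : R -> 'rV[R]_d -> R).

Lemma time_quotP I f (t : R) x (l : R) : time_quot f t x @ within I t^' --> l <->
  forall e : R, 0 < e -> exists2 del : R, 0 < del & forall s, I s -> s != t ->
    `|s - t| < del -> `|time_quot f t x s - l| <= e.
Proof.
split=> [/cvgrPdist_le H e e0|H].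
  have := H e e0; rewrite near_withinE => /nbhs_ballP[del /= del0 {}H].
  exists del => // s Is st sd; rewrite distrC; apply: H => //.
  by rewrite -ball_normE /= distrC.
apply/cvgrPdist_le => e e0; have [del del0 {}H] := H e e0.
rewrite near_withinE; apply: (proj2 (nbhs_ballP t _)); exists del => //= s st sn Is.
by rewrite distrC; apply: H => //; move: st; rewrite -ball_normE /= distrC.
Qed.

(** Accumulation points of [I]: there the filter that defines [dt I] is proper, so any limit of the
    difference quotients determines the derivative. *)
Definition limit_time I (t : R) := forall del : R, 0 < del -> exists2 s, I s & (s != t) && (`|s - t| < del).

Lemma limit_time_proper I t : limit_time I t -> ProperFilter (within I t^').
Proof.
move=> H; apply: Build_ProperFilter_ex => P HP.
have /nbhs_ballP[del /= del0 K] : nbhs t (fun s => s != t -> I s -> P s) := HP.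
have [s Is /andP[st sd]] := H del del0; exists s; apply: K => //.
by rewrite -ball_normE /= distrC.
Qed.

Lemma limit_time_cc (T t : R) : 0 < T -> 0 <= t <= T -> limit_time `[0, T]%classic t.
Proof.
(* [h < del] and [2 h <= T], so that [t + h] or [t - h] stays in [[0, T]]. *)
move=> T0 /andP[t0 tT] del del0; pose h := Num.min del T / 2.
have h0 : 0 < h by rewrite divr_gt0// lt_min del0.
have hd : h < del by rewrite /h; have : Num.min del T <= del by [rewrite ge_min lexx]; have : 0 < Num.min del T by [rewrite lt_min del0]; lra.
have hT : 2 * h <= T by rewrite /h mulrCA divff// mulr1 ge_min lexx orbT.
have [th|th] := leP (t + h) T.
  exists (t + h); first by rewrite /= in_itv/= th andbT addr_ge0// ltW.
  by rewrite addrC addrK gtr0_norm// hd andbT -subr_eq0 addrK gt_eqF.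
exists (t - h); first by rewrite /= in_itv/=; apply/andP; split; lra.
rewrite addrAC subrr add0r normrN gtr0_norm// hd andbT -subr_eq0 addrAC subrr add0r.
by rewrite oppr_eq0 gt_eqF.
Qed.

Lemma limit_time_co (T t : R) : 0 <= t < T -> limit_time `[0, T[%classic t.
Proof.
move=> /andP[t0 tT] del del0; pose h := Num.min del (T - t) / 2.
have Tt : 0 < T - t by rewrite subr_gt0.
have m0 : 0 < Num.min del (T - t) by rewrite lt_min del0.
have h0 : 0 < h by rewrite divr_gt0.
have hd : h < del by rewrite /h; have : Num.min del (T - t) <= del by [rewrite ge_min lexx]; lra.
have hT : h < T - t by rewrite /h; have : Num.min del (T - t) <= T - t by [rewrite ge_min lexx orbT]; lra.
exists (t + h); first by rewrite /= in_itv/= addr_ge0 ?(ltW h0)//=; lra.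
by rewrite addrC addrK gtr0_norm// hd andbT -subr_eq0 addrK gt_eqF.
Qed.

Lemma dt_unique I f t x (l : R) : limit_time I t ->
  time_quot f t x @ within I t^' --> l -> dt I f t x = l.
Proof.
by move=> /limit_time_proper PF H; apply/cvg_lim.
Qed.

Lemma time_quotS I J f t x (l : R) : (exists2 r : R, 0 < r & forall s, J s -> `|s - t| < r -> I s) ->
  time_quot f t x @ within I t^' --> l -> time_quot f t x @ within J t^' --> l.
Proof.
move=> [r r0 JI] /time_quotP H; apply/time_quotP => e e0.
have [del del0 {}H] := H e e0.
exists (Num.min del r); first by rewrite lt_min del0.
move=> s Js st; rewrite lt_min => /andP[sd sr]; apply: H => //; exact: JI.
Qed.

Lemma is_derive_time I f (t : R) x (l : R) : (exists2 r : R, 0 < r & forall s, `|s - t| < r -> I s) ->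
  time_quot f t x @ within I t^' --> l -> is_derive t 1 (f^~ x) l.
Proof.
move=> [r r0 HI] /time_quotP H.
have C : (fun h : R => h^-1 *: (f (h *: (1 : R) + t) x - f t x)) @ 0^' --> l.
  apply/cvgrPdist_le => e e0; have [del del0 {}H] := H e e0.
  apply: (proj2 (nbhs_ballP 0 _)); exists (Num.min del r) => /=; first by rewrite lt_min del0.
  move=> h; rewrite -ball_normE /= sub0r normrN lt_min => /andP[hd hr] h0.
  have := H (h + t) _ _ _; rewrite addrK distrC /time_quot addrK [h%:A]mulr1; apply => //.
    by apply: HI; rewrite addrK.
  by rewrite -subr_eq0 addrK.
apply: DeriveDef; first by apply/cvg_ex; exists l.
exact/cvg_lim.
Qed.

Lemma C12_mvt (T : R) f (u v : R) x : C12 `[0, T] f -> 0 <= u -> u <= v -> v <= T ->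
  exists2 c : R, u <= c <= v & f v x - f u x = dt `[0, T] f c x * (v - u).
Proof.
move=> [Hd [cf _] _ _] u0 uv vT.
have [||c cuv E] := @MVT_segment R (f^~ x) (fun t => dt `[0, T] f t x) u v uv.
- move=> r; rewrite in_itv/= => /andP[ur rv].
  have r0T : `[0, T]%classic r by rewrite /= in_itv/=; apply/andP; split; lra.
  apply: (@is_derive_time `[0, T]%classic); last by have [] := Hd r x r0T.
  exists (Num.min r (T - r)); first by rewrite lt_min; apply/andP; split; lra.
  move=> s; rewrite lt_min !ltr_norml => /andP[/andP[s1 s2] /andP[s3 s4]].
  by rewrite /= in_itv/=; apply/andP; split; lra.
- have sub r : `[u, v]%classic r -> `[0, T]%classic r.
    by rewrite /= !in_itv/= => /andP[? ?]; apply/andP; split; lra.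
  apply/subspace_continuousP => r /sub rT; apply/cvgrPdist_le => e e0.
  move/continuous_txP : cf => /(_ r x rT e e0)[del del0 H].
  rewrite near_withinE; apply: (proj2 (nbhs_ballP r _)); exists del => //= s rs /sub sT.
  rewrite distrC; apply: H => //; last by rewrite subrr normr0.
  by move: rs; rewrite -ball_normE /= distrC.
- by exists c => //; move: cuv; rewrite in_itv.
Qed.

Lemma C12_pC2 (T : R) f t : C12 `[0, T] f -> 0 <= t <= T -> pC2 (f t).
Proof.
move=> [Hd _ c1 c2] tT; have It : `[0, T]%classic t by rewrite /= in_itv.
have /andP[t0 /(le_trans t0) T0] := tT.
split; first by split=> [i x|i]; [have [_ h _] := Hd t x It|exact: clamped_slice tT (clamped_continuous T0 (c1 i))].
by move=> i; split=> [j x|j]; [have [_ _ h] := Hd t x It|exact: clamped_slice tT (clamped_continuous T0 (c2 i j))].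
Qed.

End time_derivative.

Notation itg m B f := (m.-integrable B (EFin \o f)).

(** * Integration of real-valued functions *)

Section real_integrable.
Context {R : realType} {dY : measure_display} {Y : measurableType dY}.
Variable m : {measure set Y -> \bar R}.
Implicit Types (B : set Y) (f g h : Y -> R).

Lemma itgD B f g : measurable B -> itg m B f -> itg m B g -> itg m B (fun y => f y + g y).
Proof. by move=> mB If Ig; have := integrableD mB If Ig; apply: eq_integrable. Qed.

Lemma itgB B f g : measurable B -> itg m B f -> itg m B g -> itg m B (fun y => f y - g y).
Proof. by move=> mB If Ig; have := integrableB mB If Ig; apply: eq_integrable. Qed.

Lemma itgZ B f k : measurable B -> itg m B f -> itg m B (fun y => k * f y).
Proof. by move=> mB If; have := integrableZl mB k If; apply: eq_integrable. Qed.

Lemma itg_sum B (I : Type) (s : seq I) (h : I -> Y -> R) : measurable B ->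
  (forall i, itg m B (h i)) -> itg m B (fun y => \sum_(i <- s) h i y).
Proof.
move=> mB H; have := @integrable_sum _ _ _ m B mB I s xpredT (fun i y => (h i y)%:E) (fun i _ => H i).
by apply: eq_integrable => // y _; rewrite /= sumEFin.
Qed.

Lemma Rint_sum B (I : Type) (s : seq I) (h : I -> Y -> R) : measurable B ->
  (forall i, itg m B (h i)) ->
  \int[m]_(y in B) (\sum_(i <- s) h i y) = \sum_(i <- s) \int[m]_(y in B) h i y.
Proof.
move=> mB H; elim: s => [|i s IH].
  under eq_Rintegral do rewrite big_nil.
  by rewrite big_nil Rintegral_cst// mul0r.
under eq_Rintegral do rewrite big_cons.
by rewrite big_cons RintegralD// ?IH//; exact: itg_sum.
Qed.

Lemma itg_meas B f : itg m B f -> measurable_fun B f.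
Proof. by move=> /measurable_int /measurable_EFinP. Qed.

Lemma itg_le B f g : measurable B -> measurable_fun B f -> itg m B g ->
  (forall y, B y -> `|f y| <= g y) -> itg m B f.
Proof.
move=> mB mf Ig fg; apply: (le_integrable mB _ _ Ig); first exact/measurable_EFinP.
move=> y By; rewrite /= lee_fin (le_trans (fg y By))// ler_norm//.
Qed.

Lemma itg_norm B f : itg m B f -> itg m B (fun y => `|f y|).
Proof. by move=> If; exact: integrable_norm. Qed.

Lemma itg_eq B f g : measurable B -> itg m B f -> (forall y, B y -> f y = g y) -> itg m B g.
Proof.
move=> mB If fg; apply: (eq_integrable mB _ _ _ If) => y /set_mem By /=.
by rewrite fg.
Qed.

Lemma itg_bdM B f g (C : R) : measurable B -> measurable_fun B f -> itg m B g ->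
  (forall y, B y -> `|f y| <= C) -> itg m B (fun y => f y * g y).
Proof.
move=> mB mf Ig fC; apply: (@itg_le _ _ (fun y => C * `|g y|)) => //.
- by apply: measurable_funM => //; exact: itg_meas.
- by apply: itgZ => //; exact: itg_norm.
- by move=> y By; rewrite normrM ler_wpM2r// fC.
Qed.

Lemma le_Rint_bound B f g : measurable B -> itg m B f -> itg m B g ->
  (forall y, B y -> `|f y| <= g y) -> `|\int[m]_(y in B) f y| <= \int[m]_(y in B) g y.
Proof.
move=> mB If Ig fg; rewrite (le_trans (le_normr_Rintegral mB If))//.
by apply: le_Rintegral => //; exact: itg_norm.
Qed.

Lemma RintB B f g : measurable B -> itg m B f -> itg m B g ->
  \int[m]_(y in B) f y - \int[m]_(y in B) g y = \int[m]_(y in B) (f y - g y).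
Proof. by move=> *; rewrite RintegralB. Qed.

End real_integrable.

Lemma itg_cst {disp : measure_display} {X : measurableType disp} {R : realType}
  (m : {finite_measure set X -> \bar R}) (c : R) : itg m setT (fun=> c).
Proof. exact: finite_measure_integrable_cst. Qed.

(* Lebesgue measure lives on [measurableTypeR R], whose structure is not found from the carrier [R]. *)
Definition leb_RintegralZl R := @RintegralZl _ (measurableTypeR R) R (@lebesgue_measure R).
Definition leb_RintegralD R := @RintegralD _ (measurableTypeR R) R (@lebesgue_measure R).
Definition leb_le_Rintegral R := @le_Rintegral _ (measurableTypeR R) R (@lebesgue_measure R).
Definition leb_le_normr_Rintegral R := @le_normr_Rintegral _ (measurableTypeR R) R (@lebesgue_measure R).
Definition leb_integrableS R := @integrableS _ (measurableTypeR R) R (@lebesgue_measure R).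
Definition leb_itgD R := @itgD R _ (measurableTypeR R) (@lebesgue_measure R).
Definition leb_itgB R := @itgB R _ (measurableTypeR R) (@lebesgue_measure R).
Definition leb_itgZ R := @itgZ R _ (measurableTypeR R) (@lebesgue_measure R).
Definition leb_itg_sum R := @itg_sum R _ (measurableTypeR R) (@lebesgue_measure R).
Definition leb_itg_eq R := @itg_eq R _ (measurableTypeR R) (@lebesgue_measure R).
Definition leb_itg_norm R := @itg_norm R _ (measurableTypeR R) (@lebesgue_measure R).
Definition leb_le_Rint_bound R := @le_Rint_bound R _ (measurableTypeR R) (@lebesgue_measure R).
Definition leb_Rint_sum R := @Rint_sum R _ (measurableTypeR R) (@lebesgue_measure R).
Definition leb_RintB R := @RintB R _ (measurableTypeR R) (@lebesgue_measure R).
Arguments leb_RintegralZl : clear implicits.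
Arguments leb_RintegralD : clear implicits.
Arguments leb_le_Rintegral : clear implicits.
Arguments leb_le_normr_Rintegral : clear implicits.
Arguments leb_integrableS : clear implicits.
Arguments leb_itgD : clear implicits.
Arguments leb_itgB : clear implicits.
Arguments leb_itgZ : clear implicits.
Arguments leb_itg_sum : clear implicits.
Arguments leb_itg_eq : clear implicits.
Arguments leb_itg_norm : clear implicits.
Arguments leb_le_Rint_bound : clear implicits.
Arguments leb_Rint_sum : clear implicits.
Arguments leb_RintB : clear implicits.

(** * Integrals depending on a parameter *)

Section continuity_param.
Context {R : realType} {dY : measure_display} {Y : measurableType dY}.
Variable m : {measure set Y -> \bar R}.

Lemma cvg_Rint (B : set Y) (F_ : nat -> Y -> R) (F g : Y -> R) : measurable B ->
  (forall n, measurable_fun B (F_ n)) -> measurable_fun B F ->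
  (forall y, B y -> F_ ^~ y @ \oo --> F y) -> itg m B g ->
  (forall n y, B y -> `|F_ n y| <= g y) ->
  (fun n => \int[m]_(y in B) F_ n y) @ \oo --> \int[m]_(y in B) F y.
Proof.
move=> mB mF_ mF FF ig Fg.
have iF : itg m B F.
  apply: (itg_le mB mF ig) => y By.
  have := FF y By => /cvg_norm FFy.
  apply: (ler_cvg_to FFy (cvg_cst (g y))); apply: nearW => n; exact: Fg.
apply: fine_cvg; rewrite fineK; last exact: integrable_fin_num.
apply: (@dominated_cvg _ _ _ m B mB (fun n y => (F_ n y)%:E) (EFin \o F) (EFin \o g)).
- by move=> n; exact/measurable_EFinP.
- by move=> y By; apply: cvg_EFin; [exact: nearW|exact: FF].
- by [].
- exact: ig.
- by move=> n y By; rewrite lee_fin; exact: Fg.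
Qed.

(** Dominated convergence is sequential: a failure of continuity at [p] provides points [q n] at
    distance less than [r / n.+1] where the integral stays [e] away, which contradicts it. *)
Lemma continuity_param (E : pseudoMetricType R) (B : set Y) (f : E -> Y -> R) (p : E)
    (r : R) (g : Y -> R) : measurable B -> 0 < r ->
  (forall q, ball p r q -> measurable_fun B (f q)) ->
  (forall y, B y -> {for p, continuous (f^~ y)}) ->
  itg m B g -> (forall q y, ball p r q -> B y -> `|f q y| <= g y) ->
  {for p, continuous (fun q => \int[m]_(y in B) f q y)}.
Proof.
move=> mB r0 mf cf ig fg; apply/cvgrPdist_le => e e0.
apply: contrapT => /= H.
have H1 n : exists q, ball p (r / n.+1%:R) q /\ e < `|\int[m]_(y in B) f p y - \int[m]_(y in B) f q y|.
  apply: contrapT => /forallNP Hn; apply: H; apply: (proj2 (nbhs_ballP p _)).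
  exists (r / n.+1%:R) => /=; first by rewrite divr_gt0.
  by move=> q pq; rewrite leNgt; apply/negP => lt; apply: (Hn q).
have [q Hq] := choice H1.
have qr n : ball p r (q n).
  apply: le_ball (Hq n).1; rewrite ler_pdivrMr//.
  by apply: ler_peMr; [exact: ltW|rewrite ler1n].
have qp : q @ \oo --> p.
  apply/cvg_ballP => e' e'0; near=> n.
  apply: le_ball (Hq n).1; rewrite ler_pdivrMr// mulrC -ler_pdivrMr// ltW// -natr1 -ltrBlDr.
    near: n; exact: nbhs_infty_gtr.
have := @cvg_Rint B (fun n => f (q n)) (f p) g mB (fun n => mf _ (qr n)) (mf _ (ballxx p r0)).
move=> /(_ (fun y By => cvg_comp _ _ qp (cf y By)) ig (fun n y => fg _ y (qr n))).
move=> /cvgrPdist_le /(_ e e0)[N _ /(_ N (leqnn N))] /=.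
by rewrite leNgt (Hq N).2.
Unshelve. all: by end_near. Qed.

End continuity_param.

(** * Transfer of integrals between two spaces *)

Section transfer.
Context {R : realType} {d1 d2 dE : measure_display} {S1 : measurableType d1}
  {S2 : measurableType d2} {E : measurableType dE}.
Variables (m1 : {measure set S1 -> \bar R}) (m2 : {measure set S2 -> \bar R}).
Variables (V1 : S1 -> E) (V2 : S2 -> E) (D1 : S1 -> R) (D2 : S2 -> R).
Hypotheses (mV1 : measurable_fun setT V1) (mV2 : measurable_fun setT V2).
Hypotheses (iD1 : itg m1 setT D1) (iD2 : itg m2 setT D2).
Hypothesis DE : forall A, measurable A ->
  \int[m1]_(x in V1 @^-1` A) D1 x = \int[m2]_(x in V2 @^-1` A) D2 x.

Import HBNNSimple.

Let nnsfun_int d (S : measurableType d) (m : {measure set S -> \bar R}) (V : S -> E)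
    (D : S -> R) (f : {nnsfun E >-> R}) : measurable_fun setT V -> itg m setT D ->
  \int[m]_x (f (V x) * D x) =
  \sum_(y <- finmap.enum_fset (fset_set (range f)))
     y * \int[m]_(x in V @^-1` (f @^-1` [set y])) D x.
Proof.
move=> mV iD.
have mA y : measurable (V @^-1` (f @^-1` [set y])).
  by rewrite -[X in measurable X]setTI; apply: mV => //; exact: measurable_funPTI.
have iA y : itg m setT (fun x => \1_(V @^-1` (f @^-1` [set y])) x * D x).
  apply: (@itg_bdM _ _ _ _ _ _ _ 1) => // x _.
  by rewrite indicE; case: (_ \in _); rewrite ?normr1 ?normr0.
transitivity (\int[m]_x (\sum_(y <- finmap.enum_fset (fset_set (range f)))
     (y * (\1_(V @^-1` (f @^-1` [set y])) x * D x)))).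
  apply: eq_Rintegral => x _; rewrite (fimfunE f) fsbig_finite//= mulr_suml.
  by apply: eq_bigr => y _; rewrite mulrA.
rewrite Rint_sum//; last by move=> y; exact: itgZ.
apply: eq_bigr => y _; rewrite RintegralZl//; congr (_ * _).
rewrite [RHS]Rintegral_mkcond; apply: eq_Rintegral => x _.
by rewrite patchE indicE; case: ifPn => _; rewrite ?mul1r ?mul0r.
Qed.

Let transfer_ge0 (f : E -> R) : measurable_fun setT f -> (forall x, 0 <= f x) ->
  itg m1 setT (fun x => f (V1 x) * D1 x) -> itg m2 setT (fun x => f (V2 x) * D2 x) ->
  \int[m1]_x (f (V1 x) * D1 x) = \int[m2]_x (f (V2 x) * D2 x).
Proof.
move=> mf f0 i1 i2.
have mEf : measurable_fun setT (EFin \o f) by exact/measurable_EFinP.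
pose g := nnsfun_approx measurableT mEf.
have gf x : g ^~ x @ \oo --> f x.
  have := @cvg_nnsfun_approx _ _ _ _ measurableT _ mEf (fun x _ => f0 x) x Logic.I.
  by move/fine_cvg.
have g_le n x : g n x <= f x.
  have /cvg_lim <- // := gf x.
  apply: nondecreasing_cvgn_le; last by apply/cvg_ex; exists (f x); exact: gf.
  by move=> a b ab; exact/lefP/nd_nnsfun_approx.
have cvgS d (S : measurableType d) (m : {measure set S -> \bar R}) (V : S -> E) (D : S -> R) :
    measurable_fun setT V -> itg m setT D -> itg m setT (fun x => f (V x) * D x) ->
    (fun n => \int[m]_x (g n (V x) * D x)) @ \oo --> \int[m]_x (f (V x) * D x).
  move=> mV iD iFD; apply: (@cvg_Rint _ _ _ _ _ _ _ (fun x => `|f (V x) * D x|)) => //.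
  - by move=> n; apply: measurable_funM; [exact: measurableT_comp|exact: itg_meas iD].
  - exact: itg_meas iFD.
  - by move=> x _; apply: cvgMr_tmp; exact: gf.
  - exact: itg_norm.
  - by move=> n x _; rewrite !normrM ler_wpM2r// !ger0_norm.
have c1 := cvgS _ _ m1 V1 D1 mV1 iD1 i1.
have c2 := cvgS _ _ m2 V2 D2 mV2 iD2 i2.
have E12 : (fun n => \int[m1]_x (g n (V1 x) * D1 x)) = (fun n => \int[m2]_x (g n (V2 x) * D2 x)).
  apply/funext => n; rewrite !nnsfun_int//; apply: eq_bigr => y _; congr (_ * _).
  by apply: DE; exact: measurable_funPTI.
by rewrite E12 in c1; exact: (cvg_unique _ c1 c2).
Qed.

(** [DE] is the case of indicators. Linearity gives simple functions, dominated convergence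
    nonnegative ones, and positive and negative parts the general case. The weights [D1] and [D2]
    may change sign, so the same statement serves for densities, for independence and for the
    martingale property. *)
Lemma Rintegral_transfer (f : E -> R) : measurable_fun setT f ->
  itg m1 setT (fun x => f (V1 x) * D1 x) -> itg m2 setT (fun x => f (V2 x) * D2 x) ->
  \int[m1]_x (f (V1 x) * D1 x) = \int[m2]_x (f (V2 x) * D2 x).
Proof.
move=> mf i1 i2.
pose fp (x : E) : R := Num.max (f x) 0; pose fn (x : E) : R := Num.max (- f x) 0.
have mfp : measurable_fun setT fp by exact: measurable_maxr.
have mfn : measurable_fun setT fn.
  by apply: measurable_maxr => //; exact: measurableT_comp.
have fp0 x : 0 <= fp x by rewrite /fp le_max lexx orbT.
have fn0 x : 0 <= fn x by rewrite /fn le_max lexx orbT.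
have fpn x : f x = fp x - fn x.
  by rewrite /fp /fn !maxEle; case: (leP (f x) 0) => h; case: (leP (- f x) 0) => k; lra.
have fpl x : fp x <= `|f x| by rewrite /fp ge_max ler_norm normr_ge0.
have fnl x : fn x <= `|f x| by rewrite /fn ge_max -normrN ler_norm normr_ge0.
have ip d (S : measurableType d) (m : {measure set S -> \bar R}) (V : S -> E) (D : S -> R) (h : E -> R) :
    measurable_fun setT h -> (forall x, 0 <= h x) -> (forall x, h x <= `|f x|) ->
    measurable_fun setT V -> itg m setT D -> itg m setT (fun x => f (V x) * D x) ->
    itg m setT (fun x => h (V x) * D x).
  move=> mh h0 hf mV iD iFD; apply: (@itg_le _ _ _ _ _ _ (fun x => `|f (V x) * D x|)) => //.
  - by apply: measurable_funM; [exact: measurableT_comp|exact: itg_meas iD].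
  - exact: itg_norm.
  - by move=> x _; rewrite !normrM ler_wpM2r// ger0_norm.
have eqd d (S : measurableType d) (m : {measure set S -> \bar R}) (V : S -> E) (D : S -> R) :
    measurable_fun setT V -> itg m setT D -> itg m setT (fun x => f (V x) * D x) ->
    \int[m]_x (f (V x) * D x) = \int[m]_x (fp (V x) * D x) - \int[m]_x (fn (V x) * D x).
  move=> mV iD iFD; rewrite RintB//; last 2 first.
  - exact: ip.
  - exact: ip.
  by apply: eq_Rintegral => x _; rewrite fpn mulrBl.
by rewrite !eqd// !transfer_ge0//; exact: ip.
Qed.

End transfer.

Section continuous_measurable.
Context {R : realType}.

Lemma continuous_measurable_rV n (f : 'rV[R]_n -> R) : continuous f -> measurable_fun setT f.
Proof.
move=> cf.
apply: (@measurability _ _ _ _ _ _ _ (measurable_realfun.RGenOpens.measurableE R)).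
move=> _ [B [a [b ->]] <-]; rewrite setTI; apply: open_measurable_rV.
by apply: open_comp; [move=> x _; exact: cf|exact: interval_open].
Qed.

(** Pairs carry the product sigma-algebra, which is not by definition the Borel one of the product
    topology. The detour through [R^(d+1)], where continuous functions are Borel measurable, and the
    measurable map [rV_cons] connect the two. *)
Lemma continuous_measurable_tx d (F : R * 'rV[R]_d -> R) : continuous F -> measurable_fun setT F.
Proof.
move=> cF.
have cG : continuous (F \o @rV_uncons R d).
  move=> x; apply/cts_rVP => e e0.
  have /cts_txP /(_ e e0)[del del0 H] := cF (rV_uncons x).
  exists del => // y xy; apply: H.
    apply: le_lt_trans xy.
    by have := coord_norm (y - x) ord0; rewrite !mxE.
  apply: le_lt_trans xy; apply: norm_le_coord => // i.
  by have := coord_norm (y - x) (lift ord0 i); rewrite !mxE.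
have -> : F = (F \o @rV_uncons R d) \o @rV_cons R d.
  by apply/funext => p /=; rewrite rV_consK.
apply: measurableT_comp; first exact: continuous_measurable_rV.
exact: measurable_rV_cons.
Qed.

End continuous_measurable.

(** * Fubini's theorem for real-valued integrals *)

Section fubini_real.
Context {R : realType} {d1 d2 : measure_display} {T1 : measurableType d1} {T2 : measurableType d2}.
Variables (m1 : {sigma_finite_measure set T1 -> \bar R}) (m2 : {sigma_finite_measure set T2 -> \bar R}).
Implicit Types f : T1 * T2 -> R.

Lemma measurable_Rint1 f (B : set T2) : measurable B -> measurable_fun setT f ->
  measurable_fun setT (fun x => \int[m2]_(y in B) f (x, y)).
Proof.
move=> mB mf; under eq_fun do rewrite Rintegral_mkcond.
pose g (p : T1 * T2) : R := f p * \1_B p.2.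
have gE x y : ((fun y => f (x, y)) \_ B) y = g (x, y).
  by rewrite patchE /g indicE /=; case: ifPn => _; rewrite ?mulr1 ?mulr0.
have mg : measurable_fun setT (EFin \o g).
  apply/measurable_EFinP/measurable_funM => //.
  by apply: measurableT_comp => //; exact: measurable_indic.
have -> : (fun x => \int[m2]_y ((fun y => f (x, y)) \_ B) y) =
  (fun x => fine (\int[m2]_y (EFin \o g)^\+ (x, y) - \int[m2]_y (EFin \o g)^\- (x, y))%E).
  apply/funext => x; rewrite /Rintegral integralE; congr (fine (_ - _)%E).
    by apply: eq_integral => y _; rewrite !funeposE /= gE.
  by apply: eq_integral => y _; rewrite !funenegE /= gE.
apply: (measurableT_comp (f := fine)) => //; apply: emeasurable_funB.
  by apply: measurable_fun_fubini_tonelli_F => //; exact: measurable_funepos.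
by apply: measurable_fun_fubini_tonelli_F => //; exact: measurable_funeneg.
Qed.

(** The inner real integral takes the default value 0 of [fine] where the extended one is infinite.
    This happens on a null set only, so the iterated real integrals still agree. *)
Lemma fubini_Rint (D : set T1) f : measurable D -> measurable_fun setT f ->
  (\int[m1]_(x in D) \int[m2]_y (`|f (x, y)|)%:E < +oo)%E ->
  [/\ itg m1 D (fun x => \int[m2]_y f (x, y)),
      itg m2 setT (fun y => \int[m1]_(x in D) f (x, y)) &
      \int[m1]_(x in D) \int[m2]_y f (x, y) = \int[m2]_y \int[m1]_(x in D) f (x, y)].
Proof.
move=> mD mf Ffin.
pose g (p : T1 * T2) : R := \1_D p.1 * f p.
have mg : measurable_fun setT g.
  by apply: measurable_funM => //; apply: measurableT_comp => //; exact: measurable_indic.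
have ig : (m1 \x m2)%E.-integrable setT (EFin \o g).
  apply/integrable12ltyP; first exact/measurable_EFinP.
  apply: le_lt_trans Ffin; rewrite [X in (_ <= X)%E]integral_mkcond le_eqVlt; apply/orP; left; apply/eqP.
  apply: eq_integral => x _; rewrite patchE; case: ifPn => xD.
    by apply: eq_integral => y _; rewrite /g /= indicE xD mul1r.
  by apply: integral0_eq => y _; rewrite /g /= indicE (negbTE xD) mul0r normr0.
have gx x : (fun y => g (x, y)) = (fun y => \1_D x * f (x, y)) by [].
have F1 := integrable_fubini_F ig.
have mEg : measurable_fun setT (EFin \o g) by exact/measurable_EFinP.
have F2 : m2.-integrable setT (fun y => \int[m1]_x (EFin \o g) (x, y))%E.
  have mG := measurable_fubini_G ig.
  apply/integrableP; split => //.
  have L := (integrable21ltyP m1 m2 mEg).1 ig.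
  apply: le_lt_trans L; apply: ge0_le_integral => //.
  - exact: measurableT_comp.
  - apply: (measurable_fun_fubini_tonelli_G (abse \o (EFin \o g))); last by move=> p; exact: abse_ge0.
    exact: measurableT_comp.
  - move=> y _; apply: le_abse_integral => //; exact: measurableT_comp.

have ae1 := ae_integrable1 ig; have ae2 := ae_integrable2 ig.
have E1 : (fun x => \int[m2]_y g (x, y)) = (fun x => \int[m2]_y f (x, y)) \_ D.
  apply/funext => x; rewrite patchE; case: ifPn => xD.
    by apply: eq_Rintegral => y _; rewrite /g /= indicE xD mul1r.
  under eq_Rintegral do rewrite /g /= indicE (negbTE xD) mul0r.
  by rewrite Rintegral_cst// mul0r.
have E2 : (fun y => \int[m1]_x g (x, y)) = (fun y => \int[m1]_(x in D) f (x, y)).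
  apply/funext => y; rewrite [RHS]Rintegral_mkcond; apply: eq_Rintegral => x _.
  by rewrite patchE /g indicE; case: ifPn => _; rewrite ?mul1r ?mul0r.
have fin d (T : measurableType d) (m : {measure set T -> \bar R}) (G : T -> \bar R) :
    m.-integrable setT G -> m.-integrable setT (EFin \o (fine \o G)) /\
      (\int[m]_x (fine (G x))%:E = \int[m]_x G x)%E.
  move=> iG; have aeG := integrable_ae measurableT iG.
  have mG : measurable_fun setT G by exact: measurable_int iG.
  have mfG : measurable_fun setT (EFin \o (fine \o G)).
    by apply/measurable_EFinP; exact: measurableT_comp.
  split; last first.
    apply: ae_eq_integral => //.
    by apply: filterS aeG => x /= H /H /fineK.
  apply: (le_integrable measurableT mfG _ iG) => x _ /=.
  by case: (G x) => [r||]; rewrite ?leey//= normr0.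
have [i1 e1] := fin _ _ _ _ F1; have [i2 e2] := fin _ _ _ _ F2.
have i1' : itg m1 setT ((fun x => \int[m2]_y f (x, y)) \_ D) by rewrite -E1.
split.
- by apply/(integrable_mkcond _ mD); rewrite restrict_EFin.
- by rewrite -E2.
- rewrite Rintegral_mkcond -E1 -E2; congr fine.
  by rewrite [LHS]e1 [RHS]e2; exact: Fubini.
Qed.

End fubini_real.

Section fubini_lebesgue.
Context {R : realType} {d2 : measure_display} {T2 : measurableType d2}.
Variable m2 : {sigma_finite_measure set T2 -> \bar R}.
Local Notation leb := (@lebesgue_measure R).
Implicit Types f : R * T2 -> R.

Lemma fubini_leb (D : set R) f : measurable D -> measurable_fun setT f ->
  (\int[leb]_(t in D) \int[m2]_y (`|f (t, y)|)%:E < +oo)%E ->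
  [/\ itg leb D (fun t => \int[m2]_y f (t, y)),
      itg m2 setT (fun y => \int[leb]_(t in D) f (t, y)) &
      \int[leb]_(t in D) \int[m2]_y f (t, y) = \int[m2]_y \int[leb]_(t in D) f (t, y)].
Proof. exact: (@fubini_Rint R _ _ (measurableTypeR R) T2 leb m2). Qed.

Lemma measurable_Rint_leb (D : set R) f : measurable D -> measurable_fun setT f ->
  measurable_fun setT (fun y => \int[leb]_(t in D) f (t, y)).
Proof.
move=> mD mf.
apply: (@measurable_Rint1 R _ _ T2 (measurableTypeR R) leb (fun p => f (p.2, p.1)) D mD).
by apply: (measurableT_comp mf); apply/measurable_fun_pairP; split; [exact: measurable_snd|exact: measurable_fst].
Qed.

Lemma measurable_Rint2 f : measurable_fun setT f ->
  measurable_fun setT (fun t => \int[m2]_y f (t, y)).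
Proof. exact: (@measurable_Rint1 R _ _ (measurableTypeR R) T2 m2 f setT measurableT). Qed.

Lemma tonelli_leb (D : set R) (f : R * T2 -> \bar R) : measurable D -> measurable_fun setT f ->
  (forall p, 0 <= f p)%E ->
  (\int[leb]_(t in D) \int[m2]_y f (t, y) = \int[m2]_y \int[leb]_(t in D) f (t, y))%E.
Proof.
move=> mD mf f0.
pose g (p : R * T2) : \bar R := ((\1_D p.1)%:E * f p)%E.
have mg : measurable_fun setT g.
  apply: emeasurable_funM => //; apply/measurable_EFinP.
  by apply: measurableT_comp => //; exact: measurable_indic.
have g0 p : (0 <= g p)%E by rewrite /g mule_ge0// lee_fin indicE.
have := @fubini_tonelli _ _ (measurableTypeR R) T2 R leb m2 g mg g0.
have E1 : (fun t => \int[m2]_y g (t, y))%E = (fun t => \int[m2]_y f (t, y))%E \_ D.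
  apply/funext => t; rewrite patchE /g /= indicE; case: ifPn => tD.
    by apply: eq_integral => y _; rewrite mul1e.
  by apply: integral0_eq => y _; rewrite mul0e.
have E2 y : (\int[leb]_t g (t, y) = \int[leb]_(t in D) f (t, y))%E.
  rewrite [RHS]integral_mkcond; apply: eq_integral => t _; rewrite patchE /g /= indicE.
  by case: ifPn => _; rewrite ?mul1e ?mul0e.
rewrite E1 -integral_mkcond => ->.
by apply: eq_integral => y _; exact: E2.
Qed.

End fubini_lebesgue.

(** * Calculus rules for the classes [pC1] and [pC2] *)

Section closure.
Context {R : realType} {d : nat}.
Implicit Types (f g : 'rV[R]_d -> R) (x v : 'rV[R]_d).
Local Notation e_ i := (delta_mx ord0 i : 'rV[R]_d).

(** Converse of [is_derive_line] at [r = 0]: directional derivatives can be computed on one-variable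
    restrictions. *)
Lemma derive_of_line f x v (l : R) : is_derive (0 : R) 1 (fun h : R => f (x + h *: v)) l ->
  derivable f x v /\ 'D_v f x = l.
Proof.
move=> [D1 D2].
have E : (fun h : R => h^-1 *: (f (x + (h *: (1 : R) + 0) *: v) - f (x + (0 : R) *: v)))
    = (fun h : R => h^-1 *: (f (h *: v + x) - f x)).
  apply/funext => h; rewrite scale0r !addr0 [_%:A]mulr1.
  by rewrite [x + _]addrC.
split; first by move: D1; rewrite /derivable /= E.
by rewrite -D2 /derive /= E.
Qed.

Lemma pC1_ext f (Df : 'I_d -> 'rV[R]_d -> R) :
  (forall i x, pderivable i f x /\ partial i f x = Df i x) ->
  (forall i, continuous (Df i)) -> pC1 f.
Proof.
move=> H cD; split=> [i x|i]; first by have [] := H i x.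
rewrite (_ : partial i f = Df i); first exact: cD.
by apply/funext => x; have [] := H i x.
Qed.

Lemma pC1_cst (c : R) : pC1 (fun _ : 'rV[R]_d => c).
Proof.
apply: (@pC1_ext _ (fun _ _ => 0)) => [i x|i x]; last exact: cst_continuous.
by split; [exact: derivable_cst|exact: derive_cst].
Qed.

Lemma partial_cst i (c : R) : partial i (fun _ : 'rV[R]_d => c) = fun _ => 0.
Proof. by apply/funext => x; exact: derive_cst. Qed.

Lemma partialD f g i x : pderivable i f x -> pderivable i g x ->
  pderivable i (fun y => f y + g y) x /\ partial i (fun y => f y + g y) x = partial i f x + partial i g x.
Proof.
move=> df dg; split; first exact: (@derivableD _ _ _ f g x (e_ i) df dg).
exact: (@deriveD _ _ _ f g x (e_ i) df dg).
Qed.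

Lemma partialB f g i x : pderivable i f x -> pderivable i g x ->
  pderivable i (fun y => f y - g y) x /\ partial i (fun y => f y - g y) x = partial i f x - partial i g x.
Proof.
move=> df dg; split; first exact: (@derivableB _ _ _ f g x (e_ i) df dg).
exact: (@deriveB _ _ _ f g x (e_ i) df dg).
Qed.

Lemma partialM f g i x : pderivable i f x -> pderivable i g x ->
  pderivable i (fun y => f y * g y) x /\
  partial i (fun y => f y * g y) x = f x * partial i g x + g x * partial i f x.
Proof.
move=> df dg; split; first exact: (@derivableM _ _ f g x (e_ i) df dg).
exact: (@deriveM _ _ f g x (e_ i) df dg).
Qed.

Lemma partial_sum (I : Type) (s : seq I) (F : I -> 'rV[R]_d -> R) i x :
  (forall k, pderivable i (F k) x) ->
  pderivable i (fun y => \sum_(k <- s) F k y) x /\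
  partial i (fun y => \sum_(k <- s) F k y) x = \sum_(k <- s) partial i (F k) x.
Proof.
move=> H; elim: s => [|k s [IH1 IH2]].
  under eq_fun do rewrite big_nil.
  by rewrite big_nil; split; [exact: derivable_cst|exact: derive_cst].
under eq_fun do rewrite big_cons.
rewrite big_cons -IH2.
exact: (@partialD (F k) (fun y => \sum_(k <- s) F k y) i x (H k) IH1).
Qed.

Lemma pC1D f g : pC1 f -> pC1 g -> pC1 (fun y => f y + g y).
Proof.
move=> Cf Cg; apply: (@pC1_ext _ (fun i x => partial i f x + partial i g x)) => [i x|i x].
  exact: (partialD (Cf.1 i x) (Cg.1 i x)).
exact: (continuousD (Cf.2 i x) (Cg.2 i x)).
Qed.

Lemma pC1B f g : pC1 f -> pC1 g -> pC1 (fun y => f y - g y).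
Proof.
move=> Cf Cg; apply: (@pC1_ext _ (fun i x => partial i f x - partial i g x)) => [i x|i x].
  exact: (partialB (Cf.1 i x) (Cg.1 i x)).
exact: (continuousB (Cf.2 i x) (Cg.2 i x)).
Qed.

Lemma pC1M f g : pC1 f -> pC1 g -> pC1 (fun y => f y * g y).
Proof.
move=> Cf Cg; apply: (@pC1_ext _ (fun i x => f x * partial i g x + g x * partial i f x)) => [i x|i x].
  exact: (partialM (Cf.1 i x) (Cg.1 i x)).
exact: (continuousD (continuousM (pC1_continuous Cf (x:=x)) (Cg.2 i x))
  (continuousM (pC1_continuous Cg (x:=x)) (Cf.2 i x))).
Qed.

Lemma partial_comp (s s' : R -> R) f i x : (forall y : R, is_derive y 1 s (s' y)) -> pC1 f ->
  pderivable i (fun y => s (f y)) x /\ partial i (fun y => s (f y)) x = partial i f x * s' (f x).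
Proof.
move=> ds Cf.
have H := @is_derive_line R d f x (e_ i) 0 (Cf.1 i).
have K := @is_derive1_comp R s (fun h : R => f (x + h *: e_ i)) 0 _ _ (ds _) H.
have [A B] := @derive_of_line (fun y => s (f y)) x (e_ i) _ K.
move: B; rewrite scale0r addr0 => B; split; [exact: A|rewrite /partial B mulrC; exact: erefl].
Qed.

Lemma pC1_comp (s s' : R -> R) f : (forall y : R, is_derive y 1 s (s' y)) -> continuous s' ->
  pC1 f -> pC1 (fun y => s (f y)).
Proof.
move=> ds cs Cf; apply: (@pC1_ext _ (fun i x => partial i f x * s' (f x))) => [i x|i x].
  exact: partial_comp.
apply: (continuousM (Cf.2 i x)).
by apply: (@continuous_comp _ _ _ f s'); [exact: pC1_continuous|exact: cs].
Qed.

Lemma pC2_cst (c : R) : pC2 (fun _ : 'rV[R]_d => c).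
Proof.
split=> [|i]; first exact: pC1_cst.
by rewrite partial_cst; exact: pC1_cst.
Qed.

Lemma pC2D f g : pC2 f -> pC2 g -> pC2 (fun y => f y + g y).
Proof.
move=> [Cf Cf'] [Cg Cg']; split=> [|i]; first exact: (pC1D Cf Cg).
rewrite (_ : partial i _ = fun x => partial i f x + partial i g x); first exact: (pC1D (Cf' i) (Cg' i)).
by apply/funext => x; have [] := partialD (Cf.1 i x) (Cg.1 i x).
Qed.

Lemma pC2B f g : pC2 f -> pC2 g -> pC2 (fun y => f y - g y).
Proof.
move=> [Cf Cf'] [Cg Cg']; split=> [|i]; first exact: (pC1B Cf Cg).
rewrite (_ : partial i _ = fun x => partial i f x - partial i g x); first exact: (pC1B (Cf' i) (Cg' i)).
by apply/funext => x; have [] := partialB (Cf.1 i x) (Cg.1 i x).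
Qed.

Lemma pC2M f g : pC2 f -> pC2 g -> pC2 (fun y => f y * g y).
Proof.
move=> [Cf Cf'] [Cg Cg']; split=> [|i]; first exact: (pC1M Cf Cg).
rewrite (_ : partial i _ = fun x => f x * partial i g x + g x * partial i f x).
  exact: (pC1D (pC1M Cf (Cg' i)) (pC1M Cg (Cf' i))).
by apply/funext => x; have [] := partialM (Cf.1 i x) (Cg.1 i x).
Qed.

Lemma pC2_comp (s s' s'' : R -> R) f : (forall y : R, is_derive y 1 s (s' y)) ->
  (forall y : R, is_derive y 1 s' (s'' y)) -> continuous s'' ->
  pC2 f -> pC2 (fun y => s (f y)).
Proof.
move=> ds ds' cs [Cf Cf'].
have cs' : continuous s'.
  by move=> y; apply/differentiable_continuous/derivable1_diffP; have [] := ds' y.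
split=> [|i]; first exact: (pC1_comp ds cs' Cf).
rewrite (_ : partial i _ = fun x => partial i f x * s' (f x)).
  exact: (pC1M (Cf' i) (pC1_comp ds' cs Cf)).
by apply/funext => x; have [] := partial_comp i x ds Cf.
Qed.

Lemma pC2_sum (I : Type) (s : seq I) (F : I -> 'rV[R]_d -> R) :
  (forall k, pC2 (F k)) -> pC2 (fun y => \sum_(k <- s) F k y).
Proof.
move=> H; elim: s => [|k s IH].
  under eq_fun do rewrite big_nil.
  exact: pC2_cst.
under eq_fun do rewrite big_cons.
exact: (@pC2D (F k) (fun y => \sum_(k <- s) F k y) (H k) IH).
Qed.

Lemma partial_coord (k i : 'I_d) x : pderivable i (fun y => y ord0 k) x /\
  partial i (fun y => y ord0 k) x = (k == i)%:R.
Proof.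
apply: derive_of_line.
rewrite (_ : (fun h : R => _) = fun h : R => x ord0 k + h * (k == i)%:R); last first.
  by apply/funext => h; rewrite !mxE eqxx.
apply: is_derive_eq.
by rewrite /GRing.scale /=; ring.
Qed.

Lemma pC2_coord (k : 'I_d) : pC2 (fun y : 'rV[R]_d => y ord0 k).
Proof.
have E i : partial i (fun y : 'rV[R]_d => y ord0 k) = fun _ => (k == i)%:R.
  by apply/funext => x; have [] := partial_coord k i x.
split=> [|i]; last by rewrite E; exact: pC1_cst.
apply: (@pC1_ext _ (fun i _ => (k == i)%:R)) => [i x|i x]; last exact: cst_continuous.
exact: partial_coord.
Qed.

Lemma partial_eq0 f (N : R) i x : (forall y, N < `|y| -> f y = 0) -> N < `|x| -> partial i f x = 0.
Proof.
move=> f0 Nx; rewrite /partial.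
have [_ ->//] : derivable f x (e_ i) /\ 'D_(e_ i) f x = 0.
apply: derive_of_line.
apply: (@near_eq_is_derive _ _ _ (cst 0) (fun h : R => f (x + h *: e_ i))) => //.
have cl := @continuous_line R d x (e_ i) 0.
apply: (proj2 (nbhs_ballP (0 : R) _)); exists (`|x| - N) => /=; first by rewrite subr_gt0.
move=> h; rewrite -ball_normE /= sub0r normrN => hN; rewrite f0//.
apply: (@lt_le_trans _ _ (`|x| - `|h|)); first by rewrite ltrBrDl -ltrBrDr.
rewrite lerBlDr (le_trans (_ : _ <= `|x + h *: e_ i| + `|h *: e_ i|))//.
  rewrite -{1}(addrK (h *: e_ i) x); exact: ler_normB.
by rewrite lerD2l normrZ ler_piMr// norm_delta.
Qed.

End closure.

(** * Bump and plateau functions *)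

Section bumps.
Context {R : realType}.

(** Powers of the positive part. The third one is of class C^2, which is all the smoothness asked of
    test functions and cutoffs below. *)
Definition pospow (k : nat) (y : R) : R := Num.max y 0 ^+ k.

Lemma pospow_ge0 k y : 0 <= pospow k y.
Proof. by rewrite exprn_ge0// le_max lexx orbT. Qed.

Lemma pospow_le0 k y : y <= 0 -> pospow k.+1 y = 0.
Proof. by move=> y0; rewrite /pospow (max_idPr y0) expr0n. Qed.

Lemma continuous_pospow k : continuous (pospow k).
Proof.
have cm : continuous (fun y : R => Num.max y 0).
  move=> y; apply/cvgrPdist_le => e e0.
  apply: (proj2 (nbhs_ballP (y : R) _)); exists e => //= z; rewrite -ball_normE /= => /ltW.
  apply: le_trans; have n1 := ler_norm (y - z).
  have n2 : z - y <= `|y - z| by rewrite distrC ler_norm.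
  rewrite ler_norml !maxEle.
  by case: (leP y 0) => ?; case: (leP z 0) => ?; apply/andP; split; lra.
elim: k => [|k IH] y.
  rewrite (_ : pospow 0 = cst 1); first exact: cst_continuous.
  by apply/funext => z; rewrite /pospow expr0.
rewrite (_ : pospow k.+1 = fun z => Num.max z 0 * pospow k z).
  exact: (continuousM (cm y) (IH y)).
by apply/funext => z; rewrite /pospow exprS.
Qed.

Lemma is_derive_pospow k (y : R) : is_derive y 1 (pospow k.+2) (k.+2%:R * pospow k.+1 y).
Proof.
have [y0|y0|->] := ltrgtP y 0.
- rewrite pospow_le0 ?ltW// mulr0.
  apply: (@near_eq_is_derive _ _ _ (cst 0)) => //.
  near=> z; rewrite /= pospow_le0// ltW//; near: z; exact: lt_nbhsl.
- apply: (@near_eq_is_derive R R R (fun z : R => z ^+ k.+2)).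
  + near=> z; rewrite /pospow (max_idPl _)// ltW//; near: z; exact: lt_nbhsr.
  + rewrite /pospow (max_idPl (ltW y0)).
    apply: DeriveDef; first exact: (@exprn_derivable R k.+2 y 1).
    by rewrite exp_derive /GRing.scale/= mulr1 -mulr_natl.
(* At the origin the quotient is bounded by [|h| ^+ k.+1], hence by [|h|] when [|h| <= 1]. *)
- rewrite pospow_le0// mulr0.
  have C : (fun h : R => h^-1 *: (pospow k.+2 (h *: (1 : R) + 0) - pospow k.+2 0)) @ 0^' --> (0 : R).
    apply/cvgrPdist_le => e e0.
    apply: (proj2 (nbhs_ballP (0 : R) _)); exists (Num.min 1 e) => /=; first by rewrite lt_min ltr01.
    move=> h; rewrite -ball_normE /= sub0r normrN lt_min => /andP[h1 he] h0.
    rewrite [X in pospow _ X]addr0 [X in pospow _ X]mulr1 [pospow k.+2 0]pospow_le0// subr0 sub0r normrN.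
    rewrite /GRing.scale/= normrM normfV mulrC ler_pdivrMr ?normr_gt0//.
    apply: (@le_trans _ _ (`|h| ^+ k.+2)).
      rewrite ger0_norm ?pospow_ge0// /pospow lerXn2r ?nnegrE ?le_max ?lexx ?orbT//.
      by rewrite ge_max ler_norm normr_ge0.
    rewrite exprS mulrC ler_wpM2r// exprS (le_trans _ (ltW he))// ler_piMr//.
    by rewrite exprn_ile1// ltW.
  apply: DeriveDef; first by apply/cvg_ex; exists 0.
  exact/cvg_lim.
Unshelve. all: by end_near. Qed.

Context {d : nat}.
Implicit Types (x c : 'rV[R]_d).

Lemma pC2_pospow3 (f : 'rV[R]_d -> R) : pC2 f -> pC2 (fun y => pospow 3 (f y)).
Proof.
apply: (@pC2_comp R d _ (fun y => 3%:R * pospow 2 y) (fun y => 3%:R * (2%:R * pospow 1 y))).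
- by move=> y; exact: is_derive_pospow.
- by move=> y; have H := @is_derive_pospow 0 y; exact: (is_deriveZ 3%:R H).
- by move=> y; do 2 apply: cvgMl_tmp; exact: continuous_pospow.
Qed.

(** The norm of row vectors is the sup norm, which is not differentiable; the cutoffs are functions
    of this polynomial, and [sqdist_ge] and [sqdist_le] compare it with the norm. *)
Definition sqdist c x : R := \sum_i (x ord0 i - c ord0 i) ^+ 2.

Lemma pC2_sqdist c : pC2 (sqdist c).
Proof.
apply: pC2_sum => i.
have H : pC2 (fun y : 'rV[R]_d => y ord0 i - c ord0 i) by apply: pC2B; [exact: pC2_coord|exact: pC2_cst].
exact: (pC2M H H).
Qed.

Lemma sqdist_ge c x (e : R) : 0 < e -> e <= `|x - c| -> e ^+ 2 <= sqdist c x.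
Proof.
move=> e0 xc.
suff [i ei] : exists i, e <= `|x ord0 i - c ord0 i|.
  apply: (@le_trans _ _ ((x ord0 i - c ord0 i) ^+ 2)).
    by rewrite -[leRHS]real_normK ?num_real// lerXn2r// nnegrE// ltW.
  by rewrite /sqdist (bigD1 i)//= lerDl sumr_ge0// => j _; exact: sqr_ge0.
apply: contrapT => /forallNP H.
have [m me Hm] : exists2 m, m < e & forall i, `|(x - c) ord0 i| <= m.
  exists (\big[Num.max/0]_i `|x ord0 i - c ord0 i|).
    by apply: bigmax_lt => // i _; rewrite ltNge; apply/negP/H.
  by move=> i; rewrite !mxE; apply/bigmax_geP; right; exists i.
have m0 : 0 <= Num.max m 0 by rewrite le_max lexx orbT.
have : `|x - c| <= Num.max m 0.
  by apply: norm_le_coord => // i; rewrite le_max Hm.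
by apply/negP; rewrite -ltNge (lt_le_trans _ xc)// gt_max me.
Qed.

Lemma sqdist_le c x (e : R) : `|x - c| <= e -> sqdist c x <= d%:R * e ^+ 2.
Proof.
move=> xc; apply: (@le_trans _ _ (\sum_(i < d) e ^+ 2)); last by rewrite sumr_const card_ord mulr_natl.
apply: ler_sum => i _; rewrite -[leLHS]real_normK ?num_real//.
have H : `|x ord0 i - c ord0 i| <= e.
  by have := le_trans (coord_norm (x - c) i) xc; rewrite !mxE.
by rewrite lerXn2r// nnegrE// (le_trans _ H).
Qed.

Lemma bump_exists c (e : R) : 0 < e -> exists eta : 'rV[R]_d -> R,
  [/\ pC2 eta, forall x, 0 <= eta x, forall x, e <= `|x - c| -> eta x = 0 &
      exists2 a : R, 0 < a & exists2 r : R, 0 < r & forall x, `|x - c| <= r -> a <= eta x].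
Proof.
move=> e0; have e2 : 0 < e ^+ 2 by rewrite exprn_gt0.
exists (fun x => pospow 3 (e ^+ 2 - sqdist c x)); split.
- apply: pC2_pospow3; apply: pC2B; [exact: pC2_cst|exact: pC2_sqdist].
- by move=> x; exact: pospow_ge0.
- by move=> x xc; rewrite pospow_le0// subr_le0; exact: sqdist_ge.
- exists ((e ^+ 2 / 2) ^+ 3); first by rewrite exprn_gt0// divr_gt0.
  have K0 : 0 < d%:R *+ 2 + 1 :> R by rewrite ltr_wpDl// mulrn_wge0.
  (* With [r = e / (2 d + 1)], [d r^2 <= e^2 / 2] since [2 d <= (2 d + 1)^2]; hence the bump is at
     least [(e^2 / 2)^3] on that ball. *)
  pose r := e / (d%:R *+ 2 + 1); have r0 : 0 < r by rewrite divr_gt0.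
  exists r => // x xr.
  have H : sqdist c x <= e ^+ 2 / 2.
    apply: (le_trans (sqdist_le xr)).
    rewrite ler_pdivlMr// /r expr_div_n mulrAC mulrA ler_pdivrMr ?exprn_gt0//.
    rewrite [leRHS]mulrC; apply: ler_wpM2r; first exact: ltW.
    rewrite expr2 -[leLHS]mulr1; apply: ler_pM => //; rewrite ?mulr_ge0//.
      by rewrite mulr_natr lerDl.
    by rewrite lerDr mulrn_wge0.
  have H' : e ^+ 2 / 2 <= e ^+ 2 - sqdist c x by rewrite lerBrDl -lerBrDr; lra.
  rewrite /pospow lerXn2r ?nnegrE ?le_max ?lexx ?orbT// ?H'//.
  by rewrite divr_ge0// ltW.
Qed.

Lemma plateau_exists (N : R) : 0 <= N -> exists chi : 'rV[R]_d -> R, exists M : R,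
  [/\ pC2 chi, forall x, `|x| <= N -> chi x = 1 & forall x, M < `|x| -> chi x = 0].
Proof.
move=> N0; pose K := d%:R * N ^+ 2 + 1.
have K1 : 1 <= K by rewrite lerDr mulr_ge0// exprn_ge0.
(* For [|x| <= N] the inner base [K - sqdist 0 x] is at least 1, and for [|x| > K] it is nonpositive
   because [sqdist 0 x >= K^2 >= K]; the outer expression sends these cases to exactly 1 and 0. *)
exists (fun x => 1 - pospow 3 (1 - pospow 3 (K - sqdist 0 x))), K; split.
- apply: pC2B; first exact: pC2_cst.
  apply/pC2_pospow3/pC2B; first exact: pC2_cst.
  by apply/pC2_pospow3/pC2B; [exact: pC2_cst|exact: pC2_sqdist].
- move=> x xN; rewrite [X in _ - X]pospow_le0 ?subr0// subr_le0.
  have : 1 <= K - sqdist 0 x.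
    by rewrite lerBrDl -lerBrDr /K addrK; apply: sqdist_le; rewrite subr0.
  by move=> H; rewrite /pospow exprn_ege1// le_max H.
- move=> x xK; rewrite [X in 1 - X](_ : _ = 1) ?subrr//.
  rewrite (_ : pospow 3 (K - sqdist 0 x) = 0).
    by rewrite /pospow subr0 (max_idPl ler01) expr1n.
  rewrite pospow_le0// subr_le0.
  have KK : K <= K ^+ 2 by rewrite expr2 ler_peMl// (le_trans _ K1).
  apply: (le_trans KK); apply: sqdist_ge; first exact: lt_le_trans K1.
  by rewrite subr0 ltW.
Qed.

End bumps.

(** * Lebesgue measure on [R^n] and integration by parts *)

Section lebesgue_product.
Context {R : realType}.
Local Notation leb := (@lebesgue_measure R).
Local Notation e_ i := (delta_mx ord0 i : 'rV[R]__).

Definition cube n (c : 'rV[R]_n) (r : R) : set 'rV[R]_n := [set x | `|x - c| <= r].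

Lemma measurable_cube n (c : 'rV[R]_n) r : measurable (cube c r).
Proof.
have mf : measurable_fun setT (fun x : 'rV[R]_n => `|x - c|).
  apply: continuous_measurable_rV => x; apply/cts_rVP => e e0; exists e => // y yx.
  rewrite (le_trans (ler_dist_dist _ _))// opprB addrA subrK.
  exact: ltW.
have := mf measurableT _ (measurable_itv `]-oo, r]); rewrite setTI.
by congr (measurable _); apply/seteqP; split => x /=; rewrite in_itv.
Qed.

Lemma cube_cons n (c : 'rV[R]_n.+1) r p : 0 <= r ->
  cube c r (rV_cons p) <-> `|p.1 - c ord0 ord0| <= r /\ cube (rV_uncons c).2 r p.2.
Proof.
move=> r0; split=> [H|[H1 H2]]; rewrite /cube /=.
  split.
    by have := le_trans (coord_norm _ ord0) H; rewrite !mxE unlift_none.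
  apply: norm_le_coord => // i.
  by have := le_trans (coord_norm _ (lift ord0 i)) H; rewrite !mxE liftK.
apply: norm_le_coord => // i; rewrite !mxE; case: unliftP => [j|] -> //=.
by have := le_trans (coord_norm _ j) H2; rewrite !mxE.
Qed.

Lemma lebesgue_rVS n (A : set 'rV[R]_n.+1) :
  lebesgue_rV n.+1 A = (leb \x lebesgue_rV n)%E (@rV_cons R n @^-1` A).
Proof. by []. Qed.

Lemma lebesgue_cube n (c : 'rV[R]_n) r : 0 <= r -> lebesgue_rV n (cube c r) = ((2 * r) ^+ n)%:E.
Proof.
move=> r0; elim: n c => [|n IH] c.
  rewrite /= diracE mem_set//= /cube/= (_ : 0 - c = 0); last by apply/rowP => -[].
  by rewrite normr0.
rewrite lebesgue_rVS.
have -> : @rV_cons R n @^-1` cube c r = `[c ord0 ord0 - r, c ord0 ord0 + r]%classic `*` cube (rV_uncons c).2 r.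
  apply/seteqP; split => p.
    by move=> /cube_cons-/(_ r0)[H1 H2]; split => //=; rewrite in_itv/= -ler_distl.
  by move=> [/=]; rewrite in_itv/= -ler_distl => H1 H2; apply/cube_cons.
rewrite product_measure1E//; last exact: measurable_cube.
transitivity ((2 * r)%:E * ((2 * r) ^+ n)%:E)%E; last by rewrite -EFinM exprS.
congr (_ * _)%E; last exact: IH.
have : leb `[c ord0 ord0 - r, c ord0 ord0 + r]%classic = (2 * r)%:E; last exact.
rewrite lebesgue_measure_itv/= lte_fin; case: ifPn => [_|].
  by rewrite -EFinD; congr (_%:E); ring.
rewrite -leNgt => H; have -> : r = 0 by apply/eqP; rewrite eq_le r0 andbT; lra.
by rewrite mulr0.
Qed.

Lemma integral_rVS n (f : 'rV[R]_n.+1 -> \bar R) : measurable_fun setT f -> (forall x, 0 <= f x)%E ->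
  (\int[lebesgue_rV n.+1]_x f x = \int[leb]_t \int[lebesgue_rV n]_x f (rV_cons (t, x)))%E.
Proof.
move=> mf f0.
have mfc : measurable_fun setT (f \o @rV_cons R n).
  by apply: measurableT_comp => //; exact: measurable_rV_cons.
transitivity (\int[leb \x lebesgue_rV n]_p (f \o @rV_cons R n) p)%E; last first.
  exact: (@fubini_tonelli1 _ _ _ _ R leb (lebesgue_rV n) (f \o @rV_cons R n) mfc (fun p => f0 _)).
have H := fun mphi => @ge0_integral_pushforward _ _ (measurableTypeR R * 'rV[R]_n)%type _ R (@rV_cons R n) mphi (leb \x lebesgue_rV n)%E setT f.
exact: (H (@measurable_rV_cons R n) measurableT mf (fun x _ => f0 x)).
Qed.

Lemma Rint_rVS n (f : 'rV[R]_n.+1 -> R) : itg (lebesgue_rV n.+1) setT f ->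
  \int[lebesgue_rV n.+1]_x f x = \int[leb]_t \int[lebesgue_rV n]_x f (rV_cons (t, x)) /\
  \int[lebesgue_rV n.+1]_x f x = \int[lebesgue_rV n]_x \int[leb]_t f (rV_cons (t, x)).
Proof.
move=> If; have mf := itg_meas If.
have mfc : measurable_fun setT (f \o @rV_cons R n).
  by apply: measurableT_comp => //; exact: measurable_rV_cons.
have L : (\int[leb]_t \int[lebesgue_rV n]_x (`|(f \o @rV_cons R n) (t, x)|)%:E < +oo)%E.
  move/integrableP : If => [_]; rewrite integral_rVS//; apply: measurableT_comp => //.
  exact/measurable_EFinP.
have [_ _ E] := fubini_leb measurableT mfc L.
suff H : \int[lebesgue_rV n.+1]_x f x = \int[leb]_t \int[lebesgue_rV n]_x f (rV_cons (t, x)).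
  by split=> //; rewrite H.
have H := fun mphi => @integral_pushforward _ _ (measurableTypeR R * 'rV[R]_n)%type _ R (@rV_cons R n) mphi (leb \x lebesgue_rV n)%E setT (EFin \o f).
have ic : (leb \x lebesgue_rV n)%E.-integrable setT (EFin \o (f \o @rV_cons R n)).
  apply/integrable12ltyP; first exact/measurable_EFinP.
  exact: L.
transitivity (\int[(leb \x lebesgue_rV n)%E]_p (f \o @rV_cons R n) p).
  congr fine; apply: (H (@measurable_rV_cons R n) _ ic measurableT); exact/measurable_EFinP.
rewrite /Rintegral -(integral12_prod_meas1 ic); congr fine.
have F1 := integrable_fubini_F ic.
apply: ae_eq_integral => //.
- exact: measurable_int F1.
- apply/measurable_EFinP; apply: (measurableT_comp (f := fine)) => //.
  exact: measurable_int F1.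
- by have := integrable_ae measurableT F1; apply: filterS => x /= K /K /fineK ->.
Qed.

Lemma integrable_supp n (f : 'rV[R]_n -> R) (N : R) : continuous f ->
  (forall x, N < `|x| -> f x = 0) -> itg (lebesgue_rV n) setT f.
Proof.
move=> cf f0.
have cF : continuous (fun p : R * 'rV[R]_n => f p.2).
  move=> p; apply/cts_txP => e e0.
  by have /cts_rVP /(_ e e0)[del del0 H] := cf p.2; exists del => // s y _; exact: H.
have [C C0 HC] := bounded_on_box 0 N cF.
pose M := Num.max N 0.
have M0 : 0 <= M by rewrite le_max lexx orbT.
have mc := measurable_cube (0 : 'rV[R]_n) M.
apply: (@itg_le _ _ _ _ _ _ (fun x => C * \1_(cube 0 M) x)) => //.
- exact: continuous_measurable_rV.
- apply: itgZ => //; apply/integrableP; split.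
    by apply/measurable_EFinP; exact: measurable_indic.
  under eq_integral do rewrite /= ger0_norm//.
  rewrite integral_indic// setIT.
  have : (lebesgue_rV n (cube 0 M) < +oo)%E by rewrite lebesgue_cube// ltry.
  exact.
- move=> x _; rewrite indicE; have [xN|xN] := leP `|x| N; last first.
    by rewrite f0// normr0 mulr_ge0.
  rewrite mem_set ?mulr1; first by apply: (HC 0 x) => //; rewrite lexx.
  by rewrite /cube /= subr0 le_max xN.
Qed.

Lemma int_supp1 (g g' : R -> R) (N : R) : (forall t : R, is_derive t 1 g (g' t)) -> continuous g' ->
  (forall t, N < `|t| -> g t = 0) -> (forall t, N < `|t| -> g' t = 0) -> \int[leb]_t g' t = 0.
Proof.
(* [M] exceeds [N] strictly, so that [g] vanishes at both end points of [[- M, M]]. *)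
move=> dg cg' g0 g'0; pose M := `|N| + 1.
have NM t : M <= `|t| -> N < `|t|.
  by apply: lt_le_trans; rewrite /M (le_lt_trans (ler_norm N))// ltrDl.
have M0 : 0 < M by rewrite /M ltr_wpDl.
have cg : continuous g.
  by move=> t; apply/differentiable_continuous/derivable1_diffP; have [] := dg t.
have MM : - M < M by lra.
have F := @continuous_FTC2 R g' g (- M) M MM (continuous_subspaceT cg').
transitivity (\int[leb]_(t in `[- M, M]) g' t).
  rewrite [RHS]Rintegral_mkcond; apply: eq_Rintegral => t _; rewrite patchE.
  case: ifPn => // tM; rewrite g'0//; apply: NM; rewrite leNgt; apply: contra tM => tM.
  by rewrite inE /= in_itv/= -ler_norml ltW.
rewrite /Rintegral F.
- have gM : g M = 0 by apply/g0/NM; rewrite ger0_norm// ltW.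
  have gN : g (- M) = 0 by apply/g0/NM; rewrite normrN ger0_norm// ltW.
  by rewrite gM gN -EFinB subrr.
- split.
  + by move=> t _; have [] := dg t.
  + exact: cvg_at_right_filter (cg _).
  + exact: cvg_at_left_filter (cg _).
- by move=> t _; rewrite derive1E; exact: derive_val.
Qed.

Lemma continuous_rV_consl n (x : 'rV[R]_n) : forall t, rV_cons (t, x) = rV_cons (0, x) + t *: delta_mx ord0 ord0.
Proof.
move=> t; apply/rowP => i; rewrite !mxE; case: unliftP => [j|] -> /=.
  by rewrite mulr0 addr0.
by rewrite mulr1 add0r.
Qed.

Lemma rV_cons_lift n (t : R) (x : 'rV[R]_n) (j : 'I_n) (h : R) :
  rV_cons (t, x + h *: delta_mx ord0 j) = rV_cons (t, x) + h *: delta_mx ord0 (lift ord0 j).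
Proof.
apply/rowP => i; rewrite !mxE; case: unliftP => [k|] -> /=.
  by rewrite !mxE eqxx /= (inj_eq lift_inj).
by rewrite mulr0 addr0.
Qed.

Lemma rV_cons_dist n (p q : R * 'rV[R]_n) (e : R) : `|p.1 - q.1| <= e -> `|p.2 - q.2| <= e ->
  `|rV_cons p - rV_cons q| <= e.
Proof.
move=> H1 H2; apply: norm_le_coord => [|i]; first exact: le_trans H1.
rewrite !mxE; case: unlift => [j|] //=.
by have := le_trans (coord_norm _ j) H2; rewrite !mxE.
Qed.

Lemma norm_rV_cons n (p : R * 'rV[R]_n) : `|p.1| <= `|rV_cons p| /\ `|p.2| <= `|rV_cons p|.
Proof.
split; first by have := coord_norm (rV_cons p) ord0; rewrite !mxE unlift_none.
by apply: norm_le_coord => // i; have := coord_norm (rV_cons p) (lift ord0 i); rewrite !mxE liftK.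
Qed.

(** Induction on the dimension. In a direction other than the first, the first coordinate is frozen
    and the induction hypothesis applies; in the first direction, Fubini lets the first coordinate
    be integrated before the others, and the fundamental theorem of calculus gives zero. *)
Lemma int_partial0 n (i : 'I_n) (F : 'rV[R]_n -> R) (N : R) : (forall x, pderivable i F x) ->
  continuous (partial i F) -> (forall x, N < `|x| -> F x = 0) ->
  \int[lebesgue_rV n]_x partial i F x = 0.
Proof.
elim: n i F => [|n IH] i F; first by case: i.
have [[j ->]|->] : (exists j, i = lift ord0 j) \/ i = ord0.
  by case: (unliftP ord0 i) => [j|] ->; [left; exists j|right].
  move=> dF cF F0.
  have dF0 x : N < `|x| -> partial (lift ord0 j) F x = 0 by exact: partial_eq0.
  have [E1 E2] := Rint_rVS (integrable_supp cF dF0).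
  rewrite E1.
  transitivity (\int[leb]_x (cst (0 : R)) x); last by rewrite Rintegral_cst// mul0r.
  apply: eq_Rintegral => t _ /=.
  have P x : pderivable j (fun x => F (rV_cons (t, x))) x /\
      partial j (fun x => F (rV_cons (t, x))) x = partial (lift ord0 j) F (rV_cons (t, x)).
    apply: derive_of_line.
    rewrite (_ : (fun h : R => _) = fun h => F (rV_cons (t, x) + h *: delta_mx ord0 (lift ord0 j))); last first.
      by apply/funext => h; rewrite rV_cons_lift.
    have := @is_derive_line R n.+1 F (rV_cons (t, x)) _ 0 dF.
    by rewrite scale0r addr0.
  have E : partial j (fun x => F (rV_cons (t, x))) = fun x => partial (lift ord0 j) F (rV_cons (t, x)).
    by apply/funext => x; have [] := P x.
  rewrite -E; apply: IH.
  - by move=> x; have [] := P x.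
  - rewrite E => x; apply/cts_rVP => e e0.
    have /cts_rVP /(_ e e0)[del del0 H] := cF (rV_cons (t, x)).
    exists (del / 2); first by rewrite divr_gt0.
    move=> y yx; apply: H; apply: (@le_lt_trans _ _ (del / 2)).
      by apply: rV_cons_dist => /=; rewrite ?subrr ?normr0 ltW// divr_gt0.
    by rewrite ltr_pdivrMr// mulr_natr mulr2n ltrDl.
  - by move=> x xN; apply: F0; apply: lt_le_trans xN _; have [] := norm_rV_cons (t, x).
move=> dF cF F0.
have dF0 x : N < `|x| -> partial ord0 F x = 0 by exact: partial_eq0.
have [E1 E2] := Rint_rVS (integrable_supp cF dF0).
rewrite E2.
transitivity (\int[lebesgue_rV n]_x (cst (0 : R)) x); last by rewrite Rintegral_cst// mul0r.
apply: eq_Rintegral => x _ /=.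
apply: (@int_supp1 (fun t => F (rV_cons (t, x))) _ N).
- move=> t; rewrite (_ : (fun t => _) = fun t => F (rV_cons (0, x) + t *: delta_mx ord0 ord0)); last first.
    by apply/funext => s; rewrite continuous_rV_consl.
  rewrite [in partial _ _ _]continuous_rV_consl.
  exact: (@is_derive_line R _ F (rV_cons (0, x)) _ t dF).
- move=> t; apply: (@continuous_comp _ _ _ (fun t => rV_cons (t, x)) (partial ord0 F)); last exact: cF.
  rewrite (_ : (fun t => _) = fun t => rV_cons (0, x) + t *: delta_mx ord0 ord0); last first.
    by apply/funext => s; rewrite continuous_rV_consl.
  exact: continuous_line.
- by move=> t tN; apply: F0; apply: lt_le_trans tN _; have [] := norm_rV_cons (t, x).
- by move=> t tN; apply: dF0; apply: lt_le_trans tN _; have [] := norm_rV_cons (t, x).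
Qed.

(** Compact support of [f] alone suffices: the product inherits it, and the integral of its partial
    derivative vanishes. *)
Lemma integration_by_parts_rV n (i : 'I_n) (f g : 'rV[R]_n -> R) (N : R) : pC1 f ->
  (forall x, pderivable i g x) -> continuous g -> continuous (partial i g) ->
  (forall x, N < `|x| -> f x = 0) ->
  \int[lebesgue_rV n]_x (partial i f x * g x) = - \int[lebesgue_rV n]_x (f x * partial i g x).
Proof.
move=> Cf dg cg cdg f0; have cf := pC1_continuous Cf.
have M x := @partialM R n f g i x (Cf.1 i x) (dg x).
have E : partial i (fun y => f y * g y) = fun x => f x * partial i g x + partial i f x * g x.
  by apply/funext => x; rewrite (M x).2 [g x * _]mulrC.
have c1 : continuous (fun x => f x * partial i g x).
  by move=> x; exact: (continuousM (cf x) (cdg x)).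
have c2 : continuous (fun x => partial i f x * g x).
  by move=> x; exact: (continuousM (Cf.2 i x) (cg x)).
have i1 : itg (lebesgue_rV n) setT (fun x => f x * partial i g x).
  by apply: (@integrable_supp _ _ N) => // x xN; rewrite f0// mul0r.
have i2 : itg (lebesgue_rV n) setT (fun x => partial i f x * g x).
  by apply: (@integrable_supp _ _ N) => // x xN; rewrite (@partial_eq0 _ _ _ N)// mul0r.
have : \int[lebesgue_rV n]_x partial i (fun y => f y * g y) x = 0.
  apply: (@int_partial0 _ _ _ N).
  - by move=> x; have [] := M x.
  - by rewrite E => x; exact: (continuousD (c1 x) (c2 x)).
  - by move=> x xN; rewrite f0// mul0r.
rewrite E RintegralD// => /eqP; rewrite addrC addr_eq0 => /eqP ->.
by [].
Qed.

End lebesgue_product.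

Section one_dimensional.
Context {R : realType}.
Local Notation leb := (@lebesgue_measure R).

Lemma itg_cst_itv (a b k : R) : itg leb `[a, b] (fun=> k).
Proof.
apply: continuous_compact_integrable; first exact: segment_compact.
by apply: continuous_subspaceT => x; exact: cvg_cst.
Qed.

Lemma Rint_cst_itv (a b k : R) : a <= b -> \int[leb]_(x in `[a, b]) k = k * (b - a).
Proof.
move=> ab; rewrite Rintegral_cst//; congr (_ * _).
suff : leb `[a, b]%classic = (b - a)%:E by move=> /(congr1 fine).
rewrite lebesgue_measure_itv/= lte_fin; case: ltgtP ab => // -> _; by rewrite subrr.
Qed.

Lemma itg_cts_itv (f : R -> R) (a b : R) : continuous f -> itg leb `[a, b] f.
Proof.
move=> cf; apply: continuous_compact_integrable; first exact: segment_compact.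
exact: continuous_subspaceT.
Qed.

Lemma itg_bd_itv (f : R -> R) (a b C : R) : measurable_fun `[a, b] f ->
  (forall x, a <= x <= b -> `|f x| <= C) -> itg leb `[a, b] f.
Proof.
move=> mf fC.
apply: (@itg_le R _ (measurableTypeR R) leb _ f _ (measurable_itv _) mf (itg_cst_itv a b C)).
by move=> x /=; rewrite in_itv/=; exact: fC.
Qed.

Lemma FTC_is_derive (F f : R -> R) (a b : R) : a <= b -> (forall x : R, is_derive x 1 F (f x)) ->
  continuous f -> \int[leb]_(x in `[a, b]) f x = F b - F a.
Proof.
rewrite le_eqVlt => /predU1P[<- dF cf|ab dF cf].
  by rewrite subrr set_itv1 Rintegral_set1.
have cF : continuous F.
  by move=> t; apply/differentiable_continuous/derivable1_diffP; have [] := dF t.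
rewrite /Rintegral (@continuous_FTC2 R f F a b ab (continuous_subspaceT cf)).
- by rewrite -EFinB.
- split.
  + by move=> t _; have [] := dF t.
  + exact: cvg_at_right_filter (cF _).
  + exact: cvg_at_left_filter (cF _).
- by move=> t _; rewrite derive1E; exact: derive_val.
Qed.

End one_dimensional.

(** * The fundamental lemma of the calculus of variations *)

Section fundamental_lemma.
Context {R : realType} {d : nat}.
Local Notation leb := (@lebesgue_measure R).

(** In time, the test functions are indicators of intervals, which is what the weak equations
    provide. If [K t x > 0], then [K] exceeds half this value on a time window times the support of
    a bump, and the integral is positive. *)
Let fundamental_le0 (S : R) (K : R -> 'rV[R]_d -> R) : 0 < S -> continuous (clamped S K) ->
  (forall u v eta N, 0 <= u -> u < v -> v <= S -> pC2 eta -> (forall x, N < `|x| -> eta x = 0) ->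
     \int[leb]_(r in `[u, v]) \int[lebesgue_rV d]_x (eta x * K r x) = 0) ->
  forall t x, 0 <= t <= S -> K t x <= 0.
Proof.
move=> S0 cK HK t x tS; rewrite leNgt; apply/negP => Kp.
pose c := K t x / 2; have c0 : 0 < c by rewrite divr_gt0.
have /cts_txP /(_ c c0)[del del0 Hd] := cK (t, x).
(* The window around [t] is clipped to [[0, S]]; it keeps a positive length even if [t] is an end
   point. *)
pose u := Num.max 0 (t - del / 2); pose v := Num.min S (t + del / 2).
have d20 : 0 < del / 2 by rewrite divr_gt0.
have [t0 tS'] := andP tS.
have uv : u < v.
  have h1 : 0 < t + del / 2 by lra.
  have h2 : t - del / 2 < S by lra.
  have h3 : t - del / 2 < t + del / 2 by lra.
  by rewrite /u /v gt_max !lt_min S0 h1 h2 h3.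
have u0 : 0 <= u by rewrite /u le_max lexx.
have vS : v <= S by rewrite /v ge_min lexx.
have uvt r : u <= r <= v -> `|r - t| < del.
  rewrite /u /v ge_max le_min => /andP[/andP[_ h1] /andP[_ h2]].
  by rewrite ltr_distl; apply/andP; split; lra.
have uvS r : u <= r <= v -> 0 <= r <= S.
  by move=> /andP[ur rv]; rewrite (le_trans u0 ur) (le_trans rv vS).
have [eta [Ceta eta0 etaS [a a0 [r r0 Ha]]]] := bump_exists x del0.
pose N := `|x| + del.
have etaN y : N < `|y| -> eta y = 0.
  move=> yN; apply: etaS; have := lerB_dist y x; rewrite /N in yN; lra.
have ceta := pC1_continuous Ceta.1.
have Kc y s : u <= s <= v -> `|y - x| < del -> c <= K s y.
  move=> sv yx; have := Hd s y (uvt _ sv) yx; rewrite /clamped /= (clamp_id (uvS _ sv)) (clamp_id tS).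
  by rewrite ler_norml /c => /andP[h _]; lra.
have cs s : continuous (fun y => eta y * clamped S K (s, y)).
  move=> y; apply: (continuousM (ceta y)).
  apply/cts_rVP => e e0; have /cts_txP /(_ e e0)[dd dd0 H] := cK (s, y).
  by exists dd => // z zy; apply: H => //=; rewrite subrr normr0.
have its s : itg (lebesgue_rV d) setT (fun y => eta y * clamped S K (s, y)).
  by apply: (@integrable_supp _ _ _ N (cs s)) => y yN; rewrite etaN// mul0r.
have ie : itg (lebesgue_rV d) setT eta by exact: (@integrable_supp _ _ _ N).
pose G s := \int[lebesgue_rV d]_y (eta y * clamped S K (s, y)).
have [C C0 HC] := @bounded_on_box R d (clamped S K) S N cK.
have GC s : u <= s <= v -> `|G s| <= C * \int[lebesgue_rV d]_y eta y.
  move=> sv; rewrite -RintegralZl//; apply: le_Rint_bound => //; first exact: itgZ.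
  move=> y _; have [yN|yN] := leP `|y| N; last by rewrite etaN// mul0r mulr0 normr0.
  rewrite normrM (ger0_norm (eta0 y)) mulrC; apply: ler_wpM2r; first exact: eta0.
  by apply: HC => //; exact: uvS.
have mG : measurable_fun setT G.
  apply: (@measurable_Rint2 R _ _ (lebesgue_rV d) (fun p : R * 'rV[R]_d => eta p.2 * clamped S K p)).
  apply: measurable_funM; last exact: continuous_measurable_tx.
  by apply: measurableT_comp => //; exact: continuous_measurable_rV.
have iG : itg leb `[u, v] G.
  apply: itg_bd_itv; last exact: GC.
  exact: measurable_funTS.
(* Lower bound of the space integral at every time of the window: [c] bounds [K] from below, [a] the
   bump on the small cube. *)
pose gam := c * (a * fine (lebesgue_rV d (cube x r))).
have gam0 : 0 < gam.
  by rewrite !mulr_gt0// lebesgue_cube ?ltW//= exprn_gt0// mulr_gt0.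
have mc := measurable_cube x r.
have ic : itg (lebesgue_rV d) setT (fun y => a * \1_(cube x r) y).
  apply: itgZ => //; apply/integrableP; split.
    by apply/measurable_EFinP; exact: measurable_indic.
  under eq_integral do rewrite /= ger0_norm//.
  rewrite integral_indic// setIT.
  have : (lebesgue_rV d (cube x r) < +oo)%E by rewrite lebesgue_cube ?ltry// ltW.
  exact.
have Gg s : u <= s <= v -> gam <= G s.
  move=> sv; apply: (@le_trans _ _ (\int[lebesgue_rV d]_y (c * (a * \1_(cube x r) y)))).
    rewrite RintegralZl// RintegralZl//.
      by rewrite /gam /Rintegral integral_indic// setIT.
    apply: (itg_eq measurableT (itgZ a^-1 measurableT ic)) => y _.
    by rewrite mulrA mulVf ?mul1r// gt_eqF.
  apply: le_Rintegral => //; first exact: itgZ.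
  move=> y _; rewrite /clamped /= (clamp_id (uvS _ sv)).
  have [yx|yx] := ltP `|y - x| del; last first.
    rewrite etaS// mul0r; have : a * \1_(cube x r) y <= 0; last first.
      by move=> h; rewrite mulr_ge0_le0// ltW.
    rewrite indicE; case: (boolP (y \in cube x r)) => [|_]; last by rewrite mulr0.
    rewrite inE => /Ha; rewrite etaS// mulr1n mulr1; exact.
  rewrite mulrC; apply: ler_pM; rewrite ?(ltW c0)//.
  - by rewrite mulr_ge0 ?(ltW a0)// indicE.
  - rewrite indicE; case: (boolP (y \in cube x r)) => [|_]; last by rewrite mulr0 eta0.
    by rewrite inE mulr1 => /Ha.
  - exact: Kc.
have := HK u v eta N u0 uv vS Ceta etaN.
rewrite (_ : \int[leb]_(r in `[u, v]) _ = \int[leb]_(r in `[u, v]) G r); last first.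
  apply: eq_Rintegral => s; rewrite inE /= in_itv/= => sv; apply: eq_Rintegral => y _.
  by rewrite /clamped /= clamp_id// uvS.
apply/eqP; rewrite gt_eqF//; apply: (@lt_le_trans _ _ (\int[leb]_(r in `[u, v]) gam)).
  by rewrite Rint_cst_itv ?(ltW uv)// mulr_gt0// subr_gt0.
apply: le_Rintegral => //; first exact: itg_cst_itv.
Qed.

Lemma fundamental_lemma_tx (S : R) (K : R -> 'rV[R]_d -> R) : 0 < S -> continuous (clamped S K) ->
  (forall u v eta N, 0 <= u -> u < v -> v <= S -> pC2 eta -> (forall x, N < `|x| -> eta x = 0) ->
     \int[leb]_(r in `[u, v]) \int[lebesgue_rV d]_x (eta x * K r x) = 0) ->
  forall t x, 0 <= t <= S -> K t x = 0.
Proof.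
move=> S0 cK HK t x tS; apply/eqP; rewrite eq_le (fundamental_le0 S0 cK HK)//=.
rewrite -oppr_le0; apply: (@fundamental_le0 S (fun t x => - K t x)) => //.
  by move=> p; exact: (@continuousN _ _ _ (clamped S K) p (cK p)).
move=> u v eta N u0 uv vS Ceta etaN.
have Cn : pC2 (fun x => - eta x).
  rewrite (_ : (fun x => - eta x) = fun x => 0 - eta x); first exact: (pC2B (pC2_cst 0) Ceta).
  by apply/funext => y; rewrite sub0r.
have en y : N < `|y| -> - eta y = 0 by move=> yN; rewrite etaN// oppr0.
apply: etrans (HK u v _ N u0 uv vS Cn en).
by apply: eq_Rintegral => r _; apply: eq_Rintegral => y _; rewrite mulrN mulNr.
Qed.

End fundamental_lemma.

(** * Monotone limits and transfer of integrability *)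

Section monotone_limit.
Context {R : realType} {dY : measure_display} {Y : measurableType dY}.
Variable m : {measure set Y -> \bar R}.

Lemma itg_ge0P (B : set Y) (f : Y -> R) : measurable B -> measurable_fun B f ->
  (forall y, B y -> 0 <= f y) -> (\int[m]_(y in B) (f y)%:E < +oo)%E -> itg m B f.
Proof.
move=> mB mf f0 Ffin; apply/integrableP; split; first exact/measurable_EFinP.
rewrite (eq_integral (EFin \o f))// => y /set_mem By.
by rewrite /= ger0_norm// f0.
Qed.

Lemma itg_restrict (B : set Y) (f : Y -> R) : measurable B -> itg m B f -> itg m setT (f \_ B).
Proof. by move=> mB /(integrable_mkcond _ mB); rewrite restrict_EFin. Qed.

Lemma itg_fin (B : set Y) (f : Y -> R) : measurable B -> itg m B f ->
  ((\int[m]_(y in B) f y)%:E = \int[m]_(y in B) (f y)%:E)%E.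
Proof. by move=> mB If; rewrite /Rintegral fineK//; exact: integrable_fin_num. Qed.

(** Monotone convergence in the direction that proves integrability: uniformly bounded integrals of
    truncations make the limit integrable with the same bound. *)
Lemma itg_limit (B : set Y) (F_ : nat -> Y -> R) (F : Y -> R) (C : R) : measurable B ->
  (forall n, itg m B (F_ n)) -> measurable_fun B F ->
  (forall n y, B y -> 0 <= F_ n y) -> (forall y, B y -> {homo F_ ^~ y : n k / (n <= k)%N >-> n <= k}) ->
  (forall y, B y -> F_ ^~ y @ \oo --> F y) -> (forall n, \int[m]_(y in B) F_ n y <= C) ->
  itg m B F /\ \int[m]_(y in B) F y <= C.
Proof.
move=> mB iF mF F0 ndF cF FC.
have F0' y : B y -> 0 <= F y.
  move=> By; have H := cF y By; rewrite -(cvg_lim _ H)//.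
  apply: limr_ge; first by apply/cvg_ex; exists (F y).
  by apply: nearW => n; exact: F0.
have H : ((fun n => \int[m]_(y in B) (F_ n y)%:E) @ \oo --> \int[m]_(y in B) (F y)%:E)%E.
  have -> : (\int[m]_(y in B) (F y)%:E = \int[m]_(y in B) (limn (fun n => (F_ n y)%:E)))%E.
    apply: eq_integral => y /set_mem By; apply/esym/cvg_lim => //.
    by apply: cvg_EFin; [exact: nearW|exact: cF].
  apply: cvg_monotone_convergence => //.
  by move=> n; apply/measurable_EFinP; exact: itg_meas (iF n).
have L : (\int[m]_(y in B) (F y)%:E <= C%:E)%E.
  rewrite -(cvg_lim _ H)//; apply: lime_le; first by apply/cvg_ex; eexists; exact: H.
  by apply: nearW => n; rewrite -itg_fin// lee_fin.
have If : itg m B F by apply: itg_ge0P => //; exact: le_lt_trans L (ltry _).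
by split=> //; rewrite -lee_fin itg_fin.
Qed.

End monotone_limit.

Definition leb_itg_fin R := @itg_fin R _ (measurableTypeR R) (@lebesgue_measure R).
Arguments leb_itg_fin : clear implicits.

Section transfer_integrable.
Context {R : realType} {d1 d2 dE : measure_display} {S1 : measurableType d1}
  {S2 : measurableType d2} {E : measurableType dE}.
Variables (m1 : {measure set S1 -> \bar R}) (m2 : {measure set S2 -> \bar R}).
Variables (V1 : S1 -> E) (V2 : S2 -> E) (D1 : S1 -> R) (D2 : S2 -> R).
Hypotheses (mV1 : measurable_fun setT V1) (mV2 : measurable_fun setT V2).
Hypotheses (iD1 : itg m1 setT D1) (iD2 : itg m2 setT D2).
Hypotheses (D10 : forall x, 0 <= D1 x) (D20 : forall x, 0 <= D2 x).
Hypothesis DE : forall A, measurable A ->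
  \int[m1]_(x in V1 @^-1` A) D1 x = \int[m2]_(x in V2 @^-1` A) D2 x.

(** Truncations of [f] at [n] are bounded, so [Rintegral_transfer] applies to them without assuming
    integrability over [m1]; their integrals stay below the integral over [m2]. *)
Lemma itg_transfer_ge0 (f : E -> R) : measurable_fun setT f -> (forall x, 0 <= f x) ->
  itg m2 setT (fun x => f (V2 x) * D2 x) -> itg m1 setT (fun x => f (V1 x) * D1 x).
Proof.
move=> mf f0 i2.
pose fn (n : nat) x : R := Num.min (f x) n%:R.
have mfn n : measurable_fun setT (fn n) by exact: measurable_minr.
have fn0 n x : 0 <= fn n x by rewrite /fn le_min f0 /=.
have fnn n x : `|fn n x| <= n%:R by rewrite ger0_norm// /fn ge_min lexx orbT.
have fnf n x : fn n x <= f x by rewrite /fn ge_min lexx.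
have i1n n : itg m1 setT (fun x => fn n (V1 x) * D1 x).
  by apply: (@itg_bdM _ _ _ _ _ _ _ n%:R) => //; exact: measurableT_comp.
have i2n n : itg m2 setT (fun x => fn n (V2 x) * D2 x).
  by apply: (@itg_bdM _ _ _ _ _ _ _ n%:R) => //; exact: measurableT_comp.
have H := @itg_limit _ _ _ m1 setT (fun n x => fn n (V1 x) * D1 x) (fun x => f (V1 x) * D1 x)
  (\int[m2]_x (f (V2 x) * D2 x)) measurableT i1n.
apply: (proj1 (H _ _ _ _ _)); clear H.
- by apply: measurable_funM; [exact: measurableT_comp|exact: itg_meas iD1].
- by move=> n x _; exact: mulr_ge0.
- move=> x _ n k nk; apply: ler_wpM2r => //.
  by rewrite /fn le_min ge_min lexx /= ge_min orbC ler_nat nk.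
- move=> x _; apply: cvgMr_tmp; apply: cvg_near_cst; near=> n.
  by rewrite /fn; apply/min_idPl; near: n; exact: nbhs_infty_ger.
- move=> n; rewrite (Rintegral_transfer mV1 mV2 iD1 iD2 DE (mfn n) (i1n n) (i2n n)).
  by apply: le_Rintegral => // x _; apply: ler_wpM2r.
Unshelve. all: by end_near. Qed.

Lemma itg_transfer (f : E -> R) : measurable_fun setT f ->
  itg m2 setT (fun x => f (V2 x) * D2 x) -> itg m1 setT (fun x => f (V1 x) * D1 x).
Proof.
move=> mf i2.
have i2' : itg m2 setT (fun x => `|f (V2 x)| * D2 x).
  apply: (itg_eq measurableT (itg_norm i2)) => x _.
  by rewrite normrM (ger0_norm (D20 x)).
have mnf : measurable_fun setT (fun x => `|f x|) by exact: measurableT_comp.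
have := @itg_transfer_ge0 (fun x => `|f x|) mnf (fun x => normr_ge0 _) i2'.
move=> /(itg_le measurableT _); apply.
- by apply: measurable_funM; [exact: measurableT_comp|exact: itg_meas iD1].
- by move=> x _; rewrite normrM (ger0_norm (D10 x)).
Qed.

End transfer_integrable.

(** * Gaussian moments *)

Section gaussian.
Context {R : realType}.
Local Notation leb := (@lebesgue_measure R).
Variable s : R.
Hypothesis s0 : 0 < s.
Local Notation g := (normal_pdf 0 s).

Let sn0 : s != 0. Proof. by rewrite gt_eqF. Qed.

Lemma is_derive_normal_pdf (x : R) : is_derive x 1 g (- (x / s ^+ 2) * g x).
Proof.
have E : g = fun x => normal_peak s * expR (- (x * x) * (s ^+ 2 *+ 2)^-1).
  by apply/funext => y; rewrite normal_pdfE// /normal_fun subr0 expr2.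
rewrite E; apply: is_derive_eq.
rewrite /GRing.scale/= -mulr_natr; field.
by rewrite sn0.
Qed.

Lemma integral_normal_pdf1 : \int[leb]_x g x = 1.
Proof. by rewrite /Rintegral integral_normal_pdf. Qed.

Let cg : continuous g. Proof. exact: continuous_normal_pdf. Qed.
Let g0 x : 0 <= g x. Proof. exact: normal_pdf_ge0. Qed.
Let gN x : g (- x) = g x.
Proof. by rewrite !normal_pdfE// /normal_fun !subr0 sqrrN. Qed.
Let cXg k : continuous (fun x : R => x ^+ k * g x).
Proof.
have cX : continuous (fun x : R => x ^+ k).
  move=> x; apply/differentiable_continuous/derivable1_diffP.
  exact: (@exprn_derivable R k x 1).
by move=> x; exact: (continuousM (cX x) (cg (x:=x))).
Qed.

(** Integrating the derivative of [x ^+ k.+1 * g x] over [[- n, n]] relates the truncated moments of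
    orders [k] and [k + 2], with explicit boundary terms. *)
Let FTCX k (n : R) : 0 <= n ->
  k.+1%:R * \int[leb]_(x in `[- n, n]) (x ^+ k * g x)
   - s ^- 2 * \int[leb]_(x in `[- n, n]) (x ^+ k.+2 * g x)
  = n ^+ k.+1 * g n - (- n) ^+ k.+1 * g n.
Proof.
move=> n0; rewrite -{2}(gN n).
have dF (x : R) : is_derive x 1 (fun x => x ^+ k.+1 * g x)
   (k.+1%:R * (x ^+ k * g x) - s ^- 2 * (x ^+ k.+2 * g x)).
  have H1 : is_derive x 1 (fun x : R => x ^+ k.+1) (k.+1%:R * x ^+ k).
    apply: DeriveDef; first exact: (@exprn_derivable R k.+1 x 1).
    by rewrite exp_derive /GRing.scale/= mulr1.
  have H2 := is_derive_normal_pdf x.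
  apply: (is_derive_eq (is_deriveM H1 H2)).
  rewrite /GRing.scale/= !exprS; field.
  exact: sn0.
rewrite -(FTC_is_derive _ dF); last 2 first.
- by rewrite ge0_cp.
- have cZ c j : continuous (fun x : R => c * (x ^+ j * g x)).
    by move=> x; apply: cvgMl_tmp; exact: cXg.
  by move=> x; exact: (continuousB (cZ _ k x) (cZ _ k.+2 x)).
rewrite RintegralB//; last 2 first.
- by apply: itgZ => //; exact: itg_cts_itv.
- by apply: itgZ => //; exact: itg_cts_itv.
by rewrite !RintegralZl//; exact: itg_cts_itv.
Qed.

Let I k (n : R) := \int[leb]_(x in `[- n, n]) (x ^+ k * g x).

Let iI k n : itg leb `[- n, n] (fun x => x ^+ k * g x).
Proof. by apply: itg_cts_itv; exact: cXg. Qed.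

Let ig : itg leb setT g. Proof. exact: integrable_normal_pdf. Qed.

Let I0_le n : I 0 n <= 1.
Proof.
rewrite -integral_normal_pdf1 /I [leLHS]Rintegral_mkcond.
apply: le_Rintegral => //.
  by apply: (@itg_restrict R _ (measurableTypeR R) leb); [exact: measurable_itv|exact: iI].
move=> x _; rewrite patchE; case: ifPn => // _.
by rewrite expr0 mul1r.
Qed.

Let s2 : 0 < s ^+ 2. Proof. exact: exprn_gt0. Qed.

Let I2E n : 0 <= n -> I 2 n = s ^+ 2 * (I 0 n - 2 * (n * g n)).
Proof.
move=> n0; have := FTCX 0 n0; rewrite -/(I 0 n) -/(I 2 n) !expr1 => E.
have -> : I 0 n - 2 * (n * g n) = s ^- 2 * I 2 n by lra.
by rewrite mulrA divff ?mul1r// gt_eqF.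
Qed.

Let I4E n : 0 <= n -> I 4 n = s ^+ 2 * (3 * I 2 n - 2 * (n ^+ 3 * g n)).
Proof.
move=> n0; have := FTCX 2 n0; rewrite -/(I 2 n) -/(I 4 n) exprNn => E.
have -> : 3 * I 2 n - 2 * (n ^+ 3 * g n) = s ^- 2 * I 4 n.
  by move: E; rewrite (_ : (-1) ^+ 3 = -1 :> R) => [|]; [lra|rewrite !exprS expr0; ring].
by rewrite mulrA divff ?mul1r// gt_eqF.
Qed.

Let I2_le n : 0 <= n -> I 2 n <= s ^+ 2.
Proof.
move=> n0; rewrite I2E// -[leRHS]mulr1 ler_wpM2l ?(ltW s2)//.
have := I0_le n; have : 0 <= n * g n by rewrite mulr_ge0.
lra.
Qed.

(** In [I2E] and [I4E] the boundary terms enter with a negative sign, so dropping them gives bounds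
    uniform in [n]; integrability of the fourth moment then follows by monotone limits. *)
Let I4_le n : 0 <= n -> I 4 n <= 3 * s ^+ 4.
Proof.
move=> n0; rewrite I4E// (_ : 3 * s ^+ 4 = s ^+ 2 * (3 * s ^+ 2)); last by rewrite !exprS; ring.
rewrite ler_wpM2l ?(ltW s2)//.
have := I2_le n0; have : 0 <= n ^+ 3 * g n by rewrite mulr_ge0// exprn_ge0.
lra.
Qed.

Let restr k (n : nat) (x : R) : R := ((fun x => x ^+ k * g x) \_ `[- (n%:R : R), n%:R]) x.

Let restrE k n x : n%:R >= `|x| -> restr k n x = x ^+ k * g x.
Proof. by move=> xn; rewrite /restr patchE mem_set//= in_itv/= -ler_norml. Qed.

Let restr0 k n x : n%:R < `|x| -> restr k n x = 0.
Proof.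
move=> xn; rewrite /restr patchE; case: ifPn => //.
by rewrite inE /= in_itv/= -ler_norml leNgt xn.
Qed.

Let int_restr k n : \int[leb]_x restr k n x = I k n%:R.
Proof. by rewrite /I [RHS]Rintegral_mkcond. Qed.

Let itg_restr k n : itg leb setT (restr k n).
Proof.
by apply: (@itg_restrict R _ (measurableTypeR R) leb); [exact: measurable_itv|exact: iI].
Qed.

Let mX k : measurable_fun setT (fun x : measurableTypeR R => x ^+ k * g x).
Proof. by apply: continuous_measurable_fun; exact: cXg. Qed.

Let cvg_restr k x : restr k ^~ x @ \oo --> x ^+ k * g x.
Proof.
apply: cvg_near_cst; near=> n; rewrite restrE//.
by near: n; exact: nbhs_infty_ger.
Unshelve. all: by end_near. Qed.

Let itg4 : itg leb setT (fun x => x ^+ 4 * g x) /\ \int[leb]_x (x ^+ 4 * g x) <= 3 * s ^+ 4.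
Proof.
have x40 (x : R) : 0 <= x ^+ 4 * g x by rewrite mulr_ge0// exprn_even_ge0.
apply: (@itg_limit _ _ _ leb setT (restr 4)) => //.
- by move=> n x _; have [/restrE->|/restr0->] := leP `|x| n%:R.
- move=> x _ n k nk; have [xn|/restr0->] := leP `|x| n%:R; last first.
    by have [/restrE->|/restr0->] := leP `|x| k%:R.
  by rewrite !restrE// (le_trans xn)// ler_nat.
- by move=> n; rewrite int_restr; exact: I4_le.
Qed.

Lemma itg_normal_moment k : (k <= 4)%N -> itg leb setT (fun x => x ^+ k * g x).
Proof.
move=> k4; have i := itgD measurableT ig itg4.1.
apply: (itg_le measurableT (mX k) i) => x _.
rewrite normrM (ger0_norm (g0 x)) (_ : g x + x ^+ 4 * g x = (1 + x ^+ 4) * g x); last by ring.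
rewrite ler_wpM2r//.
rewrite normrX -[X in _ <= 1 + X]ger0_norm ?exprn_even_ge0// normrX.
have [x1|x1] := leP `|x| 1.
  by rewrite (le_trans (exprn_ile1 k (normr_ge0 x) x1))// lerDl exprn_ge0.
rewrite (@le_trans _ _ (`|x| ^+ 4))//; last by rewrite lerDr.
by rewrite ler_weXn2l// ltW.
Qed.

Let cvg_I k : (k <= 4)%N -> (fun n : nat => I k n%:R) @ \oo --> \int[leb]_x (x ^+ k * g x).
Proof.
move=> k4; rewrite (_ : (fun n : nat => _) = (fun n : nat => \int[leb]_x restr k n x)); last first.
  by apply/funext => n; rewrite int_restr.
apply: (@cvg_Rint _ _ _ leb setT (restr k) _ (fun x => `|x ^+ k * g x|)) => //.
- by move=> n; exact: itg_meas (itg_restr k n).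
- exact/itg_norm/itg_normal_moment.
- by move=> n x _; have [/restrE->//|/restr0->] := leP `|x| n%:R; rewrite normr0.
Qed.

Lemma normal_moment1 : \int[leb]_x (x * g x) = 0.
Proof.
(* The first moment vanishes already on [[- n, n]], since [- s ^+ 2 * g] is an even
   antiderivative. *)
have H : (fun n : nat => I 1 n%:R) = fun=> 0.
  apply/funext => n.
  have dF (x : R) : is_derive x 1 (fun x => - s ^+ 2 * g x) (x ^+ 1 * g x).
    have H := is_derive_normal_pdf x.
    apply: (is_derive_eq (is_deriveZ (- s ^+ 2) H)).
    rewrite /GRing.scale/= expr1; field.
    exact: sn0.
  rewrite /I (FTC_is_derive _ dF); last 2 first.
  - by rewrite ge0_cp.
  - exact: cXg.
  by rewrite gN subrr.
have := @cvg_I 1 isT; rewrite H => c.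
exact: (cvg_unique (@Rhausdorff R) c (cvg_cst 0)).
Qed.

Lemma normal_moment2 : \int[leb]_x (x ^+ 2 * g x) = s ^+ 2.
Proof.
have c2 := @cvg_I 2 isT; have c0 := @cvg_I 0 isT.
(* The decay of the boundary term comes from [0 <= I 4 n]: by [I4E] and [I2_le] it forces
   [2 n^3 g(n) <= 3 s^2], and [n (n + 1) g(n)] is smaller than the left side. *)
have cg0 : (fun n : nat => n%:R * g n%:R) @ \oo --> 0.
  apply: (@squeeze_cvgr _ _ _ _ (cst 0) (fun n => 3 * s ^+ 2 * n.+1%:R^-1)).
  - near=> n; rewrite mulr_ge0//=.
    have n0 : 0 <= n%:R :> R by [].
    have n1 : 1 <= n%:R :> R by near: n; exact: nbhs_infty_ger.
    have P : 0 <= I 4 n%:R.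
      apply: Rintegral_ge0 => x _; by rewrite mulr_ge0// exprn_even_ge0.
    rewrite ler_pdivlMr// -natr1.
    have A : 2 * (n%:R ^+ 3 * g n%:R) <= 3 * s ^+ 2.
      have := I4E n0; have := I2_le n0 => h E.
      have : 0 <= 3 * I 2 n%:R - 2 * (n%:R ^+ 3 * g n%:R) by rewrite -(pmulr_rge0 _ s2) -E.
      lra.
    apply: le_trans A; rewrite mulrDr mulr1.
    have B : n%:R * g n%:R <= n%:R ^+ 3 * g n%:R.
      by rewrite ler_wpM2r// -[leLHS]expr1 ler_weXn2l.
    have C : n%:R * g n%:R * n%:R <= n%:R ^+ 3 * g n%:R.
      rewrite mulrAC -expr2 ler_wpM2r// ler_weXn2l//.
    lra.
  - exact: cvg_cst.
  - rewrite -[X in _ --> X](mulr0 (3 * s ^+ 2)); apply: cvgMl_tmp; exact: cvg_harmonic.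
have E : (fun n : nat => I 2 n%:R) = fun n : nat => s ^+ 2 * (I 0 n%:R - 2 * (n%:R * g n%:R)).
  by apply/funext => n; rewrite I2E.
have c : (fun n : nat => s ^+ 2 * (I 0 n%:R - 2 * (n%:R * g n%:R))) @ \oo -->
    s ^+ 2 * (\int[leb]_x (x ^+ 0 * g x) - 2 * 0).
  by apply: cvgMl_tmp; apply: cvgB => //; exact: cvgMl_tmp.
rewrite E in c2; rewrite (cvg_unique _ c2 c)// mulr0 subr0.
rewrite (_ : \int[leb]_x (x ^+ 0 * g x) = 1) ?mulr1// -integral_normal_pdf1.
by apply: eq_Rintegral => x _; rewrite expr0 mul1r.
Unshelve. all: by end_near. Qed.

Lemma normal_moment4 : \int[leb]_x (x ^+ 4 * g x) <= 3 * s ^+ 4.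
Proof. exact: itg4.2. Qed.

End gaussian.

(** * Independent Gaussian increments *)

Section gaussian_increment.
Context {R : realType} {dS dE : measure_display} {S : measurableType dS} {E : measurableType dE} {d : nat}.
Local Notation leb := (@lebesgue_measure R).
Variables (P : probability S R) (V : S -> E) (Z : S -> 'rV[R]_d) (h : R).
Hypotheses (h0 : 0 < h) (mV : measurable_fun setT V).
Hypothesis mZ : forall i, measurable_fun setT (fun w => Z w ord0 i).
Hypothesis indep : forall (C : set E) (B : 'I_d -> set R), measurable C -> (forall i, measurable (B i)) ->
  fine (P (V @^-1` C `&` [set w | forall i, B i (Z w ord0 i)])) =
  fine (P (V @^-1` C)) * \prod_i fine (normal_prob 0 (Num.sqrt h) (B i)).

Local Notation s := (Num.sqrt h).
Local Notation g := (normal_pdf 0 s).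
Local Notation N := (normal_prob 0 s).

Let s0 : 0 < s. Proof. by rewrite sqrtr_gt0. Qed.

Let itg_bd (f : S -> R) (C : R) : measurable_fun setT f -> (forall w, `|f w| <= C) -> itg P setT f.
Proof.
move=> mf fC; apply: (itg_le measurableT mf (itg_cst P C)).
by move=> w _; exact: fC.
Qed.

Let mpre d' (E' : measurableType d') (f : S -> E') (A : set E') : measurable_fun setT f -> measurable A -> measurable (f @^-1` A).
Proof. by move=> mf mA; rewrite -[X in measurable X]setTI; exact: mf. Qed.

Let NT : fine (N [set: R]) = 1.
Proof. by have -> : N [set: R] = 1%E by exact: probability_setT. Qed.

Let indep1 (C : set E) (i : 'I_d) (A : set R) : measurable C -> measurable A ->
  fine (P (V @^-1` C `&` [set w | A (Z w ord0 i)])) = fine (P (V @^-1` C)) * fine (N A).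
Proof.
move=> mC mA.
have := @indep C (fun k => if k == i then A else setT) mC.
rewrite (bigD1 i)//= eqxx big1 ?mulr1; last by move=> k /negbTE ->.
move=> <-; last by move=> k; case: ifP.
congr (fine (P (_ `&` _))); apply/seteqP; split => w /=.
  by move=> H k; case: eqP => // ->.
by move=> /(_ i); rewrite eqxx.
Qed.

(** An event of the past can be enlarged by a condition on another coordinate and remains
    independent of the [i]-th one; this gives the off-diagonal covariances. *)
Let indep2 (C : set E) (i j : 'I_d) (A B : set R) : i != j -> measurable C -> measurable A -> measurable B ->
  fine (P ((V @^-1` C `&` [set w | B (Z w ord0 j)]) `&` [set w | A (Z w ord0 i)])) =
   fine (P (V @^-1` C `&` [set w | B (Z w ord0 j)])) * fine (N A).
Proof.
move=> ij mC mA mB; rewrite indep1//.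
have := @indep C (fun k => if k == i then A else if k == j then B else setT) mC.
rewrite (bigD1 i)//= eqxx (bigD1 j)/=; last by rewrite eq_sym.
rewrite eq_sym (negbTE ij) eqxx big1 ?mulr1; last by move=> k /andP[/negbTE -> /negbTE ->].
rewrite [fine (N A) * _]mulrC mulrA => <-; last first.
  by move=> k; case: ifP => //; case: ifP.
congr (fine (P _)); apply/seteqP; split => w /=.
  by move=> [[cw bw] aw]; split=> // k; case: eqP => [->//|_]; case: eqP => [->|].
move=> [cw H]; split; last by have := H i; rewrite eqxx.
by split=> //; have := H j; rewrite eq_sym (negbTE ij) eqxx.
Qed.

Let itg_indic (A : set S) : measurable A -> itg P setT (fun w => \1_A w : R).
Proof. by move=> mA; exact: integrable_indic. Qed.

Let Rint_indic (A B : set S) : measurable A -> measurable B ->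
  \int[P]_(w in B) (\1_A w : R) = fine (P (A `&` B)).
Proof. by move=> mA mB; rewrite /Rintegral integral_indic. Qed.

(* [G] stands for an event independent of the [i]-th coordinate of [Z]. *)
Let transferN (G : set S) (i : 'I_d) (f : R -> R) : measurable G ->
  (forall A : set R, measurable A -> fine (P (G `&` [set w | A (Z w ord0 i)])) = fine (P G) * fine (N A)) ->
  measurable_fun setT f -> itg leb setT (fun x => f x * g x) ->
  itg P setT (fun w => f (Z w ord0 i) * \1_G w) /\
  \int[P]_w (f (Z w ord0 i) * \1_G w) = fine (P G) * \int[leb]_x (f x * g x).
Proof.
move=> mG GA mf If.
have ig : itg leb setT g by exact: integrable_normal_pdf.
have DE (A : set R) : measurable A -> \int[P]_(x in (fun w => Z w ord0 i) @^-1` A) \1_G x =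
    \int[leb]_(x in id @^-1` A) (fine (P G) * g x).
  move=> mA; have mpA := mpre (mZ i) mA.
  rewrite Rint_indic// (GA A mA) RintegralZl//.
  exact: (@integrableS _ _ _ leb setT).
have If' : itg leb setT (fun x => f (id x) * (fine (P G) * g x)).
  apply: (itg_eq measurableT (itgZ (fine (P G)) measurableT If)) => x _.
  by rewrite mulrCA.
have ig' : itg leb setT (fun x => fine (P G) * g x) by exact: itgZ.
have g0 (x : R) : 0 <= fine (P G) * g x.
  by rewrite mulr_ge0 ?fine_ge0// normal_pdf_ge0.
have G0 w : 0 <= (\1_G w : R) by rewrite indicE.
have i1 : itg P setT (fun w => f (Z w ord0 i) * \1_G w).
  exact: (@itg_transfer R _ _ _ S (measurableTypeR R) R P leb (fun w => Z w ord0 i) id (\1_G)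
    (fun x => fine (P G) * g x) (mZ i) (@measurable_id _ _ _) (itg_indic mG) ig' G0 g0 DE f mf If').
split=> //.
rewrite (@Rintegral_transfer R _ _ _ S (measurableTypeR R) R P leb (fun w => Z w ord0 i) id (\1_G)
    (fun x => fine (P G) * g x) (mZ i) (@measurable_id _ _ _) (itg_indic mG) ig' DE f mf i1 If').
rewrite -RintegralZl//; apply: eq_Rintegral => x _; by rewrite mulrCA.
Qed.

Let mX k : measurable_fun setT (fun x : R => x ^+ k).
Proof. exact: exprn_measurable. Qed.

Let GT i : forall A : set R, measurable A ->
  fine (P (setT `&` [set w | A (Z w ord0 i)])) = fine (P setT) * fine (N A).
Proof. by move=> A mA; have := @indep1 setT i A measurableT mA; rewrite preimage_setT. Qed.

Lemma itg_increment k i : (k <= 4)%N -> itg P setT (fun w => Z w ord0 i ^+ k).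
Proof.
move=> k4; have [H _] := transferN measurableT (GT i) (mX k) (itg_normal_moment s0 k4).
by apply: (itg_eq measurableT H) => w _; rewrite indicE in_setT mulr1.
Qed.

Lemma increment_fourth i : \int[P]_w (Z w ord0 i ^+ 4) <= 3 * h ^+ 2.
Proof.
have [_ H] := transferN measurableT (GT i) (mX 4) (itg_normal_moment s0 (leqnn 4)).
have -> : \int[P]_w (Z w ord0 i ^+ 4) = \int[P]_w (Z w ord0 i ^+ 4 * \1_setT w).
  by apply: eq_Rintegral => w _; rewrite indicE in_setT mulr1.
rewrite H probability_setT mul1r (le_trans (normal_moment4 s0))//.
rewrite (_ : s ^+ 4 = (s ^+ 2) ^+ 2); last by rewrite -exprM.
by rewrite sqr_sqrtr// ltW.
Qed.

Let itgZ1 i : itg P setT (fun w => Z w ord0 i).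
Proof. exact: (@itg_increment 1 i isT). Qed.

Lemma itg_increment2 i j : itg P setT (fun w => Z w ord0 i * Z w ord0 j).
Proof.
have H := itgD measurableT (@itg_increment 2 i isT) (@itg_increment 2 j isT).
apply: (itg_le measurableT _ H) => [|w _]; first exact: measurable_funM.
rewrite normrM; move: (Z w ord0 i) (Z w ord0 j) => a b.
have := sqr_ge0 (`|a| - `|b|); rewrite sqrrB !real_normK ?num_real// => q.
have := normr_ge0 (a * b); rewrite normrM => p; lra.
Qed.

Let condE (C : set E) (D D' : S -> R) : measurable C ->
  \int[P]_w (D w * \1_(V @^-1` C) w) = \int[P]_w (D' w * \1_(V @^-1` C) w) ->
  \int[P]_(w in V @^-1` C) D w = \int[P]_(w in V @^-1` C) D' w.
Proof.
move=> mC; rewrite ![\int[P]_(w in V @^-1` C) _]Rintegral_mkcond => H.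
have r (F : S -> R) : F \_ (V @^-1` C) = (fun w => F w * \1_(V @^-1` C) w : R).
  apply/funext => w; rewrite patchE indicE; case: ifPn => _; by rewrite ?mulr1 ?mulr0.
by rewrite !r.
Qed.

Variable phi : E -> R.
Hypotheses (mphi : measurable_fun setT phi) (phib : exists K, forall x, `|phi x| <= K).

Let itg_phi (D : S -> R) : itg P setT D -> itg P setT (fun w => phi (V w) * D w).
Proof.
move=> iD; have [K HK] := phib.
by apply: (@itg_bdM _ _ _ _ _ _ _ K) => //; exact: measurableT_comp.
Qed.

Let itg0 : itg P setT (fun=> 0 : R). Proof. exact: itg_cst. Qed.

Lemma increment_mean i : \int[P]_w (phi (V w) * Z w ord0 i) = 0.
Proof.
transitivity (\int[P]_w (phi (V w) * (fun=> 0) w)); last first.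
  under eq_Rintegral do rewrite mulr0.
  by rewrite Rintegral_cst// mul0r.
apply: (Rintegral_transfer mV mV (itgZ1 i) itg0 _ mphi) => //; try exact: itg_phi.
move=> C mC; apply: condE => //.
have [_] := transferN (mpre mV mC) (fun A mA => indep1 i mC mA) (mX 1) (itg_normal_moment s0 (isT : (1 <= 4)%N)).
have -> : \int[leb]_x (x ^+ 1 * g x) = 0 by exact: normal_moment1.
rewrite mulr0 => ->; under eq_Rintegral do rewrite mul0r.
by rewrite Rintegral_cst// mul0r.
Qed.

Lemma increment_cov i j : \int[P]_w (phi (V w) * (Z w ord0 i * Z w ord0 j)) =
  (i == j)%:R * (h * \int[P]_w phi (V w)).
Proof.
have [<-|ij] := eqVneq i j.
  rewrite mul1r.
  have ih : itg P setT (fun=> h) by exact: itg_cst.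
  transitivity (\int[P]_w (phi (V w) * (fun=> h) w)); last first.
    rewrite -RintegralZl//; first by apply: eq_Rintegral => w _; rewrite mulrC.
    have [K HK] := phib; apply: (@itg_bd _ K); first exact: measurableT_comp.
    by move=> w; exact: HK.
  apply: (Rintegral_transfer mV mV (itg_increment2 i i) ih _ mphi); try exact: itg_phi => //.
  - move=> C mC; apply: condE => //.
    have [_] := transferN (mpre mV mC) (fun A mA => indep1 i mC mA) (mX 2) (itg_normal_moment s0 (isT : (2 <= 4)%N)).
    rewrite normal_moment2// sqr_sqrtr ?(ltW h0)// => H.
    rewrite RintegralZl//; last by apply: itg_indic; exact: mpre.
    rewrite Rint_indic//; last exact: mpre.
    by rewrite setIT mulrC -H; apply: eq_Rintegral => w _; rewrite expr2.
  - by apply: itg_phi; exact: itg_increment2.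
rewrite mul0r.
transitivity (\int[P]_w (phi (V w) * (fun=> 0) w)); last first.
  under eq_Rintegral do rewrite mulr0.
  by rewrite Rintegral_cst// mul0r.
apply: (Rintegral_transfer mV mV (itg_increment2 i j) itg0 _ mphi).
- move=> C mC; apply: condE => //.
  have mVC := mpre mV mC.
  under [RHS]eq_Rintegral do rewrite mul0r.
  rewrite Rintegral_cst// mul0r.
  have iD : itg P setT (fun w => Z w ord0 i * \1_(V @^-1` C) w).
    apply: (itg_le measurableT _ (itg_norm (itgZ1 i))) => [|w _].
      by apply: measurable_funM => //; exact: measurable_indic.
    by rewrite normrM indicE; case: (_ \in _); rewrite ?normr1 ?mulr1// normr0 mulr0.
  (* Off the diagonal the transfer is applied again, now over the values of the [j]-th coordinate:
     on the events where [V] lies in [C] and [Z_j] in [B], the [i]-th coordinate is still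
     centered. *)
  transitivity (\int[P]_w (Z w ord0 j * (Z w ord0 i * \1_(V @^-1` C) w))).
    by apply: eq_Rintegral => w _; rewrite mulrA [Z w ord0 i * _]mulrC.
  transitivity (\int[P]_w (Z w ord0 j * (fun=> 0) w)); last first.
    under eq_Rintegral do rewrite mulr0.
    by rewrite Rintegral_cst// mul0r.
  apply: (@Rintegral_transfer R _ _ _ S S R P P (fun w => Z w ord0 j) (fun w => Z w ord0 j) _ _ (mZ j) (mZ j) iD itg0 _ id) => //.
  + move=> B mB; rewrite [LHS]Rintegral_mkcond Rintegral_cst//; last exact: mpre.
    rewrite mul0r.
    have mCB : measurable (V @^-1` C `&` [set w | B (Z w ord0 j)]).
      by apply: measurableI => //; exact: (mpre (mZ j)).
    have [_] := transferN mCB (fun A mA => indep2 ij mC mA mB) (mX 1) (itg_normal_moment s0 (isT : (1 <= 4)%N)).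
    have -> : \int[leb]_x (x ^+ 1 * g x) = 0 by exact: normal_moment1.
    rewrite mulr0 => <-; apply: eq_Rintegral => w _.
    rewrite patchE !indicE in_setI expr1.
    have -> : (w \in [set w | B (Z w ord0 j)]) = (w \in (fun w => Z w ord0 j) @^-1` B) by [].
    by case: ifPn => _; rewrite ?andbT ?andbF ?mulr0.
  + apply: (itg_le measurableT _ (itg_norm (itg_increment2 j i))) => [|w _].
      apply: measurable_funM => //; apply: measurable_funM => //; exact: measurable_indic.
    rewrite mulrA normrM indicE; case: (_ \in _); rewrite ?normr1 ?mulr1// normr0 mulr0.
    exact: normr_ge0.
  + by apply: (itg_eq measurableT itg0) => w _; rewrite mulr0.
- by apply: itg_phi; exact: itg_increment2.
- exact: itg_phi.
Qed.

End gaussian_increment.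

Lemma measurable_integral_ge0 {disp : measure_display} {X : measurableType disp} {R : realType}
    (m : {sigma_finite_measure set X -> \bar R}) (f : R * X -> R) :
  measurable_fun setT f -> (forall p, 0 <= f p) ->
  measurable_fun setT (fun r : R => \int[m]_x (f (r, x))%:E)%E.
Proof.
move=> mf f0.
apply: (@measurable_fun_fubini_tonelli_F _ _ (measurableTypeR R) _ R m (EFin \o f)); first exact/measurable_EFinP.
by move=> p; rewrite lee_fin.
Qed.

(** * Measurability and integration on path space *)

Section path_measurability.
Context {R : realType} {d : nat} {T : R}.
Local Notation Om := (path_space R d T).

(** By continuity of paths, evaluation is the limit of evaluations at the grid time [q n r] just
    below [r]; each of these is a countable gluing of coordinate maps over time cells. *)
Lemma measurable_eval : measurable_fun setT (fun p : R * Om => (p.2 : R -> 'rV[R]_d) p.1).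
Proof.
apply: measurable_rV => i.
pose q (n : nat) (r : R) : R := (Num.floor (r * n.+1%:R))%:~R / n.+1%:R.
have qr r : q ^~ r @ \oo --> r.
  apply/cvgrPdist_le => e e0; near=> n; rewrite /q.
  have n0 : 0 < n.+1%:R :> R by [].
  have /andP[f1 f2] := floor_itv (r * n.+1%:R).
  rewrite (_ : r - _ = (r * n.+1%:R - (Num.floor (r * n.+1%:R))%:~R) / n.+1%:R); last first.
    by rewrite mulrBl mulfK// gt_eqF.
  rewrite normrM normfV (gtr0_norm n0) ler_pdivrMr//.
  have e1 : 1 <= e * n.+1%:R.
    rewrite -ler_pdivrMl// mulr1 (@le_trans _ _ n%:R) ?ler_nat//.
    by near: n; exact: nbhs_infty_ger.
  apply: le_trans e1; rewrite intrD in f2; rewrite ger0_norm; lra.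
apply: (@measurable_fun_cvg _ _ _ setT (fun n (p : R * Om) => (p.2 : R -> 'rV[R]_d) (q n p.1) ord0 i)); last first.
  move=> [r w] _ /=.
  have c : {for r, continuous (fun t => (w : R -> 'rV[R]_d) t ord0 i)}.
    apply: (@continuous_comp _ _ _ (w : R -> 'rV[R]_d) (fun x : 'rV[R]_d => x ord0 i) r).
      exact: (@path_continuous _ _ _ w r).
    exact: coord_continuous.
  exact: (cvg_comp _ _ (qr r) c).
move=> n _ B mB; rewrite setTI.
pose A (k : int) : set (R * Om) := `[k%:~R / n.+1%:R, (k + 1)%:~R / n.+1%:R[%classic `*`
   [set w : Om | B ((w : R -> 'rV[R]_d) (k%:~R / n.+1%:R) ord0 i)].
have -> : (fun p : R * Om => (p.2 : R -> 'rV[R]_d) (q n p.1) ord0 i) @^-1` B = \bigcup_k A k.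
  apply/seteqP; split => -[r w] /=.
    move=> H; exists (Num.floor (r * n.+1%:R)) => //; split => //=.
    have /andP[f1 f2] := floor_itv (r * n.+1%:R).
    by rewrite in_itv/= ler_pdivrMr// ltr_pdivlMr// f1 f2.
  move=> [k _ [/=]]; rewrite in_itv/= ler_pdivrMr// ltr_pdivlMr// => H Bk.
  by rewrite /q (_ : Num.floor _ = k)//; exact/floor_def.
apply: countable_bigcupT_measurable => // k; apply: measurableX; first exact: measurable_itv.
have mc : measurable_fun setT (fun w : Om => (w : R -> 'rV[R]_d) (k%:~R / n.+1%:R) ord0 i).
  exact: (measurableT_comp (measurable_coord i) (measurable_coordp _)).
by rewrite -[X in measurable X]setTI; exact: mc.
Unshelve. all: by end_near. Qed.

Lemma measurable_along_path (F : R * 'rV[R]_d -> R) : continuous F ->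
  measurable_fun setT (fun p : R * Om => F (p.1, (p.2 : R -> 'rV[R]_d) p.1)).
Proof.
move=> cF; apply: (measurableT_comp (continuous_measurable_tx cF)).
by apply/measurable_fun_pairP; split; [exact: measurable_fst|exact: measurable_eval].
Qed.

Lemma measurable_at (f : 'rV[R]_d -> R) (t : R) : measurable_fun setT f ->
  measurable_fun setT (fun w : Om => f ((w : R -> 'rV[R]_d) t)).
Proof. by move=> mf; exact: (measurableT_comp mf (measurable_coordp t)). Qed.

Lemma path_clampE (w : Om) (t : R) : w t = w (clamp T t).
Proof. exact: path_clamp. Qed.

Lemma continuous_along_path (F : R * 'rV[R]_d -> R) (w : Om) : continuous F ->
  continuous (fun r => F (r, w r)).
Proof.
move=> cF r; apply/cvgrPdist_le => e e0.
have /cts_txP /(_ e e0)[del del0 H] := cF (r, w r).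
have := @path_continuous _ _ _ w r => /cvgrPdist_lt /(_ _ del0) /nbhs_ballP[d1 /= d10 H1].
apply: (proj2 (nbhs_ballP r _)); exists (Num.min del d1) => /=; first by rewrite lt_min del0.
move=> s; rewrite -ball_normE /= lt_min => /andP[s1 s2].
rewrite distrC; apply: H; rewrite /= distrC//.
by apply: H1; rewrite -ball_normE.
Qed.

Lemma enorm_continuous n : continuous (@enorm R n).
Proof.
have H : continuous (fun u : 'rV[R]_n => dotv u u).
  move=> u; apply: (@pC1_continuous R n (fun u => dotv u u)).
  apply: (@pC2_sum R n _ _ (fun i u => u ord0 i * u ord0 i) _).1 => i.
  exact: (pC2M (pC2_coord i) (pC2_coord i)).
move=> u; exact: (@continuous_comp _ _ _ (fun u : 'rV[R]_n => dotv u u) Num.sqrt u (H u) (@sqrt_continuous R _)).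
Qed.

Lemma norm_le_enorm n (u : 'rV[R]_n) : `|u| <= enorm u.
Proof.
apply: norm_le_coord => [|i]; first exact: sqrtr_ge0.
rewrite /enorm -sqrtr_sqr ler_wsqrtr// /dotv (bigD1 i)//= -expr2 lerDl.
by apply: sumr_ge0 => j _; rewrite -expr2 sqr_ge0.
Qed.

Lemma enorm_sq n (u : 'rV[R]_n) : enorm u ^+ 2 = \sum_i u ord0 i ^+ 2.
Proof.
rewrite sqr_sqrtr; first by apply: eq_bigr => i _; rewrite expr2.
by apply: sumr_ge0 => j _; rewrite -expr2 sqr_ge0.
Qed.

Definition supnorm (w : Om) : \bar R :=
  ereal_sup [set (enorm (coordp t w))%:E | t in [set` `[0%R, T]]].

(** Superlevel sets of the supremum are open for the uniform topology: a path close to [w] still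
    exceeds [r] at the time where [w] does. *)
Lemma measurable_supnorm : measurable_fun setT supnorm.
Proof.
move=> mD; apply: (measurability _ (ErealGenOInfty.measurableE R)) => //.
move=> _ [_ [r ->] <-]; rewrite setTI; apply: sub_sigma_algebra => w /=.
rewrite /supnorm in_itv/= andbT => /ereal_sup_gt[_ [t tT <-]]; rewrite lte_fin => rt.
have /cts_rVP := @enorm_continuous d (w t).
have e20 : 0 < (enorm (w t) - r) / 2 by rewrite divr_gt0// subr_gt0.
move=> /(_ _ e20)[del del0 H]; exists del => // w' ww'.
rewrite /= in_itv/= andbT; apply: (@lt_le_trans _ _ (enorm (w' t))%:E); last first.
  by apply: ereal_sup_ubound; exists t.
rewrite lte_fin.
have := H (w' t) (le_lt_trans (norm_le_enorm _) (ww' t)).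
rewrite ler_norml => /andP[h _]; lra.
Qed.

Hypothesis T0 : 0 <= T.

Lemma supnorm_fin (w : Om) : supnorm w \is a fin_num.
Proof.
have c : {within `[0, T], continuous (fun t => enorm (w t))}.
  apply: continuous_subspaceT => t.
  apply: (@continuous_comp _ _ _ (w : R -> 'rV[R]_d) (@enorm R d)); first exact: path_continuous.
  exact: enorm_continuous.
have [c0 _ Hc] := EVT_max T0 c.
rewrite fin_numE; apply/andP; split.
  rewrite -ltNye; apply: (@lt_le_trans _ _ (enorm (w 0))%:E); first exact: ltNyr.
  by apply: ereal_sup_ubound; exists 0 => //=; rewrite in_itv/= lexx.
rewrite -ltey; apply: (@le_lt_trans _ _ (enorm (w c0))%:E); last exact: ltry.
by apply: ge_ereal_sup => _ [t tT <-]; rewrite lee_fin; exact: Hc.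
Qed.

(** Dominates the position at all times at once, which is what dominated convergence needs when the
    time varies together with the space variable. *)
Definition runmax (w : Om) : R := fine (supnorm w).

Lemma norm_le_runmax (w : Om) t : `|w t| <= runmax w.
Proof.
rewrite path_clampE (le_trans (norm_le_enorm _))// -lee_fin /runmax fineK ?supnorm_fin//.
by apply: ereal_sup_ubound; exists (clamp T t) => //=; rewrite in_itv/= clamp_itv.
Qed.

Lemma runmax_ge0 w : 0 <= runmax w.
Proof. exact: le_trans (norm_le_runmax w 0). Qed.

Lemma itg_runmax (P : probability Om R) : P1 P -> itg P setT runmax.
Proof.
move=> H; apply: itg_ge0P => //.
- by apply: (measurableT_comp (f := fine)) => //; exact: measurable_supnorm.
- by move=> w _; exact: runmax_ge0.
- apply: le_lt_trans H; rewrite le_eqVlt; apply/orP; left; apply/eqP.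
  by apply: eq_integral => w _; rewrite /runmax fineK// supnorm_fin.
Qed.

End path_measurability.

Section marginals.
Context {R : realType} {d : nat} {T : R} (P : probability (path_space R d T) R).

Lemma ge0_integral_marg t (f : 'rV[R]_d -> \bar R) : measurable_fun setT f -> (forall x, 0 <= f x)%E ->
  (\int[marg P t]_x f x = \int[P]_w f (w t))%E.
Proof.
move=> mf f0; apply: (ge0_integral_pushforward (@measurable_coordp R d T t) P measurableT mf).
by move=> x _; exact: f0.
Qed.

Lemma itg_marg t (f : 'rV[R]_d -> R) : measurable_fun setT f ->
  itg P setT (fun w => f (w t)) -> itg (marg P t) setT f.
Proof.
move=> mf If; have mEf : measurable_fun setT (EFin \o f) by exact/measurable_EFinP.
exact: (integrable_pushforward (@measurable_coordp R d T t) mEf If measurableT).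
Qed.

Lemma Rint_marg t (f : 'rV[R]_d -> R) : measurable_fun setT f ->
  itg P setT (fun w => f (w t)) -> \int[marg P t]_x f x = \int[P]_w f (w t).
Proof.
move=> mf If; have mEf : measurable_fun setT (EFin \o f) by exact/measurable_EFinP.
congr fine.
exact: (integral_pushforward (@measurable_coordp R d T t) mEf If measurableT).
Qed.

End marginals.

(** * Cauchy-Schwarz and Gronwall inequalities on an interval *)

Section interval_inequalities.
Context {R : realType}.
Local Notation leb := (@lebesgue_measure R).

Lemma sqr_sum_le (n : nat) (a : 'I_n -> R) : (\sum_i a i) ^+ 2 <= n%:R * \sum_i a i ^+ 2.
Proof.
have H : \sum_i \sum_j (a i - a j) ^+ 2 = 2 * (n%:R * (\sum_i a i ^+ 2) - (\sum_i a i) ^+ 2).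
  transitivity (\sum_i (n%:R * a i ^+ 2 + \sum_j a j ^+ 2 - 2 * (a i * \sum_j a j))).
    apply: eq_bigr => i _; rewrite mulr_sumr mulr_sumr.
    transitivity (\sum_(j < n) (a i ^+ 2 + a j ^+ 2 - 2 * (a i * a j))).
      by apply: eq_bigr => j _; ring.
    by rewrite sumrB big_split /= sumr_const card_ord mulr_natl.
  rewrite sumrB big_split /= -!mulr_sumr sumr_const card_ord -mulr_natl -mulr_suml; ring.
have : 0 <= \sum_i \sum_j (a i - a j) ^+ 2.
  by apply: sumr_ge0 => i _; apply: sumr_ge0 => j _; exact: sqr_ge0.
by rewrite H; lra.
Qed.

(* Integrate [2 m f - m^2 <= f^2] with [m] the mean of [f]. *)
Lemma sqr_Rint_le (f : R -> R) (u v : R) : u < v -> itg leb `[u, v] f -> itg leb `[u, v] (fun s => f s ^+ 2) ->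
  (\int[leb]_(s in `[u, v]) f s) ^+ 2 <= (v - u) * \int[leb]_(s in `[u, v]) (f s ^+ 2).
Proof.
move=> uv If If2; set A := \int[leb]_(s in `[u, v]) f s.
have vu : 0 < v - u by rewrite subr_gt0.
pose m := A / (v - u).
have I1 : itg leb `[u, v] (fun s => 2 * m * f s) by exact: itgZ.
have I2 := itg_cst_itv u v (m ^+ 2).
have : \int[leb]_(s in `[u, v]) (2 * m * f s - m ^+ 2) <= \int[leb]_(s in `[u, v]) (f s ^+ 2).
  apply: le_Rintegral => //; first exact: itgB.
  by move=> s _; have := sqr_ge0 (f s - m); rewrite sqrrB -mulr_natl; lra.
rewrite RintegralB// RintegralZl// Rint_cst_itv ?(ltW uv)// -/A => H.
have E : A = m * (v - u) by rewrite /m divfK// gt_eqF.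
have -> : A ^+ 2 = (v - u) * (2 * m * A - m ^+ 2 * (v - u)) by rewrite E; ring.
by rewrite ler_wpM2l// ltW.
Qed.

(** With [U] the primitive of [u], the derivative of [expR (- (L * t)) * U t] is
    [expR (- (L * t)) * (u t - L * U t)], hence at most [a t]. The conclusion bounds the integral of
    [u], so [a] need only be integrable. *)
Lemma gronwall (u a : R -> R) (L T : R) : 0 < L -> 0 < T -> continuous u -> (forall t, 0 <= u t) ->
  itg leb `[0, T] a -> (forall t, 0 <= t <= T -> 0 <= a t) ->
  (forall t, 0 <= t <= T -> u t <= a t + L * \int[leb]_(s in `[0, t]) u s) ->
  \int[leb]_(s in `[0, T]) u s <= expR (L * T) * \int[leb]_(s in `[0, T]) a s.
Proof.
move=> L0 T0 cu u0 ia a0 H.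
pose U t := \int[leb]_(s in `[0, t]) u s.
pose F (t : R) := expR (- (L * t)) * U t.
pose f (t : R) := expR (- (L * t)) * (u t - L * U t).
have iu t : itg leb `[0, t] u by exact: itg_cts_itv.
have cU : {within `[0, T], continuous U}.
  by apply: parameterized_integral_continuous => //; exact: ltW.
have ce : continuous (fun t : R => expR (- (L * t))).
  move=> t; apply: (@continuous_comp _ _ _ (fun t : R => - (L * t)) expR); last exact: continuous_expR.
  by apply: cvgN; apply: cvgMl_tmp; exact: cvg_id.
have cF : {within `[0, T], continuous F}.
  by move=> t; apply: cvgM_fun; [exact: continuous_subspaceT|exact: cU].
have cf : {within `[0, T], continuous f}.
  move=> t; apply: cvgM_fun.
    exact: continuous_subspaceT.
  apply: cvgB_fun; first exact: continuous_subspaceT.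
  apply: cvgM_fun; last exact: cU.
  exact: cst_continuous.
have dF t : t \in `]0, T[ -> derivable F t 1 /\ derive1 F t = f t.
  rewrite in_itv/= => /andP[t0 tT].
  have [dU U'] := @continuous_FTC1_closed R u 0 t T tT (iu T) t0 (cu t).
  have H1 : is_derive t 1 U (u t) by apply: DeriveDef; [exact: dU|rewrite -derive1E; exact: U'].
  have H2 : is_derive t 1 (fun t : R => expR (- (L * t))) (- L * expR (- (L * t))).
    apply: is_derive_eq; rewrite /GRing.scale/=; ring.
  have H3 := is_deriveM H2 H1.
  have E : expR (- (L * t)) *: u t + U t *: (- L * expR (- (L * t))) = f t.
    by rewrite /GRing.scale/= /f; ring.
  by split; [have [] := H3|rewrite derive1E -E; have [] := H3].
have /continuous_within_itvP-/(_ T0)[_ F0 FT] := cF.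
have FTC := @continuous_FTC2 R f F 0 T T0 cf.
have E : \int[leb]_(t in `[0, T]) f t = F T - F 0.
  rewrite /Rintegral FTC//; first split => //.
  - by move=> t /dF[].
  - by move=> t /dF[].
have F00 : F 0 = 0 by rewrite /F /U set_itv1 Rintegral_set1 mulr0.
have : \int[leb]_(t in `[0, T]) f t <= \int[leb]_(t in `[0, T]) a t.
  apply: le_Rintegral => //.
    by apply: continuous_compact_integrable => //; exact: segment_compact.
  move=> t /=; rewrite in_itv/= => tT; have [t0 _] := andP tT.
  have h := H t tT; apply: (@le_trans _ _ (expR (- (L * t)) * a t)).
    by rewrite /f ler_wpM2l ?expR_ge0// lerBlDr.
  rewrite ler_piMl ?a0// -[leRHS]expR0 ler_expR oppr_le0 mulr_ge0// ltW//.
rewrite E F00 subr0 /F expRN mulrC ler_pdivrMr ?expR_gt0//.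
by rewrite mulrC.
Qed.

End interval_inequalities.

Lemma subrBB (V : zmodType) (x y z : V) : (x - z) - (x - y) = y - z.
Proof. by rewrite opprB addrC addrA subrK. Qed.

Lemma subrBB' (V : zmodType) (y a p b : V) : y - a - (p - b) = (y - p) + (b - a).
Proof. by rewrite opprB [b - p]addrC addrACA [- a + b]addrC. Qed.

Lemma Rint_cst_prob {R : realType} {dS : measure_display} {S : measurableType dS} (P : probability S R) (c : R) :
  \int[P]_w c = c.
Proof.
transitivity (c * fine (P setT)); first exact: Rintegral_cst.
by have /= -> := @probability_setT _ _ _ P; rewrite mulr1.
Qed.

(** * Convolution with the law of [X_t] *)

Section convolution.
Context {R : realType} {d : nat} {T : R} (P : probability (path_space R d T) R).
Local Notation Om := (path_space R d T).
Hypotheses (T0 : 0 <= T) (iS : itg P setT (@runmax R d T)).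

(** The convolution with the marginal is written as an integral over paths: the measure no longer
    depends on [t], and joint continuity in [(t, x)] follows by domination with [runmax]. *)
Definition convP (k : 'rV[R]_d -> R) (t : R) (x : 'rV[R]_d) : R := \int[P]_w k (x - w t).

Lemma measurable_path_shift (k : 'rV[R]_d -> R) (x : 'rV[R]_d) (t : R) : continuous k ->
  measurable_fun setT (fun w : Om => k (x - w t)).
Proof.
move=> ck; apply: (@measurable_at R d T (fun y => k (x - y)) t); apply: continuous_measurable_rV => y.
apply/cts_rVP => e e0; have /cts_rVP /(_ e e0)[del del0 H] := ck (x - y).
exists del => // z zy; apply: H.
by rewrite subrBB distrC.
Qed.

Lemma continuous_path_shift (k : 'rV[R]_d -> R) (w : Om) : continuous k ->
  continuous (fun p : R * 'rV[R]_d => k (p.2 - w p.1)).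
Proof.
move=> ck p; apply/cts_txP => e e0.
have /cts_rVP /(_ e e0)[del del0 H] := ck (p.2 - w p.1).
have d20 : 0 < del / 2 by rewrite divr_gt0.
have := @path_continuous _ _ _ w p.1 => /cvgrPdist_lt /(_ _ d20) /nbhs_ballP[d1 /= d10 H1].
exists (Num.min (del / 2) d1); first by rewrite lt_min d20.
move=> s y; rewrite !lt_min => /andP[_ s1] /andP[y1 _]; apply: H => /=.
have -> : y - w s - (p.2 - w p.1) = (y - p.2) + (w p.1 - w s).
  exact: subrBB'.
rewrite (splitr del) (le_lt_trans (ler_normD _ _))// ltrD//.
by apply: H1; rewrite -ball_normE /= distrC.
Qed.

Variables (k : 'rV[R]_d -> R) (A B : R).
Hypotheses (A0 : 0 <= A) (B0 : 0 <= B) (kb : forall z, `|k z| <= A + B * `|z|).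

Lemma itg_path_shift x t : continuous k -> itg P setT (fun w => k (x - w t)).
Proof.
move=> ck.
have I : itg P setT (fun w => A + B * `|x| + B * runmax w).
  by apply: itgD => //; [exact: itg_cst|exact: itgZ].
apply: (itg_le measurableT (measurable_path_shift x t ck) I) => w _.
apply: (le_trans (kb _)); rewrite -addrA lerD2l -mulrDr ler_wpM2l//.
by rewrite (le_trans (ler_normB _ _))// lerD2l norm_le_runmax.
Qed.

Lemma convP_le x t : continuous k -> `|convP k t x| <= A + B * `|x| + B * \int[P]_w runmax w.
Proof.
move=> ck.
have I : itg P setT (fun w => A + B * `|x| + B * runmax w).
  by apply: itgD => //; [exact: itg_cst|exact: itgZ].
rewrite -RintegralZl// -(Rint_cst_prob P (A + B * `|x|)).
rewrite -RintegralD//; [|exact: itg_cst|exact: itgZ].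
apply: le_Rint_bound => //; first exact: itg_path_shift.
move=> w _.
apply: (le_trans (kb _)); rewrite -addrA lerD2l -mulrDr ler_wpM2l//.
by rewrite (le_trans (ler_normB _ _))// lerD2l norm_le_runmax.
Qed.

Lemma convP_continuous : continuous k -> continuous (fun p => convP k p.1 p.2).
Proof.
move=> ck p.
pose g (w : Om) := A + B * (`|p.2| + 1) + B * runmax w.
have ig : itg P setT g.
  by apply: itgD => //; [exact: itg_cst|exact: itgZ].
apply: (@continuity_param R _ Om P (R * 'rV[R]_d)%type setT (fun q w => k (q.2 - w q.1)) p 1 g) => //.
- by move=> q _; exact: measurable_path_shift.
- by move=> w _; exact: continuous_path_shift.
- move=> q w [_ q2] _.
  have {}q2 : `|q.2| <= `|p.2| + 1.
    rewrite -lerBlDl; apply: (le_trans (lerB_dist _ _)); apply: ltW.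
    by move: q2; rewrite -ball_normE /= distrC.
  apply: (le_trans (kb _)); rewrite /g -addrA lerD2l -mulrDr ler_wpM2l//.
  by rewrite (le_trans (ler_normB _ _))// lerD// norm_le_runmax.
Qed.

End convolution.

Section convolution_derivative.
Context {R : realType} {d : nat} {T : R} (P : probability (path_space R d T) R).
Local Notation Om := (path_space R d T).

(** The weight [om] allows two uses: constant 1 for the convolution of [grad W], and the corrector
    along the path for the nonlocal term. Only the derivative of [k] is bounded; [k] itself may
    grow. *)
Lemma partial_weighted (k : 'rV[R]_d -> R) (j : 'I_d) (C : R) (om : Om -> R) (t : R) (x : 'rV[R]_d) :
  pC1 k -> (forall z, `|partial j k z| <= C) -> itg P setT om ->
  (forall y, itg P setT (fun w : Om => k (y - w t) * om w)) ->
  pderivable j (fun y => \int[P]_w (k (y - w t) * om w)) x /\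
  partial j (fun y => \int[P]_w (k (y - w t) * om w)) x = \int[P]_w (partial j k (x - w t) * om w).
Proof.
move=> Ck kC iom ik; apply: derive_of_line.
pose f (h : R) (w : Om) := k (x + h *: delta_mx ord0 j - w t) * om w.
have df (h : R) (w : Om) : is_derive h 1 (f ^~ w) (partial j k (x + h *: delta_mx ord0 j - w t) * om w).
  have H := @is_derive_line R d k (x - w t) (delta_mx ord0 j) h (Ck.1 j).
  have H2 := is_deriveZ (om w) H.
  have E : (om w \*: (fun h : R => k (x - w t + h *: delta_mx ord0 j))) = f ^~ w.
    by apply/funext => z; rewrite /f /= /GRing.scale /= mulrC addrAC.
  rewrite -E; apply: (is_derive_eq H2).
  by rewrite /GRing.scale /= mulrC addrAC.
have d1 (h : R) (w : Om) : partial1of2 f h w = partial j k (x + h *: delta_mx ord0 j - w t) * om w.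
  by rewrite partial1of2E; apply: derive_val.
have I0 : (`]-1, 1[%classic : set R) 0 by rewrite /= in_itv/= ltrN10 ltr01.
have iG : itg P setT (fun w => C * `|om w|) by apply: itgZ => //; exact: itg_norm.
have C0 : 0 <= C by exact: le_trans (kC 0).
have G0 w : 0 <= C * `|om w| by rewrite mulr_ge0.
have if' (h : R) : (`]-1, 1[%classic : set R) h -> itg P setT (f h) by move=> _; exact: ik.
have df' (h : R) (w : Om) : (`]-1, 1[%classic : set R) h -> [set: Om] w -> derivable (f ^~ w) h 1.
  by move=> _ _; have [] := df h w.
have Gu (h : R) (w : Om) : (`]-1, 1[%classic : set R) h -> [set: Om] w -> `|partial1of2 f h w| <= C * `|om w|.
  by move=> _ _; rewrite d1 normrM ler_wpM2r.
have D1 := @derivable_under_integral R _ Om P f setT measurableT 0 (-1) 1 I0 if' df' _ G0 iG Gu.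
have D2 := @differentiation_under_integral R _ Om P f setT measurableT 0 (-1) 1 I0 if' df' _ G0 iG Gu.
apply: DeriveDef; first exact: D1.
rewrite -derive1E D2; apply: eq_Rintegral => w _.
by rewrite d1 scale0r addr0.
Qed.

End convolution_derivative.

(** * Fubini on time and path space *)

Section path_integrals.
Context {R : realType} {d : nat} {T : R} (P : probability (path_space R d T) R).
Local Notation Om := (path_space R d T).
Local Notation leb := (@lebesgue_measure R).

(** The upper limit of integration is itself a variable. The integrand is therefore extended by zero
    and becomes a measurable function of the upper limit, the path and the integration time. *)
Lemma measurable_running (F : R * Om -> R) : measurable_fun setT F ->
  measurable_fun setT (fun p : R * Om => \int[leb]_(r in `[0, p.1]) F (r, p.2)).
Proof.
move=> mF.
pose f (q : (R * Om) * R) : R := if (0 <= q.2) && (q.2 <= q.1.1) then F (q.2, q.1.2) else 0.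
have mf : measurable_fun setT f.
  have m1 : measurable_fun setT (fun q : (R * Om) * R => q.1.1) by exact: (measurableT_comp measurable_fst measurable_fst).
  have m2 : measurable_fun setT (fun q : (R * Om) * R => q.1.2) by exact: (measurableT_comp measurable_snd measurable_fst).
  have m3 : measurable_fun setT (fun q : (R * Om) * R => q.2) by exact: measurable_snd.
  apply: measurable_fun_ifT.
  - apply: measurable_and; apply: measurable_fun_ler => //.
  - by apply: (measurableT_comp mF); apply/measurable_fun_pairP; split.
  - exact: measurable_cst.
have := @measurable_Rint1 R _ _ (R * Om)%type (measurableTypeR R) leb f setT measurableT mf.
congr (measurable_fun setT _); apply/funext => -[t w] /=.
rewrite [RHS]Rintegral_mkcond; apply: eq_Rintegral => r _.
rewrite patchE /f /= mem_setE in_itv/=; by case: ifP.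
Qed.

Lemma measurable_Rint_path (F : R * Om -> R) (u v : R) : measurable_fun setT F ->
  measurable_fun setT (fun w : Om => \int[leb]_(r in `[u, v]) F (r, w)).
Proof. by move=> mF; exact: measurable_Rint_leb. Qed.

Lemma fubini_path (f : R * Om -> R) (u v : R) : measurable_fun setT f ->
  (\int[leb]_(r in `[u, v]) \int[P]_w (`|f (r, w)|)%:E < +oo)%E ->
  [/\ itg leb `[u, v] (fun r => \int[P]_w f (r, w)),
      itg P setT (fun w => \int[leb]_(r in `[u, v]) f (r, w)) &
      \int[leb]_(r in `[u, v]) \int[P]_w f (r, w) = \int[P]_w \int[leb]_(r in `[u, v]) f (r, w)].
Proof. by move=> mf Ffin; exact: (@fubini_leb R _ Om P _ f (measurable_itv _) mf Ffin). Qed.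

Lemma tonelli_path_bound (f : R * Om -> R) (u v c : R) : u <= v -> measurable_fun setT f ->
  (forall p, 0 <= f p) ->
  (forall r, u <= r <= v -> itg P setT (fun w => f (r, w)) /\ \int[P]_w f (r, w) <= c) ->
  itg P setT (fun w => \int[leb]_(r in `[u, v]) f (r, w)) /\
  \int[P]_w \int[leb]_(r in `[u, v]) f (r, w) <= c * (v - u).
Proof.
move=> uv mf f0 H.
have Ffin : (\int[leb]_(r in `[u, v]) \int[P]_w (`|f (r, w)|)%:E < +oo)%E.
  apply: (@le_lt_trans _ _ (\int[leb]_(r in `[u, v]) c%:E)%E).
    apply: ge0_le_integral => //.
    - by move=> r _; apply: integral_ge0 => w _; rewrite lee_fin.
    - by apply: measurable_funTS; apply: (@measurable_integral_ge0 _ _ R P (fun p => `|f p|)) => //; exact: measurableT_comp.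
    - move=> r /=; rewrite in_itv/= => /H[i1 i2].
      rewrite (eq_integral (fun w => (f (r, w))%:E)); last by move=> w _; rewrite ger0_norm.
      by rewrite -itg_fin// lee_fin.
  have := leb_itg_fin R `[u, v]%classic (fun=> c) (measurable_itv _) (itg_cst_itv u v c).
  by move=> <-; exact: ltry.
have [i1 i2 <-] := fubini_path mf Ffin; split => //.
rewrite -Rint_cst_itv//; apply: le_Rintegral => //; first exact: itg_cst_itv.
by move=> r /=; rewrite in_itv/= => /H[].
Qed.

Lemma tonelli_path_fin (f : R * Om -> R) (u v : R) : measurable_fun setT f -> (forall p, 0 <= f p) ->
  (forall w, itg leb `[u, v] (fun r => f (r, w))) ->
  itg P setT (fun w => \int[leb]_(r in `[u, v]) f (r, w)) ->
  (\int[leb]_(r in `[u, v]) \int[P]_w (f (r, w))%:E < +oo)%E.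
Proof.
move=> mf f0 If IF.
rewrite (@tonelli_leb R _ Om P _ (fun p => (f p)%:E) (measurable_itv _))//; last first.
  exact/measurable_EFinP.
have -> : (\int[P]_w \int[leb]_(r in `[u, v]) (f (r, w))%:E = \int[P]_w (\int[leb]_(r in `[u, v]) f (r, w))%:E)%E.
  by apply: eq_integral => w _; rewrite (leb_itg_fin R).
by rewrite -itg_fin// ltry.
Qed.

End path_integrals.

(** The inner integral is extended-valued, since the second moment may be infinite on a null set of
    times. *)
Definition finite_energy {R : realType} {d : nat} {T : R} (P : probability (path_space R d T) R)
  (b : 'I_d -> R * 'rV[R]_d -> R) := forall i,
  (\int[@lebesgue_measure R]_(t in `[0%R, T]) \int[P]_w (b i (t, w t) ^+ 2)%:E < +oo)%E.

(** * Energy of the drift *)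

Section drift.
Context {R : realType} {d : nat} {T : R} (P : probability (path_space R d T) R).
Local Notation Om := (path_space R d T).
Local Notation leb := (@lebesgue_measure R).
Variable b : 'I_d -> R * 'rV[R]_d -> R.
Hypotheses (T0 : 0 < T) (cb : forall i, continuous (b i)).

Definition driftint (u v : R) (w : Om) (i : 'I_d) : R := \int[leb]_(r in `[u, v]) b i (r, w r).

Definition noise (u v : R) (w : Om) : 'rV[R]_d :=
  \row_i (w v ord0 i - w u ord0 i - driftint u v w i).

Lemma itg_b w i u v : itg leb `[u, v] (fun r => b i (r, (w : Om) r)).
Proof. by apply: itg_cts_itv; exact: continuous_along_path. Qed.

Lemma itg_b2 w i u v : itg leb `[u, v] (fun r => b i (r, (w : Om) r) ^+ 2).
Proof.
apply: itg_cts_itv => r.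
have c := @continuous_along_path R d T (b i) w (@cb i) r.
apply: (@continuous_comp _ _ _ (fun r => b i (r, w r)) (fun x => x ^+ 2)) => //.
exact: exprn_continuous.
Qed.

Lemma measurable_pathX i (t : R) : measurable_fun setT (fun w : Om => w t ord0 i).
Proof. exact: (measurableT_comp (measurable_coord i) (measurable_coordp t)). Qed.

Lemma measurable_b i : measurable_fun setT (fun p : R * Om => b i (p.1, p.2 p.1)).
Proof. exact: measurable_along_path. Qed.

Lemma measurable_noise u v i : measurable_fun setT (fun w => noise u v w ord0 i).
Proof.
under eq_fun do rewrite mxE.
apply: measurable_funB; first by apply: measurable_funB; exact: measurable_pathX.
exact: (measurable_Rint_path u v (measurable_b i)).
Qed.

(** Independence from [X_u] alone: the expansions below only meet expectations of the increment
    weighted by functions of [X_u]. *)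
Definition independent_noise : Prop := forall (u v : R) (C : set 'rV[R]_d) (B : 'I_d -> set R),
  0 <= u -> u < v -> v <= T -> measurable C -> (forall i, measurable (B i)) ->
  fine (P (coordp u @^-1` C `&` [set w | forall i, B i (noise u v w ord0 i)])) =
  fine (P (coordp u @^-1` C)) * \prod_i fine (normal_prob 0 (Num.sqrt (v - u)) (B i)).
Hypothesis indep : independent_noise.

Section one_interval.
Variables (u v : R).
Hypotheses (u0 : 0 <= u) (uv : u < v) (vT : v <= T).

Let h0 : 0 < v - u. Proof. by rewrite subr_gt0. Qed.
Let G C B := @indep u v C B u0 uv vT.

Lemma itg_noise k i : (k <= 4)%N -> itg P setT (fun w => noise u v w ord0 i ^+ k).
Proof. exact: (itg_increment h0 (measurable_noise u v) G). Qed.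

Lemma noise_fourth i : \int[P]_w (noise u v w ord0 i ^+ 4) <= 3 * (v - u) ^+ 2.
Proof. exact: (increment_fourth h0 (measurable_noise u v) G). Qed.

Lemma itg_noise2 i j : itg P setT (fun w => noise u v w ord0 i * noise u v w ord0 j).
Proof. exact: (itg_increment2 h0 (measurable_noise u v) G). Qed.

Lemma noise_mean (phi : 'rV[R]_d -> R) i : measurable_fun setT phi -> (exists K, forall x, `|phi x| <= K) ->
  \int[P]_w (phi (w u) * noise u v w ord0 i) = 0.
Proof. by move=> mphi bphi; exact: (increment_mean h0 (measurable_coordp u) (measurable_noise u v) G mphi bphi i). Qed.

Lemma noise_cov (phi : 'rV[R]_d -> R) i j : measurable_fun setT phi -> (exists K, forall x, `|phi x| <= K) ->
  \int[P]_w (phi (w u) * (noise u v w ord0 i * noise u v w ord0 j)) =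
  (i == j)%:R * ((v - u) * \int[P]_w phi (w u)).
Proof. by move=> mphi bphi; exact: (increment_cov h0 (measurable_coordp u) (measurable_noise u v) G mphi bphi i j). Qed.

Lemma noise_var i : \int[P]_w (noise u v w ord0 i ^+ 2) = v - u.
Proof.
have := @noise_cov (fun=> 1) i i (measurable_cst _) _; rewrite eqxx mul1r Rint_cst_prob mulr1 => <-.
  by apply: eq_Rintegral => w _; rewrite mul1r expr2.
by exists 1 => x; rewrite normr1.
Qed.

End one_interval.

Section energy.
Hypothesis Hb : finite_energy P b.

(** [energy] is computed along one path and [power] is the expected density in time. The time
    integral of [power] is additive over adjacent intervals and serves as a control in
    [chaining]. *)
Definition energy (u v : R) (w : Om) : R := \sum_i \int[leb]_(r in `[u, v]) (b i (r, w r) ^+ 2).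
Definition power (r : R) : R := \sum_i \int[P]_w (b i (r, w r) ^+ 2).

Let mb2 i : measurable_fun setT (fun p : R * Om => b i (p.1, p.2 p.1) ^+ 2).
Proof. by apply: (measurableT_comp (exprn_measurable 2)); exact: measurable_b. Qed.

Let Hbuv (u v : R) i : 0 <= u -> v <= T ->
  (\int[leb]_(r in `[u, v]) \int[P]_w (`|b i (r, w r) ^+ 2|)%:E < +oo)%E.
Proof.
move=> u0 vT; apply: le_lt_trans (Hb i).
have -> : (\int[leb]_(r in `[u, v]) \int[P]_w (`|b i (r, w r) ^+ 2|)%:E =
  \int[leb]_(r in `[u, v]) \int[P]_w (b i (r, w r) ^+ 2)%:E)%E.
  by apply: eq_integral => r _; apply: eq_integral => w _; rewrite ger0_norm// sqr_ge0.
apply: ge0_subset_integral.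
- exact: measurable_itv.
- exact: measurable_itv.
- apply: measurable_funTS; apply: (@measurable_integral_ge0 _ _ R P (fun p => b i (p.1, p.2 p.1) ^+ 2)) => [|p].
    exact: mb2.
  exact: sqr_ge0.
- by move=> r _; apply: integral_ge0 => w _; rewrite lee_fin sqr_ge0.
- move=> r /=; rewrite !in_itv/= => /andP[ur rv]; apply/andP; split; lra.
Qed.

Lemma energy_fubini (u v : R) : 0 <= u -> v <= T ->
  [/\ itg leb `[u, v] power, itg P setT (energy u v) &
      \int[P]_w energy u v w = \int[leb]_(r in `[u, v]) power r].
Proof.
move=> u0 vT; have F i := fubini_path (mb2 i) (Hbuv i u0 vT).
have F1 i : itg leb `[u, v] (fun r => \int[P]_w (b i (r, w r) ^+ 2)) by have [] := F i.
have F2 i : itg P setT (fun w => \int[leb]_(r in `[u, v]) (b i (r, w r) ^+ 2)) by have [] := F i.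
split.
- exact: (leb_itg_sum R _ _ _ _ (measurable_itv _) F1).
- exact: itg_sum.
- rewrite Rint_sum// (leb_Rint_sum R _ _ _ _ (measurable_itv _) F1).
  by apply: eq_bigr => i _; have [_ _ <-] := F i.
Qed.

Lemma energy_ge0 u v w : 0 <= energy u v w.
Proof. by apply: sumr_ge0 => i _; apply: Rintegral_ge0 => r _; exact: sqr_ge0. Qed.

Lemma energy_mono u v w : 0 <= u -> v <= T -> energy u v w <= energy 0 T w.
Proof.
move=> u0 vT; apply: ler_sum => i _.
rewrite -lee_fin !(leb_itg_fin R) //; try exact: itg_b2.
apply: ge0_subset_integral.
- exact: measurable_itv.
- exact: measurable_itv.
- by apply/measurable_EFinP/itg_meas; exact: itg_b2.
- by move=> r _; rewrite lee_fin sqr_ge0.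
- move=> r /=; rewrite !in_itv/= => /andP[ur rv]; apply/andP; split; lra.
Qed.

Lemma driftint_sq u v w i : u < v -> driftint u v w i ^+ 2 <= (v - u) * energy u v w.
Proof.
move=> uv; apply: le_trans (sqr_Rint_le uv (itg_b w i u v) (itg_b2 w i u v)) _.
rewrite ler_wpM2l ?subr_ge0 ?(ltW uv)// /energy (bigD1 i)//= lerDl.
by apply: sumr_ge0 => j _; apply: Rintegral_ge0 => r _; exact: sqr_ge0.
Qed.

Definition energyT : R := \int[P]_w energy 0 T w.

(** A displacement is the noise plus the drift integral. The first has variance [v - u], and by
    Cauchy-Schwarz the square of the second is at most [v - u] times the energy. *)
Lemma displacement_sq u v i : 0 <= u -> u <= v -> v <= T ->
  itg P setT (fun w : Om => (w v ord0 i - w u ord0 i) ^+ 2) /\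
  \int[P]_w ((w v ord0 i - w u ord0 i) ^+ 2) <= 2 * (1 + energyT) * (v - u).
Proof.
move=> u0; rewrite le_eqVlt => /predU1P[<- _|uv vT].
  under eq_Rintegral do rewrite subrr expr0n/=.
  rewrite subrr mulr0 Rint_cst_prob; split => //.
  have E : (fun w : Om => (w u ord0 i - w u ord0 i) ^+ 2) = fun=> 0.
    by apply/funext => w; rewrite subrr expr0n.
  by rewrite E; exact: itg_cst.
have h0 : 0 <= v - u by rewrite subr_ge0 ltW.
have [_ ie _] := energy_fubini (lexx 0) (lexx T).
have in2 := @itg_noise u v u0 uv vT 2 i isT.
have I := itgD measurableT (itgZ 2 measurableT in2) (itgZ (2 * (v - u)) measurableT ie).
have B (w : Om) : `|(w v ord0 i - w u ord0 i) ^+ 2| <= 2 * noise u v w ord0 i ^+ 2 + 2 * (v - u) * energy 0 T w.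
  rewrite ger0_norm ?sqr_ge0//.
  have D := driftint_sq w i uv; have M := energy_mono w u0 vT.
  have {}M : (v - u) * energy u v w <= (v - u) * energy 0 T w by rewrite ler_wpM2l.
  rewrite mxE; move: D; set a := driftint u v w i; set x := w v ord0 i; set y := w u ord0 i => D.
  have := sqr_ge0 (x - y - a - a); lra.
have mX : measurable_fun setT (fun w : Om => (w v ord0 i - w u ord0 i) ^+ 2).
  apply: (measurableT_comp (exprn_measurable 2)).
  by apply: measurable_funB; exact: measurable_pathX.
have IX := itg_le measurableT mX I (fun w _ => B w); split => //.
apply: (@le_trans _ _ (\int[P]_w (2 * noise u v w ord0 i ^+ 2 + 2 * (v - u) * energy 0 T w))).
  by apply: le_Rintegral => // w _; exact: le_trans (ler_norm _) (B w).
rewrite RintegralD//; [|exact: itgZ|exact: itgZ].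
rewrite !RintegralZl// noise_var// -/energyT; lra.
Qed.

Hypothesis H0 : forall i, itg P setT (fun w : Om => w 0 ord0 i ^+ 2).

Lemma position_sq : exists2 K : R, 0 <= K & forall t i, itg P setT (fun w : Om => w t ord0 i ^+ 2) /\
  \int[P]_w (w t ord0 i ^+ 2) <= K.
Proof.
pose K := \sum_i 2 * \int[P]_w (w 0 ord0 i ^+ 2) + 4 * (1 + energyT) * T.
have e0 : 0 <= energyT by apply: Rintegral_ge0 => w _; exact: energy_ge0.
have E0 i : 0 <= \int[P]_w (w 0 ord0 i ^+ 2) by apply: Rintegral_ge0 => w _; exact: sqr_ge0.
exists K.
  rewrite addr_ge0 ?mulr_ge0 ?addr_ge0 ?(ltW T0)//.
  by apply: sumr_ge0 => i _; rewrite mulr_ge0.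
move=> t0 i.
have -> : (fun w : Om => w t0 ord0 i ^+ 2) = (fun w : Om => w (clamp T t0) ord0 i ^+ 2).
  by apply/funext => w; rewrite path_clampE.
move: (clamp T t0) (clamp_itv t0 (ltW T0)) => {t0} t /andP[t0 tT].
have [I1 I2] := displacement_sq i (lexx 0) t0 tT; rewrite subr0 in I2.
have I := itgD measurableT (itgZ 2 measurableT I1) (itgZ 2 measurableT (H0 i)).
have B (w : Om) : `|w t ord0 i ^+ 2| <= 2 * (w t ord0 i - w 0 ord0 i) ^+ 2 + 2 * w 0 ord0 i ^+ 2.
  rewrite ger0_norm ?sqr_ge0//; set x := w t ord0 i; set y := w 0 ord0 i.
  have := sqr_ge0 (x - y - y); lra.
have mX : measurable_fun setT (fun w : Om => w t ord0 i ^+ 2).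
  by apply: (measurableT_comp (exprn_measurable 2)); exact: measurable_pathX.
have IX := itg_le measurableT mX I (fun w _ => B w); split => //.
apply: (@le_trans _ _ (\int[P]_w (2 * (w t ord0 i - w 0 ord0 i) ^+ 2 + 2 * w 0 ord0 i ^+ 2))).
  by apply: le_Rintegral => // w _; exact: le_trans (ler_norm _) (B w).
rewrite RintegralD//; [|exact: itgZ|exact: itgZ].
rewrite !RintegralZl// /K (bigD1 i)//=.
have : 0 <= \sum_(j < d | j != i) 2 * \int[P]_w (w 0 ord0 j ^+ 2).
  by apply: sumr_ge0 => j _; rewrite mulr_ge0.
have : 2 * (1 + energyT) * t <= 2 * (1 + energyT) * T by rewrite ler_wpM2l// mulr_ge0// addr_ge0.
lra.
Qed.

End energy.

End drift.

Section energy_bound.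
Context {R : realType} {d : nat} {T : R} (P : probability (path_space R d T) R).
Local Notation Om := (path_space R d T).
Local Notation leb := (@lebesgue_measure R).
Variables (b s : 'I_d -> R * 'rV[R]_d -> R) (A L : R).
Hypotheses (T0 : 0 < T) (cb : forall i, continuous (b i)) (cs : forall i, continuous (s i)).
Hypotheses (A0 : 0 <= A) (L0 : 0 <= L).
Hypothesis bs : forall i t x, `|b i (t, x)| <= A + L * `|x| + `|s i (t, x)|.
Hypothesis indep : independent_noise P b.
Hypothesis H0 : forall i, itg P setT (fun w : Om => w 0 ord0 i ^+ 2).
Hypothesis Hs : finite_energy P s.

(** [Y] is the Brownian part including the initial position, so its second moments are explicit. [a]
    is the free term of the Gronwall inequality [gw] satisfied by [|w t|], with rate [L']; the
    summand 1 in [L'] makes the rate positive. [c] is the resulting constant. *)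
Let Y i (p : R * Om) : R := p.2 p.1 ord0 i - driftint b 0 p.1 p.2 i.
Let L' := d%:R * L + 1.
Let c := L' * expR (L' * T).
Let S2 i (w : Om) : R := \int[leb]_(r in `[0, T]) (s i (r, w r) ^+ 2).
Let C (w : Om) : R := d%:R * A * T + \sum_i \int[leb]_(r in `[0, T]) `|s i (r, w r)|.
Let a (t : R) (w : Om) : R := \sum_i `|Y i (t, w)| + C w.

Let L'0 : 0 < L'. Proof. by rewrite ltr_wpDl// mulr_ge0. Qed.
Let T0' : 0 <= T. Proof. exact: ltW. Qed.
Let Tm : measurable `[0, T]%classic. Proof. exact: measurable_itv. Qed.

Let cw (w : Om) : continuous (fun r => `|w r|).
Proof. by move=> r; apply: (@cvg_norm _ _ _ _ _ (w : R -> 'rV[R]_d)); exact: path_continuous. Qed.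

Let cY i (w : Om) : {within `[0, T], continuous (fun t => Y i (t, w))}.
Proof.
move=> t; apply: (@continuousB _ _ (subspace `[0, T]) (fun t => w t ord0 i) (fun t => driftint b 0 t w i)).
  apply: continuous_subspaceT => r.
  apply: (@continuous_comp _ _ _ (w : R -> 'rV[R]_d) (fun x : 'rV[R]_d => x ord0 i)).
    exact: path_continuous.
  exact: coord_continuous.
move: t; apply: parameterized_integral_continuous => //.
exact: itg_b.
Qed.

Let mY i : measurable_fun setT (Y i).
Proof.
apply: measurable_funB.
  by have := @measurable_along_path R d T (fun p => p.2 ord0 i); apply => p;
    exact: continuous_snd_coord.
exact: (measurable_running (measurable_along_path (@cb i))).
Qed.

Let itg_a w : itg leb `[0, T] (fun t => a t w).
Proof.
apply: continuous_compact_integrable; first exact: segment_compact.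
move=> t; apply: cvgD_fun; last exact: cst_continuous.
apply: cvg_sum_fin => i.
by apply: cvg_norm; exact: cY.
Qed.

Let itg_Y2 w i : itg leb `[0, T] (fun t => Y i (t, w) ^+ 2).
Proof.
apply: continuous_compact_integrable; first exact: segment_compact.
move=> t; apply: cvgM_fun; exact: cY.
Qed.

Let cs1 i (w : Om) : continuous (fun r => `|s i (r, w r)|).
Proof.
move=> r; apply: (@cvg_norm _ _ _ _ _ (fun r => s i (r, w r))).
exact: (@continuous_along_path R d T (s i) w (@cs i) r).
Qed.

Let cs2 i (w : Om) : continuous (fun r => s i (r, w r) ^+ 2).
Proof.
move=> r; apply: (@continuous_comp _ _ _ (fun r => s i (r, w r)) (fun x => x ^+ 2)).
  exact: (@continuous_along_path R d T (s i) w (@cs i) r).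
exact: exprn_continuous.
Qed.

Let gw (w : Om) t : 0 <= t <= T -> `|w t| <= a t w + L' * \int[leb]_(r in `[0, t]) `|w r|.
Proof.
move=> tT; have [t0 tT'] := andP tT.
have n1 : `|w t| <= \sum_i `|w t ord0 i|.
  apply: norm_le_coord => [|i]; first by apply: sumr_ge0.
  by rewrite (bigD1 i)//= lerDl; apply: sumr_ge0.
apply: (le_trans n1).
have I1 := itg_cst_itv 0 t A.
have I2 : itg leb `[0, t] (fun r => `|w r|) by exact: itg_cts_itv.
have I3 i : itg leb `[0, t] (fun r => `|s i (r, w r)|) by exact: itg_cts_itv.
have tm : measurable `[0, t]%classic by exact: measurable_itv.
have I2' := leb_itgZ R _ _ L tm I2.
have I12 := leb_itgD R _ _ _ tm I1 I2'.
have I i := leb_itgD R _ _ _ tm I12 (I3 i).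
have di i : `|w t ord0 i| <= `|Y i (t, w)| + (A * T + L * (\int[leb]_(r in `[0, t]) `|w r|) + \int[leb]_(r in `[0, T]) `|s i (r, w r)|).
  have -> : w t ord0 i = Y i (t, w) + driftint b 0 t w i by rewrite subrK.
  apply: (le_trans (ler_normD _ _)); rewrite lerD2l.
  apply: (@le_trans _ _ (\int[leb]_(r in `[0, t]) (A + L * `|w r| + `|s i (r, w r)|))).
    apply: (leb_le_Rint_bound R) => //; exact: itg_b.
  rewrite (leb_RintegralD R)// (leb_RintegralD R)//.
  rewrite (leb_RintegralZl R)// Rint_cst_itv// subr0.
  apply: lerD; first by rewrite lerD2r ler_wpM2l.
  rewrite -lee_fin !(leb_itg_fin R)//; last exact: itg_cts_itv.
  apply: ge0_subset_integral => //.
  - by apply/measurable_EFinP; apply: itg_meas; exact: itg_cts_itv.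
  - move=> r /=; rewrite !in_itv/= => /andP[r0 rt]; apply/andP; split; lra.
apply: (le_trans (ler_sum _ (fun i _ => di i))).
rewrite big_split /= /a /C -!addrA lerD2l big_split /= sumr_const card_ord -[(_ + _) *+ d]mulr_natl.
have U0 : 0 <= \int[leb]_(r in `[0, t]) `|w r| by exact: Rintegral_ge0.
move: U0; set U := \int[leb]_(r in `[0, t]) `|w r|; rewrite /L' => U0.
by set Sg := \sum_i _; rewrite mulrDr !mulrA mulrDl mul1r; lra.
Qed.

(** Gronwall gives [|w t| <= a t w + c J], with [J] the time integral of [a]. Squares and
    Cauchy-Schwarz leave only quantities whose expectations are known: the squares of [Y] and of
    [s]. *)
Let square_bound (w : Om) : \int[leb]_(t in `[0, T]) (`|w t| ^+ 2) <=
  (2 + 2 * c ^+ 2 * T ^+ 2) * (2 * d%:R * \sum_i (\int[leb]_(t in `[0, T]) (Y i (t, w) ^+ 2))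
     + 4 * (d%:R * A * T) ^+ 2 * T + 4 * d%:R * T ^+ 2 * \sum_i S2 i w).
Proof.
have Ia := itg_a w.
have a0 t : 0 <= t <= T -> 0 <= a t w.
  move=> _; rewrite addr_ge0 ?sumr_ge0// addr_ge0 ?mulr_ge0 ?sumr_ge0// => i _.
  exact: Rintegral_ge0.
have G := gronwall L'0 T0 (@cw w) (fun t => normr_ge0 _) Ia a0 (@gw w).
pose J := \int[leb]_(t in `[0, T]) a t w.
have ca : {within `[0, T], continuous (fun t => a t w)}.
  move=> t; apply: cvgD_fun; last exact: cst_continuous.
  apply: cvg_sum_fin => i.
  by apply: cvg_norm; exact: cY.
have Ia2 : itg leb `[0, T] (fun t => a t w ^+ 2).
  apply: continuous_compact_integrable; first exact: segment_compact.
  move=> t; apply: cvgM_fun; exact: ca.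
have U t : 0 <= t <= T -> `|w t| <= a t w + c * J.
  move=> tT; have [t0 tT'] := andP tT; apply: (le_trans (gw w tT)); rewrite lerD2l /c -mulrA ler_wpM2l ?(ltW L'0)//.
  apply: le_trans G.
  rewrite -lee_fin !(leb_itg_fin R) //; try exact: itg_cts_itv; try exact: measurable_itv.
  apply: ge0_subset_integral => //.
  - by apply/measurable_EFinP; apply: itg_meas; exact: itg_cts_itv.
  - move=> r /=; rewrite !in_itv/= => /andP[r0 rt]; apply/andP; split; lra.
have J0 : 0 <= J by apply: Rintegral_ge0 => t /=; rewrite in_itv/=; exact: a0.
have J2 : J ^+ 2 <= T * \int[leb]_(t in `[0, T]) (a t w ^+ 2).
  by have := sqr_Rint_le T0 Ia Ia2; rewrite subr0.
have c0 : 0 <= c by rewrite mulr_ge0 ?expR_ge0// ltW.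
have Iu2 : itg leb `[0, T] (fun t => `|w t| ^+ 2).
  apply: itg_cts_itv => t; apply: (@continuous_comp _ _ _ (fun t => `|w t|) (fun x => x ^+ 2)); first exact: cw.
  exact: exprn_continuous.
have Z2 := leb_itgZ R _ _ 2 Tm Ia2.
have K2 := itg_cst_itv 0 T (2 * (c * J) ^+ 2).
apply: (@le_trans _ _ ((2 + 2 * c ^+ 2 * T ^+ 2) * \int[leb]_(t in `[0, T]) (a t w ^+ 2))).
  apply: (@le_trans _ _ (\int[leb]_(t in `[0, T]) (2 * a t w ^+ 2 + 2 * (c * J) ^+ 2))).
    apply: (leb_le_Rintegral R) => //.
      exact: (leb_itgD R).
    move=> t /=; rewrite in_itv/= => tT.
    apply: (@le_trans _ _ ((a t w + c * J) ^+ 2)).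
      by apply: (lerXn2r 2 _ _ (U t tT)); rewrite nnegrE//; exact: (addr_ge0 (a0 t tT) (mulr_ge0 c0 J0)).
    have := sqr_ge0 (a t w - c * J); lra.
  rewrite (leb_RintegralD R)// (leb_RintegralZl R)// Rint_cst_itv// subr0.
  rewrite [leRHS]mulrDl lerD2l exprMn; set I2 := \int[leb]_(t in `[0, T]) _ in J2 *.
  have -> : 2 * c ^+ 2 * T ^+ 2 * I2 = 2 * c ^+ 2 * T * (T * I2) by ring.
  have -> : 2 * (c ^+ 2 * J ^+ 2) * T = 2 * c ^+ 2 * T * J ^+ 2 by ring.
  by apply: ler_wpM2l => //; apply: mulr_ge0 => //; apply: mulr_ge0 => //; exact: sqr_ge0.
rewrite ler_wpM2l//.
  by apply: addr_ge0 => //; apply: mulr_ge0; [apply: mulr_ge0 => //|]; exact: sqr_ge0.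
have CC : C w ^+ 2 <= 2 * (d%:R * A * T) ^+ 2 + 2 * d%:R * T * \sum_i S2 i w.
  have S i : (\int[leb]_(r in `[0, T]) `|s i (r, w r)|) ^+ 2 <= T * S2 i w.
    have I1 : itg leb `[0, T] (fun r => `|s i (r, w r)|) by exact: itg_cts_itv.
    have E : (fun r => `|s i (r, w r)| ^+ 2) = (fun r => s i (r, w r) ^+ 2).
      by apply/funext => r; rewrite real_normK ?num_real.
    have I2 : itg leb `[0, T] (fun r => `|s i (r, w r)| ^+ 2) by rewrite E; exact: itg_cts_itv.
    by have := sqr_Rint_le T0 I1 I2; rewrite subr0 E.
  have Q := sqr_sum_le (fun i => \int[leb]_(r in `[0, T]) `|s i (r, w r)|).
  have Q2 : d%:R * \sum_i (\int[leb]_(r in `[0, T]) `|s i (r, w r)|) ^+ 2 <= d%:R * (T * \sum_i S2 i w).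
    by rewrite ler_wpM2l// mulr_sumr; apply: ler_sum => i _; exact: S.
  rewrite /C; move: Q Q2; set x := \sum_i \int[leb]_(r in _) _; set y := \sum_i (_ ^+ 2); set z := \sum_i S2 i w => Q Q2.
  have := sqr_ge0 (d%:R * A * T - x); rewrite -!mulrA; lra.
have IY := leb_itg_sum R _ _ (index_enum 'I_d) _ Tm (itg_Y2 w).
have IY' := leb_itgZ R _ _ (2 * d%:R) Tm IY.
have KC := itg_cst_itv 0 T (2 * C w ^+ 2).
apply: (@le_trans _ _ (\int[leb]_(t in `[0, T]) (2 * d%:R * (\sum_i Y i (t, w) ^+ 2) + 2 * C w ^+ 2))).
  apply: (leb_le_Rintegral R) => //.
    exact: (leb_itgD R).
  move=> t _; rewrite /a.
  have Q := sqr_sum_le (fun i => `|Y i (t, w)|).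
  have E : \sum_i `|Y i (t, w)| ^+ 2 = \sum_i Y i (t, w) ^+ 2.
    by apply: eq_bigr => i _; rewrite real_normK ?num_real.
  rewrite E in Q; move: Q; set x := \sum_i `|_|; set y := \sum_i _ => Q.
  have := sqr_ge0 (x - C w); rewrite -mulrA; lra.
rewrite (leb_RintegralD R)// (leb_RintegralZl R)// Rint_cst_itv// subr0.
rewrite (leb_Rint_sum R _ _ _ _ Tm (itg_Y2 w)) -addrA lerD2l.
have -> : 4 * (d%:R * A * T) ^+ 2 * T + 4 * d%:R * T ^+ 2 * (\sum_i S2 i w) =
  2 * (2 * (d%:R * A * T) ^+ 2 + 2 * d%:R * T * \sum_i S2 i w) * T by ring.
by rewrite ler_wpM2r// ler_wpM2l.
Qed.

(** The drift grows linearly in the position, so its energy cannot be read off from integrability of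
    the supremum of the path. The bound is proved on each path and only then integrated, which
    avoids assuming the moment that is to be shown. *)
Lemma position_drift_energy :
  (\int[leb]_(t in `[0%R, T]) \int[P]_w (`|w t| ^+ 2)%:E < +oo)%E /\
  finite_energy P b.
Proof.
have ms i : measurable_fun setT (fun p : R * Om => s i (p.1, p.2 p.1)) by exact: measurable_along_path.
have ms2 i : measurable_fun setT (fun p : R * Om => s i (p.1, p.2 p.1) ^+ 2).
  by apply: (measurableT_comp (exprn_measurable 2)).
have IS2 i : itg P setT (S2 i).
  have Ffin : (\int[leb]_(t in `[0%R, T]) \int[P]_w (`|s i (t, w t) ^+ 2|)%:E < +oo)%E.
    apply: le_lt_trans (Hs i); rewrite le_eqVlt; apply/orP; left; apply/eqP.
    by apply: eq_integral => t _; apply: eq_integral => w _; rewrite ger0_norm// sqr_ge0.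
  by have [] := fubini_path (ms2 i) Ffin.
have mY2 i : measurable_fun setT (fun p => Y i p ^+ 2) by exact: (measurableT_comp (exprn_measurable 2)).
(* For [t > 0], [Y] is the noise over [[0, t]] plus the initial position. The time 0 is separate
   because the noise is controlled on nondegenerate intervals. *)
have EY i t : 0 <= t <= T -> itg P setT (fun w => Y i (t, w) ^+ 2) /\
    \int[P]_w (Y i (t, w) ^+ 2) <= 2 * T + 2 * \int[P]_w (w 0 ord0 i ^+ 2).
  move=> /andP[t0 tT]; have E0 : 0 <= \int[P]_w (w 0 ord0 i ^+ 2) by apply: Rintegral_ge0 => w _; exact: sqr_ge0.
  move: t0; rewrite le_eqVlt => /predU1P[<-|t0].
    have E w : Y i (0, w) = w 0 ord0 i by rewrite /Y /driftint /= set_itv1 Rintegral_set1 subr0.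
    have -> : (fun w => Y i (0, w) ^+ 2) = fun w : Om => w 0 ord0 i ^+ 2 by apply/funext => w; rewrite E.
    split; first exact: H0.
    have Lx (x : R) : 0 <= x -> x <= 2 * T + 2 * x by move=> x0; have := T0'; lra.
    exact: Lx.
  have in2 := @itg_noise _ _ _ P b cb indep 0 t (lexx 0) t0 tT 2 i isT.
  have ev := noise_var cb indep (lexx 0) t0 tT i; rewrite subr0 in ev.
  have I := itgD measurableT (itgZ 2 measurableT in2) (itgZ 2 measurableT (H0 i)).
  have B (w : Om) : `|Y i (t, w) ^+ 2| <= 2 * noise b 0 t w ord0 i ^+ 2 + 2 * w 0 ord0 i ^+ 2.
    rewrite ger0_norm ?sqr_ge0// mxE /Y /=; set x := w t ord0 i; set y := w 0 ord0 i; set z := driftint _ _ _ _ _.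
    have := sqr_ge0 (x - z - y - y); lra.
  have mYt : measurable_fun setT (fun w => Y i (t, w) ^+ 2).
    exact: (measurableT_comp (mY2 i) (@pair1_measurable _ _ _ _ t)).
  have IY := itg_le measurableT mYt I (fun w _ => B w); split => //.
  apply: (@le_trans _ _ (\int[P]_w (2 * noise b 0 t w ord0 i ^+ 2 + 2 * w 0 ord0 i ^+ 2))).
    by apply: le_Rintegral => // w _; exact: le_trans (ler_norm _) (B w).
  rewrite RintegralD//; [|exact: itgZ|exact: itgZ].
  by rewrite !RintegralZl// ev lerD2r ler_wpM2l.
have IY i : itg P setT (fun w => \int[leb]_(t in `[0, T]) (Y i (t, w) ^+ 2)).
  by have [] := tonelli_path_bound T0' (mY2 i) (fun p => sqr_ge0 _) (@EY i).
have mN2 : measurable_fun setT (fun p : R * Om => `|p.2 p.1| ^+ 2).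
  apply: (measurableT_comp (exprn_measurable 2)).
  have := @measurable_along_path R d T (fun p => `|p.2|); apply => p.
  by apply: cvg_norm; exact: cvg_snd.
have IU w : itg leb `[0, T] (fun t => `|(w : Om) t| ^+ 2).
  apply: itg_cts_itv => t; apply: (@continuous_comp _ _ _ (fun t => `|w t|) (fun x => x ^+ 2)); first exact: cw.
  exact: exprn_continuous.
have IN : itg P setT (fun w => \int[leb]_(t in `[0, T]) (`|w t| ^+ 2)).
  apply: (itg_le measurableT (measurable_Rint_path 0 T mN2) _ _); last first.
    move=> w _; rewrite ger0_norm; first exact: square_bound.
    by apply: Rintegral_ge0 => t _; exact: sqr_ge0.
  apply: itgZ => //; apply: itgD => //; first apply: itgD => //.
  - by apply: itgZ => //; exact: itg_sum.
  - exact: itg_cst.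
  - by apply: itgZ => //; exact: itg_sum.
split; first exact: (tonelli_path_fin mN2 (fun p => sqr_ge0 _) IU IN).
move=> i.
have mb2 : measurable_fun setT (fun p : R * Om => b i (p.1, p.2 p.1) ^+ 2).
  by apply: (measurableT_comp (exprn_measurable 2)); exact: measurable_along_path.
apply: (tonelli_path_fin mb2 (fun p => sqr_ge0 _)); first by move=> w; exact: itg_b2.
have B (w : Om) : `|\int[leb]_(t in `[0, T]) (b i (t, w t) ^+ 2)| <=
    3 * A ^+ 2 * T + (3 * L ^+ 2 * (\int[leb]_(t in `[0, T]) (`|w t| ^+ 2)) + 3 * S2 i w).
  have I1 := itg_cst_itv 0 T (3 * A ^+ 2).
  have I2 := leb_itgZ R _ _ (3 * L ^+ 2) Tm (IU w).
  have I3 : itg leb `[0, T] (fun t => 3 * s i (t, w t) ^+ 2).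
    by apply: (leb_itgZ R) => //; exact: itg_cts_itv.
  have I4 := leb_itgD R _ _ _ Tm I2 I3.
  have I5 := leb_itgD R _ _ _ Tm I1 I4.
  apply: (@le_trans _ _ (\int[leb]_(t in `[0, T]) (3 * A ^+ 2 + (3 * L ^+ 2 * `|w t| ^+ 2 + 3 * s i (t, w t) ^+ 2)))).
    apply: (leb_le_Rint_bound R) => //; first exact: itg_b2.
    move=> t _; rewrite ger0_norm ?sqr_ge0// -[b i _ ^+ 2]real_normK ?num_real// -[s i _ ^+ 2]real_normK ?num_real//.
    apply: (@le_trans _ _ ((A + L * `|w t| + `|s i (t, w t)|) ^+ 2)).
      by rewrite ler_sqr ?nnegrE// ?bs// !addr_ge0// mulr_ge0.
    rewrite -[_ * L ^+ 2 * _]mulrA -exprMn; set x := L * _; set y := `|s i _|.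
    have := sqr_ge0 (A - x); have := sqr_ge0 (A - y); have := sqr_ge0 (x - y); lra.
  rewrite (leb_RintegralD R)// (leb_RintegralD R)//.
  rewrite Rint_cst_itv// (leb_RintegralZl R)// (leb_RintegralZl R)// ?subr0//.
  exact: itg_cts_itv.
apply: (itg_le measurableT (measurable_Rint_path 0 T mb2) _ (fun w _ => B w)).
apply: itgD => //; first exact: itg_cst.
by apply: itgD => //; exact: itgZ.
Qed.

End energy_bound.

Section sums_of_squares.
Context {R : realType} {d : nat}.

Definition sqs (a : 'I_d -> R) : R := \sum_i a i ^+ 2.

Lemma sqs_ge0 a : 0 <= sqs a.
Proof. by apply: sumr_ge0 => i _; exact: sqr_ge0. Qed.

Lemma norm_sqs (x : 'rV[R]_d) : `|x| ^+ 2 <= sqs (x ord0).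
Proof. by rewrite /sqs -enorm_sq ler_sqr ?nnegrE ?norm_le_enorm// sqrtr_ge0. Qed.

Lemma sum_norm_sqs (a : 'I_d -> R) : (\sum_i `|a i|) ^+ 2 <= d%:R * sqs a.
Proof.
apply: le_trans (sqr_sum_le _) _; rewrite ler_wpM2l//.
by apply: ler_sum => i _; rewrite real_normK ?num_real.
Qed.

Lemma sqsD (a b : 'I_d -> R) : sqs (fun i => a i + b i) <= 2 * sqs a + 2 * sqs b.
Proof.
rewrite /sqs !mulr_sumr -big_split /=; apply: ler_sum => i _.
have := sqr_ge0 (a i - b i); lra.
Qed.

(** Young's inequality with weight [del]. Here [z] will be the noise and [e] the drift integral: the
    noise pays the small factor, and the large factor [del^-1] falls on the drift, whose square
    carries an additional factor [h]. *)
Lemma cross_bound (z e : 'I_d -> R) (del : R) : 0 < del ->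
  \sum_i \sum_j `|(z i + e i) * (z j + e j) - z i * z j| <=
  d%:R * (del * sqs z + (del^-1 + 1) * sqs e).
Proof.
move=> del0.
have H i j : `|(z i + e i) * (z j + e j) - z i * z j| <=
    (2^-1 * del * z i ^+ 2 + 2^-1 * (del^-1 + 1) * e i ^+ 2) +
    (2^-1 * del * z j ^+ 2 + 2^-1 * (del^-1 + 1) * e j ^+ 2).
  have Y (a b : R) : `|a * b| <= 2^-1 * del * a ^+ 2 + 2^-1 * del^-1 * b ^+ 2.
    rewrite normrM -[a ^+ 2]real_normK ?num_real// -[b ^+ 2]real_normK ?num_real//.
    set x := `|a|; set y := `|b|.
    have := sqr_ge0 (del * x - y).
    have -> : 2^-1 * del * x ^+ 2 + 2^-1 * del^-1 * y ^+ 2 = x * y + 2^-1 * del^-1 * (del * x - y) ^+ 2.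
      field. by rewrite gt_eqF.
    by move=> q; rewrite lerDl; apply: mulr_ge0 => //; rewrite mulr_ge0// invr_ge0 ltW.
  have -> : (z i + e i) * (z j + e j) - z i * z j = (z i * e j + z j * e i) + e i * e j by ring.
  apply: (le_trans (ler_normD _ _)); have := ler_normD (z i * e j) (z j * e i).
  have := Y (z i) (e j); have := Y (z j) (e i).
  have : `|e i * e j| <= 2^-1 * e i ^+ 2 + 2^-1 * e j ^+ 2.
    rewrite normrM -[e i ^+ 2]real_normK ?num_real// -[e j ^+ 2]real_normK ?num_real//.
    have := sqr_ge0 (`|e i| - `|e j|); lra.
  lra.
apply: (le_trans (ler_sum _ (fun i _ => ler_sum _ (fun j _ => H i j)))).
have S (x : 'I_d -> R) : \sum_i \sum_j (x i + x j) = 2 * d%:R * \sum_i x i.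
  under eq_bigr do rewrite big_split /= sumr_const card_ord -mulr_natl.
  rewrite big_split /= -mulr_sumr sumr_const card_ord -[_ *+ d]mulr_natl; ring.
rewrite S big_split /= -!mulr_sumr -/(sqs z) -/(sqs e).
rewrite (_ : 2 * d%:R * _ = d%:R * (del * sqs z + (del^-1 + 1) * sqs e))//; field.
by rewrite gt_eqF.
Qed.

End sums_of_squares.

(** * Ito's formula in expectation *)

Section ito_pathwise.
Context {R : realType} {d : nat} {T : R} (P : probability (path_space R d T) R).
Local Notation Om := (path_space R d T).
Local Notation leb := (@lebesgue_measure R).
Variable b : 'I_d -> R * 'rV[R]_d -> R.
Hypotheses (T0 : 0 < T) (cb : forall i, continuous (b i)).

Definition spread (u v : R) (w : Om) : R := \int[leb]_(r in `[u, v]) sqs ((w r - w u) ord0).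

(** A modulus of continuity that is affine in [|s - t|] and in the squared distance: along the
    process its expectation is [eps] plus [K] times a quantity of the order of the elapsed time, by
    [displacement_sq]. *)
Definition modulus (eps K : R) (F : R * 'rV[R]_d -> R) : Prop :=
  forall t x s y, 0 <= t <= T -> 0 <= s <= T ->
    `|F (s, y) - F (t, x)| <= eps + K * (`|s - t| + sqs ((y - x) ord0)).

Lemma continuous_spread u (w : Om) : continuous (fun r => sqs ((w r - w u) ord0)).
Proof.
move=> r; apply: cvg_sum_fin => i.
apply: cvg_sqr.
apply: (@continuous_comp _ _ _ (fun r => w r - w u) (fun x : 'rV[R]_d => x ord0 i)); last exact: coord_continuous.
apply: (@continuousB _ _ _ (w : R -> 'rV[R]_d) (fun=> w u)); first exact: path_continuous.
exact: cst_continuous.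
Qed.

Variables (eps K C del u v : R).
Hypotheses (eps0 : 0 <= eps) (K0 : 0 <= K) (C0 : 0 <= C) (del0 : 0 < del).
Hypotheses (u0 : 0 <= u) (uv : u < v) (vT : v <= T).
Local Notation h := (v - u).
Let h0 : 0 < h. Proof. by rewrite subr_gt0. Qed.
Let mI : measurable `[u, v]%classic. Proof. exact: measurable_itv. Qed.
Let uT : 0 <= u <= T. Proof. by rewrite u0 (le_trans (ltW uv)). Qed.

Let Iq (w : Om) : itg leb `[u, v] (fun r => eps + K * (h + sqs ((w r - w u) ord0))).
Proof.
apply: itg_cts_itv => r.
apply: cvgD_fun; first exact: cst_continuous.
apply: cvgM_fun; first exact: cst_continuous.
apply: cvgD_fun; first exact: cst_continuous.
exact: continuous_spread.
Qed.

Let Rq (w : Om) : \int[leb]_(r in `[u, v]) (eps + K * (h + sqs ((w r - w u) ord0))) =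
  h * (eps + K * h) + K * spread u v w.
Proof.
have I1 := itg_cts_itv u v (@continuous_spread u w).
have I2 := leb_itgZ R _ _ K mI I1.
transitivity (\int[leb]_(r in `[u, v]) ((eps + K * h) + K * sqs ((w r - w u) ord0))).
  by apply: eq_Rintegral => r _; ring.
rewrite (leb_RintegralD R)//; last exact: itg_cst_itv.
rewrite (leb_RintegralZl R)// Rint_cst_itv ?(ltW uv)// /spread; ring.
Qed.

Let gap F (w : Om) r : modulus eps K F -> u <= r <= v ->
  `|F (u, w u) - F (r, w r)| <= eps + K * (h + sqs ((w r - w u) ord0)).
Proof.
move=> MF /andP[ur rv]; rewrite distrC.
have rT : 0 <= r <= T by rewrite (le_trans u0 ur) (le_trans rv vT).
apply: (le_trans (MF u (w u) r (w r) uT rT)).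
by rewrite lerD2l ler_wpM2l// lerD2r ger0_norm; lra.
Qed.

Lemma gap_int F (w : Om) : modulus eps K F -> continuous F ->
  `|h * F (u, w u) - \int[leb]_(r in `[u, v]) F (r, w r)| <= h * (eps + K * h) + K * spread u v w.
Proof.
move=> MF cF; rewrite -Rq [h * _]mulrC -(Rint_cst_itv _ (ltW uv)).
have I1 := itg_cst_itv u v (F (u, w u)).
have I2 : itg leb `[u, v] (fun r => F (r, w r)) by apply: itg_cts_itv; exact: continuous_along_path.
rewrite (leb_RintB R)//.
apply: (leb_le_Rint_bound R) => //.
  exact: (leb_itgB R).
by move=> r /=; rewrite in_itv/=; exact: gap.
Qed.

(** The coefficient [F] is frozen in front of a drift that is only square integrable; Young's
    inequality separates the two and gives the energy the small factor [del]. *)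
Lemma gap_int_drift F (w : Om) i : modulus eps K F -> continuous F -> (forall p, `|F p| <= C) ->
  `|F (u, w u) * driftint b u v w i - \int[leb]_(r in `[u, v]) (F (r, w r) * b i (r, w r))| <=
  del * \int[leb]_(r in `[u, v]) (b i (r, w r) ^+ 2) +
    (2^-1 * C / del) * (h * (eps + K * h) + K * spread u v w).
Proof.
move=> MF cF FC; rewrite -Rq.
have Ib := itg_b cb w i u v; have Ib2 := itg_b2 cb w i u v.
have cFb : continuous (fun r => F (r, w r) * b i (r, w r)).
  move=> r; apply: cvgM_fun.
    exact: (@continuous_along_path R d T F w cF r).
  exact: (@continuous_along_path R d T (b i) w (@cb i) r).
have IFb := itg_cts_itv u v cFb.
have IF := leb_itgZ R _ _ (F (u, w u)) mI Ib.
rewrite /driftint -(leb_RintegralZl R)// (leb_RintB R)//.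
have I1 := leb_itgZ R _ _ del mI Ib2.
have I2 := leb_itgZ R _ _ (2^-1 * C / del) mI (Iq w).
rewrite -(leb_RintegralZl R)// -(leb_RintegralZl R)//.
rewrite -(leb_RintegralD R)//.
apply: (leb_le_Rint_bound R) => //.
- exact: (leb_itgB R).
- exact: (leb_itgD R).
move=> r /=; rewrite in_itv/= => ruv.
have := gap w MF ruv; set q := eps + _; rewrite -mulrBl normrM => Hq.
set x := `|_ - _| in Hq *; rewrite -[b i _ ^+ 2]real_normK ?num_real//; set y := `|b i _|.
(* One factor of the square is bounded by [2 * C], the other by the modulus; this keeps the estimate
   linear in [q], whose time integral involves only second moments. *)
have x2 : x ^+ 2 <= 2 * C * q.
  have xC : x <= 2 * C.
    by rewrite /x; apply: (le_trans (ler_normB _ _)); have := FC (u, w u); have := FC (r, w r); lra.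
  by rewrite expr2; apply: ler_pM => //; exact: normr_ge0.
have -> : del * y ^+ 2 + 2^-1 * C / del * q = x * y + del^-1 * ((del * y - 2^-1 * x) ^+ 2 + 4^-1 * (2 * C * q - x ^+ 2)).
  field. by rewrite gt_eqF.
rewrite lerDl mulr_ge0 ?invr_ge0 ?(ltW del0)// addr_ge0 ?sqr_ge0// mulr_ge0// subr_ge0//.
Qed.

Variables (g : R -> 'rV[R]_d -> R) (phi : 'rV[R]_d -> R) (D0 : R * 'rV[R]_d -> R)
  (D1 : 'I_d -> R * 'rV[R]_d -> R) (D2 : 'I_d -> 'I_d -> R * 'rV[R]_d -> R) (Kphi : R).
Hypotheses (cphi : continuous phi) (phiK : forall x, `|phi x| <= Kphi).
Hypothesis g_t : forall u v x, 0 <= u -> u <= v -> v <= T ->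
  exists2 c : R, u <= c <= v & g v x - g u x = D0 (c, x) * (v - u).
Hypothesis g_x : forall t, 0 <= t <= T -> pC2 (g t).
Hypothesis g_1 : forall t i x, 0 <= t <= T -> partial i (g t) x = D1 i (t, x).
Hypothesis g_2 : forall t i j x, 0 <= t <= T -> partial j (partial i (g t)) x = D2 i j (t, x).
Hypotheses (cD0 : continuous D0) (cD1 : forall i, continuous (D1 i)) (cD2 : forall i j, continuous (D2 i j)).

Let G0 p := phi p.2 * D0 p.
Let G1 i p := phi p.2 * D1 i p.
Let G2 i j p := phi p.2 * D2 i j p.

Let cphi2 : continuous (fun p : R * 'rV[R]_d => phi p.2).
Proof. exact: (continuous_snd cphi). Qed.
Let cG0 : continuous G0. Proof. by move=> p; exact: (continuousM (@cphi2 p) (@cD0 p)). Qed.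
Let cG1 i : continuous (G1 i). Proof. by move=> p; exact: (continuousM (@cphi2 p) (@cD1 i p)). Qed.
Let cG2 i j : continuous (G2 i j). Proof. by move=> p; exact: (continuousM (@cphi2 p) (@cD2 i j p)). Qed.

Hypotheses (MD0 : modulus eps K D0) (MD2 : forall i j, modulus eps K (D2 i j)).
Hypotheses (MG0 : modulus eps K G0) (MG1 : forall i, modulus eps K (G1 i)) (MG2 : forall i j, modulus eps K (G2 i j)).
Hypotheses (CG1 : forall i p, `|G1 i p| <= C) (CD2 : forall i j p, `|D2 i j p| <= C)
  (CG2 : forall i j p, `|G2 i j p| <= C).

Definition generator p : R :=
  phi p.2 * (D0 p + 2^-1 * (\sum_i D2 i i p) + \sum_i b i p * D1 i p).

(** The part of the second-order expansion with zero expectation: the noise is centered given [X_u],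
    and its products have conditional mean [h] on the diagonal and 0 elsewhere. *)
Definition ito_noise (w : Om) : R :=
  \sum_i G1 i (u, w u) * noise b u v w ord0 i +
  2^-1 * \sum_i \sum_j G2 i j (u, w u) * (noise b u v w ord0 i * noise b u v w ord0 j - (i == j)%:R * h).

Definition noise_sq (w : Om) : R := sqs (noise b u v w ord0).
Definition noise_4 (w : Om) : R := \sum_i noise b u v w ord0 i ^+ 4.
Definition jump_sq (w : Om) : R := sqs ((w v - w u) ord0).

(** Every term has an expectation that becomes an arbitrarily small multiple of [h] plus the energy,
    once [del], [eps] and finally [h] are taken small, in this order. *)
Definition ito_error (w : Om) : R :=
  h * (eps + K * h) * (Kphi + 1 + d%:R * (2^-1 * C / del) + d%:R * 2^-1)
  + K * (1 + d%:R * (2^-1 * C / del) + d%:R * 2^-1) * spread u v w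
  + Kphi * K * h * jump_sq w
  + (del + 2^-1 * C * d%:R * (del^-1 + 1) * d%:R * h + Kphi * d%:R * (8 * C * d%:R * h)) * energy b u v w
  + (2^-1 * C * d%:R * del + Kphi * d%:R * (4 * eps)) * noise_sq w
  + Kphi * d%:R * (16 * K * d%:R) * noise_4 w.

Let Kphi0 : 0 <= Kphi. Proof. exact: le_trans (phiK 0). Qed.

Let drift_sq (w : Om) : sqs (driftint b u v w) <= d%:R * h * energy b u v w.
Proof.
apply: (@le_trans _ _ (\sum_(i < d) h * energy b u v w)).
  by apply: ler_sum => i _; exact: driftint_sq.
by rewrite sumr_const card_ord -[_ *+ d]mulr_natl mulrA.
Qed.

Let dxE (w : Om) i : (w v - w u) ord0 i = noise b u v w ord0 i + driftint b u v w i.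
Proof. by rewrite mxE [noise _ _ _ _ _ _]mxE subrK mxE. Qed.

Let time_part (w : Om) : `|phi (w u) * (g v (w v) - g u (w v)) - \int[leb]_(r in `[u, v]) G0 (r, w r)| <=
  h * (eps + K * h) * (Kphi + 1) + Kphi * K * h * jump_sq w + K * spread u v w.
Proof.
have [c /andP[uc cv] ->] := g_t (w v) u0 (ltW uv) vT.
have cT : 0 <= c <= T by rewrite (le_trans u0 uc) (le_trans cv vT).
have H1 : `|D0 (c, w v) - D0 (u, w u)| <= eps + K * (h + jump_sq w).
  apply: (le_trans (MD0 (w u) (w v) uT cT)); rewrite lerD2l ler_wpM2l// lerD2r ger0_norm; lra.
have H2 := gap_int w MG0 cG0.
have -> : phi (w u) * (D0 (c, w v) * h) - \int[leb]_(r in `[u, v]) G0 (r, w r) =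
  phi (w u) * h * (D0 (c, w v) - D0 (u, w u)) + (h * G0 (u, w u) - \int[leb]_(r in `[u, v]) G0 (r, w r)).
  rewrite /G0 /=; ring.
apply: (le_trans (ler_normD _ _)).
have H3 : `|phi (w u) * h * (D0 (c, w v) - D0 (u, w u))| <= Kphi * h * (eps + K * (h + jump_sq w)).
  rewrite normrM; apply: ler_pM => //; rewrite normrM (gtr0_norm h0); exact: (ler_wpM2r (ltW h0)).
lra.
Qed.

(** The noise has a fourth moment, the drift integral only a second one. The oscillation of the
    second derivatives is therefore bounded in two ways, collected in [e]: if the noise dominates
    the displacement, the modulus is used and produces [noise_4]; if the drift dominates, the
    uniform bound [2 * C] is used and only its square appears. *)
Let taylor_part (w : Om) : `|g u (w v) - g u (w u) - \sum_i (w v - w u) ord0 i * D1 i (u, w u)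
    - 2^-1 * \sum_i \sum_j (w v - w u) ord0 i * (w v - w u) ord0 j * D2 i j (u, w u)| <=
  d%:R * (8 * C * d%:R * h * energy b u v w + 4 * eps * noise_sq w + 16 * K * d%:R * noise_4 w).
Proof.
set q := jump_sq w; have q0 : 0 <= q by exact: sqs_ge0.
pose e := Num.min (2 * C) (eps + K * q).
have He (c : R) i j : `|c| <= 1 ->
    `|partial j (partial i (g u)) (w u + c *: (w v - w u)) - partial j (partial i (g u)) (w u)| <= e.
  move=> c1; rewrite !g_2// le_min; apply/andP; split.
    by apply: (le_trans (ler_normB _ _)); have := CD2 i j (u, w u); have := CD2 i j (u, w u + c *: (w v - w u)); lra.
  apply: (le_trans (MD2 i j (w u) _ uT uT)); rewrite lerD2l ler_wpM2l// subrr normr0 add0r.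
  apply: ler_sum => k _; rewrite addrAC subrr add0r mxE exprMn ler_piMl ?sqr_ge0//.
  by rewrite -[c ^+ 2]real_normK ?num_real// exprn_ile1.
have := pC2_taylor (g_x uT) He; rewrite addrCA subrr addr0.
under [X in `|_ - X - _|]eq_bigr do rewrite g_1//.
under [X in 2^-1 * X]eq_bigr => i _ do
  (rewrite mulr_sumr; under eq_bigr do rewrite g_2// mulrA).
move=> H; apply: (le_trans H).
have e0 : 0 <= e by rewrite le_min mulr_ge0//= addr_ge0// mulr_ge0.
apply: (@le_trans _ _ (e * (d%:R * q))); first by rewrite ler_wpM2l//; exact: sum_norm_sqs.
rewrite mulrCA ler_wpM2l//.
set z := noise_sq w; set D := sqs (driftint b u v w).
have z0 : 0 <= z by exact: sqs_ge0.
have Dq : 0 <= D by exact: sqs_ge0.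
have qzD : q <= 2 * z + 2 * D.
  have -> : q = sqs (fun i => noise b u v w ord0 i + driftint b u v w i).
    by apply: eq_bigr => i _; rewrite dxE.
  exact: sqsD.
have z2 : z ^+ 2 <= d%:R * noise_4 w.
  apply: le_trans (sqr_sum_le _) _; rewrite ler_wpM2l//.
  by apply: ler_sum => i _; rewrite -exprM.
have DE := drift_sq w.
have n40 : 0 <= noise_4 w by apply: sumr_ge0 => i _; rewrite exprn_even_ge0.
have en0 := energy_ge0 b u v w.
have e1 : e <= 2 * C by rewrite ge_min lexx.
have e2 : e <= eps + K * q by rewrite ge_min lexx orbT.
have [Dz|zD] := leP D z.
  apply: (@le_trans _ _ ((eps + K * (4 * z)) * (4 * z))).
    apply: ler_pM => //; last lra.
    apply: (le_trans e2); rewrite lerD2l ler_wpM2l//; lra.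
  have : K * z ^+ 2 <= K * (d%:R * noise_4 w) by rewrite ler_wpM2l.
  have : 0 <= 8 * C * d%:R * h * energy b u v w by rewrite !mulr_ge0// ltW.
  lra.
apply: (@le_trans _ _ (2 * C * (4 * D))).
  apply: ler_pM => //; lra.
have : C * D <= C * (d%:R * h * energy b u v w) by rewrite ler_wpM2l.
have : 0 <= 4 * eps * z by rewrite !mulr_ge0.
have : 0 <= 16 * K * d%:R * noise_4 w by rewrite !mulr_ge0.
lra.
Qed.

Let mS (I : Type) (s : seq I) (f : I -> R -> R) : (forall i, continuous (f i)) ->
  \int[leb]_(r in `[u, v]) (\sum_(i <- s) f i r) = \sum_(i <- s) \int[leb]_(r in `[u, v]) f i r.
Proof.
by move=> cf; apply: (leb_Rint_sum R) => // i; exact: itg_cts_itv.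
Qed.

Let genE (w : Om) : \int[leb]_(r in `[u, v]) generator (r, w r) =
  \int[leb]_(r in `[u, v]) G0 (r, w r) + 2^-1 * (\sum_i \int[leb]_(r in `[u, v]) G2 i i (r, w r)) +
  \sum_i \int[leb]_(r in `[u, v]) (G1 i (r, w r) * b i (r, w r)).
Proof.
have ap (F : R * 'rV[R]_d -> R) : continuous F -> continuous (fun r : R => F (r, w r)) by move=> cF; exact: (@continuous_along_path R d T F w cF).
have c1 i : continuous (fun r => G1 i (r, w r) * b i (r, w r)).
  by move=> r; apply: cvgM_fun; exact: ap.
have cS (f : 'I_d -> R -> R) : (forall i, continuous (f i)) -> continuous (fun r => \sum_i f i r).
  by move=> cf r; apply: cvg_sum_fin => i; exact: cf.
rewrite -!mS//; last by move=> i; exact: ap.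
have I1 : itg leb `[u, v] (fun r => G0 (r, w r)) by apply: itg_cts_itv; exact: ap.
have I2 : itg leb `[u, v] (fun r => \sum_i G2 i i (r, w r)).
  by apply: itg_cts_itv; apply: (cS (fun i r => G2 i i (r, w r))) => i; exact: ap.
have I2' := leb_itgZ R _ _ 2^-1 mI I2.
have I3 := itg_cts_itv u v (cS _ c1).
have I12 := leb_itgD R _ _ _ mI I1 I2'.
rewrite -(leb_RintegralZl R)// -(leb_RintegralD R)//.
rewrite -(leb_RintegralD R)//; apply: eq_Rintegral => r _.
rewrite /generator /G0 /G1 /G2 /= !mulrDr mulrCA !mulr_sumr; congr (_ + _); last first.
  by apply: eq_bigr => i _; ring.
Qed.

Lemma ito_path (w : Om) :
  `|phi (w u) * (g v (w v) - g u (w u)) - ito_noise w - \int[leb]_(r in `[u, v]) generator (r, w r)| <=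
  ito_error w.
Proof.
pose dx i := (w v - w u) ord0 i; pose Z i := noise b u v w ord0 i; pose D i := driftint b u v w i.
pose rem := g u (w v) - g u (w u) - \sum_i dx i * D1 i (u, w u)
    - 2^-1 * \sum_i \sum_j dx i * dx j * D2 i j (u, w u).
(* Besides the Taylor remainder [rem]: [e1] is the error of the time increment, [e2] that of
   freezing the first derivatives in front of the drift, [e3] replaces displacements by noise in the
   quadratic term, and [e4] freezes the second derivatives. *)
pose e1 := phi (w u) * (g v (w v) - g u (w v)) - \int[leb]_(r in `[u, v]) G0 (r, w r).
pose e2 i := G1 i (u, w u) * D i - \int[leb]_(r in `[u, v]) (G1 i (r, w r) * b i (r, w r)).
pose e3 := \sum_i \sum_j G2 i j (u, w u) * (dx i * dx j - Z i * Z j).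
pose e4 i := h * G2 i i (u, w u) - \int[leb]_(r in `[u, v]) G2 i i (r, w r).
have E : phi (w u) * (g v (w v) - g u (w u)) - ito_noise w - \int[leb]_(r in `[u, v]) generator (r, w r) =
    e1 + phi (w u) * rem + \sum_i e2 i + 2^-1 * e3 + 2^-1 * \sum_i e4 i.
  rewrite genE /ito_noise /e1 /rem.
  have -> : \sum_i e2 i = phi (w u) * (\sum_i dx i * D1 i (u, w u)) - \sum_i G1 i (u, w u) * Z i
     - \sum_i \int[leb]_(r in `[u, v]) (G1 i (r, w r) * b i (r, w r)).
    rewrite /e2 sumrB; congr (_ - _); rewrite mulr_sumr -sumrB; apply: eq_bigr => i _.
    by rewrite /dx dxE /G1 /= -/(Z i) -/(D i); ring.
  have -> : \sum_i e4 i = \sum_i \sum_j G2 i j (u, w u) * ((i == j)%:R * h) - \sum_i \int[leb]_(r in `[u, v]) G2 i i (r, w r).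
    rewrite /e4 sumrB; congr (_ - _); apply: eq_bigr => i _.
    rewrite (bigD1 i)//= eqxx mul1r big1 ?addr0; first by ring.
    by move=> j ji; rewrite eq_sym (negbTE ji) mul0r mulr0.
  have -> : e3 = phi (w u) * (\sum_i \sum_j dx i * dx j * D2 i j (u, w u)) - \sum_i \sum_j G2 i j (u, w u) * (Z i * Z j).
    rewrite /e3 mulr_sumr -sumrB; apply: eq_bigr => i _.
    rewrite mulr_sumr -sumrB; apply: eq_bigr => j _; rewrite /G2 /=; ring.
  have -> : \sum_i \sum_j G2 i j (u, w u) * (noise b u v w ord0 i * noise b u v w ord0 j - (i == j)%:R * h) =
     \sum_i \sum_j G2 i j (u, w u) * (Z i * Z j) - \sum_i \sum_j G2 i j (u, w u) * ((i == j)%:R * h).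
    rewrite -sumrB; apply: eq_bigr => i _; rewrite -sumrB; apply: eq_bigr => j _; rewrite /Z; ring.
  rewrite -/(Z _); ring.
have B1 : `|e1| <= h * (eps + K * h) * (Kphi + 1) + Kphi * K * h * jump_sq w + K * spread u v w := time_part w.
have B2 : `|phi (w u) * rem| <= Kphi * (d%:R * (8 * C * d%:R * h * energy b u v w + 4 * eps * noise_sq w + 16 * K * d%:R * noise_4 w)).
  by rewrite normrM; apply: ler_pM => //; exact: taylor_part.
have B3 : `|\sum_i e2 i| <= del * energy b u v w + d%:R * ((2^-1 * C / del) * (h * (eps + K * h) + K * spread u v w)).
  apply: (le_trans (ler_norm_sum _ _ _)).
  apply: (le_trans (ler_sum _ (fun i _ => gap_int_drift w i (MG1 i) (@cG1 i) (CG1 i)))).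
  by rewrite big_split /= -mulr_sumr sumr_const card_ord -[_ *+ d]mulr_natl.
have B4 : `|e3| <= C * (d%:R * (del * noise_sq w + (del^-1 + 1) * (d%:R * h * energy b u v w))).
  apply: (le_trans (ler_norm_sum _ _ _)).
  apply: (@le_trans _ _ (\sum_i \sum_j C * `|(Z i + D i) * (Z j + D j) - Z i * Z j|)).
    apply: ler_sum => i _; apply: (le_trans (ler_norm_sum _ _ _)); apply: ler_sum => j _.
    by rewrite /dx !dxE normrM ler_wpM2r.
  under eq_bigr do rewrite -mulr_sumr.
  rewrite -mulr_sumr ler_wpM2l//; apply: (le_trans (cross_bound Z D del0)).
  rewrite ler_wpM2l// lerD2l ler_wpM2l//; last exact: drift_sq.
  by rewrite addr_ge0// invr_ge0 ltW.
have B5 : `|\sum_i e4 i| <= d%:R * (h * (eps + K * h) + K * spread u v w).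
  apply: (le_trans (ler_norm_sum _ _ _)).
  apply: (le_trans (ler_sum _ (fun i _ => gap_int w (MG2 i i) (@cG2 i i)))).
  by rewrite sumr_const card_ord -[_ *+ d]mulr_natl.
rewrite E; apply: (@le_trans _ _ (`|e1| + `|phi (w u) * rem| + `|\sum_i e2 i| + 2^-1 * `|e3| + 2^-1 * `|\sum_i e4 i|)).
  have n2 : `|2^-1 : R| = 2^-1 by rewrite ger0_norm.
  apply: (le_trans (ler_normD _ _)); rewrite normrM n2 lerD2r.
  apply: (le_trans (ler_normD _ _)); rewrite normrM n2 lerD2r.
  apply: (le_trans (ler_normD _ _)); rewrite lerD2r; exact: ler_normD.
apply: (@le_trans _ _ ((h * (eps + K * h) * (Kphi + 1) + Kphi * K * h * jump_sq w + K * spread u v w)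
  + (Kphi * (d%:R * (8 * C * d%:R * h * energy b u v w + 4 * eps * noise_sq w + 16 * K * d%:R * noise_4 w)))
  + (del * energy b u v w + d%:R * ((2^-1 * C / del) * (h * (eps + K * h) + K * spread u v w)))
  + 2^-1 * (C * (d%:R * (del * noise_sq w + (del^-1 + 1) * (d%:R * h * energy b u v w))))
  + 2^-1 * (d%:R * (h * (eps + K * h) + K * spread u v w)))).
  by rewrite !lerD// ler_wpM2l.
rewrite le_eqVlt; apply/orP; left; apply/eqP; rewrite /ito_error; ring.
Qed.

End ito_pathwise.

Section compact_support.
Context {R : realType} {d : nat} {T : R}.
Hypothesis T0 : 0 < T.

Definition cpt (N : R) (F : R * 'rV[R]_d -> R) : Prop :=
  [/\ continuous F, forall t x, F (t, x) = F (clamp T t, x) & forall t x, N < `|x| -> F (t, x) = 0].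

Lemma cpt_bounded N F : cpt N F -> exists2 C : R, 0 <= C & forall p, `|F p| <= C.
Proof.
move=> [cF cl F0]; have [C C0 HC] := bounded_on_box T N cF.
exists C => // -[t x]; have [xN|xN] := leP `|x| N; last by rewrite F0// normr0.
by rewrite cl; apply: HC => //; apply: clamp_itv; exact: ltW.
Qed.

Lemma cpt_modulus N F (eps : R) : cpt N F -> 0 < eps -> exists2 K : R, 0 <= K & @modulus R d T eps K F.
Proof.
move=> [cF cl F0] e0.
have [K K0 HK] := quadratic_modulus (ltW T0) cF (fun t x _ => F0 t x) e0.
exists K => // t x s y tT sT; apply: (le_trans (HK t x s y tT sT)).
by rewrite lerD2l ler_wpM2l// lerD2l norm_sqs.
Qed.

Lemma cptM N (phi : 'rV[R]_d -> R) F : continuous phi -> cpt N F -> cpt N (fun p => phi p.2 * F p).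
Proof.
move=> cphi [cF cl F0]; split=> [p|t x|t x xN].
- have c2 : {for p, continuous (fun p : R * 'rV[R]_d => phi p.2)}.
    exact: (continuous_snd cphi).
  exact: (continuousM c2 (@cF p)).
- by rewrite /= cl.
- by rewrite F0// mulr0.
Qed.

Lemma cpt_clamped N f : continuous_tx `[0, T] f ->
  (forall t x, 0 <= t <= T -> N < `|x| -> f t x = 0) -> cpt N (clamped T f).
Proof.
move=> cf f0; split=> [|t x|t x xN].
- by apply: clamped_continuous => //; exact: ltW.
- by rewrite /clamped /= (clamp_id (clamp_itv t (ltW T0))).
- by rewrite /clamped /= f0// clamp_itv// ltW.
Qed.

(** Monotonicity in the constant lets the sum of the individual constants serve the whole finite
    family. *)
Lemma family_bound (I : finType) (Q : I -> R -> Prop) :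
  (forall i, exists2 K : R, 0 <= K & Q i K) -> (forall i K K', K <= K' -> Q i K -> Q i K') ->
  exists2 K : R, 0 <= K & forall i, Q i K.
Proof.
move=> H mono; have /choice[k Hk] : forall i, exists K : R, 0 <= K /\ Q i K.
  by move=> i; have [K K0 QK] := H i; exists K.
exists (\sum_i k i); first by apply: sumr_ge0 => i _; have [] := Hk i.
move=> i; apply: (mono i (k i)); last by have [] := Hk i.
by rewrite (bigD1 i)//= lerDl; apply: sumr_ge0 => j _; have [] := Hk j.
Qed.

Lemma modulus_mono eps K K' F : K <= K' -> @modulus R d T eps K F -> @modulus R d T eps K' F.
Proof.
move=> KK M t x s y tT sT; apply: (le_trans (M t x s y tT sT)); rewrite lerD2l ler_wpM2r//.
by rewrite addr_ge0// sqs_ge0.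
Qed.

End compact_support.

Section local_ito.
Context {R : realType} {d : nat} {T : R} (P : probability (path_space R d T) R).
Local Notation Om := (path_space R d T).
Local Notation leb := (@lebesgue_measure R).
Variable b : 'I_d -> R * 'rV[R]_d -> R.
Hypotheses (T0 : 0 < T) (cb : forall i, continuous (b i)).
Hypothesis indep : independent_noise P b.
Hypothesis Hb : finite_energy P b.

Variables (g : R -> 'rV[R]_d -> R) (phi : 'rV[R]_d -> R) (N : R).
Hypotheses (gC : C12 `[0, T] g) (gN : forall t x, 0 <= t <= T -> N < `|x| -> g t x = 0).
Hypotheses (cphi : continuous phi) (bphi : exists K, forall x, `|phi x| <= K).

Let D0 := clamped T (dt `[0, T] g).
Let D1 i := clamped T (fun t => partial i (g t)).
Let D2 i j := clamped T (fun t => partial j (partial i (g t))).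

Definition ito_generator : R * 'rV[R]_d -> R := generator b phi D0 D1 D2.

Let cptD0 : cpt (T := T) N D0.
Proof.
have [Hd [_ cd] _ _] := gC; apply: cpt_clamped => // t x tT xN.
apply: dt_unique; first exact: limit_time_cc.
apply/time_quotP => e e0; exists 1 => // s Is _ _.
by rewrite /time_quot !gN// ?subr0 ?mulr0 ?subrr ?normr0 ?ltW//; move: Is; rewrite /= in_itv.
Qed.

Let cptD1 i : cpt (T := T) N (D1 i).
Proof.
have [Hd _ c1 _] := gC; apply: cpt_clamped => // t x tT xN.
by apply: (@partial_eq0 R d (g t) N) => // y; exact: gN.
Qed.

Let cptD2 i j : cpt (T := T) N (D2 i j).
Proof.
have [Hd _ _ c2] := gC; apply: cpt_clamped => // t x tT xN.
apply: (@partial_eq0 R d (partial i (g t)) N) => // y yN.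
by apply: (@partial_eq0 R d (g t) N) => // z; exact: gN.
Qed.

Let cptg : cpt (T := T) N (clamped T g).
Proof. by have [_ [cg _] _ _] := gC; apply: cpt_clamped. Qed.

Let g_pC2 t : 0 <= t <= T -> pC2 (g t). Proof. exact: C12_pC2 gC. Qed.

Let g_t (u v : R) x : 0 <= u -> u <= v -> v <= T ->
  exists2 c : R, u <= c <= v & g v x - g u x = D0 (c, x) * (v - u).
Proof.
move=> u0 uv vT; have [c cuv E] := C12_mvt x gC u0 uv vT; exists c => //.
by rewrite /D0 /clamped /= clamp_id//; case/andP: cuv => uc cv; rewrite (le_trans u0 uc) (le_trans cv vT).
Qed.

Lemma cpt_generator : cpt (T := T) N (fun p => phi p.2 * (D0 p + 2^-1 * (\sum_i D2 i i p)))
  /\ forall i, cpt (T := T) N (fun p => phi p.2 * D1 i p).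
Proof.
split; last by move=> i; exact: cptM.
apply: (@cptM R d T N phi (fun p => D0 p + 2^-1 * (\sum_i D2 i i p)) cphi); split=> [p|t x|t x xN].
- have [c0 _ _] := cptD0; apply: cvgD_fun; first exact: c0.
  apply: cvgM_fun; first exact: cst_continuous.
  by apply: cvg_sum_fin => i; have [c _ _] := cptD2 i i; exact: c.
- have cl i : D2 i i (t, x) = D2 i i (clamp T t, x) by have [_ H _] := cptD2 i i; exact: H.
  have [_ H _] := cptD0.
  exact: (f_equal2 (fun a s => a + 2^-1 * s) (H t x) (eq_bigr _ (fun i _ => cl i))).
- have [_ _ ->//] := cptD0; rewrite big1 ?mulr0 ?addr0// => i _; by have [_ _ ->] := cptD2 i i.
Qed.

Lemma generatorE p : ito_generator p = phi p.2 * (D0 p + 2^-1 * (\sum_i D2 i i p)) +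
  \sum_i b i p * (phi p.2 * D1 i p).
Proof.
rewrite /ito_generator /generator mulrDr; congr (_ + _); rewrite mulr_sumr.
by apply: eq_bigr => i _; rewrite mulrCA.
Qed.

Lemma continuous_generator : continuous ito_generator.
Proof.
have -> : ito_generator = fun p => phi p.2 * (D0 p + 2^-1 * (\sum_i D2 i i p)) +
  \sum_i b i p * (phi p.2 * D1 i p) by apply/funext => p; exact: generatorE.
have [[c0 _ _] c1] := cpt_generator; move=> p.
apply: cvgD_fun; first exact: c0.
apply: cvg_sum_fin => i; have [ci _ _] := c1 i.
exact: (continuousM (@cb i p) (ci p)).
Qed.

Lemma generator_supp t x : N < `|x| -> ito_generator (t, x) = 0.
Proof.
move=> xN; rewrite generatorE; have [[_ _ ->//] c1] := cpt_generator.
by rewrite big1 ?addr0// => i _; have [_ _ ->//] := c1 i; rewrite mulr0.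
Qed.

Lemma generator_bounded : exists2 C : R, 0 <= C & forall t x, 0 <= t <= T -> `|ito_generator (t, x)| <= C.
Proof.
have [C C0 HC] := bounded_on_box T N continuous_generator.
exists C => // t x tT; have [xN|xN] := leP `|x| N; last by rewrite generator_supp// normr0.
exact: HC.
Qed.

Let mgen : measurable_fun setT (fun p : R * Om => ito_generator (p.1, p.2 p.1)).
Proof. by apply: measurable_along_path; exact: continuous_generator. Qed.

Lemma generator_fubini (u v : R) : 0 <= u -> u <= v -> v <= T ->
  [/\ itg leb `[u, v] (fun r => \int[P]_w ito_generator (r, w r)),
      itg P setT (fun w : Om => \int[leb]_(r in `[u, v]) ito_generator (r, w r)) &
      \int[leb]_(r in `[u, v]) \int[P]_w ito_generator (r, w r) =
      \int[P]_w \int[leb]_(r in `[u, v]) ito_generator (r, w r)].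
Proof.
move=> u0 uv vT; have [C C0 HC] := generator_bounded.
apply: (fubini_path mgen).
have mn : measurable_fun setT (fun p : R * Om => `|ito_generator (p.1, p.2 p.1)|) by exact: measurableT_comp.
have mt r : measurable_fun setT (fun w : Om => `|ito_generator (r, w r)|).
  exact: (measurableT_comp mn (@pair1_measurable _ _ _ _ r)).
pose f (p : R * Om) : R := Num.min `|ito_generator (p.1, p.2 p.1)| C.
have mf : measurable_fun setT f by apply: measurable_minr.
have f0 p : 0 <= f p by rewrite le_min C0 normr_ge0.
have If r : u <= r <= v -> itg P setT (fun w => f (r, w)) /\ \int[P]_w f (r, w) <= C.
  move=> _; have I1 : itg P setT (fun w => f (r, w)).
    apply: (itg_le measurableT _ (itg_cst P C)).
      exact: (measurableT_comp mf (@pair1_measurable _ _ _ _ r)).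
    by move=> w _; rewrite ger0_norm ?f0// /f ge_min lexx orbT.
  split => //; rewrite -[leRHS](Rint_cst_prob P); apply: le_Rintegral => //.
    exact: itg_cst.
  by move=> w _; rewrite /f ge_min lexx orbT.
have [I1 _] := tonelli_path_bound uv mf f0 If.
have Iw w : itg leb `[u, v] (fun r => f (r, w)).
  have mfw : measurable_fun `[u, v]%classic (fun r => f (r, w)).
    by apply: measurable_funTS; exact: (measurableT_comp mf (@pair2_measurable _ _ _ _ w)).
  by apply: (itg_bd_itv mfw (C := C)) => r _; rewrite ger0_norm ?f0// /f ge_min lexx orbT.
have F := tonelli_path_fin mf f0 Iw I1.
apply: le_lt_trans F; rewrite le_eqVlt; apply/orP; left; apply/eqP.
apply: eq_integral => r /set_mem /=; rewrite in_itv/= => /andP[ur rv].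
apply: eq_integral => w _; congr EFin; rewrite /f /=; apply/esym/min_idPl.
by apply: HC; rewrite (le_trans u0 ur) (le_trans rv vT).
Qed.

Let c1 := 2 * (1 + energyT P b).

Let e0T : 0 <= energyT P b.
Proof. by apply: Rintegral_ge0 => w _; exact: energy_ge0. Qed.

Let c10 : 0 <= c1. Proof. by rewrite mulr_ge0// addr_ge0. Qed.

Let disp (u v : R) : 0 <= u -> u <= v -> v <= T ->
  itg P setT (fun w : Om => sqs ((w v - w u) ord0)) /\
  \int[P]_w sqs ((w v - w u) ord0) <= c1 * d%:R * (v - u).
Proof.
move=> u0 uv vT; have H i := displacement_sq cb indep Hb i u0 uv vT.
have E (w : Om) : sqs ((w v - w u) ord0) = \sum_i (w v ord0 i - w u ord0 i) ^+ 2.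
  by apply: eq_bigr => i _; rewrite !mxE.
have I i : itg P setT (fun w : Om => (w v ord0 i - w u ord0 i) ^+ 2) by have [] := H i.
have -> : (fun w : Om => sqs ((w v - w u) ord0)) = fun w => \sum_i (w v ord0 i - w u ord0 i) ^+ 2.
  by apply/funext => w; exact: E.
split; first exact: itg_sum.
rewrite Rint_sum//; apply: (@le_trans _ _ (\sum_(i < d) c1 * (v - u))).
  by apply: ler_sum => i _; have [] := H i.
by rewrite sumr_const card_ord -[_ *+ d]mulr_natl mulrA [d%:R * _]mulrC.
Qed.

Section expectation.
Variables (u v : R).
Hypotheses (u0 : 0 <= u) (uv : u < v) (vT : v <= T).
Local Notation h := (v - u).
Let h0 : 0 < h. Proof. by rewrite subr_gt0. Qed.
Let uT : 0 <= u <= T. Proof. by rewrite u0 (le_trans (ltW uv)). Qed.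

Let Espread : itg P setT (spread (T := T) (d := d) u v) /\
  \int[P]_w spread u v w <= c1 * d%:R * h * h.
Proof.
apply: (tonelli_path_bound (ltW uv) (f := fun p : R * Om => sqs ((p.2 p.1 - p.2 u) ord0))).
- apply: measurable_sum => i; apply: (measurableT_comp (exprn_measurable 2)).
  have -> : (fun x : R * Om => (x.2 x.1 - x.2 u) ord0 i) = fun x => x.2 x.1 ord0 i - x.2 u ord0 i by apply/funext => x; rewrite !mxE.
  apply: measurable_funB.
    by have := @measurable_along_path R d T (fun p => p.2 ord0 i); apply => p;
      exact: continuous_snd_coord.
  exact: (measurableT_comp (@measurable_pathX R d T i u) measurable_snd).
- by move=> p; exact: sqs_ge0.
- move=> r /andP[ur rv]; have [I1 I2] := disp u0 ur (le_trans rv vT); split => //.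
  apply: (le_trans I2); apply: ler_wpM2l; [exact: mulr_ge0|exact: (lerB rv (lexx u))].
Qed.

Let Enoise_sq : itg P setT (noise_sq b u v) /\ \int[P]_w noise_sq b u v w = d%:R * h.
Proof.
have I i : itg P setT (fun w : Om => noise b u v w ord0 i ^+ 2) by exact: (itg_noise cb indep u0 uv vT).
split; first exact: itg_sum.
rewrite Rint_sum//; under eq_bigr do rewrite (noise_var cb indep u0 uv vT).
by rewrite sumr_const card_ord -[_ *+ d]mulr_natl.
Qed.

Let Enoise_4 : itg P setT (noise_4 b u v) /\ \int[P]_w noise_4 b u v w <= 3 * d%:R * h ^+ 2.
Proof.
have I i : itg P setT (fun w : Om => noise b u v w ord0 i ^+ 4) by exact: (itg_noise cb indep u0 uv vT).
split; first exact: itg_sum.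
rewrite Rint_sum//; apply: (@le_trans _ _ (\sum_(i < d) 3 * h ^+ 2)).
  by apply: ler_sum => i _; exact: (noise_fourth cb indep u0 uv vT).
by rewrite sumr_const card_ord -[_ *+ d]mulr_natl mulrA [d%:R * _]mulrC.
Qed.

Let bounded_slice N' (F : R * 'rV[R]_d -> R) : cpt (T := T) N' F ->
  measurable_fun setT (fun x => F (u, x)) /\ exists K, forall x, `|F (u, x)| <= K.
Proof.
move=> cF; have [C C0 HC] := cpt_bounded T0 cF; split; last by exists C.
apply: continuous_measurable_rV => x; case: cF => c _ _.
apply/cts_rVP => e e0; have /cts_txP /(_ e e0)[del del0 H] := c (u, x).
by exists del => // y yx; apply: H => //=; rewrite subrr normr0.
Qed.

Let Eito_noise : itg P setT (ito_noise b u v phi D1 D2) /\ \int[P]_w ito_noise b u v phi D1 D2 w = 0.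
Proof.
have B1 i := bounded_slice (cptM cphi (cptD1 i)).
have B2 i j := bounded_slice (cptM cphi (cptD2 i j)).
have In i : itg P setT (fun w : Om => noise b u v w ord0 i) by exact: (@itg_noise _ _ _ P b cb indep u v u0 uv vT 1 i isT).
have I1 i : itg P setT (fun w : Om => phi (w u) * D1 i (u, w u) * noise b u v w ord0 i).
  have [m [K HK]] := B1 i.
  apply: (@itg_bdM _ _ _ _ _ _ _ K) => //; first exact: (measurable_at u m).
  by move=> w _; exact: HK.
have I2a i j : itg P setT (fun w : Om => phi (w u) * D2 i j (u, w u)).
  have [m [K HK]] := B2 i j.
  apply: (itg_le measurableT (measurable_at u m) (itg_cst P K)).
  by move=> w _; exact: HK.
have I2b i j : itg P setT (fun w : Om => phi (w u) * D2 i j (u, w u) * (noise b u v w ord0 i * noise b u v w ord0 j)).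
  have [m [K HK]] := B2 i j.
  apply: (@itg_bdM _ _ _ _ _ _ _ K) => //; first exact: (measurable_at u m).
    exact: (itg_noise2 cb indep u0 uv vT).
  by move=> w _; exact: HK.
have I2 i j : itg P setT (fun w : Om => phi (w u) * D2 i j (u, w u) * (noise b u v w ord0 i * noise b u v w ord0 j - (i == j)%:R * h)).
  apply: (itg_eq measurableT (itgB measurableT (I2b i j) (itgZ ((i == j)%:R * h) measurableT (I2a i j)))) => w _.
  by rewrite [RHS]mulrBr; congr (_ - _); exact: mulrC.
have J1 : itg P setT (fun w : Om => \sum_i phi (w u) * D1 i (u, w u) * noise b u v w ord0 i) by exact: itg_sum.
have J2i i : itg P setT (fun w : Om => \sum_j phi (w u) * D2 i j (u, w u) * (noise b u v w ord0 i * noise b u v w ord0 j - (i == j)%:R * h)).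
  by apply: itg_sum => //; exact: I2.
have J2 : itg P setT (fun w : Om => \sum_i \sum_j phi (w u) * D2 i j (u, w u) * (noise b u v w ord0 i * noise b u v w ord0 j - (i == j)%:R * h)).
  exact: itg_sum.
have J2' := itgZ 2^-1 measurableT J2.
split; first exact: itgD.
rewrite /ito_noise RintegralD// RintegralZl// Rint_sum// Rint_sum//.
rewrite big1 ?add0r; last first.
  by move=> i _; have [m K] := B1 i; exact: (noise_mean cb indep u0 uv vT i m K).
rewrite big1 ?mulr0// => i _; rewrite Rint_sum; [|by []|exact: I2].
rewrite big1// => j _; have [m K] := B2 i j.
have -> : \int[P]_w (phi (w u) * D2 i j (u, w u) * (noise b u v w ord0 i * noise b u v w ord0 j - (i == j)%:R * h)) =
    \int[P]_w (phi (w u) * D2 i j (u, w u) * (noise b u v w ord0 i * noise b u v w ord0 j)) -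
    \int[P]_w ((i == j)%:R * h * (phi (w u) * D2 i j (u, w u))).
  rewrite RintB//; last by exact: itgZ.
  by apply: eq_Rintegral => w _; rewrite [LHS]mulrBr; congr (_ - _); exact: mulrC.
rewrite RintegralZl//.
by have /= -> := noise_cov cb indep u0 uv vT i j m K; rewrite mulrA subrr.
Qed.

Let Iincr : itg P setT (fun w : Om => phi (w u) * (g v (w v) - g u (w u))).
Proof.
have [K HK] := bphi; have [C C0 HC] := cpt_bounded T0 cptg.
have vT' : 0 <= v <= T by rewrite (le_trans u0 (ltW uv)).
have [cg _ _] := cptg.
have mg t : 0 <= t <= T -> measurable_fun setT (fun w : Om => g t (w t)).
  by move=> tT; apply: (measurable_at t); apply: continuous_measurable_rV; exact: (clamped_slice tT cg).
have gC' t x : 0 <= t <= T -> `|g t x| <= C.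
  by move=> tT; have := HC (t, x); rewrite /clamped /= clamp_id.
apply: (@itg_bdM _ _ _ _ _ _ _ K) => //.
- by apply: (measurable_at u); exact: continuous_measurable_rV.
- apply: (itg_le measurableT _ (itg_cst P (C + C))).
    by apply: measurable_funB; exact: mg.
  by move=> w _; rewrite (le_trans (ler_normB _ _))// lerD// gC'.
Qed.

(** Taking expectations in [ito_path] removes the noise. Displacements contribute through
    [displacement_sq] with constant [c1], the noise through its second and fourth moments, and the
    energy becomes the time integral of [power]. *)
Lemma ito_expectation (eps K C del Kphi : R) : 0 <= eps -> 0 <= K -> 0 <= C -> 0 < del ->
  (forall x, `|phi x| <= Kphi) ->
  @modulus R d T eps K D0 -> (forall i j, @modulus R d T eps K (D2 i j)) ->
  @modulus R d T eps K (fun p => phi p.2 * D0 p) ->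
  (forall i, @modulus R d T eps K (fun p => phi p.2 * D1 i p)) ->
  (forall i j, @modulus R d T eps K (fun p => phi p.2 * D2 i j p)) ->
  (forall i p, `|phi p.2 * D1 i p| <= C) -> (forall i j p, `|D2 i j p| <= C) ->
  (forall i j p, `|phi p.2 * D2 i j p| <= C) ->
  `|\int[P]_w (phi (w u) * (g v (w v) - g u (w u))) - \int[leb]_(r in `[u, v]) \int[P]_w ito_generator (r, w r)| <=
  h * (eps * (Kphi + 1 + d%:R * (2^-1 * C / del) + d%:R * 2^-1 + 4 * Kphi * d%:R ^+ 2)
       + 2^-1 * C * d%:R ^+ 2 * del
       + h * (K * ((Kphi + 1 + d%:R * (2^-1 * C / del) + d%:R * 2^-1) +
            (1 + d%:R * (2^-1 * C / del) + d%:R * 2^-1 + Kphi) * (c1 * d%:R) + 48 * Kphi * d%:R ^+ 3)))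
  + (del + (2^-1 * C * d%:R ^+ 2 * (del^-1 + 1) + Kphi * 8 * C * d%:R ^+ 2) * h) * \int[leb]_(r in `[u, v]) power P b r.
Proof.
move=> eps0 K0 C0 del0 phiK MD0 MD2 MG0 MG1 MG2 CG1 CD2 CG2.
have c0 : continuous D0 by have [] := cptD0.
have c1' i : continuous (D1 i) by have [] := cptD1 i.
have c2' i j : continuous (D2 i j) by have [] := cptD2 i j.
have g1 t i x : 0 <= t <= T -> partial i (g t) x = D1 i (t, x) by move=> tT; rewrite /D1 /clamped /= clamp_id.
have g2 t i j x : 0 <= t <= T -> partial j (partial i (g t)) x = D2 i j (t, x).
  by move=> tT; rewrite /D2 /clamped /= clamp_id.
have PB := @ito_path R d T b cb eps K C del u v eps0 K0 C0 del0 u0 uv vT g phi D0 D1 D2 Kphi cphi phiK g_t g_pC2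
  g1 g2 c0 c1' c2' MD0 MD2 MG0 MG1 MG2 CG1 CD2 CG2.
have [I1 E1] := Espread; have [I2 E2] := disp u0 (ltW uv) vT; have [I3 E3] := Enoise_sq; have [I4 E4] := Enoise_4.
have [_ I5 E5] := energy_fubini cb Hb u0 vT.
have [I6 E6] := Eito_noise; have [_ I7 ->] := generator_fubini u0 (ltW uv) vT.
have Kphi0 : 0 <= Kphi by exact: le_trans (phiK 0).
set k0 := h * (eps + K * h) * (Kphi + 1 + d%:R * (2^-1 * C / del) + d%:R * 2^-1).
set k1 := K * (1 + d%:R * (2^-1 * C / del) + d%:R * 2^-1).
set k2 := Kphi * K * h.
set k3 := del + 2^-1 * C * d%:R * (del^-1 + 1) * d%:R * h + Kphi * d%:R * (8 * C * d%:R * h).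
set k4 := 2^-1 * C * d%:R * del + Kphi * d%:R * (4 * eps).
set k5 := Kphi * d%:R * (16 * K * d%:R).
have J0 : itg P setT (fun _ : Om => k0) by exact: itg_cst.
have J1 := itgZ k1 measurableT I1; have J2 := itgZ k2 measurableT I2; have J3 := itgZ k3 measurableT I5.
have J4 := itgZ k4 measurableT I3; have J5 := itgZ k5 measurableT I4.
have J01 := itgD measurableT J0 J1; have J02 := itgD measurableT J01 J2; have J03 := itgD measurableT J02 J3.
have J04 := itgD measurableT J03 J4; have J05 := itgD measurableT J04 J5.
have Ia := itgB measurableT Iincr I6; have Ib := itgB measurableT Ia I7.
have -> : \int[P]_w (phi (w u) * (g v (w v) - g u (w u))) - \int[P]_w \int[leb]_(r in `[u, v]) ito_generator (r, w r) =
  \int[P]_w (phi (w u) * (g v (w v) - g u (w u)) - ito_noise b u v phi D1 D2 w - \int[leb]_(r in `[u, v]) ito_generator (r, w r)).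
  by rewrite -RintB// -RintB// E6 subr0.
apply: (le_trans (le_Rint_bound measurableT Ib J05 (fun w _ => PB w))).
rewrite !RintegralD// Rint_cst_prob !RintegralZl// E3 E5.
have k10 : 0 <= k1 by rewrite mulr_ge0// !addr_ge0// mulr_ge0// divr_ge0 ?mulr_ge0// ltW.
have k20 : 0 <= k2 by rewrite !mulr_ge0// ltW.
have k50 : 0 <= k5 by rewrite !mulr_ge0.
have F1 := ler_wpM2l k10 E1; have F2 := ler_wpM2l k20 E2; have F5 := ler_wpM2l k50 E4.
set pw := \int[leb]_(r in _) _.
apply: (@le_trans _ _ (k0 + k1 * (c1 * d%:R * h * h) + k2 * (c1 * d%:R * h) + k3 * pw + k4 * (d%:R * h) + k5 * (3 * d%:R * h ^+ 2))).
  by rewrite !lerD.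
by rewrite le_eqVlt; apply/orP; left; apply/eqP; rewrite /k0 /k1 /k2 /k3 /k4 /k5; ring.
Qed.

End expectation.

(** The constants are chosen in this order: [C] bounds the derivatives, [del] depends on [C], [eps]
    on [del], the modulus constant [K] on [eps], and the mesh [h0] on all of them. Each kind of
    error receives [e / 4]. *)
Lemma local_ito (e : R) : 0 < e -> exists2 del : R, 0 < del &
  forall u v, 0 <= u -> u < v -> v <= T -> v - u < del ->
  `|\int[P]_w (phi (w u) * (g v (w v) - g u (w u))) - \int[leb]_(r in `[u, v]) \int[P]_w ito_generator (r, w r)| <=
  e * ((v - u) + \int[leb]_(r in `[u, v]) power P b r).
Proof.
move=> e0; have [Kphi phiK] := bphi.
have aux (q : R) : 0 < q -> q * (e / (4 * q)) = e / 4 by move=> q0; field; rewrite gt_eqF.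
have Kphi0 : 0 <= Kphi by exact: le_trans (phiK 0).
have bd1 i := cpt_bounded T0 (cptM cphi (cptD1 i)).
have bd2 i j := cpt_bounded T0 (cptD2 i j).
have bd3 i j := cpt_bounded T0 (cptM cphi (cptD2 i j)).
have mono (F : R * 'rV[R]_d -> R) (K K' : R) : K <= K' -> (forall p, `|F p| <= K) -> (forall p, `|F p| <= K').
  by move=> KK H p; exact: le_trans (H p) KK.
have [Ca Ca0 HCa] := family_bound bd1 (fun i => @mono _).
have [Cb Cb0 HCb] := @family_bound R ('I_d * 'I_d)%type (fun ij K => forall p, `|D2 ij.1 ij.2 p| <= K)
  (fun ij => bd2 ij.1 ij.2) (fun ij => @mono _).
have [Cc Cc0 HCc] := @family_bound R ('I_d * 'I_d)%type (fun ij K => forall p, `|phi p.2 * D2 ij.1 ij.2 p| <= K)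
  (fun ij => bd3 ij.1 ij.2) (fun ij => @mono _).
pose C := Ca + Cb + Cc; have C0 : 0 <= C by rewrite !addr_ge0.
pose del := e / (4 * (1 + 2^-1 * C * d%:R ^+ 2)).
have q0 : 0 < 1 + 2^-1 * C * d%:R ^+ 2 by rewrite ltr_wpDr// !mulr_ge0// exprn_ge0.
have del0 : 0 < del by rewrite divr_gt0// mulr_gt0.
have delE : (1 + 2^-1 * C * d%:R ^+ 2) * del = e / 4 by exact: aux.
pose A := Kphi + 1 + d%:R * (2^-1 * C / del) + d%:R * 2^-1.
clearbody del; have Cd0 : 0 <= 2^-1 * C / del by apply: divr_ge0; [exact: mulr_ge0|exact: ltW].
have A0 : 0 <= A by rewrite !addr_ge0// mulr_ge0.
pose A' := A + 4 * Kphi * d%:R ^+ 2 + 1.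
have d20 : 0 <= (d%:R : R) ^+ 2 by rewrite exprn_ge0.
have A'0 : 0 < A' by rewrite ltr_wpDl// addr_ge0// !mulr_ge0.
pose eps := e / (4 * A'); have eps0 : 0 < eps by rewrite divr_gt0// mulr_gt0.
have epsE : eps * A' = e / 4 by rewrite mulrC; exact: aux.
clearbody eps; have md0 := cpt_modulus T0 cptD0 eps0.
have md2 i j := cpt_modulus T0 (cptD2 i j) eps0.
have mg0 := cpt_modulus T0 (cptM cphi cptD0) eps0.
have mg1 i := cpt_modulus T0 (cptM cphi (cptD1 i)) eps0.
have mg2 i j := cpt_modulus T0 (cptM cphi (cptD2 i j)) eps0.
have mm F K K' : K <= K' -> @modulus R d T eps K F -> @modulus R d T eps K' F by exact: modulus_mono.
have [Ka Ka0 HKa] := md0; have [Kb Kb0 HKb] := mg0.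
have [Kc Kc0 HKc] := family_bound mg1 (fun i => @mm _).
have [Kd Kd0 HKd] := @family_bound R ('I_d * 'I_d)%type (fun ij K => @modulus R d T eps K (D2 ij.1 ij.2))
  (fun ij => md2 ij.1 ij.2) (fun ij => @mm _).
have [Ke Ke0 HKe] := @family_bound R ('I_d * 'I_d)%type (fun ij K => @modulus R d T eps K (fun p => phi p.2 * D2 ij.1 ij.2 p))
  (fun ij => mg2 ij.1 ij.2) (fun ij => @mm _).
pose K := Ka + Kb + Kc + Kd + Ke; have K0 : 0 <= K by rewrite !addr_ge0.
pose B := K * (A + (1 + d%:R * (2^-1 * C / del) + d%:R * 2^-1 + Kphi) * (c1 * d%:R) + 48 * Kphi * d%:R ^+ 3).
have B0 : 0 <= B.
  rewrite mulr_ge0// addr_ge0//; last by rewrite !mulr_ge0// exprn_ge0.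
  by rewrite addr_ge0// mulr_ge0// ?mulr_ge0// !addr_ge0// mulr_ge0.
pose q := 2^-1 * C * d%:R ^+ 2 * (del^-1 + 1) + Kphi * 8 * C * d%:R ^+ 2.
have q'0 : 0 <= q by rewrite addr_ge0// !mulr_ge0// addr_ge0// invr_ge0 ltW.
pose h0 := e / (4 * (B + q + 1)).
have Bq : 0 < B + q + 1 by rewrite ltr_wpDl// addr_ge0.
exists h0; first by rewrite divr_gt0// mulr_gt0.
move=> u v u0 uv vT; set h := v - u => hh.
have h0' : 0 < h by rewrite subr_gt0.
have hE : h * (B + q + 1) <= e / 4.
  have -> : e / 4 = h0 * (B + q + 1) by rewrite [RHS]mulrC; apply/esym; exact: aux.
  by rewrite ler_wpM2r// ltW.
have hB : h * B <= e / 4 by apply: le_trans hE; rewrite ler_wpM2l ?(ltW h0')//; lra.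
have hq : q * h <= e / 4 by rewrite mulrC; apply: le_trans hE; rewrite ler_wpM2l ?(ltW h0')//; lra.
have [KaK KbK KcK KdK KeK] : [/\ Ka <= K, Kb <= K, Kc <= K, Kd <= K & Ke <= K] by rewrite /K; split; lra.
have [CaC CbC CcC] : [/\ Ca <= C, Cb <= C & Cc <= C] by rewrite /C; split; lra.
apply: le_trans (@ito_expectation u v u0 uv vT eps K C del Kphi (ltW eps0) K0 C0 del0 phiK
  (mm _ _ _ KaK HKa) (fun i j => mm _ _ _ KdK (HKd (i, j))) (mm _ _ _ KbK HKb) (fun i => mm _ _ _ KcK (HKc i))
  (fun i j => mm _ _ _ KeK (HKe (i, j))) (fun i => mono _ _ _ CaC (HCa i)) (fun i j => mono _ _ _ CbC (HCb (i, j)))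
  (fun i j => mono _ _ _ CcC (HCc (i, j)))) _.
rewrite -/h -/A -/B -/q.
set pw := \int[leb]_(r in _) _.
have pw0 : 0 <= pw by apply: Rintegral_ge0 => r _; apply: sumr_ge0 => i _; apply: Rintegral_ge0 => w _; exact: sqr_ge0.
rewrite [e * _]mulrDr; apply: lerD.
  rewrite [leRHS]mulrC ler_wpM2l ?(ltW h0')//.
  have : eps * (A + 4 * Kphi * d%:R ^+ 2) <= e / 4 by rewrite -epsE ler_wpM2l ?(ltW eps0)// /A'; lra.
  have : 2^-1 * C * d%:R ^+ 2 * del <= e / 4 by rewrite -delE mulrDl mul1r lerDr ltW.
  lra.
apply: ler_wpM2r => //.
have : del <= e / 4 by rewrite -delE mulrDl mul1r lerDl !mulr_ge0// ltW.
lra.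
Qed.

End local_ito.

(** * Chaining of local estimates *)

Section chaining.
Context {R : realType}.
Local Notation leb := (@lebesgue_measure R).

Lemma Rint_split (f : R -> R) (u m v : R) : u <= m -> m <= v -> itg leb `[u, v] f ->
  \int[leb]_(r in `[u, v]) f r = \int[leb]_(r in `[u, m]) f r + \int[leb]_(r in `[m, v]) f r.
Proof.
move=> um mv If; apply/eqP; rewrite addrC -subr_eq; apply/eqP.
have := @Rintegral_itvB R f (BLeft u) (BRight v) m If; rewrite !bnd_simp => -> //.
apply: Rintegral_itv_obnd_cbnd.
apply: (leb_integrableS R `[u, v]%classic) => //; try exact: measurable_itv.
by move=> r /=; rewrite !in_itv/= => /andP[mr ->]; rewrite andbT (le_trans um)// ltW.
Qed.

(** Cut [[u, v]] into pieces shorter than [del]. By additivity of [L] and [Q] the local bounds add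
    up to [e' * Q u v], where [e'] is arbitrary and [Q u v] does not depend on the subdivision. *)
Lemma chaining (T : R) (L Q : R -> R -> R) :
  (forall u m v, 0 <= u -> u <= m -> m <= v -> v <= T -> L u v = L u m + L m v) ->
  (forall u m v, 0 <= u -> u <= m -> m <= v -> v <= T -> Q u v = Q u m + Q m v) ->
  (forall e, 0 < e -> exists2 del : R, 0 < del & forall u v, 0 <= u -> u < v -> v <= T -> v - u < del ->
     `|L u v| <= e * Q u v) ->
  forall u v, 0 <= u -> u <= v -> v <= T -> L u v = 0.
Proof.
move=> addL addQ small u v u0; rewrite le_eqVlt => /predU1P[<- uT|uv vT].
  have := addL u u u u0 (lexx _) (lexx _) uT => /eqP; rewrite -subr_eq0 opprD addrA subrr sub0r oppr_eq0.
  by move=> /eqP.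
apply/eqP; rewrite -normr_le0; apply/ler_addgt0Pl => e e0; rewrite addr0.
have Quu t : 0 <= t -> t <= T -> Q t t = 0.
  move=> t0 tT; have := addQ t t t t0 (lexx _) (lexx _) tT => /eqP.
  by rewrite -subr_eq0 opprD addrA subrr sub0r oppr_eq0 => /eqP.
have Luu t : 0 <= t -> t <= T -> L t t = 0.
  move=> t0 tT; have := addL t t t t0 (lexx _) (lexx _) tT => /eqP.
  by rewrite -subr_eq0 opprD addrA subrr sub0r oppr_eq0 => /eqP.
pose e' := e / (`|Q u v| + 1).
have q1 : 0 < `|Q u v| + 1 by rewrite ltr_wpDl.
have e'0 : 0 < e' by rewrite divr_gt0.
have [del del0 H] := small e' e'0.
have vu : 0 < v - u by rewrite subr_gt0.
pose n := Num.truncn ((v - u) / del).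
pose h := (v - u) / n.+1%:R.
have n0 : 0 < n.+1%:R :> R by [].
have h0 : 0 < h by rewrite divr_gt0.
have hd : h < del.
  by rewrite /h ltr_pdivrMr// mulrC -ltr_pdivrMr// truncnS_gt.
have step k : (k <= n.+1)%N -> u + k%:R * h <= v.
  move=> kn; rewrite -lerBrDl (_ : v - u = n.+1%:R * h); last by rewrite /h mulrC divfK// gt_eqF.
  by rewrite ler_wpM2r ?(ltW h0)// ler_nat.
have K k : (k <= n.+1)%N -> `|L u (u + k%:R * h)| <= e' * Q u (u + k%:R * h).
  elim: k => [_|k IH kn]; first by rewrite mul0r addr0 Luu ?Quu ?normr0 ?mulr0// (le_trans (ltW uv)).
  have uk : u <= u + k%:R * h by rewrite lerDl mulr_ge0// ltW.
  have kk : u + k%:R * h < u + k.+1%:R * h by rewrite ltrD2l ltr_pM2r// ltr_nat.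
  have kT : u + k.+1%:R * h <= T by exact: le_trans (step _ kn) vT.
  rewrite (addL u (u + k%:R * h) _)// ?(ltW kk)// (addQ u (u + k%:R * h) _)// ?(ltW kk)// mulrDr.
  apply: (le_trans (ler_normD _ _)); apply: lerD; first by apply: IH; exact: ltnW.
  apply: H => //; first exact: le_trans uk.
  rewrite (_ : u + k.+1%:R * h - _ = h)//; rewrite -natr1; ring.
have := K n.+1 (leqnn _).
rewrite (_ : u + n.+1%:R * h = v); last by rewrite /h mulrC divfK ?gt_eqF// addrC subrK.
move=> /le_trans; apply; rewrite /e' mulrAC ler_pdivrMr// ler_wpM2l ?(ltW e0)//.
by rewrite (le_trans (ler_norm _))// lerDl.
Qed.

End chaining.

Section time_regularity.
Context {R : realType} {d : nat} {T : R}.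
Local Notation leb := (@lebesgue_measure R).
Hypothesis T0 : 0 < T.

(** Derivatives at 0 and [T] are one-sided. The mean value theorem and uniform continuity of the
    time derivative make the local error at most [e] times the length, and [chaining] applies with
    the length as control. *)
Lemma C12_FTC (f : R -> 'rV[R]_d -> R) (u v : R) (x : 'rV[R]_d) : C12 `[0, T] f -> 0 <= u -> u <= v -> v <= T ->
  f v x - f u x = \int[leb]_(r in `[u, v]) clamped T (dt `[0, T] f) (r, x).
Proof.
move=> Cf u0 uv vT; have [_ [_ cd] _ _] := Cf.
have cD := clamped_continuous (ltW T0) cd.
have cDx := @continuous_slice R d _ x cD.
pose L a b := f b x - f a x - \int[leb]_(r in `[a, b]) clamped T (dt `[0, T] f) (r, x).
suff : L u v = 0 by move=> /eqP; rewrite subr_eq0 => /eqP.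
apply: (@chaining R T L (fun a b => b - a)) => //.
- move=> a m b a0 am mb bT; rewrite /L (@Rint_split R _ a m b)//; last exact: itg_cts_itv.
  ring.
- by move=> a m b _ _ _ _; ring.
move=> e e0; have [del del0 H] := unif_on_box T `|x| cD e0.
exists del => // a b a0 ab bT abd; rewrite /L.
have [c /andP[ac cb] ->] := C12_mvt x Cf a0 (ltW ab) bT.
have cT : 0 <= c <= T by rewrite (le_trans a0 ac) (le_trans cb bT).
rewrite -(Rint_cst_itv _ (ltW ab)) (leb_RintB R) //; last 2 first.
- exact: itg_cst_itv.
- exact: itg_cts_itv.
rewrite -(Rint_cst_itv _ (ltW ab)).
apply: (leb_le_Rint_bound R).
- exact: measurable_itv.
- apply: (leb_itgB R); [exact: measurable_itv|exact: itg_cst_itv|exact: itg_cts_itv].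
- exact: itg_cst_itv.
move=> r /=; rewrite in_itv/= => /andP[ar rb].
have -> : dt `[0, T] f c x = clamped T (dt `[0, T] f) (c, x) by rewrite /clamped /= clamp_id.
rewrite distrC; apply: (H c x r x cT) => //; last by rewrite subrr normr0.
by apply: le_lt_trans abd; rewrite ler_norml; apply/andP; split; lra.
Qed.

Lemma fubini_supp (F : R * 'rV[R]_d -> R) (N u v : R) : continuous F ->
  (forall t x, N < `|x| -> F (t, x) = 0) -> 0 <= u -> v <= T ->
  [/\ itg leb `[u, v] (fun r => \int[lebesgue_rV d]_x F (r, x)),
      itg (lebesgue_rV d) setT (fun x => \int[leb]_(r in `[u, v]) F (r, x)) &
      \int[leb]_(r in `[u, v]) \int[lebesgue_rV d]_x F (r, x) =
      \int[lebesgue_rV d]_x \int[leb]_(r in `[u, v]) F (r, x)].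
Proof.
move=> cF F0 u0 vT; have mF := continuous_measurable_tx cF.
apply: (@fubini_leb R _ _ (lebesgue_rV d) _ F (measurable_itv _) mF).
have [C C0 HC] := bounded_on_box T `|N| cF.
have mc : measurable (@cube R d 0 `|N|) by exact: measurable_cube.
apply: (@le_lt_trans _ _ (\int[leb]_(r in `[u, v]) (C * (2 * `|N|) ^+ d)%:E)%E).
  apply: ge0_le_integral.
  - exact: measurable_itv.
  - by move=> r _; apply: integral_ge0 => x _; rewrite lee_fin.
  - by apply: measurable_funTS; apply: (@measurable_integral_ge0 _ _ R (lebesgue_rV d) (fun p => `|F p|)) => //; exact: measurableT_comp.
  - by [].
  move=> r /=; rewrite in_itv/= => /andP[ur rv].
  apply: (@le_trans _ _ (\int[lebesgue_rV d]_x (C * \1_(cube 0 `|N|) x)%:E)%E).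
    apply: ge0_le_integral => //.
    - apply/measurable_EFinP; apply: measurableT_comp => //.
      by apply: continuous_measurable_rV; exact: continuous_slice2.
    - by apply/measurable_EFinP/measurable_funM => //; exact: measurable_indic.
    move=> x _; rewrite lee_fin indicE.
    have [xN|xN] := leP `|x| `|N|.
      rewrite mem_set ?mulr1; last by rewrite /cube /= subr0.
      by apply: HC => //; rewrite (le_trans u0 ur) (le_trans rv vT).
    by rewrite F0 ?normr0 ?mulr_ge0// (le_lt_trans (ler_norm N)).
  rewrite (eq_integral (fun x => (C%:E * (\1_(cube 0 `|N|) x)%:E)%E)); last by move=> x _; rewrite EFinM.
  rewrite ge0_integralZl//; last by apply/measurable_EFinP; exact: measurable_indic.
  have E : (lebesgue_rV d (cube 0 `|N|) <= ((2 * `|N|) ^+ d)%:E)%E by rewrite lebesgue_cube.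
  by rewrite integral_indic// setIT EFinM; apply: lee_wpmul2l.
have := leb_itg_fin R `[u, v]%classic (fun=> C * (2 * `|N|) ^+ d) (measurable_itv _) (itg_cst_itv u v _).
by move=> <-; exact: ltry.
Qed.

End time_regularity.

(** * The Fokker-Planck equation *)

Section density.
Context {R : realType} {d : nat} {T : R} (P : probability (path_space R d T) R).
Local Notation Om := (path_space R d T).
Local Notation leb := (@lebesgue_measure R).
Variable mu : R -> 'rV[R]_d -> R.
Hypotheses (mu_dens : forall t : R, 0 <= t <= T -> has_density (marg P t) (mu t))
  (mu_gt0 : forall (t : R) x, 0 <= t <= T -> 0 < mu t x).

Lemma itg_density t : 0 <= t <= T -> itg (lebesgue_rV d) setT (mu t).
Proof.
move=> tT; have [mm H] := mu_dens tT; apply: itg_ge0P => //.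
  by move=> x _; rewrite ltW// mu_gt0.
by rewrite -H//; apply: (@le_lt_trans _ _ 1%E); [exact: probability_le1|exact: ltry].
Qed.

Lemma expect_density t (f : 'rV[R]_d -> R) : 0 <= t <= T -> measurable_fun setT f ->
  itg (lebesgue_rV d) setT (fun x => f x * mu t x) ->
  itg P setT (fun w => f (w t)) /\ \int[P]_w f (w t) = \int[lebesgue_rV d]_x (f x * mu t x).
Proof.
move=> tT mf If; have [mm H] := mu_dens tT.
have i1 : itg P setT (fun=> 1 : R) by exact: itg_cst.
have DE A : measurable A -> \int[P]_(w in (coordp t) @^-1` A) 1 = \int[lebesgue_rV d]_(x in id @^-1` A) mu t x.
  move=> mA; rewrite Rintegral_cst ?mul1r; last first.
    by rewrite -[X in measurable X]setTI; exact: measurable_coordp.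
  have := H A mA; rewrite /marg /distribution /= => E.
  by rewrite /Rintegral -E.
have I1 : itg P setT (fun w => f (w t) * 1).
  apply: (@itg_transfer R _ _ _ Om _ _ P (lebesgue_rV d) (coordp t) id (fun=> 1) (mu t)
    (measurable_coordp t) (@measurable_id _ _ _) i1 (itg_density tT) _ _ DE f mf If) => //.
  by move=> x; rewrite ltW// mu_gt0.
have E := @Rintegral_transfer R _ _ _ Om _ _ P (lebesgue_rV d) (coordp t) id (fun=> 1) (mu t)
    (measurable_coordp t) (@measurable_id _ _ _) i1 (itg_density tT) DE f mf I1 If.
split; first by apply: (itg_eq measurableT I1) => w _; rewrite mulr1.
by rewrite -E; apply: eq_Rintegral => w _; rewrite mulr1.
Qed.

Hypothesis T0 : 0 < T.
Hypothesis mu_cont : continuous (clamped T mu).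

Lemma continuous_density t : 0 <= t <= T -> continuous (mu t).
Proof.
move=> tT; have -> : mu t = (fun x => clamped T mu (t, x)) by apply/funext => x; rewrite /clamped /= clamp_id.
exact: continuous_slice2.
Qed.

Lemma expect_supp t (f : 'rV[R]_d -> R) (N : R) : 0 <= t <= T -> continuous f ->
  (forall x, N < `|x| -> f x = 0) ->
  itg P setT (fun w => f (w t)) /\ \int[P]_w f (w t) = \int[lebesgue_rV d]_x (f x * mu t x).
Proof.
move=> tT cf f0; apply: expect_density => //; first exact: continuous_measurable_rV.
apply: (@integrable_supp R d _ N) => [x|x xN]; last by rewrite f0// mul0r.
exact: (continuousM (@cf x) (@continuous_density t tT x)).
Qed.

Lemma null_in_law (S : R) (K : R -> 'rV[R]_d -> R) : 0 < S -> S <= T -> continuous (clamped S K) ->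
  (forall u v eta N, 0 <= u -> u < v -> v <= S -> pC2 eta -> (forall x, N < `|x| -> eta x = 0) ->
     \int[leb]_(r in `[u, v]) \int[P]_w (eta (w r) * K r (w r)) = 0) ->
  forall t x, 0 <= t <= S -> K t x = 0.
Proof.
move=> S0 ST cK HK t x tS.
have ST' t' : 0 <= t' <= S -> 0 <= t' <= T by move=> /andP[-> t'S]; exact: le_trans t'S ST.
have c2 : continuous (clamped S (fun t x => K t x * mu t x)).
  have cm : continuous (clamped S mu).
    have -> : clamped S mu = fun p => clamped T mu (clamp S p.1, p.2).
      by apply/funext => p; rewrite /clamped /= (@clamp_id _ T)// ST'// clamp_itv// ltW.
    move=> p; apply/cts_txP => e e0; have /cts_txP /(_ e e0)[del del0 H] := @mu_cont (clamp S p.1, p.2).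
    by exists del => // s y sp yp; apply: H => //=; exact: le_lt_trans (clamp_lip _ _ _) sp.
  by move=> p; exact: (continuousM (@cK p) (cm p)).
have := @fundamental_lemma_tx R d S (fun t x => K t x * mu t x) S0 c2 _ t x tS.
move=> /(_ _)/wrap[]; last first.
  by move=> /eqP; rewrite mulf_eq0 (gt_eqF (mu_gt0 _ (ST' _ tS))) orbF => /eqP.
move=> u v eta N u0 uv vS Ceta etaN; rewrite -[RHS](HK u v eta N u0 uv vS Ceta etaN).
apply: eq_Rintegral => r /set_mem /=; rewrite in_itv/= => /andP[ur rv].
have rS : 0 <= r <= S by rewrite (le_trans u0 ur) (le_trans rv vS).
have cKr : continuous (K r).
  have -> : K r = (fun x => clamped S K (r, x)) by apply/funext => y; rewrite /clamped /= clamp_id.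
  exact: continuous_slice2.
have ceta := pC1_continuous Ceta.1.
have cek : continuous (fun x => eta x * K r x) by move=> y; exact: (continuousM (@ceta y) (cKr y)).
have [|_ ->] := @expect_supp r (fun x => eta x * K r x) N (ST' _ rS) cek.
  by move=> y yN; rewrite etaN// mul0r.
by apply: eq_Rintegral => y _; rewrite mulrA.
Qed.

End density.

Lemma continuous_sum_rV {R : realType} {n : nat} (I : finType) (f : I -> 'rV[R]_n -> R) :
  (forall i, continuous (f i)) -> continuous (fun x => \sum_i f i x).
Proof.
move=> cf x; apply: (@cvg_sum_fin R _ _ (nbhs x) (nbhs_filter x) (index_enum I) f (fun i => f i x)) => i.
exact: cf.
Qed.

Section static_functions.
Context {R : realType} {d : nat} {T : R}.
Hypothesis T0 : 0 < T.

Lemma dt_static (eta : 'rV[R]_d -> R) t x : 0 <= t <= T -> dt `[0, T] (fun=> eta) t x = 0.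
Proof.
move=> tT; apply: dt_unique; first exact: limit_time_cc.
apply/time_quotP => e e0; exists 1 => // s _ _ _.
by rewrite /time_quot subrr mulr0 subrr normr0 ltW.
Qed.

Lemma continuous_tx_static I (f : 'rV[R]_d -> R) : continuous f -> continuous_tx I (fun=> f).
Proof.
move=> cf; apply/continuous_txP => t x _ e e0; have /cts_rVP /(_ e e0)[del del0 H] := cf x.
by exists del => // s y _ _; exact: H.
Qed.

Lemma C12_static (eta : 'rV[R]_d -> R) : pC2 eta -> C12 `[0, T] (fun=> eta).
Proof.
move=> Ce; split.
- move=> t x _; split=> [|i|i j]; [|exact: (Ce.1.1 i x)|exact: ((Ce.2 i).1 j x)].
  apply/cvg_ex; exists 0; apply/time_quotP => e e0; exists 1 => // s _ _ _.
  by rewrite /time_quot subrr mulr0 subrr normr0 ltW.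
- split; first by apply: continuous_tx_static; exact: pC1_continuous Ce.1.
  apply/continuous_txP => t x; rewrite /= in_itv/= => tT e e0; exists 1 => // s y.
  by rewrite /= in_itv/= => sT _ _; rewrite !dt_static// subrr normr0 ltW.
- by move=> i; apply: continuous_tx_static; exact: (Ce.1.2 i).
- by move=> i j; apply: continuous_tx_static; exact: ((Ce.2 i).2 j).
Qed.

End static_functions.

Section fokker_planck.
Context {R : realType} {d : nat} {T : R} (P : probability (path_space R d T) R).
Local Notation Om := (path_space R d T).
Local Notation leb := (@lebesgue_measure R).
Variable b : 'I_d -> R * 'rV[R]_d -> R.
Hypotheses (T0 : 0 < T) (cb : forall i, continuous (b i)).
Hypothesis indep : independent_noise P b.
Hypothesis Hb : finite_energy P b.

Lemma power_split (u m v : R) : 0 <= u -> u <= m -> m <= v -> v <= T ->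
  (v - u) + \int[leb]_(r in `[u, v]) power P b r =
  ((m - u) + \int[leb]_(r in `[u, m]) power P b r) + ((v - m) + \int[leb]_(r in `[m, v]) power P b r).
Proof.
move=> u0 um mv vT; have [I _ _] := energy_fubini cb Hb u0 vT.
rewrite (Rint_split um mv I); ring.
Qed.

(** [local_ito] for the time-independent function [eta] with weight 1, summed up by [chaining]. *)
Lemma weak_fokker_planck (eta : 'rV[R]_d -> R) (N u v : R) : pC2 eta -> (forall x, N < `|x| -> eta x = 0) ->
  0 <= u -> u <= v -> v <= T ->
  let G r x := 2^-1 * laplacian eta x + \sum_i b i (r, x) * partial i eta x in
  itg leb `[u, v] (fun r => \int[P]_w G r (w r)) /\
  \int[P]_w eta (w v) - \int[P]_w eta (w u) = \int[leb]_(r in `[u, v]) \int[P]_w G r (w r).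
Proof.
move=> Ce eN u0 uv vT G.
have gC := @C12_static R d T T0 eta Ce.
have gN t x : 0 <= t <= T -> N < `|x| -> (fun _ : R => eta) t x = 0 by move=> _; exact: eN.
have c1 : continuous (fun _ : 'rV[R]_d => 1 : R) by exact: cst_continuous.
have b1 : exists K : R, forall x : 'rV[R]_d, `|(fun=> 1) x : R| <= K by exists 1 => x; rewrite normr1.
pose gen := @ito_generator R d T b (fun=> eta) (fun=> 1).
have genE r x : gen (r, x) = G r x.
  rewrite /gen /ito_generator /generator /clamped /= mul1r dt_static ?clamp_itv ?(ltW T0)// add0r.
  by [].
have EG r : \int[P]_w gen (r, w r) = \int[P]_w G r (w r) by apply: eq_Rintegral => w _; exact: genE.
have F a c' : 0 <= a -> a <= c' -> c' <= T -> itg leb `[a, c'] (fun r => \int[P]_w G r (w r)).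
  move=> a0 ac cT; have [I _ _] := generator_fubini P T0 cb gC gN c1 a0 ac cT.
  by apply: (leb_itg_eq R _ _ _ _ I).
split; first exact: F.
pose L a c := \int[P]_w eta (w c) - \int[P]_w eta (w a) - \int[leb]_(r in `[a, c]) \int[P]_w G r (w r).
suff : L u v = 0 by move=> /eqP; rewrite subr_eq0 => /eqP.
apply: (@chaining R T L (fun a c => (c - a) + \int[leb]_(r in `[a, c]) power P b r)) => //.
- move=> a m c a0 am mc cT; rewrite /L (Rint_split am mc (F _ _ a0 (le_trans am mc) cT)); ring.
- exact: power_split.
have [C HC] : exists C, forall x, `|eta x| <= C.
  have ce2 : continuous (fun p : R * 'rV[R]_d => eta p.2).
    exact: (continuous_snd (pC1_continuous Ce.1)).
  have [C C0 HC] := bounded_on_box 0 N ce2.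
  exists C => x; have [xN|xN] := leP `|x| N; last by rewrite eN// normr0.
  by apply: (HC 0 x) => //; rewrite lexx.
have Ieta t : itg P setT (fun w : Om => eta (w t)).
  apply: (itg_le measurableT _ (itg_cst P C)).
    by apply: measurable_at; apply: continuous_measurable_rV; exact: (pC1_continuous Ce.1).
  by move=> w _; exact: HC.
move=> e e0; have [del del0 H] := local_ito T0 cb indep Hb gC gN c1 b1 e0.
exists del; first exact: del0.
move=> a c a0 ac cT acd.
have EL : \int[P]_w ((fun=> 1) (w a) * (eta (w c) - eta (w a))) - \int[leb]_(r in `[a, c]) \int[P]_w gen (r, w r) = L a c.
  have E1 : \int[P]_w ((fun=> 1) (w a) * (eta (w c) - eta (w a))) = \int[P]_w eta (w c) - \int[P]_w eta (w a).
    rewrite (RintB measurableT (Ieta c) (Ieta a)); apply: eq_Rintegral => w _; exact: mul1r.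
  have E2 : \int[leb]_(r in `[a, c]) \int[P]_w gen (r, w r) = \int[leb]_(r in `[a, c]) \int[P]_w G r (w r).
    by apply: eq_Rintegral => r _; exact: EG.
  by rewrite E1 E2.
rewrite -EL; exact: (H a c a0 ac cT acd).
Qed.

Variable mu : R -> 'rV[R]_d -> R.
Hypotheses (mu_dens : forall t : R, 0 <= t <= T -> has_density (marg P t) (mu t))
  (mu_gt0 : forall (t : R) x, 0 <= t <= T -> 0 < mu t x) (mu_C12 : C12 `[0, T] mu).
Hypothesis db : forall t i x, 0 <= t <= T -> pderivable i (fun y => b i (t, y)) x.
Hypothesis cdb : forall i, continuous (clamped T (fun t => partial i (fun y => b i (t, y)))).

Lemma fokker_planck t x : 0 <= t <= T ->
  (forall i, pderivable i (fun y => mu t y * b i (t, y)) x) /\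
  dt `[0, T] mu t x - 2^-1 * laplacian (mu t) x + \sum_i partial i (fun y => mu t y * b i (t, y)) x = 0.
Proof.
have alg (a b' c s1 s2 k : R) : s1 = b' -> s2 = - c -> k = a - 2^-1 * b' + c -> 2^-1 * s1 + s2 = a - k.
  by move=> -> -> ->; ring.
have [Hd [cm cdt] cm1 cm2] := mu_C12.
have T0' := ltW T0.
have cM := clamped_continuous T0' cm; have cMt := clamped_continuous T0' cdt.
have cM1 i := clamped_continuous T0' (cm1 i); have cM2 i j := clamped_continuous T0' (cm2 i j).
have muC2 s : 0 <= s <= T -> pC2 (mu s) := C12_pC2 mu_C12.
have dmb s i y : 0 <= s <= T -> pderivable i (fun y => mu s y * b i (s, y)) y /\
    partial i (fun y => mu s y * b i (s, y)) y = mu s y * partial i (fun y => b i (s, y)) y + b i (s, y) * partial i (mu s) y.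
  by move=> sT; exact: (@partialM R d (mu s) (fun y => b i (s, y)) i y ((muC2 s sT).1.1 i y) (@db s i y sT)).
move=> tT; split; first by move=> i; have [] := dmb t i x tT.
(* The left-hand side with its divergence expanded by the product rule, so that each term is visibly
   continuous in [(s, y)]. *)
pose K s y := dt `[0, T] mu s y - 2^-1 * (\sum_i partial i (partial i (mu s)) y)
  + \sum_i (mu s y * partial i (fun y => b i (s, y)) y + b i (s, y) * partial i (mu s) y).
have -> : dt `[0, T] mu t x - 2^-1 * laplacian (mu t) x + \sum_i partial i (fun y => mu t y * b i (t, y)) x = K t x.
  by congr (_ + _); apply: eq_bigr => i _; have [_ ->] := dmb t i x tT.
have cbT i : continuous (clamped T (fun t x => b i (t, x))).
  move=> p; apply/cts_txP => e e0; have /cts_txP /(_ e e0)[del del0 H] := @cb i (clamp T p.1, p.2).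
  by exists del => // s y sp yp; apply: H => //=; exact: le_lt_trans (clamp_lip _ _ _) sp.
apply: (@fundamental_lemma_tx R d T K T0 _ _ t x tT).
  move=> p; apply: cvgD_fun.
    apply: cvgB_fun; first exact: cMt.
    apply: cvgM_fun; first exact: cst_continuous.
    by apply: cvg_sum_fin => i; exact: cM2.
  apply: cvg_sum_fin => i.
  apply: cvgD_fun.
    exact: (continuousM (@cM p) (@cdb i p)).
  exact: (continuousM (@cbT i p) (@cM1 i p)).
move=> u v eta N u0 uv vT Ce eN.
have ceta := pC1_continuous Ce.1.
have ceta2 : continuous (fun p : R * 'rV[R]_d => eta p.2).
  exact: (continuous_snd ceta).
have eN1 i y : N < `|y| -> partial i eta y = 0 by move=> yN; exact: (@partial_eq0 R d eta N i y eN yN).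
have eN2 i j y : N < `|y| -> partial j (partial i eta) y = 0.
  by move=> yN; apply: (@partial_eq0 R d (partial i eta) N j y _ yN) => z; exact: eN1.
have [IG EG] := weak_fokker_planck Ce eN u0 (ltW uv) vT.
pose G r x := 2^-1 * laplacian eta x + \sum_i b i (r, x) * partial i eta x.
have uT : 0 <= u <= T by rewrite u0 (le_trans (ltW uv)).
have vT' : 0 <= v <= T by rewrite vT (le_trans u0 (ltW uv)).
have cE t' : 0 <= t' <= T -> itg (lebesgue_rV d) setT (fun x => eta x * mu t' x).
  move=> tT'; apply: (@integrable_supp R d _ N) => [y|y yN]; last by rewrite eN// mul0r.
  exact: (continuousM (@ceta y) (pC1_continuous (muC2 _ tT').1 (x := y))).
have cF : continuous (fun p => eta p.2 * clamped T (dt `[0, T] mu) p).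
  by move=> p; exact: (continuousM (@ceta2 p) (@cMt p)).
have F0 s y : N < `|y| -> (fun p => eta p.2 * clamped T (dt `[0, T] mu) p) (s, y) = 0.
  by move=> yN; rewrite /= eN// mul0r.
have [I1 I2 E1] := @fubini_supp R d T _ N u v cF F0 u0 vT.
have E2 : \int[leb]_(r in `[u, v]) \int[lebesgue_rV d]_x (eta x * clamped T (dt `[0, T] mu) (r, x)) =
    \int[leb]_(r in `[u, v]) \int[P]_w G r (w r).
  rewrite -EG.
  have [_ ->] := expect_supp mu_dens mu_gt0 cM vT' ceta eN.
  have [_ ->] := expect_supp mu_dens mu_gt0 cM uT ceta eN.
  rewrite RintB//; [|exact: cE|exact: cE].
  transitivity (\int[lebesgue_rV d]_x \int[leb]_(r in `[u, v]) (eta x * clamped T (dt `[0, T] mu) (r, x))).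
    exact: E1.
  apply: eq_Rintegral => y _; rewrite -mulrBr (C12_FTC T0 y mu_C12 u0 (ltW uv) vT).
  rewrite (leb_RintegralZl R)//.
  by apply: itg_cts_itv; exact: (@continuous_slice R d (clamped T (dt `[0, T] mu)) y cMt).
(* At a fixed time, two integrations by parts for the Laplacian and one for the drift move all
   derivatives from [eta] to the density; what is left over is exactly the pairing with [K]. *)
have E3 r : 0 <= r <= T -> \int[P]_w G r (w r) =
   \int[lebesgue_rV d]_y (eta y * clamped T (dt `[0, T] mu) (r, y)) - \int[lebesgue_rV d]_y (eta y * K r y).
  move=> rT.
  have cmu := pC1_continuous (muC2 r rT).1.
  have cbr i : continuous (fun y => b i (r, y)) by exact: (@continuous_slice2 R d (b i) r (@cb i)).
  have cGr : continuous (G r).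
    move=> y; apply: (@continuousD _ _ _ (fun y => 2^-1 * laplacian eta y) (fun y => \sum_i b i (r, y) * partial i eta y)).
      apply: (@continuousM _ _ (fun=> 2^-1) (laplacian eta)); first exact: cst_continuous.
      by move: y; apply: continuous_sum_rV => i; exact: ((Ce.2 i).2 i).
    move: y; apply: continuous_sum_rV => i y; exact: (continuousM (@cbr i y) (Ce.1.2 i y)).
  have G0 y : N < `|y| -> G r y = 0.
    move=> yN; rewrite /G /laplacian big1 ?mulr0 ?add0r; last by move=> i _; exact: eN2.
    by rewrite big1// => i _; rewrite eN1// mulr0.
  have [_ ->] := expect_supp mu_dens mu_gt0 cM rT cGr G0.
  have supp_itg (f : 'rV[R]_d -> R) : continuous f -> (forall y, N < `|y| -> f y = 0) -> itg (lebesgue_rV d) setT f.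
    by move=> cf f0; exact: (@integrable_supp R d f N cf f0).
  have cd2 i : continuous (partial i (partial i (mu r))) by exact: ((muC2 r rT).2 i).2.
  have cdbr i : continuous (partial i (fun y => b i (r, y))) by exact: (clamped_slice rT (@cdb i)).
  have cdmb i : continuous (partial i (fun y => mu r y * b i (r, y))).
    have -> : partial i (fun y => mu r y * b i (r, y)) = fun y => mu r y * partial i (fun y => b i (r, y)) y + b i (r, y) * partial i (mu r) y.
      by apply/funext => y; have [_] := dmb r i y rT.
    move=> y; apply: (@continuousD _ _ _ (fun y => mu r y * partial i (fun y => b i (r, y)) y) (fun y => b i (r, y) * partial i (mu r) y)).
      exact: (continuousM (@cmu y) (@cdbr i y)).
    exact: (continuousM (@cbr i y) ((muC2 r rT).1.2 i y)).
  have cmb i : continuous (fun y => mu r y * b i (r, y)) by move=> y; exact: (continuousM (@cmu y) (@cbr i y)).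
  have P2 i : \int[lebesgue_rV d]_y (partial i (partial i eta) y * mu r y) = \int[lebesgue_rV d]_y (eta y * partial i (partial i (mu r)) y).
    have A1 := @integration_by_parts_rV R d i (partial i eta) (mu r) N (Ce.2 i) (fun y => (muC2 r rT).1.1 i y) cmu ((muC2 r rT).1.2 i) (@eN1 i).
    have A2 := @integration_by_parts_rV R d i eta (partial i (mu r)) N Ce.1 (fun y => ((muC2 r rT).2 i).1 i y) ((muC2 r rT).1.2 i) (cd2 i) eN.
    by rewrite A1 A2 opprK.
  have P1' i : \int[lebesgue_rV d]_y (partial i eta y * (mu r y * b i (r, y))) =
      - \int[lebesgue_rV d]_y (eta y * partial i (fun y => mu r y * b i (r, y)) y).
    exact: (@integration_by_parts_rV R d i eta (fun y => mu r y * b i (r, y)) N Ce.1 (fun y => (dmb r i y rT).1) (@cmb i) (cdmb i) eN).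
  have J1 i : itg (lebesgue_rV d) setT (fun y => partial i (partial i eta) y * mu r y).
    apply: supp_itg => [y|y yN]; last by rewrite eN2// mul0r.
    exact: (continuousM ((Ce.2 i).2 i y) (@cmu y)).
  have J2 i : itg (lebesgue_rV d) setT (fun y => partial i eta y * (mu r y * b i (r, y))).
    apply: supp_itg => [y|y yN]; last by rewrite eN1// mul0r.
    exact: (continuousM (Ce.1.2 i y) (@cmb i y)).
  have J3 i : itg (lebesgue_rV d) setT (fun y => eta y * partial i (partial i (mu r)) y).
    apply: supp_itg => [y|y yN]; last by rewrite eN// mul0r.
    exact: (continuousM (@ceta y) (@cd2 i y)).
  have J4 i : itg (lebesgue_rV d) setT (fun y => eta y * partial i (fun y => mu r y * b i (r, y)) y).
    apply: supp_itg => [y|y yN]; last by rewrite eN// mul0r.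
    exact: (continuousM (@ceta y) (@cdmb i y)).
  have J5 : itg (lebesgue_rV d) setT (fun y => eta y * clamped T (dt `[0, T] mu) (r, y)).
    apply: supp_itg => [y|y yN]; last by rewrite eN// mul0r.
    exact: (continuousM (@ceta y) (@continuous_slice2 R d _ r cMt y)).
  have S1 := itg_sum (index_enum 'I_d) measurableT J1.
  have S2 := itg_sum (index_enum 'I_d) measurableT J2.
  have S3 := itg_sum (index_enum 'I_d) measurableT J3.
  have S4 := itg_sum (index_enum 'I_d) measurableT J4.
  have S1' := itgZ 2^-1 measurableT S1; have S3' := itgZ 2^-1 measurableT S3.
  have -> : \int[lebesgue_rV d]_y (G r y * mu r y) = 2^-1 * (\sum_i \int[lebesgue_rV d]_y (partial i (partial i eta) y * mu r y))
     + \sum_i \int[lebesgue_rV d]_y (partial i eta y * (mu r y * b i (r, y))).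
    rewrite -!Rint_sum// -RintegralZl// -RintegralD//; apply: eq_Rintegral => y _.
    rewrite /G /laplacian mulrDl -mulrA !mulr_suml; congr (_ + _); apply: eq_bigr => i _; ring.
  have Q1 : \sum_i \int[lebesgue_rV d]_y (partial i (partial i eta) y * mu r y) =
      \int[lebesgue_rV d]_y \sum_i eta y * partial i (partial i (mu r)) y.
    exact: (etrans (eq_bigr _ (fun i _ => P2 i)) (esym (Rint_sum (index_enum 'I_d) measurableT J3))).
  have Q2 : \sum_i \int[lebesgue_rV d]_y (partial i eta y * (mu r y * b i (r, y))) =
      - \int[lebesgue_rV d]_y \sum_i eta y * partial i (fun y => mu r y * b i (r, y)) y.
    apply: (etrans (eq_bigr _ (fun i _ => P1' i))); rewrite sumrN; congr (- _).
    exact: (esym (Rint_sum (index_enum 'I_d) measurableT J4)).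
  have S53 := itgB measurableT J5 S3'.
  have Q3 : \int[lebesgue_rV d]_y (eta y * K r y) =
      \int[lebesgue_rV d]_y (eta y * clamped T (dt `[0, T] mu) (r, y))
      - 2^-1 * \int[lebesgue_rV d]_y (\sum_i eta y * partial i (partial i (mu r)) y)
      + \int[lebesgue_rV d]_y \sum_i eta y * partial i (fun y => mu r y * b i (r, y)) y.
    transitivity (\int[lebesgue_rV d]_y ((eta y * clamped T (dt `[0, T] mu) (r, y)
      - 2^-1 * (\sum_i eta y * partial i (partial i (mu r)) y)) + \sum_i eta y * partial i (fun y => mu r y * b i (r, y)) y)).
      apply: eq_Rintegral => y _; rewrite /K /clamped /= clamp_id// -!mulr_sumr.
      rewrite (eq_bigr _ (fun i _ => (dmb r i y rT).2)); set s1 := \sum_i partial i _ y; set s2 := \sum_i (_ + _); ring.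
    by rewrite (RintegralD measurableT S53 S4) (RintegralB measurableT J5 S3') (RintegralZl _ measurableT S3).
  exact: (alg _ _ _ _ _ _ Q1 Q2 Q3).
have IK : itg leb `[u, v] (fun r => \int[lebesgue_rV d]_y (eta y * K r y)).
  apply: (leb_itg_eq R _ _ _ _ (leb_itgB R _ _ _ _ I1 IG)); try exact: measurable_itv.
  move=> r /=; rewrite in_itv/= => /andP[ur rv].
  have rT : 0 <= r <= T by rewrite (le_trans u0 ur) (le_trans rv vT).
  by have := E3 r rT; rewrite /G => ->; ring.
have : \int[leb]_(r in `[u, v]) \int[P]_w G r (w r) =
  \int[leb]_(r in `[u, v]) \int[lebesgue_rV d]_x (eta x * clamped T (dt `[0, T] mu) (r, x)) - \int[leb]_(r in `[u, v]) \int[lebesgue_rV d]_y (eta y * K r y).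
  rewrite (leb_RintB R)//.
  apply: eq_Rintegral => r /set_mem /=; rewrite in_itv/= => /andP[ur rv].
  by rewrite E3// (le_trans u0 ur) (le_trans rv vT).
rewrite E2 => /eqP; rewrite -subr_eq0 opprB addrCA subrr addr0 => /eqP.
exact.
Qed.

End fokker_planck.

(** * Gradient structure of the corrector *)

Section spatial_slices.
Context {R : realType} {d : nat}.
Implicit Types phi : R * 'rV[R]_d -> R.

Let e_ (i : 'I_d) : R * 'rV[R]_d := (0, delta_mx ord0 i).

Lemma slice_partial phi i t x : derivable phi (t, x) (e_ i) ->
  pderivable i (fun y => phi (t, y)) x /\ partial i (fun y => phi (t, y)) x = 'D_(e_ i) phi (t, x).
Proof.
have E : (fun h : R => h^-1 *: (phi (h *: e_ i + (t, x)) - phi (t, x))) =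
    (fun h : R => h^-1 *: (phi (t, h *: delta_mx ord0 i + x) - phi (t, x))).
  apply/funext => h; congr (_ *: (phi _ - _)).
  by apply/pair_equal_spec; split => //=; rewrite scaler0 add0r.
by rewrite /pderivable /partial /derivable /derive E.
Qed.

(** Freezing the time amounts to differentiating only in the directions [(0, e_ i)]. *)
Lemma class_C_slice phi t : (forall n, class_C n phi) ->
  pC2 (fun x => phi (t, x)) /\ forall i, continuous (fun p => partial i (fun x => phi (p.1, x)) p.2).
Proof.
move=> C; have [_ C2] := C 2.
have E i s : partial i (fun x => phi (s, x)) = fun x => 'D_(e_ i) phi (s, x).
  by apply/funext => x; have [] := @slice_partial phi i s x ((C2 (e_ i)).1 (s, x)).
have E2 i j s : partial j (fun x => 'D_(e_ i) phi (s, x)) = fun x => 'D_(e_ j) ('D_(e_ i) phi) (s, x).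
  by apply/funext => x; have [] := @slice_partial ('D_(e_ i) phi) j s x (((C2 (e_ i)).2.2 (e_ j)).1 (s, x)).
split; last first.
  move=> i; have -> : (fun p => partial i (fun x => phi (p.1, x)) p.2) = 'D_(e_ i) phi.
    by apply/funext => -[s x] /=; rewrite E.
  exact: (C2 (e_ i)).2.1.
split.
  split=> [i x|i]; first by have [] := @slice_partial phi i t x ((C2 (e_ i)).1 (t, x)).
  rewrite E; exact: (@continuous_slice2 R d ('D_(e_ i) phi) t (C2 (e_ i)).2.1).
move=> i; rewrite E; split=> [j x|j].
  by have [] := @slice_partial ('D_(e_ i) phi) j t x (((C2 (e_ i)).2.2 (e_ j)).1 (t, x)).
rewrite E2; exact: (@continuous_slice2 R d ('D_(e_ j) ('D_(e_ i) phi)) t ((C2 (e_ i)).2.2 (e_ j)).2.1).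
Qed.

End spatial_slices.

Section l2_distance.
Context {R : realType} {d : nat} {T : R} (P : probability (path_space R d T) R).
Local Notation Om := (path_space R d T).
Local Notation leb := (@lebesgue_measure R).
Hypothesis T0 : 0 < T.

Definition sqdrift (D : 'I_d -> R * 'rV[R]_d -> R) (u v : R) (w : Om) : R :=
  \int[leb]_(r in `[u, v]) \sum_i D i (r, w r) ^+ 2.

Lemma continuous_sqdrift (D : 'I_d -> R * 'rV[R]_d -> R) (w : Om) : (forall i, continuous (D i)) ->
  continuous (fun r => \sum_i D i (r, w r) ^+ 2).
Proof.
move=> cD r; apply: cvg_sum_fin => i.
apply: cvg_sqr.
exact: (@continuous_along_path R d T (D i) w (cD i) r).
Qed.

Lemma measurable_sqdrift (D : 'I_d -> R * 'rV[R]_d -> R) : (forall i, continuous (D i)) ->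
  measurable_fun setT (fun p : R * Om => \sum_i D i (p.1, p.2 p.1) ^+ 2).
Proof.
move=> cD; apply: measurable_sum => i; apply: (measurableT_comp (exprn_measurable 2)).
exact: measurable_along_path.
Qed.

Lemma L2_distP (F G : R -> 'rV[R]_d -> 'rV[R]_d) (D : 'I_d -> R * 'rV[R]_d -> R) :
  (forall i, continuous (D i)) ->
  (forall t x i, 0 <= t <= T -> D i (t, x) = (F t x - G t x) ord0 i) ->
  (L2_dist2 (T := T) (marg P) F G = \int[leb]_(t in `[0%R, T]) \int[P]_w (\sum_i D i (t, w t) ^+ 2)%:E)%E.
Proof.
move=> cD DE; rewrite /L2_dist2; apply: eq_integral => t /set_mem /=; rewrite in_itv/= => tT.
have E x : enorm (F t x - G t x) ^+ 2 = \sum_i D i (t, x) ^+ 2.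
  by rewrite enorm_sq; apply: eq_bigr => i _; rewrite DE.
transitivity (\int[marg P t]_x (\sum_i D i (t, x) ^+ 2)%:E)%E.
  by apply: eq_integral => x _; rewrite E.
apply: (@ge0_integral_marg R d T P t (fun x => (\sum_i D i (t, x) ^+ 2)%:E)).
  apply/measurable_EFinP; apply: measurable_sum => i; apply: (measurableT_comp (exprn_measurable 2)).
  by apply: continuous_measurable_rV; exact: continuous_slice2.
by move=> x; rewrite lee_fin; apply: sumr_ge0 => i _; exact: sqr_ge0.
Qed.

Lemma L2_bound (D : 'I_d -> R * 'rV[R]_d -> R) (e : R) : (forall i, continuous (D i)) ->
  (\int[leb]_(t in `[0%R, T]) \int[P]_w (\sum_i D i (t, w t) ^+ 2)%:E <= e%:E)%E ->
  itg P setT (sqdrift D 0 T) /\ \int[P]_w sqdrift D 0 T w <= e.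
Proof.
move=> cD; have mD := measurable_sqdrift cD.
rewrite (@tonelli_leb R _ Om P _ (fun p : R * Om => (\sum_i D i (p.1, p.2 p.1) ^+ 2)%:E) (measurable_itv _)); last 2 first.
- exact/measurable_EFinP.
- by move=> p; rewrite lee_fin; apply: sumr_ge0 => i _; exact: sqr_ge0.
have -> : (\int[P]_w \int[leb]_(t in `[0%R, T]) (\sum_i D i (t, w t) ^+ 2)%:E = \int[P]_w (sqdrift D 0 T w)%:E)%E.
  apply: eq_integral => w _; rewrite /sqdrift (leb_itg_fin R)//.
  by apply: itg_cts_itv; exact: continuous_sqdrift.
move=> H.
have I : itg P setT (sqdrift D 0 T).
  apply: itg_ge0P => //; last exact: le_lt_trans H (ltry _).
    exact: (measurable_Rint_path 0 T mD).
  by move=> w _; apply: Rintegral_ge0 => r _; apply: sumr_ge0 => i _; exact: sqr_ge0.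
by split => //; rewrite -lee_fin itg_fin.
Qed.

End l2_distance.

Section curl_free.
Context {R : realType} {d : nat} {T : R} (P : probability (path_space R d T) R).
Local Notation Om := (path_space R d T).
Local Notation leb := (@lebesgue_measure R).
Hypothesis T0 : 0 < T.
Variable mu : R -> 'rV[R]_d -> R.
Hypotheses (mu_dens : forall t : R, 0 <= t <= T -> has_density (marg P t) (mu t))
  (mu_gt0 : forall (t : R) x, 0 <= t <= T -> 0 < mu t x) (cmu : continuous (clamped T mu)).
Variable Psi : R -> 'rV[R]_d -> 'rV[R]_d.
Hypothesis PsiH : H_minus1 (T := T) (marg P) Psi.
Hypothesis PsiC : forall i, C12 `[0, T] (fun t x => Psi t x ord0 i).

Let ps i := clamped T (fun t x => Psi t x ord0 i).

Let cps i : continuous (ps i).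
Proof. by have [_ [c _] _ _] := PsiC i; apply: clamped_continuous => //; exact: ltW. Qed.

Let T0' : 0 <= T. Proof. exact: ltW. Qed.

(* The pairing with [zeta] is small against [L2]-small fields, by [|z D| <= |z| (del + D^2 / del)]. *)
Let pairing_small (zeta : R * 'rV[R]_d -> R) (C : R) (u v : R) (e : R) : continuous zeta ->
  (forall p, `|zeta p| <= C) -> 0 <= u -> u < v -> v <= T -> 0 < e ->
  exists2 c : R, 0 < c & forall (D : 'I_d -> R * 'rV[R]_d -> R) i, (forall i, continuous (D i)) ->
    (\int[leb]_(t in `[0%R, T]) \int[P]_w (\sum_i D i (t, w t) ^+ 2)%:E <= c%:E)%E ->
    (forall w, itg leb `[u, v] (fun r => zeta (r, (w : Om) r) * D i (r, w r))) /\
    (itg P setT (fun w => \int[leb]_(r in `[u, v]) (zeta (r, w r) * D i (r, w r))) /\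
    `|\int[P]_w \int[leb]_(r in `[u, v]) (zeta (r, w r) * D i (r, w r))| <= e).
Proof.
move=> cz zC u0 uv vT e0.
have C0 : 0 <= C by exact: le_trans (zC 0).
(* [del] makes the constant part [C * T * del] at most [e / 2]; below, [c] does the same for the
   quadratic part [C / del * c]. *)
pose del := e / (2 * (C * T + 1)).
have CT : 0 < C * T + 1 by rewrite ltr_wpDl// mulr_ge0.
have del0 : 0 < del by rewrite divr_gt0// mulr_gt0.
have delE : del * (C * T + 1) = e / 2 by rewrite /del; field; rewrite gt_eqF.
clearbody del.
pose c := e * del / (2 * (C + 1)).
have C1 : 0 < C + 1 by rewrite ltr_wpDl.
have cE : c * (C + 1) = e * del / 2 by rewrite /c; field; rewrite gt_eqF.
have c0 : 0 < c by rewrite divr_gt0// mulr_gt0.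
clearbody c; exists c => //.
move=> D i cD Hc; have [I1 I2] := L2_bound cD Hc.
have czD (w : Om) : continuous (fun r => zeta (r, w r) * D i (r, w r)).
  move=> r; apply: cvgM_fun.
    exact: (@continuous_along_path R d T zeta w cz r).
  exact: (@continuous_along_path R d T (D i) w (cD i) r).
have J (w : Om) : itg leb `[u, v] (fun r => zeta (r, w r) * D i (r, w r)) by exact: itg_cts_itv.
split => //.
have B (w : Om) : `|\int[leb]_(r in `[u, v]) (zeta (r, w r) * D i (r, w r))| <= C * T * del + C / del * sqdrift D 0 T w.
  have cS := continuous_sqdrift (w := w) cD.
  have K1 := itg_cst_itv u v (C * del).
  have K2 : itg leb `[u, v] (fun r => C / del * \sum_i D i (r, w r) ^+ 2).
    by apply: (leb_itgZ R); [exact: measurable_itv|exact: itg_cts_itv].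
  have mI : measurable `[u, v]%classic by exact: measurable_itv.
  have K12 := leb_itgD R _ _ _ mI K1 K2.
  apply: (@le_trans _ _ (\int[leb]_(r in `[u, v]) (C * del + C / del * \sum_i D i (r, w r) ^+ 2))).
    apply: (leb_le_Rint_bound R) => //.
    move=> r _; rewrite normrM; apply: (@le_trans _ _ (C * `|D i (r, w r)|)); first by rewrite ler_wpM2r.
    rewrite -mulrA -mulrDr ler_wpM2l//.
    apply: (@le_trans _ _ (del + del^-1 * D i (r, w r) ^+ 2)); last first.
      rewrite lerD2l ler_wpM2l ?invr_ge0 ?(ltW del0)// (bigD1 i)//= lerDl.
      by apply: sumr_ge0 => j _; exact: sqr_ge0.
    rewrite -[D i _ ^+ 2]real_normK ?num_real//; set y := `|D i _|.
    have -> : del + del^-1 * y ^+ 2 = y + del^-1 * ((y - 2^-1 * del) ^+ 2 + (3 / 4) * del ^+ 2).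
      field. by rewrite gt_eqF.
    by rewrite lerDl mulr_ge0 ?invr_ge0 ?(ltW del0)// addr_ge0 ?sqr_ge0// mulr_ge0// sqr_ge0.
  rewrite (leb_RintegralD R)// Rint_cst_itv ?(ltW uv)//.
  rewrite (leb_RintegralZl R)//; last exact: itg_cts_itv.
  apply: lerD.
    rewrite mulrAC; apply: ler_wpM2r; first exact: ltW.
    by apply: ler_wpM2l => //; rewrite lerBlDr (le_trans vT)// lerDl.
  apply: ler_wpM2l; first by apply: divr_ge0; [exact: C0|exact: ltW].
  rewrite -lee_fin !(leb_itg_fin R)//; try exact: measurable_itv; try exact: itg_cts_itv.
  apply: ge0_subset_integral => //.
  - by apply/measurable_EFinP; apply: itg_meas; exact: itg_cts_itv.
  - by move=> r _; rewrite lee_fin; apply: sumr_ge0 => k _; exact: sqr_ge0.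
  - move=> r /=; rewrite !in_itv/= => /andP[ur rv]; apply/andP; split; lra.
have mzD : measurable_fun setT (fun p : R * Om => zeta (p.1, p.2 p.1) * D i (p.1, p.2 p.1)).
  by apply: measurable_funM; exact: measurable_along_path.
have IB : itg P setT (fun w => C * T * del + C / del * sqdrift D 0 T w).
  by apply: itgD => //; [exact: itg_cst|exact: itgZ].
have II := itg_le measurableT (measurable_Rint_path u v mzD) IB (fun w _ => B w).
split => //.
apply: (le_trans (le_Rint_bound measurableT II IB (fun w _ => B w))).
rewrite RintegralD//; [|exact: itg_cst|exact: itgZ].
rewrite Rint_cst_prob RintegralZl//.
have H1 : C * T * del <= e / 2 by rewrite -delE [_ * del]mulrC ler_wpM2l ?(ltW del0)// lerDl.
have H2 : C / del * \int[P]_w sqdrift D 0 T w <= e / 2.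
  apply: (@le_trans _ _ (C / del * c)); first by rewrite ler_wpM2l// divr_ge0// ltW.
  rewrite mulrAC ler_pdivrMr// mulrAC -cE mulrC ler_wpM2l//; last by rewrite lerDl.
  exact: ltW.
lra.
Qed.

(** Tested against [eta], the curl becomes an antisymmetrized pairing of the field with the first
    derivatives of [eta]. This pairing vanishes on gradients by Schwarz and is small for fields that
    are small in L^2, so it vanishes for [Psi]. *)
Lemma curl_free t x i j : 0 <= t <= T ->
  partial j (fun y => Psi t y ord0 i) x = partial i (fun y => Psi t y ord0 j) x.
Proof.
have alg (a a' p p' g g' k : R) : a = p - g -> a' = p' - g' -> g - g' = 0 -> k = p - p' -> k = a - a'.
  by move=> -> -> /eqP; rewrite subr_eq0 => /eqP -> ->; ring.
have tri (a a' q : R) : `|a| <= q / 2 -> `|a'| <= q / 2 -> `|a - a'| <= q.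
  by move=> h h'; rewrite (splitr q); apply: (le_trans (ler_normB _ _)); exact: lerD.
move=> tT; apply/eqP; rewrite -subr_eq0; apply/eqP.
have in0T s : 0 <= s <= T -> `[0, T]%classic s by rewrite /= in_itv.
have cd k l : continuous (clamped T (fun t => partial l (fun y => Psi t y ord0 k))).
  by have [_ _ c1 _] := PsiC k; exact: (clamped_continuous T0' (c1 l)).
have dP s k l y : 0 <= s <= T -> pderivable l (fun y => Psi s y ord0 k) y.
  by move=> sT; have [Hd _ _ _] := PsiC k; have [_ h _] := Hd s y (in0T _ sT).
pose K s y := partial j (fun y => Psi s y ord0 i) y - partial i (fun y => Psi s y ord0 j) y.
apply: (@fundamental_lemma_tx R d T K T0 _ _ t x tT).
  by move=> p; exact: (continuousB (@cd i j p) (@cd j i p)).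
move=> u v eta N u0 uv vT Ce eN.
have ceta := pC1_continuous Ce.1.
have eN1 k y : N < `|y| -> partial k eta y = 0 by move=> yN; exact: (@partial_eq0 R d eta N k y eN yN).
(* Division by the positive density turns a Lebesgue pairing into an expectation under [P], where
   the distance of [H_minus1] is measured; the compact support of [eta] keeps [zeta] bounded. *)
pose zeta k (p : R * 'rV[R]_d) : R := partial k eta p.2 * (clamped T mu p)^-1.
have clT s : 0 <= clamp T s <= T by exact: clamp_itv.
have mup p : 0 < clamped T mu p by apply: mu_gt0.
have cz k : continuous (zeta k).
  move=> p; apply: cvgM_fun.
    exact: (continuous_snd (Ce.1.2 k)).
  by apply: (@continuousV _ _ (clamped T mu)); [rewrite gt_eqF|exact: cmu].
have zcpt k : cpt (T := T) N (zeta k).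
  split=> [|s y|s y yN]; [exact: cz| |by rewrite /zeta /= eN1// mul0r].
  by rewrite /zeta /= /clamped /= (clamp_id (clT s)).
have [C C0 HC] : exists2 C : R, 0 <= C & forall k p, `|zeta k p| <= C.
  apply: (@family_bound R 'I_d (fun k C => forall p, `|zeta k p| <= C)) => [k|k c c' cc H p].
    exact: (cpt_bounded T0 (zcpt k)).
  exact: le_trans (H p) cc.
(* [A k l D] is the pairing of [partial k eta] with the [l]-th component of the field [D]. *)
pose A k l (D : 'I_d -> R * 'rV[R]_d -> R) := \int[P]_w \int[leb]_(r in `[u, v]) (zeta k (r, w r) * D l (r, w r)).
have AE k l (D : 'I_d -> R * 'rV[R]_d -> R) : (forall l, continuous (D l)) ->
    itg leb `[u, v] (fun r => \int[lebesgue_rV d]_x (partial k eta x * D l (r, x))) /\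
    A k l D = \int[leb]_(r in `[u, v]) \int[lebesgue_rV d]_x (partial k eta x * D l (r, x)).
  move=> cD.
  have cF : continuous (fun p => partial k eta p.2 * D l p).
    move=> p; apply: cvgM_fun; last exact: cD.
    exact: (continuous_snd (Ce.1.2 k)).
  have F0 s y : N < `|y| -> (fun p => partial k eta p.2 * D l p) (s, y) = 0 by move=> yN; rewrite /= eN1// mul0r.
  have [I1 _ _] := @fubini_supp R d T _ N u v cF F0 u0 vT; split; first exact: I1.
  have czD : continuous (fun p => zeta k p * D l p) by move=> p; exact: (continuousM (@cz k p) (cD l p)).
  have [B B0 HB] := bounded_on_box T N czD.
  have zDb r y : u <= r <= v -> `|zeta k (r, y) * D l (r, y)| <= B.
    move=> /andP[ur rv]; have [yN|yN] := leP `|y| N; last by rewrite /zeta /= eN1// !mul0r normr0.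
    by apply: HB => //; rewrite (le_trans u0 ur) (le_trans rv vT).
  have mzD : measurable_fun setT (fun p : R * Om => zeta k (p.1, p.2 p.1) * D l (p.1, p.2 p.1)).
    by apply: measurable_funM; exact: measurable_along_path.
  have Ffin : (\int[leb]_(r in `[u, v]) \int[P]_w (`|zeta k (r, w r) * D l (r, w r)|)%:E < +oo)%E.
    apply: (@le_lt_trans _ _ (\int[leb]_(r in `[u, v]) B%:E)%E).
      apply: ge0_le_integral.
      - exact: measurable_itv.
      - by move=> r _; apply: integral_ge0 => w _; rewrite lee_fin.
      - by apply: measurable_funTS; apply: (@measurable_integral_ge0 _ _ R P (fun p => `|zeta k (p.1, p.2 p.1) * D l (p.1, p.2 p.1)|)) => //; exact: measurableT_comp.
      - by [].
      move=> r /=; rewrite in_itv/= => ruv.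
      apply: (@le_trans _ _ (\int[P]_w B%:E)%E).
        apply: ge0_le_integral => //.
        - apply/measurable_EFinP; apply: measurableT_comp => //.
          exact: (measurableT_comp mzD (@pair1_measurable _ _ _ _ r)).
        - by move=> w _; rewrite lee_fin; exact: zDb.
      rewrite integral_cst//; have := @probability_setT _ _ _ P => /= ->; by rewrite mule1.
    have := leb_itg_fin R `[u, v]%classic (fun=> B) (measurable_itv _) (itg_cst_itv u v B).
    by move=> <-; exact: ltry.
  have [_ _ Eq] := fubini_path mzD Ffin.
  rewrite /A -Eq; apply: eq_Rintegral => r /set_mem /=; rewrite in_itv/= => /andP[ur rv].
  have rT : 0 <= r <= T by rewrite (le_trans u0 ur) (le_trans rv vT).
  have c2 : continuous (fun y => zeta k (r, y) * D l (r, y)).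
    exact: (@continuous_slice2 R d (fun p => zeta k p * D l p) r czD).
  have s2 y : N < `|y| -> zeta k (r, y) * D l (r, y) = 0 by move=> yN; rewrite /zeta /= eN1// !mul0r.
  have [_ ->] := expect_supp mu_dens mu_gt0 cmu rT c2 s2.
  apply: eq_Rintegral => y _; rewrite /zeta /clamped /= clamp_id//.
  by rewrite -!mulrA; congr (_ * _); rewrite mulrCA mulVf ?mulr1// gt_eqF// mu_gt0.
have KE : \int[leb]_(r in `[u, v]) \int[lebesgue_rV d]_x (eta x * K r x) = A i j ps - A j i ps.
  have [I1 ->] := AE i j ps cps; have [I2 ->] := AE j i ps cps.
  rewrite (leb_RintB R _ _ _ (measurable_itv _) I1 I2).
  apply: eq_Rintegral => r /set_mem /=; rewrite in_itv/= => /andP[ur rv].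
  have rT : 0 <= r <= T by rewrite (le_trans u0 ur) (le_trans rv vT).
  have cP k : continuous (fun y => Psi r y ord0 k) by exact: (clamped_slice rT (@cps k)).
  have cdP k l : continuous (partial l (fun y => Psi r y ord0 k)) by exact: (clamped_slice rT (@cd k l)).
  have Q k l : \int[lebesgue_rV d]_x (partial k eta x * ps l (r, x)) = - \int[lebesgue_rV d]_x (eta x * partial k (fun y => Psi r y ord0 l) x).
    rewrite -(@integration_by_parts_rV R d k eta (fun y => Psi r y ord0 l) N Ce.1 (fun y => @dP r l k y rT) (@cP l) (cdP l k) eN).
    by apply: eq_Rintegral => y _; rewrite /ps /clamped /= clamp_id.
  have J k l : itg (lebesgue_rV d) setT (fun y => eta y * partial k (fun y => Psi r y ord0 l) y).
    apply: (@integrable_supp R d _ N) => [y|y yN]; last by rewrite eN// mul0r.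
    exact: (continuousM (@ceta y) (@cdP l k y)).
  rewrite (Q i j) (Q j i) opprK addrC (RintB measurableT (J j i) (J i j)).
  by apply: eq_Rintegral => y _; rewrite /K mulrBr.
apply/eqP; rewrite -normr_le0; apply/ler_addgt0Pl => e e0; rewrite addr0.
have e20 : 0 < e / 2 by rewrite divr_gt0.
have [c1 c10 H1] := pairing_small (@cz i) (HC i) u0 uv vT e20.
have [c2 c20 H2] := pairing_small (@cz j) (HC j) u0 uv vT e20.
have c0 : 0 < Num.min c1 c2 by rewrite lt_min c10.
have [_ _ Happrox] := PsiH.
have [phi [Cphi _] Hphi] := Happrox _ c0.
pose gp k (p : R * 'rV[R]_d) : R := partial k (fun x => phi (p.1, x)) p.2.
have cgp k : continuous (gp k) by have [_ ] := class_C_slice 0 Cphi; exact.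
pose D k p := ps k p - gp k p.
have cD k : continuous (D k) by move=> p; exact: (continuousB (@cps k p) (@cgp k p)).
have DE s y k : 0 <= s <= T -> D k (s, y) = (Psi s y - grad (fun x => phi (s, x)) y) ord0 k.
  by move=> sT; rewrite /D /ps /clamped /= clamp_id// !mxE.
have HD := L2_distP P cD DE.
rewrite HD in Hphi.
have le1 : (\int[leb]_(t in `[0%R, T]) \int[P]_w (\sum_i D i (t, w t) ^+ 2)%:E <= c1%:E)%E.
  by apply: (le_trans (ltW Hphi)); rewrite lee_fin ge_min lexx.
have le2 : (\int[leb]_(t in `[0%R, T]) \int[P]_w (\sum_i D i (t, w t) ^+ 2)%:E <= c2%:E)%E.
  by apply: (le_trans (ltW Hphi)); rewrite lee_fin ge_min lexx orbT.
have [_ [_ B1]] := H1 D j cD le1; have [_ [_ B2]] := H2 D i cD le2.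
have split_A k l : A k l D = A k l ps - A k l gp.
  have [I1 E1] := AE k l D cD; have [I2 E2] := AE k l ps cps; have [I3 E3] := AE k l gp cgp.
  rewrite E1 E2 E3 (leb_RintB R _ _ _ (measurable_itv _) I2 I3).
  apply: eq_Rintegral => r _.
  have J (G : 'I_d -> R * 'rV[R]_d -> R) : (forall l, continuous (G l)) -> itg (lebesgue_rV d) setT (fun x => partial k eta x * G l (r, x)).
    move=> cG; apply: (@integrable_supp R d _ N) => [y|y yN]; last by rewrite eN1// mul0r.
    exact: (continuousM (Ce.1.2 k y) (@continuous_slice2 R d (G l) r (cG l) y)).
  rewrite (RintB measurableT (J ps cps) (J gp cgp)).
  by apply: eq_Rintegral => y _; rewrite /D mulrBr.
(* For the gradient of [phi], a second integration by parts leaves the two mixed second derivatives,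
   which coincide. *)
have A0 : A i j gp - A j i gp = 0.
  have [I1 ->] := AE i j gp cgp; have [I2 ->] := AE j i gp cgp.
  rewrite (leb_RintB R _ _ _ (measurable_itv _) I1 I2).
  rewrite (_ : (fun r => _) = fun=> 0); first by rewrite Rint_cst_itv ?(ltW uv)// mul0r.
  apply/funext => r; have [C2 _] := class_C_slice r Cphi.
  have Q k l : \int[lebesgue_rV d]_x (partial k eta x * gp l (r, x)) = - \int[lebesgue_rV d]_x (eta x * partial k (partial l (fun y => phi (r, y))) x).
    exact: (@integration_by_parts_rV R d k eta (partial l (fun y => phi (r, y))) N Ce.1 (fun y => (C2.2 l).1 k y) (C2.1.2 l) ((C2.2 l).2 k) eN).
  rewrite (Q i j) (Q j i) opprK addrC; apply/eqP; rewrite subr_eq0; apply/eqP.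
  by apply: eq_Rintegral => y _; rewrite (schwarz y i j C2).
have -> : \int[leb]_(r in `[u, v]) \int[lebesgue_rV d]_x (eta x * K r x) = A i j D - A j i D.
  exact: (alg _ _ _ _ _ _ _ (split_A i j) (split_A j i) A0 KE).
exact: (tri _ _ _ B1 B2).
Qed.

End curl_free.

Lemma abs_le_sq (R : realType) (x : R) : `|x| <= 1 + x ^+ 2.
Proof. rewrite -[x ^+ 2]real_normK ?num_real//; have := sqr_ge0 (`|x| - 1); have := normr_ge0 x; nra. Qed.

Lemma sqrD_le (R : realType) (a c e : R) : `|c| <= e -> (a + c) ^+ 2 <= 2 * a ^+ 2 + 2 * e ^+ 2.
Proof.
move=> ce; have h1 : c ^+ 2 <= e ^+ 2.
  by rewrite -[c ^+ 2]real_normK ?num_real// lerXn2r ?nnegrE//; exact: le_trans ce.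
by rewrite sqrrD; have := sqr_ge0 (a - c); rewrite sqrrB; nra.
Qed.

Lemma young_le (R : realType) (e x y Y D l : R) : 0 < e -> 0 <= x -> 0 <= y -> x ^+ 2 <= l * D -> y ^+ 2 <= Y ->
  x * y <= e * Y + e^-1 * l * D.
Proof.
move=> e0 x0 y0 hx hy; have ee : e * e^-1 = 1 by rewrite divff ?gt_eqF.
have e'0 : 0 < e^-1 by rewrite invr_gt0.
have q1 : 0 <= e * (Y - y ^+ 2) by rewrite mulr_ge0 ?(ltW e0)// subr_ge0.
have q2 : 0 <= e^-1 * (l * D - x ^+ 2) by rewrite mulr_ge0 ?(ltW e'0)// subr_ge0.
have q3 : 0 <= e^-1 * (e * y - x) ^+ 2 by rewrite mulr_ge0 ?sqr_ge0// ltW.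
have q4 : e^-1 * (e * y - x) ^+ 2 = (e * e^-1) * (e * y ^+ 2) - 2 * (e * e^-1) * (x * y) + e^-1 * x ^+ 2 by ring.
rewrite q4 ee !mul1r mulr1 in q3; have q5 : 0 <= x * y by rewrite mulr_ge0.
by rewrite mulrBr in q1; rewrite mulrBr mulrA in q2; lra.
Qed.

Lemma itg_mul (R : realType) (dY : measure_display) (Y : measurableType dY) (m : {measure set Y -> \bar R}) (f g : Y -> R) :
  measurable_fun setT f -> measurable_fun setT g ->
  itg m setT (fun w => f w ^+ 2) -> itg m setT (fun w => g w ^+ 2) -> itg m setT (fun w => f w * g w).
Proof.
move=> mf mg If Ig; apply: (itg_le measurableT (measurable_funM mf mg) (itgD measurableT If Ig)) => w _.
rewrite normrM -[f w ^+ 2]real_normK ?num_real// -[g w ^+ 2]real_normK ?num_real//.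
have alg (a c : R) : 0 <= a -> 0 <= c -> a * c <= a ^+ 2 + c ^+ 2 by move=> a0 c0; have := sqr_ge0 (a - c); nra.
exact: alg.
Qed.

(** * The martingale of the corrector *)

Section nonlocal_drift.
Context {R : realType} {d : nat} {T : R} (P : probability (path_space R d T) R).
Local Notation Om := (path_space R d T).
Local Notation leb := (@lebesgue_measure R).
Variables (ps : 'I_d -> R * 'rV[R]_d -> R) (H : 'I_d -> 'I_d -> 'rV[R]_d -> R) (C : R).
Hypotheses (T0 : 0 < T) (cps : forall i, continuous (ps i)) (cH : forall i j, continuous (H i j)).
Hypothesis HC : forall i j z, `|H i j z| <= C.
Hypothesis Hps : finite_energy P ps.

(** The independent copy of the process is a second path [w] over which [P] is integrated, at a
    fixed position of the first. [H] stands for the Hessian of [W]. *)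
Definition nonlocal (j : 'I_d) (p : R * 'rV[R]_d) : R :=
  \int[P]_w \sum_i (ps i p - ps i (p.1, w p.1)) * H i j (p.2 - w p.1).

Let T0' : 0 <= T. Proof. exact: ltW. Qed.
Let C0 : 'I_d -> 0 <= C. Proof. by move=> i; exact: le_trans (HC i i 0). Qed.
Let mI (u v : R) : measurable (`[u, v]%classic : set R). Proof. exact: measurable_itv. Qed.

Let aeF : Filter (almost_everywhere leb).
Proof. exact: (@ae_filter_ringOfSetsType _ (measurableTypeR R) R leb). Qed.

Let mps i : measurable_fun setT (fun p : R * Om => ps i (p.1, p.2 p.1)).
Proof. exact: measurable_along_path. Qed.

Let mps1 i r : measurable_fun setT (fun w : Om => ps i (r, w r)).
Proof. exact: (measurableT_comp (mps i) (@pair1_measurable _ _ _ _ r)). Qed.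

Let mcoord i : measurable_fun setT (fun p : R * Om => p.2 p.1 ord0 i).
Proof.
have := @measurable_along_path R d T (fun p => p.2 ord0 i); apply => p.
exact: continuous_snd_coord.
Qed.

Lemma measurable_nonlocal j : measurable_fun setT (fun p : R * Om => nonlocal j (p.1, p.2 p.1)).
Proof.
have m : measurable_fun setT (nonlocal j).
  pose f (q : (R * 'rV[R]_d) * Om) : R := \sum_i (ps i q.1 - ps i (q.1.1, q.2 q.1.1)) * H i j (q.1.2 - q.2 q.1.1).
  have mf : measurable_fun setT f.
    have mq : measurable_fun setT (fun q : (R * 'rV[R]_d) * Om => (q.1.1, q.2)).
      apply/measurable_fun_pairP; split; last exact: measurable_snd.
      exact: (measurableT_comp measurable_fst measurable_fst).
    apply: measurable_sum => i; apply: measurable_funM.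
      apply: measurable_funB; last exact: (measurableT_comp (mps i) mq).
      exact: (measurableT_comp (continuous_measurable_tx (@cps i)) measurable_fst).
    apply: (measurableT_comp (continuous_measurable_rV (@cH i j))).
    apply: measurable_rV => k.
    have -> : (fun q : (R * 'rV[R]_d) * Om => (q.1.2 - q.2 q.1.1) ord0 k) = fun q => q.1.2 ord0 k - q.2 q.1.1 ord0 k.
      by apply/funext => q; rewrite !mxE.
    apply: measurable_funB; last exact: (measurableT_comp (mcoord k) mq).
    apply: (measurableT_comp (measurable_coord k)).
    exact: (measurableT_comp measurable_snd measurable_fst).
  exact: (@measurable_Rint1 R _ _ (R * 'rV[R]_d)%type Om P f setT measurableT mf).
apply: (measurableT_comp m); apply/measurable_fun_pairP; split; first exact: measurable_fst.
exact: measurable_eval.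
Qed.

(** Finite energy makes almost every time good. [good_lt] later shows that every time before [T] is
    good, with the help of the martingale. *)
Definition good (r : R) : Prop := forall i, (\int[P]_w (ps i (r, w r) ^+ 2)%:E < +oo)%E.
Definition meanabs (r : R) : R := \sum_i \int[P]_w `|ps i (r, w r)|.

Lemma itg_ps_good r i : good r -> itg P setT (fun w : Om => ps i (r, w r) ^+ 2) /\ itg P setT (fun w : Om => ps i (r, w r)).
Proof.
move=> G; have I2 : itg P setT (fun w : Om => ps i (r, w r) ^+ 2).
  apply: itg_ge0P.
  - exact: measurableT.
  - exact: (measurableT_comp (exprn_measurable 2) (mps1 i r)).
  - by move=> w _; exact: sqr_ge0.
  - exact: (G i).
split => //.
apply: (itg_le measurableT (mps1 i r) (itgD measurableT (itg_cst P 1) I2)) => w _; exact: abs_le_sq.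
Qed.

Lemma nonlocal_bound r j x : good r -> `|nonlocal j (r, x)| <= C * (\sum_i `|ps i (r, x)| + meanabs r).
Proof.
move=> G; have I i : itg P setT (fun w : Om => ps i (r, w r)) by have [] := itg_ps_good i G.
have In i := itg_norm (I i).
have IH i : itg P setT (fun w : Om => (ps i (r, x) - ps i (r, w r)) * H i j (x - w r)).
  have I1 := itgB measurableT (itg_cst P (ps i (r, x))) (I i).
  have I2 := @itg_bdM _ _ _ _ _ (fun w : Om => H i j (x - w r)) _ C measurableT (measurable_path_shift x r (@cH i j)) I1 (fun w _ => HC i j _).
  by apply: (itg_eq measurableT I2) => w _; rewrite mulrC.
have IB : itg P setT (fun w : Om => C * (\sum_i `|ps i (r, x)|) + C * (\sum_i `|ps i (r, w r)|)).
  apply: itgD => //; first exact: itg_cst.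
  by apply: itgZ => //; exact: itg_sum.
have -> : C * (\sum_i `|ps i (r, x)| + meanabs r) = \int[P]_w (C * (\sum_i `|ps i (r, x)|) + C * (\sum_i `|ps i (r, w r)|)).
  rewrite RintegralD//; [|exact: itg_cst|by apply: itgZ => //; exact: itg_sum].
  by rewrite Rint_cst_prob RintegralZl//; [rewrite Rint_sum// -mulrDr|exact: itg_sum].
apply: le_Rint_bound => //; first exact: itg_sum.
move=> w _; apply: (le_trans (ler_norm_sum _ _ _)); rewrite -mulrDr -big_split /= mulr_sumr.
apply: ler_sum => i _; rewrite normrM mulrC; apply: ler_pM; [exact: normr_ge0|exact: normr_ge0|exact: HC|exact: ler_normB].
Qed.

Let mps2 i : measurable_fun setT (fun p : R * Om => ps i (p.1, p.2 p.1) ^+ 2).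
Proof. exact: (measurableT_comp (exprn_measurable 2) (mps i)). Qed.

Let mEps2 i : measurable_fun setT (fun r : R => \int[P]_w (ps i (r, w r) ^+ 2)%:E)%E.
Proof.
apply: (@measurable_integral_ge0 _ _ R P (fun p => ps i (p.1, p.2 p.1) ^+ 2)) => [|p]; [exact: mps2|exact: sqr_ge0].
Qed.

Lemma good_ae : {ae leb, forall r, `[0, T]%classic r -> good r}.
Proof.
have H1 i : {ae leb, forall r, `[0, T]%classic r -> (\int[P]_w (ps i (r, w r) ^+ 2)%:E < +oo)%E}.
  have I : leb.-integrable `[0, T] (fun r : R => \int[P]_w (ps i (r, w r) ^+ 2)%:E)%E.
    apply/integrableP; split; first by apply: measurable_funTS; exact: mEps2.
    apply: le_lt_trans (Hps i); rewrite le_eqVlt; apply/orP; left; apply/eqP.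
    by apply: eq_integral => r _; rewrite gee0_abs//; apply: integral_ge0 => w _; rewrite lee_fin sqr_ge0.
  have := @integrable_ae _ (measurableTypeR R) R leb _ (mI 0 T) _ I; apply: (@filterS _ _ aeF) => r /= h /h; rewrite ge0_fin_numE//.
  by apply: integral_ge0 => w _; rewrite lee_fin sqr_ge0.
have : {ae leb, forall r (i : 'I_d), `[0, T]%classic r -> (\int[P]_w (ps i (r, w r) ^+ 2)%:E < +oo)%E}.
  have := @filter_forall _ 'I_d (fun i r => `[0, T]%classic r -> (\int[P]_w (ps i (r, w r) ^+ 2)%:E < +oo)%E) (almost_everywhere leb) _.
  by move=> /(_ aeF); apply => i; exact: H1.
by apply: (@filterS _ _ aeF) => r h rT i; exact: h.
Qed.

Let cn i (w : Om) : continuous (fun r => `|ps i (r, w r)|).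
Proof.
move=> r; apply: (@cvg_norm _ _ _ _ _ (fun r => ps i (r, w r))).
exact: (@continuous_along_path R d T (ps i) w (@cps i) r).
Qed.

Let cn2 i (w : Om) : continuous (fun r => ps i (r, w r) ^+ 2).
Proof.
move=> r; apply: cvg_sqr.
exact: (@continuous_along_path R d T (ps i) w (@cps i) r).
Qed.

Let Eps2 i : itg P setT (fun w => \int[leb]_(r in `[0, T]) (ps i (r, w r) ^+ 2)).
Proof.
have Ffin : (\int[leb]_(t in `[0%R, T]) \int[P]_w (`|ps i (t, w t) ^+ 2|)%:E < +oo)%E.
  apply: le_lt_trans (Hps i); rewrite le_eqVlt; apply/orP; left; apply/eqP.
  by apply: eq_integral => t _; apply: eq_integral => w _; rewrite ger0_norm// sqr_ge0.
by have [] := fubini_path (mps2 i) Ffin.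
Qed.

Let Eps1 i : itg leb `[0, T] (fun r => \int[P]_w `|ps i (r, w r)|).
Proof.
have mn : measurable_fun setT (fun p : R * Om => `|ps i (p.1, p.2 p.1)|) by exact: measurableT_comp.
have Ffin : (\int[leb]_(t in `[0%R, T]) \int[P]_w (`|ps i (t, w t)|)%:E < +oo)%E.
  apply: (tonelli_path_fin mn) => [p|w|]; first exact: normr_ge0.
    by apply: itg_cts_itv; exact: cn.
  apply: (itg_le measurableT (measurable_Rint_path 0 T mn) (itgD measurableT (itg_cst P T) (Eps2 i))) => w _.
  rewrite ger0_norm; last exact: Rintegral_ge0.
  have I1 := itg_cst_itv 0 T 1; have I2 := itg_cts_itv 0 T (@cn2 i w).
  have -> : T + \int[leb]_(r in `[0, T]) (ps i (r, w r) ^+ 2) = \int[leb]_(r in `[0, T]) (1 + ps i (r, w r) ^+ 2).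
    by rewrite (leb_RintegralD R)// Rint_cst_itv// subr0 mul1r.
  apply: (leb_le_Rintegral R) => //; first by apply: itg_cts_itv; exact: cn.
    exact: (leb_itgD R).
  by move=> r _; exact: abs_le_sq.
have Fabs : (\int[leb]_(t in `[0%R, T]) \int[P]_w (`| `|ps i (t, w t)| |)%:E < +oo)%E.
  apply: le_lt_trans Ffin; rewrite le_eqVlt; apply/orP; left; apply/eqP.
  by apply: eq_integral => t _; apply: eq_integral => w _; rewrite normr_id.
by have [? ? ?] := fubini_path mn Fabs.
Qed.

Lemma itg_meanabs : itg leb `[0, T] meanabs.
Proof. exact: (leb_itg_sum R _ _ _ _ (mI 0 T) Eps1). Qed.

(** Bounds the nonlocal drift at good times. Along each path it is integrable in time, because
    [meanabs] is, even though [meanabs] need not be bounded. *)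
Definition dominator (r : R) (w : Om) : R := C * (\sum_i `|ps i (r, w r)| + meanabs r).

Let itg_dominator w : itg leb `[0, T] (dominator ^~ w).
Proof.
apply: (leb_itgZ R _ _ C (mI 0 T)); apply: (leb_itgD R _ _ _ (mI 0 T)).
  apply: (leb_itg_sum R _ _ _ _ (mI 0 T)) => i; apply: itg_cts_itv; exact: cn.
exact: itg_meanabs.
Qed.

Let sub0T u v : 0 <= u -> v <= T -> `[u, v]%classic `<=` `[0, T]%classic.
Proof. by move=> u0 vT r /=; rewrite !in_itv/= => /andP[ur rv]; rewrite (le_trans u0 ur) (le_trans rv vT). Qed.

Lemma itg_dominator_sub w u v : 0 <= u -> v <= T -> itg leb `[u, v] (dominator ^~ w).
Proof.
move=> u0 vT; apply: (leb_integrableS R `[0, T]%classic) => //; try exact: mI.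
exact: sub0T.
Qed.

Lemma meanabs_ge0 r : 0 <= meanabs r.
Proof. by apply: sumr_ge0 => i _; exact: Rintegral_ge0. Qed.

Let dominator_ge0 (j : 'I_d) r w : 0 <= dominator r w.
Proof. by rewrite mulr_ge0 ?(C0 j)// addr_ge0 ?meanabs_ge0// sumr_ge0. Qed.

(** The pointwise bound by [dominator] may fail on a null set of times, so the integrals are
    compared almost everywhere; this yields integrability and the estimate together. *)
Lemma itg_nonlocal j (w : Om) u v : 0 <= u -> v <= T ->
  itg leb `[u, v] (fun r => nonlocal j (r, w r)) /\
  `|\int[leb]_(r in `[u, v]) nonlocal j (r, w r)| <= \int[leb]_(r in `[u, v]) dominator r w.
Proof.
move=> u0 vT; have Id := itg_dominator_sub w u0 vT.
have mn : measurable_fun `[u, v]%classic (fun r => nonlocal j (r, w r)).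
  apply: measurable_funTS.
  exact: (measurableT_comp (measurable_nonlocal j) (@pair2_measurable _ _ _ _ w)).
have L : (\int[leb]_(r in `[u, v]) (`|nonlocal j (r, w r)|)%:E <= \int[leb]_(r in `[u, v]) (dominator r w)%:E)%E.
  apply: ae_ge0_le_integral.
  - exact: mI.
  - by move=> r _; rewrite lee_fin.
  - by apply/measurable_EFinP; exact: measurableT_comp.
  - by move=> r _; rewrite lee_fin; exact: dominator_ge0.
  - by apply/measurable_EFinP; exact: itg_meas Id.
  - have := good_ae; apply: (@filterS _ _ aeF) => r h ruv; rewrite lee_fin.
    by apply: nonlocal_bound; apply: h; exact: (sub0T u0 vT).
have I : itg leb `[u, v] (fun r => nonlocal j (r, w r)).
  apply/integrableP; split; first exact/measurable_EFinP.
  apply: (le_lt_trans L); rewrite -(leb_itg_fin R _ _ (mI u v) Id); exact: ltry.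
split => //.
apply: (@le_trans _ _ (\int[leb]_(r in `[u, v]) `|nonlocal j (r, w r)|)).
  by apply: (leb_le_normr_Rintegral R).
rewrite -lee_fin !(leb_itg_fin R)//.
exact: (leb_itg_norm R _ _ I).
Qed.

Definition drift_int (j : 'I_d) (t : R) (w : Om) : R := \int[leb]_(r in `[0, t]) nonlocal j (r, w r).
(** One square integrable variable that bounds [drift_int j t] for all [t <= T] at once. *)
Definition drift_bound (w : Om) : R := \int[leb]_(r in `[0, T]) dominator r w.

Lemma measurable_drift_bound : measurable_fun setT drift_bound.
Proof.
apply: (measurable_Rint_path 0 T (F := fun p : R * Om => dominator p.1 p.2)).
apply: measurable_funM => //; apply: measurable_funD.
  by apply: measurable_sum => i; apply: measurableT_comp => //; exact: mps.
apply: (measurableT_comp (f := meanabs)); last exact: measurable_fst.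
apply: measurable_sum => i.
have mn : measurable_fun setT (fun p : R * Om => `|ps i (p.1, p.2 p.1)|) by exact: measurableT_comp.
exact: (@measurable_Rint2 R _ Om P (fun p : R * Om => `|ps i (p.1, p.2 p.1)|) mn).
Qed.

Lemma drift_int_bound j t w : t <= T -> `|drift_int j t w| <= drift_bound w.
Proof.
move=> tT; have [_ B] := itg_nonlocal j w (lexx 0) tT; apply: (le_trans B).
rewrite /drift_bound -lee_fin !(leb_itg_fin R)//; last exact: (itg_dominator_sub w (lexx 0) tT).
apply: ge0_subset_integral => //.
- by apply/measurable_EFinP; exact: (itg_meas (itg_dominator w)).
- by move=> r _; rewrite lee_fin; exact: dominator_ge0.
- exact: sub0T.
Qed.

Lemma measurable_drift_int j t : measurable_fun setT (drift_int j t).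
Proof. exact: (measurable_Rint_path 0 t (measurable_nonlocal j)). Qed.

Lemma continuous_drift_int j w : {within `[0, T], continuous (fun t => drift_int j t w)}.
Proof.
apply: parameterized_integral_continuous => //.
by have [] := itg_nonlocal j w (lexx 0) (lexx T).
Qed.

Lemma drift_bound_sq : itg P setT (fun w => drift_bound w ^+ 2).
Proof.
pose g := \int[leb]_(r in `[0, T]) meanabs r.
have E (w : Om) : drift_bound w = C * (\sum_i \int[leb]_(r in `[0, T]) `|ps i (r, w r)|) + C * g.
  have I1 i : itg leb `[0, T] (fun r => `|ps i (r, w r)|) by apply: itg_cts_itv; exact: cn.
  have I2 := leb_itg_sum R _ _ (index_enum 'I_d) _ (mI 0 T) I1.
  have I3 := leb_itgD R _ _ _ (mI 0 T) I2 itg_meanabs.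
  rewrite /drift_bound /dominator (leb_RintegralZl R)//.
  rewrite (leb_RintegralD R _ _ _ (mI 0 T) I2 itg_meanabs).
  rewrite (leb_Rint_sum R _ _ _ _ (mI 0 T) I1).
  exact: mulrDr.
have B (w : Om) : `|drift_bound w ^+ 2| <= 2 * C ^+ 2 * d%:R * T * (\sum_i \int[leb]_(r in `[0, T]) (ps i (r, w r) ^+ 2)) + 2 * (C * g) ^+ 2.
  rewrite ger0_norm ?sqr_ge0// E.
  set x := \sum_i _; set s2 := (X in _ <= _ * X + _).
  have H1 : x ^+ 2 <= d%:R * (T * s2).
    apply: le_trans (sqr_sum_le _) _; rewrite ler_wpM2l// mulr_sumr; apply: ler_sum => i _.
    have I1 : itg leb `[0, T] (fun r => `|ps i (r, w r)|) by apply: itg_cts_itv; exact: cn.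
    have En : (fun r => `|ps i (r, w r)| ^+ 2) = (fun r => ps i (r, w r) ^+ 2).
      by apply/funext => r; rewrite real_normK ?num_real.
    have I2 : itg leb `[0, T] (fun r => `|ps i (r, w r)| ^+ 2) by rewrite En; apply: itg_cts_itv; exact: cn2.
    by have := sqr_Rint_le T0 I1 I2; rewrite subr0 En.
  have H2 : C ^+ 2 * x ^+ 2 <= C ^+ 2 * (d%:R * (T * s2)) by rewrite ler_wpM2l// sqr_ge0.
  have := sqr_ge0 (C * x - C * g); rewrite !exprMn; lra.
have mb : measurable_fun setT (fun w => drift_bound w ^+ 2).
  apply: (measurableT_comp (exprn_measurable 2)).
  have -> : drift_bound = fun w => C * (\sum_i \int[leb]_(r in `[0, T]) `|ps i (r, w r)|) + C * g by apply/funext => w; exact: E.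
  apply: measurable_funD => //; apply: measurable_funM => //; apply: measurable_sum => i.
  have mn : measurable_fun setT (fun p : R * Om => `|ps i (p.1, p.2 p.1)|) by exact: measurableT_comp.
  exact: (measurable_Rint_path 0 T mn).
apply: (itg_le measurableT mb _ (fun w _ => B w)).
apply: itgD => //; last exact: itg_cst.
by apply: itgZ => //; exact: itg_sum.
Qed.

Section martingale.
Definition mart (j : 'I_d) (t : R) (w : Om) : R := ps j (t, w t) - drift_int j t w.

Variable F : R -> set (set Om).
Hypothesis FX : forall t B, 0 <= t < T -> measurable B -> F t (coordp t @^-1` B).
Hypothesis FM : forall t j (B : set R), 0 <= t < T -> measurable B -> F t (mart j t @^-1` B).
Hypothesis iM : forall t j, 0 <= t < T -> itg P setT (mart j t).
Hypothesis martP : forall s t A j, 0 <= s -> s <= t -> t < T -> F s A ->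
  \int[P]_(w in A) mart j t w = \int[P]_(w in A) mart j s w.

Lemma measurable_mart j t : measurable_fun setT (mart j t).
Proof. by apply: measurable_funB; [exact: mps1|exact: measurable_drift_int]. Qed.

(** Events of [X_s] belong to [F s], so the martingale identity on events extends to weights
    [f (w s)] by transfer. *)
Lemma mart_transfer_at (f : 'rV[R]_d -> R) j s t : measurable_fun setT f -> 0 <= s -> s <= t -> t < T ->
  itg P setT (fun w : Om => f (w s) * mart j t w) -> itg P setT (fun w : Om => f (w s) * mart j s w) ->
  \int[P]_w (f (w s) * mart j t w) = \int[P]_w (f (w s) * mart j s w).
Proof.
move=> mf s0 st tT i1 i2.
have sT : 0 <= s < T by rewrite s0 (le_lt_trans st).
have tT' : 0 <= t < T by rewrite (le_trans s0).
apply: (@Rintegral_transfer R _ _ _ Om Om _ P P (coordp s) (coordp s) (mart j t) (mart j s)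
  (measurable_coordp s) (measurable_coordp s) (iM j tT') (iM j sT) _ f mf i1 i2) => A mA.
by apply: martP => //; exact: FX.
Qed.

Lemma mart_transfer_self (f : R -> R) j s t : measurable_fun setT f -> 0 <= s -> s <= t -> t < T ->
  itg P setT (fun w => f (mart j s w) * mart j t w) -> itg P setT (fun w => f (mart j s w) * mart j s w) ->
  \int[P]_w (f (mart j s w) * mart j t w) = \int[P]_w (f (mart j s w) * mart j s w).
Proof.
move=> mf s0 st tT i1 i2.
have sT : 0 <= s < T by rewrite s0 (le_lt_trans st).
have tT' : 0 <= t < T by rewrite (le_trans s0).
apply: (@Rintegral_transfer R _ _ _ Om Om _ P P (mart j s) (mart j s) (mart j t) (mart j s)
  (measurable_mart j s) (measurable_mart j s) (iM j tT') (iM j sT) _ f mf i1 i2) => A mA.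
by apply: martP => //; exact: FM.
Qed.

(* Jensen: [E (M_s^2 1_{|M_s| <= n}) = E (M_t M_s 1_{|M_s| <= n})], then let [n] tend to infinity. *)
Let mart_sq_le j s t : 0 <= s -> s <= t -> t < T -> itg P setT (fun w => mart j t w ^+ 2) ->
  itg P setT (fun w => mart j s w ^+ 2) /\ \int[P]_w (mart j s w ^+ 2) <= \int[P]_w (mart j t w ^+ 2).
Proof.
move=> s0 st tT It.
have sT : 0 <= s < T by rewrite s0 (le_lt_trans st).
have tT' : 0 <= t < T by rewrite (le_trans s0).
pose f (n : nat) (x : R) : R := if `|x| <= n%:R then x else 0.
have mf n : measurable_fun setT (f n).
  apply: measurable_fun_ifT => //.
  by apply: measurable_fun_ler => //; exact: measurableT_comp.
have fn n x : `|f n x| <= n%:R by rewrite /f; case: ifP => //; rewrite normr0.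
have ms := measurable_mart j s.
have Ifsq n : itg P setT (fun w => f n (mart j s w) ^+ 2).
  apply: (itg_le measurableT _ (itg_cst P (n%:R ^+ 2))).
    by apply: (measurableT_comp (exprn_measurable 2)); exact: (measurableT_comp (mf n) ms).
  by move=> w _; rewrite normrX lerXn2r ?nnegrE.
have Ift n : itg P setT (fun w => f n (mart j s w) * mart j t w).
  by apply: (@itg_bdM _ _ _ _ _ _ _ n%:R) => //; [exact: (measurableT_comp (mf n) ms)|exact: iM].
have Ifs n : itg P setT (fun w => f n (mart j s w) * mart j s w).
  by apply: (@itg_bdM _ _ _ _ _ _ _ n%:R) => //; [exact: (measurableT_comp (mf n) ms)|exact: iM].
apply: (@itg_limit R _ Om P setT (fun n w => f n (mart j s w) ^+ 2) (fun w => mart j s w ^+ 2)) => //.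
- exact: (measurableT_comp (exprn_measurable 2) ms).
- by move=> n w _; exact: sqr_ge0.
- move=> w _ n k nk; rewrite /f; case: ifPn => h; last by rewrite expr0n; exact: sqr_ge0.
  by rewrite (le_trans h)// ler_nat.
- move=> w _; apply: cvg_near_cst; near=> n; rewrite /f ifT//; near: n; exact: nbhs_infty_ger.
- move=> n; have E : \int[P]_w (f n (mart j s w) ^+ 2) = \int[P]_w (f n (mart j s w) * mart j t w).
    rewrite (mart_transfer_self (mf n) s0 st tT (Ift n) (Ifs n)); apply: eq_Rintegral => w _.
    by rewrite /f; case: ifP => _; rewrite ?expr2 ?mul0r.
  have L : \int[P]_w (f n (mart j s w) * mart j t w) <= \int[P]_w (2^-1 * (f n (mart j s w) ^+ 2) + 2^-1 * mart j t w ^+ 2).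
    apply: le_Rintegral => //; first by apply: itgD => //; exact: itgZ.
    move=> w _; have := sqr_ge0 (f n (mart j s w) - mart j t w); lra.
  rewrite (RintegralD measurableT (itgZ _ measurableT (Ifsq n)) (itgZ _ measurableT It)) in L.
  rewrite (RintegralZl _ measurableT (Ifsq n)) (RintegralZl _ measurableT It) -E in L.
  have alg (a b : R) : a <= 2^-1 * a + 2^-1 * b -> a <= b by lra.
  exact: alg L.
Unshelve. all: by end_near. Qed.

(** At a good time [s] after [t], the martingale is square integrable, being the difference of
    [ps j (s, w s)] and a variable bounded by [drift_bound]. Jensen's inequality carries this back
    to [t], which itself is not known to be good. *)
Lemma mart_sq j t : 0 <= t -> t < T -> itg P setT (fun w => mart j t w ^+ 2).
Proof.
move=> t0 tT.
(* Bad times form a null set, and []t, T[] has positive measure; this is where [t < T] enters. *)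
have [s [ts sT G]] : exists s, [/\ t < s, s < T & good s].
  apply: contrapT => H1.
  have sub : `]t, T[%classic `<=` [set r | ~ (`[0, T]%classic r -> good r)].
    move=> r /=; rewrite !in_itv/= => /andP[tr rT] h; apply: H1; exists r; split => //; apply: h.
    by rewrite (le_trans t0 (ltW tr)) ltW.
  have N : leb.-negligible [set r | ~ (`[0, T]%classic r -> good r)] := good_ae.
  have neg := @negligibleS _ (measurableTypeR R) R leb _ _ sub N.
  have mtT : measurable (`]t, T[%classic : set R) by exact: measurable_itv.
  have : leb (`]t, T[%classic : set R) = 0%E := (@negligibleP _ (measurableTypeR R) R leb _ mtT).1 neg.
  rewrite lebesgue_measure_itv/= lte_fin tT -EFinD => /eqP.
  by rewrite eqe subr_eq0 gt_eqF.
have [I _] := itg_ps_good j G.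
have IB : itg P setT (fun w : Om => 2 * ps j (s, w s) ^+ 2 + 2 * drift_bound w ^+ 2).
  by apply: itgD => //; apply: itgZ => //; exact: drift_bound_sq.
have Is : itg P setT (fun w => mart j s w ^+ 2).
  apply: (itg_le measurableT _ IB); first by apply: (measurableT_comp (exprn_measurable 2)); exact: measurable_mart.
  move=> w _; rewrite ger0_norm ?sqr_ge0//.
  by rewrite /mart; apply: sqrD_le; rewrite normrN; exact: drift_int_bound (ltW sT).
by have [] := mart_sq_le t0 (ltW ts) sT Is.
Qed.

Lemma mart_sq_mono j s t : 0 <= s -> s <= t -> t < T -> \int[P]_w (mart j s w ^+ 2) <= \int[P]_w (mart j t w ^+ 2).
Proof. by move=> s0 st tT; have [] := mart_sq_le s0 st tT (mart_sq j (le_trans s0 st) tT). Qed.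

(** Orthogonality of increments. The right-hand side is additive over adjacent intervals, so it can
    be part of a control in [chaining]. *)
Lemma mart_increment_sq j s t : 0 <= s -> s <= t -> t < T ->
  itg P setT (fun w => (mart j t w - mart j s w) ^+ 2) /\
  \int[P]_w ((mart j t w - mart j s w) ^+ 2) = \int[P]_w (mart j t w ^+ 2) - \int[P]_w (mart j s w ^+ 2).
Proof.
move=> s0 st tT.
have Is := mart_sq j s0 (le_lt_trans st tT); have It := mart_sq j (le_trans s0 st) tT.
have ms := measurable_mart j s; have mt := measurable_mart j t.
have Ist := itg_mul ms mt Is It.
have Iss : itg P setT (fun w => mart j s w * mart j s w) by exact: itg_mul.
have E := mart_transfer_self (@measurable_id _ _ _) s0 st tT Ist Iss.
have E2 : \int[P]_w (mart j s w * mart j s w) = \int[P]_w (mart j s w ^+ 2) by apply: eq_Rintegral => w _; rewrite expr2.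
have I1 := itgB measurableT It (itgZ 2 measurableT Ist); have I2 := itgD measurableT I1 Is.
have Eq (w : Om) : mart j t w ^+ 2 - 2 * (mart j s w * mart j t w) + mart j s w ^+ 2 = (mart j t w - mart j s w) ^+ 2 by ring.
split; first by apply: (itg_eq measurableT I2) => w _; exact: Eq.
under eq_Rintegral do rewrite -Eq.
rewrite (RintegralD measurableT I1 Is) (RintegralB measurableT It (itgZ 2 measurableT Ist)) (RintegralZl _ measurableT Ist).
have alg (a b c x : R) : x = c -> c = b -> a - 2 * x + b = a - b by move=> -> ->; ring.
exact: alg E E2.
Qed.

Lemma ps_sq j t : 0 <= t -> t < T -> itg P setT (fun w : Om => ps j (t, w t) ^+ 2).
Proof.
move=> t0 tT; have IM := mart_sq j t0 tT.
have IB : itg P setT (fun w => 2 * mart j t w ^+ 2 + 2 * drift_bound w ^+ 2).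
  by apply: itgD => //; apply: itgZ => //; exact: drift_bound_sq.
apply: (itg_le measurableT _ IB).
  exact: (measurableT_comp (exprn_measurable 2) (mps1 j t)).
move=> w _; rewrite ger0_norm ?sqr_ge0//.
have -> : ps j (t, w t) = mart j t w + drift_int j t w by rewrite subrK.
exact: sqrD_le (drift_int_bound j w (ltW tT)).
Qed.

Lemma good_lt t : 0 <= t -> t < T -> good t.
Proof. by move=> t0 tT i; rewrite -itg_fin ?ltry//; exact: ps_sq. Qed.

(** The constant involves the second moment of the martingale at [S], the largest on [[0, S]];
    finite energy alone gives no bound that is uniform in time. *)
Lemma ps_sq_bound S : 0 <= S -> S < T -> exists2 K : R, 0 <= K & forall t j, 0 <= t <= S -> \int[P]_w (ps j (t, w t) ^+ 2) <= K.
Proof.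
move=> S0 ST; pose K j := 2 * \int[P]_w (mart j S w ^+ 2) + 2 * \int[P]_w (drift_bound w ^+ 2).
have K0 j : 0 <= K j by rewrite addr_ge0// mulr_ge0//; apply: Rintegral_ge0 => w _; exact: sqr_ge0.
exists (\sum_j K j); first by apply: sumr_ge0.
move=> t j /andP[t0 tS]; apply: (@le_trans _ _ (K j)); last first.
  by rewrite (bigD1 j)//= lerDl; apply: sumr_ge0.
have tT := le_lt_trans tS ST.
have IM := mart_sq j t0 tT; have IB := drift_bound_sq.
apply: (@le_trans _ _ (\int[P]_w (2 * mart j t w ^+ 2 + 2 * drift_bound w ^+ 2))).
  apply: le_Rintegral => //; [exact: ps_sq|by apply: itgD => //; exact: itgZ|].
  move=> w _.
  have -> : ps j (t, w t) = mart j t w + drift_int j t w by rewrite subrK.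
  exact: sqrD_le (drift_int_bound j w (ltW tT)).
rewrite (RintegralD measurableT (itgZ 2 measurableT IM) (itgZ 2 measurableT IB)).
rewrite (RintegralZl _ measurableT IM) (RintegralZl _ measurableT IB) /K.
have alg (a b c : R) : a <= b -> 2 * a + 2 * c <= 2 * b + 2 * c by lra.
exact/alg/mart_sq_mono.
Qed.

(* [E (k (x - X_t) Psi_t(X_t)) = E (k (x - X_t) (M_S + A_t))], where the right-hand side no longer
   involves the value at time [t] of an unbounded function. *)
Lemma expect_weighted (k : 'rV[R]_d -> R) (K : R) j t x S : continuous k -> (forall z, `|k z| <= K) ->
  0 <= t -> t <= S -> S < T ->
  itg P setT (fun w : Om => k (x - w t) * ps j (t, w t)) /\
  \int[P]_w (k (x - w t) * ps j (t, w t)) = \int[P]_w (k (x - w t) * (mart j S w + drift_int j t w)).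
Proof.
move=> ck kK t0 tS ST; have tT := le_lt_trans tS ST.
have S0 := le_trans t0 tS.
have mk := @measurable_path_shift R d T k x t ck.
have mk' : measurable_fun setT (fun y : 'rV[R]_d => k (x - y)).
  apply: continuous_measurable_rV => y; apply/cts_rVP => e e0; have /cts_rVP /(_ e e0)[del del0 h] := ck (x - y).
  by exists del => // z zy; apply: h; rewrite subrBB distrC.
have kb w : [set: Om] w -> `|k (x - w t)| <= K by move=> _; exact: kK.
have [_ Ips] := itg_ps_good j (good_lt t0 tT).
have I0 := @itg_bdM _ _ _ _ _ _ _ K measurableT mk Ips kb; split => //.
have IS := iM j (introT andP (conj S0 ST)); have It := iM j (introT andP (conj t0 tT)).
have I1 := @itg_bdM _ _ _ _ _ _ _ K measurableT mk IS kb.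
have I2 := @itg_bdM _ _ _ _ _ _ _ K measurableT mk It kb.
have E := mart_transfer_at mk' t0 tS ST I1 I2.
have ID : itg P setT (drift_int j t).
  apply: (itg_eq measurableT (itgB measurableT Ips It)) => w _.
  by rewrite /mart opprB addrC subrK.
have I3 := @itg_bdM _ _ _ _ _ _ _ K measurableT mk ID kb.
transitivity (\int[P]_w (k (x - w t) * mart j t w) + \int[P]_w (k (x - w t) * drift_int j t w)).
  rewrite -(RintegralD measurableT I2 I3); apply: eq_Rintegral => w _; rewrite -mulrDr; congr (_ * _).
  by rewrite /mart subrK.
by rewrite -E -(RintegralD measurableT I1 I3); apply: eq_Rintegral => w _; rewrite -mulrDr.
Qed.

(** After [expect_weighted] the integrand is dominated by [K * (|M_S| + drift_bound)], which does
    not depend on the time. Fixing [S < T] is what makes this possible. *)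
Lemma continuous_weighted (k : 'rV[R]_d -> R) (K : R) j S : continuous k -> (forall z, `|k z| <= K) ->
  0 <= S -> S < T -> continuous (clamped S (fun t x => \int[P]_w (k (x - w t) * ps j (t, w t)))).
Proof.
move=> ck kK S0 ST.
have cS s : 0 <= clamp S s <= S by exact: clamp_itv.
pose f (p : R * 'rV[R]_d) (w : Om) : R := k (p.2 - w (clamp S p.1)) * (mart j S w + drift_int j (clamp S p.1) w).
have -> : clamped S (fun t x => \int[P]_w (k (x - w t) * ps j (t, w t))) = fun p => \int[P]_w f p w.
  apply/funext => p; have /andP[c0 c1] := cS p.1.
  by have [_ E] := expect_weighted j p.2 ck kK c0 c1 ST; rewrite /clamped E.
have IB2 := drift_bound_sq.
have mB := measurable_drift_bound.
have IB : itg P setT drift_bound.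
  apply: (itg_le measurableT mB (itgD measurableT (itg_cst P 1) IB2)) => w _.
  exact: abs_le_sq.
have IS := iM j (introT andP (conj S0 ST)).
pose g (w : Om) : R := K * (`|mart j S w| + drift_bound w).
have Ig : itg P setT g by apply: itgZ => //; apply: itgD => //; exact: itg_norm.
move=> p; apply: (@continuity_param R _ Om P (R * 'rV[R]_d)%type setT f p 1 g) => //.
- move=> q _; apply: measurable_funM; first exact: measurable_path_shift.
  by apply: measurable_funD; [exact: measurable_mart|exact: measurable_drift_int].
- move=> w _.
  have c1 : {for p, continuous (fun p : R * 'rV[R]_d => k (p.2 - w (clamp S p.1)))}.
    apply/cts_txP => e e0; have [del del0 h] := (cts_txP _ _).1 (@continuous_path_shift R d T k w ck (clamp S p.1, p.2)) e e0.
    exists del => // s y sp yp; apply: (h (clamp S s) y); last exact: yp.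
    exact: le_lt_trans (clamp_lip _ _ _) sp.
  have c2 : {for p, continuous (fun p : R * 'rV[R]_d => mart j S w + drift_int j (clamp S p.1) w)}.
    apply/cts_txP => e e0.
    have /subspace_continuousP /(_ (clamp S p.1)) := @continuous_drift_int j w.
    have cT : `[0, T]%classic (clamp S p.1).
      by rewrite /= in_itv/=; have /andP[-> h] := cS p.1; rewrite (le_trans h)// ltW.
    move=> /(_ cT) /cvgrPdist_le /(_ e e0); rewrite near_withinE => /nbhs_ballP[del /= del0 h].
    have alg (a b c : R) : a + b - (a + c) = - (c - b) by ring.
    exists del => // s y sp _; rewrite alg normrN; apply: h.
      by rewrite -ball_normE /= distrC; exact: le_lt_trans (clamp_lip _ _ _) sp.
    by rewrite /= in_itv/=; have /andP[-> h] := cS s; rewrite (le_trans h)// ltW.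
  exact: (continuousM c1 c2).
- move=> q w _ _; rewrite normrM; apply: ler_pM => //; apply: (le_trans (ler_normD _ _)); rewrite lerD2l.
  by apply: drift_int_bound; have /andP[_ h] := cS q.1; rewrite (le_trans h)// ltW.
Qed.

End martingale.

End nonlocal_drift.

(** * The equation of the corrector *)

Section cutoff.
Context {R : realType} {d : nat}.
Implicit Types (f g chi : 'rV[R]_d -> R).

Lemma partial_local f g (N : R) i x : (forall y, `|y| < N -> f y = g y) -> `|x| < N -> partial i f x = partial i g x.
Proof.
move=> fg xN; apply: near_eq_derive; have N0 : 0 < N - `|x| by rewrite subr_gt0.
apply/nbhs_ballP; exists (N - `|x|) => //= y; rewrite -ball_normE /= => xy; apply: fg.
have := ler_normB x (x - y); rewrite opprB addrC subrK => h.
by apply: (le_lt_trans h); rewrite -ltrBrDl.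
Qed.

Lemma bounded_supp f (N : R) : continuous f -> (forall x, N < `|x| -> f x = 0) -> exists2 C : R, 0 <= C & forall x, `|f x| <= C.
Proof.
move=> cf f0; have c2 : continuous (fun p : R * 'rV[R]_d => f p.2).
  exact: (continuous_snd cf).
have [C C0 HC] := bounded_on_box 0 N c2.
exists C => // x; have [xN|xN] := leP `|x| N; last by rewrite f0// normr0.
by apply: (HC 0 x) => //; rewrite lexx.
Qed.

Lemma continuous_tx_eq (I : set R) (f g : R -> 'rV[R]_d -> R) : (forall t x, I t -> f t x = g t x) ->
  continuous_tx I f -> continuous_tx I g.
Proof.
move=> fg /continuous_txP H; apply/continuous_txP => t x It e e0.
have [del del0 h] := H t x It e e0; exists del => // s y Is st yx; rewrite -!fg//; exact: h.
Qed.

Lemma C12M_static (T : R) (f : R -> 'rV[R]_d -> R) chi : 0 < T -> C12 `[0, T] f -> pC2 chi ->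
  C12 `[0, T] (fun t x => f t x * chi x).
Proof.
move=> T0 [Hd [cf cdf] c1 c2] [cC cC']; set I := `[0, T]%classic in Hd cf cdf c1 c2 *.
have cM (h : R -> 'rV[R]_d -> R) k : continuous_tx I h -> continuous k -> continuous_tx I (fun t x => h t x * k x).
  by move=> ch /(continuous_tx_static (I := I)) ck p; exact: cvgM (ch p) (ck p).
have cD (h k : R -> 'rV[R]_d -> R) : continuous_tx I h -> continuous_tx I k -> continuous_tx I (fun t x => h t x + k t x).
  by move=> ch ck p; exact: cvgD (ch p) (ck p).
have E1 t i x : I t -> pderivable i (fun y => f t y * chi y) x /\
    partial i (fun y => f t y * chi y) x = f t x * partial i chi x + chi x * partial i (f t) x.
  by move=> It; have [_ h _] := Hd t x It; exact: (partialM (h i) (cC.1 i x)).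
have E1' t i : I t -> partial i (fun y => f t y * chi y) = fun x => f t x * partial i chi x + chi x * partial i (f t) x.
  by move=> It; apply/funext => x; have [] := E1 t i x It.
have E2 t i j x : I t -> pderivable j (partial i (fun y => f t y * chi y)) x /\
    partial j (partial i (fun y => f t y * chi y)) x =
    (f t x * partial j (partial i chi) x + partial i chi x * partial j (f t) x) +
    (chi x * partial j (partial i (f t)) x + partial i (f t) x * partial j chi x).
  move=> It; rewrite (E1' _ _ It); have [_ h1 h2] := Hd t x It.
  have [a1 a2] := partialM (h1 j) ((cC' i).1 j x); have [b1 b2] := partialM (cC.1 j x) (h2 i j).
  by have [c1' c2'] := partialD a1 b1; split => //; rewrite c2' a2 b2.
have tq t x : I t -> time_quot (fun t x => f t x * chi x) t x @ within I t^' --> dt I f t x * chi x.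
  move=> It; have -> : time_quot (fun t x => f t x * chi x) t x = fun s => time_quot f t x s * chi x.
    by apply/funext => s; rewrite /time_quot -mulrBl mulrA.
  by have [h _ _] := Hd t x It; apply: cvgM; [exact: h|exact: cvg_cst].
split.
- move=> t x It; split=> [|i|i j]; [by apply/cvg_ex; eexists; exact: tq|by have [] := E1 t i x It|by have [] := E2 t i j x It].
- split; first exact: (cM _ _ cf (pC1_continuous cC)).
  apply: continuous_tx_eq (cM _ _ cdf (pC1_continuous cC)) => t x It; apply/esym.
  by apply: (dt_unique _ (tq t x It)); apply: limit_time_cc => //; move: It; rewrite /I /= in_itv.
- move=> i; apply: (@continuous_tx_eq I (fun t x => f t x * partial i chi x + partial i (f t) x * chi x)).
    by move=> t x It; rewrite (E1 t i x It).2 [X in _ + X]mulrC.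
  by apply: cD; apply: cM => //; [exact: (cC.2 i)|exact: pC1_continuous].
- move=> i j; apply: (@continuous_tx_eq I (fun t x => (f t x * partial j (partial i chi) x + partial j (f t) x * partial i chi x) +
    (partial j (partial i (f t)) x * chi x + partial i (f t) x * partial j chi x))).
    by move=> t x It; rewrite (E2 t i j x It).2 [X in (_ + X) + _]mulrC [X in _ + (X + _)]mulrC.
  by apply: (cD); apply: (cD); apply: cM => //; [exact: ((cC' i).2 j)|exact: (cC.2 i)|exact: pC1_continuous|exact: (cC.2 j)].
Qed.

End cutoff.

Lemma jump_bound_arith (R : realFieldType) (D y k : R) : 1 <= k -> 0 <= y -> D <= y -> 4 * D <= 4 * k * y.
Proof. nra. Qed.

Lemma tail_bound_arith (R : realFieldType) (p c x q y k z J : R) : 0 <= c -> 0 <= k -> 1 <= J -> p <= c + x + y ->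
  x <= q + k -> y <= z + 1 -> p <= q + (c + k + 1) * J + z.
Proof. nra. Qed.

(** The bookkeeping of [local_residual] in plain letters: [Ex] is the weighted increment, [Dr] that
    of the drift, [Tl] the tail, [G] and [Al] the time integrals of the generator and of the
    nonlocal term; [h], [p], [m] are the three parts of the control. *)
Lemma residual_bound_arith (R : realFieldType) (e h p m G Al Ex Dr Tl dl E Q KK ep c n : R) :
  let e4 := e / 4 in let Z := dl^-1 * Q + 48 * (KK * c * n) + 4 * (KK * c * n) + KK * E in
  0 < h -> 0 <= p -> 0 <= m -> dl * E <= e4 -> KK * ep <= e4 -> Z * h <= e4 ->
  0 <= dl^-1 * Q -> 0 <= KK * c * n -> 0 <= KK * E ->
  Ex + Tl - Dr = 0 -> `|Ex - G| <= e4 * (h + p) ->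
  `|Dr - Al| <= h * (dl * E + dl^-1 * (Q * h)) ->
  `|Tl| <= KK * (ep * m + c * (48 * n * h ^+ 2 + 4 * n * h * p) + E * h ^+ 2) ->
  `|G - Al| <= e * (h + p + m).
Proof.
move=> e4 Z h0 p0 m0 hE hK hZ q1 q2 q3 ex x1 x2 x3.
have -> : G - Al = - (Ex - G) + (Dr - Al) - Tl by rewrite (_ : Ex = Dr - Tl); [ring|move: ex; lra].
apply: (le_trans (ler_normB _ _)); apply: (@le_trans _ _ (e4 * (h + p) + h * (dl * E + dl^-1 * (Q * h)) +
  KK * (ep * m + c * (48 * n * h ^+ 2 + 4 * n * h * p) + E * h ^+ 2))).
  apply: lerD => //; apply: (le_trans (ler_normD _ _)); rewrite normrN; exact: lerD.
set a := dl^-1 * Q in q1 Z hZ; set B := KK * c * n in q2 Z hZ; set D := KK * E in q3 Z hZ.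
have -> : e4 * (h + p) + h * (dl * E + dl^-1 * (Q * h)) + KK * (ep * m + c * (48 * n * h ^+ 2 + 4 * n * h * p) + E * h ^+ 2)
  = e4 * (h + p) + (dl * E) * h + (KK * ep) * m + h * (a * h + 48 * B * h + 4 * B * p + D * h).
  by rewrite /a /B /D; ring.
have y1 : dl * E * h <= e4 * h by rewrite ler_wpM2r// ltW.
have y2 : KK * ep * m <= e4 * m by rewrite ler_wpM2r.
have y3 : a * h + 48 * B * h + 4 * B * p + D * h <= Z * (h + p).
  have p1 : 0 <= a * p by rewrite mulr_ge0.
  have p2 : 0 <= B * h by rewrite mulr_ge0// ltW.
  have p3 : 0 <= B * p by rewrite mulr_ge0.
  have p4 : 0 <= D * p by rewrite mulr_ge0.
  have -> : Z * (h + p) = a * h + 48 * B * h + 4 * B * p + D * h + (a * p + 4 * (B * h) + 48 * (B * p) + D * p).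
    by rewrite /Z; ring.
  by rewrite lerDl; lra.
have y4 : h * (a * h + 48 * B * h + 4 * B * p + D * h) <= h * (Z * (h + p)) by rewrite ler_wpM2l// ltW.
have y5 : h * (Z * (h + p)) <= e4 * (h + p).
  by rewrite mulrA [h * Z]mulrC ler_wpM2r// addr_ge0// ltW.
have e40 : 0 <= e4.
  apply: le_trans hZ; rewrite mulr_ge0 ?(ltW h0)// /Z; lra.
have E4 : e = 4 * e4 by rewrite /e4; field.
have z1 : 0 <= e4 * h by rewrite mulr_ge0// ltW.
have z2 : 0 <= e4 * p by rewrite mulr_ge0.
have z3 : 0 <= e4 * m by rewrite mulr_ge0.
rewrite E4 -mulrA !mulrDr; rewrite mulrDr in y5; lra.
Qed.

Section corrector_equation.
Context {R : realType} {d : nat} {T : R} (P : probability (path_space R d T) R).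
Local Notation Om := (path_space R d T).
Local Notation leb := (@lebesgue_measure R).
Variable b : 'I_d -> R * 'rV[R]_d -> R.
Hypotheses (T0 : 0 < T) (cb : forall i, continuous (b i)).
Hypothesis indep : independent_noise P b.
Hypothesis Hb : finite_energy P b.

Variables (psi : 'I_d -> R -> 'rV[R]_d -> R) (H : 'I_d -> 'I_d -> 'rV[R]_d -> R) (C : R).
Hypotheses (psiC : forall i, C12 `[0, T] (psi i)) (cH : forall i j, continuous (H i j)).
Hypothesis HC : forall i j z, `|H i j z| <= C.
Let ps i := clamped T (psi i).
Hypothesis Hps : finite_energy P ps.
Variable F : R -> set (set Om).
Hypothesis FX : forall t B, 0 <= t < T -> measurable B -> F t (coordp t @^-1` B).
Hypothesis FM : forall t j (B : set R), 0 <= t < T -> measurable B -> F t (mart P ps H j t @^-1` B).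
Hypothesis iM : forall t j, 0 <= t < T -> itg P setT (mart P ps H j t).
Hypothesis martP : forall s t A j, 0 <= s -> s <= t -> t < T -> F s A ->
  \int[P]_(w in A) mart P ps H j t w = \int[P]_(w in A) mart P ps H j s w.

Let cps i : continuous (ps i).
Proof. by have [_ [cf _] _ _] := psiC i; apply: clamped_continuous => //; exact: ltW. Qed.

Let mI (u v : R) : measurable (`[u, v]%classic : set R). Proof. exact: measurable_itv. Qed.

Let C0 : 'I_d -> 0 <= C. Proof. by move=> i; exact: le_trans (HC i i 0). Qed.

(** * Estimates on an interval that ends before [T] *)

Section upto.
Variables (S Ks : R).
Hypotheses (S0 : 0 < S) (ST : S < T) (Ks0 : 0 <= Ks).
Hypothesis HKs : forall t j, 0 <= t <= S -> \int[P]_w (ps j (t, w t) ^+ 2) <= Ks.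

Let gS r : 0 <= r <= S -> good P ps r.
Proof.
move=> /andP[r0 rS].
exact: (good_lt T0 cps cH HC Hps FM iM martP r0 (le_lt_trans rS ST)).
Qed.

Definition meanbound := d%:R * (1 + Ks).
Let meanabs_le r : 0 <= r <= S -> meanabs P ps r <= meanbound.
Proof.
move=> rS; rewrite /meanbound -[d in d%:R]card_ord -sum1_card natr_sum mulr_suml; apply: ler_sum => i _.
have [I2 I1] := itg_ps_good cps i (gS rS); have Ic := itg_cst P 1.
rewrite mul1r; apply: (@le_trans _ _ (\int[P]_w (1 + ps i (r, w r) ^+ 2))).
  apply: le_Rintegral; [exact: measurableT|exact: itg_norm|exact: (itgD measurableT Ic I2)|by move=> w _; exact: abs_le_sq].
by rewrite (RintegralD measurableT Ic I2) Rint_cst_prob lerD2l; exact: HKs.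
Qed.

(* A bound of the nonlocal drift that is continuous along every path. *)
Definition envelope (r : R) (w : Om) : R := C * (\sum_i `|ps i (r, w r)| + meanbound).

Lemma nonlocal_envelope j r (w : Om) : 0 <= r <= S -> `|nonlocal P ps H j (r, w r)| <= envelope r w.
Proof.
move=> rS; apply: (le_trans (nonlocal_bound cps cH HC j (w r) (gS rS))).
by rewrite ler_wpM2l ?(C0 j)// lerD2l; exact: meanabs_le.
Qed.

Let continuous_envelope w : continuous (envelope ^~ w).
Proof.
move=> r; apply: cvgM_fun; first exact: cvg_cst.
apply: cvgD_fun; last exact: cvg_cst.
apply: cvg_sum_fin => i; apply: (@cvg_norm _ _ _ _ _ (fun r => ps i (r, w r))).
exact: (@continuous_along_path R d T (ps i) w (@cps i) r).
Qed.

Let measurable_envelope : measurable_fun setT (fun p : R * Om => envelope p.1 p.2).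
Proof.
apply: measurable_funM => //; apply: measurable_funD => //; apply: measurable_sum => i.
by apply: measurableT_comp => //; exact: measurable_along_path.
Qed.

(** Bound for the second moment of [envelope] on [[0, S]]: the factors 2 come from squaring a sum of
    two terms, the factor [d%:R] in front of the moments from squaring a sum over the
    coordinates. *)
Definition envelope2 := 2 * C ^+ 2 * d%:R * (d%:R * Ks) + 2 * C ^+ 2 * meanbound ^+ 2.

Let envelope2_ge0 : 0 <= envelope2.
Proof.
exact: (addr_ge0 (mulr_ge0 (mulr_ge0 (mulr_ge0 (ler0n R 2) (sqr_ge0 C)) (ler0n R d)) (mulr_ge0 (ler0n R d) Ks0))
  (mulr_ge0 (mulr_ge0 (ler0n R 2) (sqr_ge0 C)) (sqr_ge0 meanbound))).
Qed.

Lemma envelope_sq r : 0 <= r <= S -> itg P setT (fun w => envelope r w ^+ 2) /\ \int[P]_w (envelope r w ^+ 2) <= envelope2.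
Proof.
move=> rS; pose q (w : Om) := \sum_i ps i (r, w r) ^+ 2.
have I i : itg P setT (fun w : Om => ps i (r, w r) ^+ 2) by have [] := itg_ps_good cps i (gS rS).
have Iq : itg P setT q by exact: itg_sum.
have Ic := itg_cst P (2 * C ^+ 2 * meanbound ^+ 2).
have B (w : Om) : envelope r w ^+ 2 <= 2 * C ^+ 2 * d%:R * q w + 2 * C ^+ 2 * meanbound ^+ 2.
  have h : (\sum_i `|ps i (r, w r)|) ^+ 2 <= d%:R * q w.
    apply: le_trans (sqr_sum_le _) _; rewrite ler_wpM2l//; apply: ler_sum => i _.
    by rewrite real_normK ?num_real.
  rewrite /envelope; have alg (x mm Q c : R) : x ^+ 2 <= Q -> (c * (x + mm)) ^+ 2 <= 2 * c ^+ 2 * Q + 2 * c ^+ 2 * mm ^+ 2.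
    move=> xQ; have h1 : 0 <= c ^+ 2 * (Q - x ^+ 2) by rewrite mulr_ge0 ?sqr_ge0// subr_ge0.
    by have := sqr_ge0 (c * (x - mm)); rewrite exprMn sqrrB exprMn sqrrD; nra.
  by rewrite -mulrA; apply: alg.
have IB := itgD measurableT (itgZ (2 * C ^+ 2 * d%:R) measurableT Iq) Ic.
have mE : measurable_fun setT (envelope r).
  exact: (measurableT_comp measurable_envelope (@pair1_measurable _ _ _ _ r)).
have IE : itg P setT (fun w => envelope r w ^+ 2).
  apply: (itg_le measurableT _ IB); first exact: (measurableT_comp (exprn_measurable 2) mE).
  by move=> w _; rewrite ger0_norm ?sqr_ge0//; exact: B.
split => //; apply: (@le_trans _ _ (\int[P]_w (2 * C ^+ 2 * d%:R * q w + 2 * C ^+ 2 * meanbound ^+ 2))).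
  by apply: le_Rintegral => // w _; exact: B.
rewrite (RintegralD measurableT (itgZ _ measurableT Iq) Ic) (RintegralZl _ measurableT Iq) Rint_cst_prob /envelope2 lerD2r.
apply: ler_wpM2l; first exact: (mulr_ge0 (mulr_ge0 (ler0n R 2) (sqr_ge0 C)) (ler0n R d)).
rewrite /q Rint_sum//.
rewrite -[d in d%:R]card_ord -sum1_card natr_sum mulr_suml; apply: ler_sum => i _.
by rewrite mul1r; exact: HKs.
Qed.

Lemma drift_increment j u v (w : Om) : 0 <= u -> u <= v -> v <= S ->
  drift_int P ps H j v w - drift_int P ps H j u w = \int[leb]_(r in `[u, v]) nonlocal P ps H j (r, w r).
Proof.
move=> u0 uv vS; have vT := le_trans vS (ltW ST).
have [I _] := itg_nonlocal T0 cps cH HC Hps j w (lexx 0) vT.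
by rewrite /drift_int (Rint_split u0 uv I) addrC addKr.
Qed.

Lemma drift_increment_le j u v (w : Om) : 0 <= u -> u <= v -> v <= S ->
  `|drift_int P ps H j v w - drift_int P ps H j u w| <= \int[leb]_(r in `[u, v]) envelope r w.
Proof.
move=> u0 uv vS; rewrite drift_increment//; have vT := le_trans vS (ltW ST).
have [I _] := itg_nonlocal T0 cps cH HC Hps j w u0 vT.
apply: (@le_trans _ _ (\int[leb]_(r in `[u, v]) `|nonlocal P ps H j (r, w r)|)).
  by apply: (leb_le_normr_Rintegral R).
apply: (leb_le_Rintegral R) => //.
- exact: (leb_itg_norm R _ _ I).
- by apply: itg_cts_itv; exact: continuous_envelope.
- move=> r; rewrite /= in_itv/= => /andP[ur rv]; apply: nonlocal_envelope.
  by rewrite (le_trans u0 ur) (le_trans rv vS).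
Qed.

Lemma envelope_int_sq u v : 0 <= u -> u < v -> v <= S ->
  itg P setT (fun w => (\int[leb]_(r in `[u, v]) envelope r w) ^+ 2) /\
  \int[P]_w ((\int[leb]_(r in `[u, v]) envelope r w) ^+ 2) <= envelope2 * (v - u) ^+ 2.
Proof.
move=> u0 uv vS.
have m2 : measurable_fun setT (fun p : R * Om => envelope p.1 p.2 ^+ 2).
  exact: (measurableT_comp (exprn_measurable 2) measurable_envelope).
have [I B] := tonelli_path_bound (c := envelope2) (ltW uv) m2 (fun p => sqr_ge0 _) (fun r (h : u <= r <= v) =>
   envelope_sq (introT andP (conj (le_trans u0 (andP h).1) (le_trans (andP h).2 vS)))).
have c2 w : itg leb `[u, v] (fun r => envelope r w ^+ 2).
  apply: itg_cts_itv => r; apply: cvg_sqr.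
  exact: continuous_envelope.
have L (w : Om) : (\int[leb]_(r in `[u, v]) envelope r w) ^+ 2 <= (v - u) * \int[leb]_(r in `[u, v]) envelope r w ^+ 2.
  by apply: sqr_Rint_le => //; apply: itg_cts_itv; exact: continuous_envelope.
have IZ := itgZ (v - u) measurableT I.
have IE : itg P setT (fun w => (\int[leb]_(r in `[u, v]) envelope r w) ^+ 2).
  apply: (itg_le measurableT _ IZ).
    apply: (measurableT_comp (exprn_measurable 2)).
    exact: (measurable_Rint_path u v measurable_envelope).
  by move=> w _; rewrite ger0_norm ?sqr_ge0//; exact: L.
split => //; apply: (@le_trans _ _ (\int[P]_w ((v - u) * \int[leb]_(r in `[u, v]) envelope r w ^+ 2))).
  by apply: le_Rintegral => // w _; exact: L.
rewrite (RintegralZl _ measurableT I).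
have alg (h x k : R) : 0 <= h -> x <= k * h -> h * x <= k * h ^+ 2.
  by move=> h0 xk; rewrite expr2 mulrA mulrC ler_wpM2r.
by apply: alg B; rewrite subr_ge0 ltW.
Qed.

Section local.
Variables (j : 'I_d) (phi chi : 'rV[R]_d -> R) (N M Kphi Lphi Kchi : R).
Hypotheses (cphi : continuous phi) (bphi : forall x, `|phi x| <= Kphi) (lphi : forall x y, `|phi x - phi y| <= Lphi * `|x - y|).
Hypotheses (phiN : forall x, N < `|x| -> phi x = 0) (Lphi0 : 0 <= Lphi).
Hypotheses (chiC : pC2 chi) (bchi : forall x, `|chi x| <= Kchi) (chi1 : forall x, `|x| <= N + 1 -> chi x = 1)
  (chi0 : forall x, M < `|x| -> chi x = 0).

Let Kphi0 : 0 <= Kphi. Proof. exact: le_trans (normr_ge0 _) (bphi 0). Qed.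

Let Kchi0 : 0 <= Kchi. Proof. exact: le_trans (normr_ge0 _) (bchi 0). Qed.

(** Cutting off by [chi] gives a compactly supported function to which [local_ito] applies. The
    weight [phi] lives in radius [N] while [chi] is 1 up to radius [N + 1]: a path that starts in
    the support of [phi] and leaves the plateau has moved by more than 1. *)
Let g t x := psi j t x * chi x.
Let gC : C12 `[0, T] g. Proof. exact: C12M_static. Qed.
Let gN t x : 0 <= t <= T -> M < `|x| -> g t x = 0. Proof. by move=> _ h; rewrite /g chi0// mulr0. Qed.
Let cphi2 : exists K, forall x, `|phi x| <= K. Proof. by exists Kphi. Qed.

Let mphi t : measurable_fun setT (fun w : Om => phi (w t)).
Proof. by apply: measurable_at; exact: continuous_measurable_rV. Qed.

(** Majorant of the indicator of displacements larger than 1: in some coordinate the noise [n] or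
    the drift integral [D] exceeds 1/2, and then [16 n^4 >= 1] or [4 D^2 >= 1]. Its expectation is
    of order [h] times [h] plus the energy, thanks to the fourth moment of the noise. *)
Definition big_jump (u v : R) (w : Om) : R := \sum_i 16 * noise b u v w ord0 i ^+ 4 + 4 * d%:R * (v - u) * energy b u v w.

Let jump1 u v (w : Om) : u < v -> 1 < `|w v - w u| -> 1 <= big_jump u v w.
Proof.
move=> uv h0; have [i h] : exists i, 1 < `|(w v - w u) ord0 i|.
  apply: contrapT => H1; move: h0; apply/negP; rewrite -leNgt; apply: norm_le_coord => // i.
  by rewrite leNgt; apply/negP => h; apply: H1; exists i.
have h1 : 1 <= 16 * noise b u v w ord0 i ^+ 4 + 4 * driftint b u v w i ^+ 2.
  have E : noise b u v w ord0 i + driftint b u v w i = (w v - w u) ord0 i by rewrite !mxE subrK.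
  rewrite -E in h; have alg (n D : R) : 1 < `|n + D| -> 1 <= 16 * n ^+ 4 + 4 * D ^+ 2.
    move=> hn; have h2 : 1 <= (n + D) ^+ 2.
      by rewrite -[X in _ <= X]real_normK ?num_real// -[1](expr1n _ 2) lerXn2r ?nnegrE// ltW.
    have := sqr_ge0 (n - D); have := sqr_ge0 (16 * n ^+ 2 - 2); rewrite !sqrrD sqrrN !expr2 in h2 *; nra.
  exact: alg.
rewrite /big_jump; apply: (le_trans h1); apply: lerD.
  rewrite (bigD1 i)//= lerDl; apply: sumr_ge0 => k _; apply: mulr_ge0 => //; exact: (exprn_even_ge0 _ (isT : ~~ odd 4)).
have d1 : 1 <= d%:R :> R by rewrite ler1n; exact: leq_ltn_trans (leq0n i) (ltn_ord i).
have := driftint_sq cb w i uv; set D := driftint b u v w i ^+ 2; set e := energy _ _ _ _ => hD.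
have e0 : 0 <= e by exact: energy_ge0.
have D0 : 0 <= (v - u) * e by rewrite mulr_ge0// subr_ge0 ltW.
by rewrite -mulrA; exact: jump_bound_arith.
Qed.

Let itg_big u v : 0 <= u -> u < v -> v <= T -> itg P setT (big_jump u v) /\
  \int[P]_w big_jump u v w <= 48 * d%:R * (v - u) ^+ 2 + 4 * d%:R * (v - u) * \int[leb]_(r in `[u, v]) power P b r.
Proof.
move=> u0 uv vT; have [_ IE E] := energy_fubini cb Hb u0 vT.
have I4 i : itg P setT (fun w => 16 * noise b u v w ord0 i ^+ 4).
  by apply: itgZ => //; exact: (itg_noise cb indep u0 uv vT i (isT : (4 <= 4)%N)).
have I5 : itg P setT (fun w => \sum_i 16 * noise b u v w ord0 i ^+ 4) by exact: itg_sum.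
have I6 := itgZ (4 * d%:R * (v - u)) measurableT IE.
split; first exact: (itgD measurableT I5 I6).
rewrite /big_jump (RintegralD measurableT I5 I6) (RintegralZl _ measurableT IE) E lerD2r Rint_sum//.
have E48 (h : R) : 48 * d%:R * h = \sum_(i < d) 48 * h.
  by rewrite sumr_const card_ord -mulr_natr; ring.
rewrite E48; apply: ler_sum => i _.
rewrite (RintegralZl _ measurableT (itg_noise cb indep u0 uv vT i (isT : (4 <= 4)%N))).
have := noise_fourth cb indep u0 uv vT i; set x := \int[P]_w _; set h := (v - u) ^+ 2.
have alg (y k : R) : y <= 3 * k -> 16 * y <= 48 * k by lra.
exact: alg.
Qed.

Let MM := mart P ps H j.
Let IMs t : 0 <= t -> t <= S -> itg P setT (MM t).
Proof. by move=> t0 tS; apply: iM; rewrite t0 (le_lt_trans tS ST). Qed.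

Let IX t : 0 <= t -> t <= S -> itg P setT (fun w : Om => ps j (t, w t)).
Proof. by move=> t0 tS; have [] := itg_ps_good cps j (gS (introT andP (conj t0 tS))). Qed.

Definition tail (u v : R) (w : Om) : R := phi (w u) * (ps j (v, w v) * (1 - chi (w v))).

(* The increment of [Psi(X) - Psi chi (X)] only contributes on large displacements. *)
Lemma tail_bound (CN e u v : R) (w : Om) : 0 <= CN -> (forall t x, 0 <= t <= T -> `|x| <= N -> `|ps j (t, x)| <= CN) ->
  0 < e -> 0 <= u -> u < v -> v <= S ->
  `|tail u v w| <= Kphi * (1 + Kchi) * (e * (MM v w - MM u w) ^+ 2 + (CN + e^-1 + 1) * big_jump u v w
     + (\int[leb]_(r in `[u, v]) envelope r w) ^+ 2).
Proof.
move=> CN0 HCN e0 u0 uv vS; have uT : 0 <= u <= T by rewrite u0 (le_trans (ltW uv))// (le_trans vS)// ltW.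
have e'0 : 0 < e^-1 by rewrite invr_gt0.
have BJ0 : 0 <= big_jump u v w.
  apply: addr_ge0; last by apply: mulr_ge0; [apply: mulr_ge0; [exact: mulr_ge0|rewrite subr_ge0 ltW]|exact: energy_ge0].
  by apply: sumr_ge0 => k _; apply: mulr_ge0 => //; exact: (exprn_even_ge0 _ (isT : ~~ odd 4)).
have KK0 : 0 <= Kphi * (1 + Kchi) by rewrite mulr_ge0// addr_ge0.
have M0 : 0 <= (MM v w - MM u w) ^+ 2 by exact: sqr_ge0.
have A0 : 0 <= (\int[leb]_(r in `[u, v]) envelope r w) ^+ 2 by exact: sqr_ge0.
have RHS0 : 0 <= e * (MM v w - MM u w) ^+ 2 + (CN + e^-1 + 1) * big_jump u v w + (\int[leb]_(r in `[u, v]) envelope r w) ^+ 2.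
  by apply: addr_ge0 => //; apply: addr_ge0; apply: mulr_ge0 => //; [exact: ltW|apply: addr_ge0 => //; apply: addr_ge0 => //; exact: ltW].
have [uN|uN] := leP `|w u| N; last by rewrite /tail phiN// mul0r normr0; exact: mulr_ge0.
have [vN|vN] := leP `|w v| (N + 1); first by rewrite /tail chi1// subrr !mulr0 normr0; exact: mulr_ge0.
have J1 : 1 <= big_jump u v w.
  apply: jump1 => //; have h := lerB_dist (w v) (w u).
  by apply: lt_le_trans h; rewrite ltrBrDl; apply: le_lt_trans vN; rewrite lerD2r.
have D1 := drift_increment_le j w u0 (ltW uv) vS.
(* The corrector at time [v] is compared with its value at time [u], where the position lies in the
   support of [phi] and [CN] applies; no bound on the corrector far away is needed. *)
have Eps : ps j (v, w v) = ps j (u, w u) + (MM v w - MM u w) + (drift_int P ps H j v w - drift_int P ps H j u w).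
  have alg (a a' c c' : R) : a = a' + (a - c - (a' - c')) + (c - c') by ring.
  exact: alg.
have B1 : `|ps j (v, w v)| <= CN + `|MM v w - MM u w| + \int[leb]_(r in `[u, v]) envelope r w.
  rewrite Eps; apply: (le_trans (ler_normD _ _)); apply: lerD => //; apply: (le_trans (ler_normD _ _)).
  by rewrite lerD2r; exact: HCN.
(* The square of the martingale increment gets the small factor [e]; the constant [e^-1] is absorbed
   by [big_jump], which is at least 1 here. *)
have hM : `|MM v w - MM u w| <= e * (MM v w - MM u w) ^+ 2 + e^-1.
  have alg (x : R) : `|x| <= e * x ^+ 2 + e^-1.
    rewrite -[x ^+ 2]real_normK ?num_real//; have ee : e * e^-1 = 1 by rewrite divff ?gt_eqF.
    have h1 : 0 <= e^-1 * (e * `|x| - 1) ^+ 2 by rewrite mulr_ge0 ?sqr_ge0// ltW.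
    have E : e^-1 * (e * `|x| - 1) ^+ 2 = (e * e^-1) * (e * `|x| ^+ 2) - 2 * (e * e^-1) * `|x| + e^-1 by ring.
    rewrite E ee !mul1r mulr1 in h1; have := normr_ge0 x; lra.
  exact: alg.
have hA : \int[leb]_(r in `[u, v]) envelope r w <= (\int[leb]_(r in `[u, v]) envelope r w) ^+ 2 + 1.
  by rewrite addrC; apply: le_trans (abs_le_sq _); exact: ler_norm.
have B2 : `|ps j (v, w v)| <= e * (MM v w - MM u w) ^+ 2 + (CN + e^-1 + 1) * big_jump u v w + (\int[leb]_(r in `[u, v]) envelope r w) ^+ 2.
  exact: (@tail_bound_arith _ _ CN _ _ _ e^-1 _ _ CN0 (ltW e'0) J1 B1 hM hA).
rewrite /tail !normrM -mulrA; apply: ler_pM; [exact: normr_ge0|by apply: mulr_ge0|exact: bphi|].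
rewrite mulrC; apply: ler_pM; [exact: normr_ge0|exact: normr_ge0| |exact: B2].
by apply: (le_trans (ler_normB _ _)); rewrite normr1 lerD2l.
Qed.

Lemma tail_expect (CN e u v : R) : 0 <= CN -> (forall t x, 0 <= t <= T -> `|x| <= N -> `|ps j (t, x)| <= CN) ->
  0 < e -> 0 <= u -> u < v -> v <= S -> itg P setT (tail u v) /\
  `|\int[P]_w tail u v w| <= Kphi * (1 + Kchi) * (e * (\int[P]_w (MM v w ^+ 2) - \int[P]_w (MM u w ^+ 2)) +
     (CN + e^-1 + 1) * (48 * d%:R * (v - u) ^+ 2 + 4 * d%:R * (v - u) * \int[leb]_(r in `[u, v]) power P b r)
     + envelope2 * (v - u) ^+ 2).
Proof.
move=> CN0 HCN e0 u0 uv vS; have vT := le_lt_trans vS ST.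
have [I1 E1] := mart_increment_sq T0 cps cH HC Hps FM iM martP j u0 (ltW uv) vT.
have [I2 E2] := itg_big u0 uv (ltW vT).
have [I3 E3] := envelope_int_sq u0 uv vS.
have J1 := itgZ e measurableT I1; have J2 := itgZ (CN + e^-1 + 1) measurableT I2.
have J12 := itgD measurableT J1 J2; have J123 := itgD measurableT J12 I3.
have J := itgZ (Kphi * (1 + Kchi)) measurableT J123.
have mt : measurable_fun setT (tail u v).
  apply: measurable_funM; first exact: mphi.
  apply: measurable_funM.
    apply: (@measurable_at R d T (fun y => ps j (v, y)) v); apply: continuous_measurable_rV.
    exact: (@continuous_slice2 R d (ps j) v (@cps j)).
  apply: measurable_funB => //; apply: measurable_at; apply: continuous_measurable_rV.
  exact: pC1_continuous chiC.1.
have B w := tail_bound w CN0 HCN e0 u0 uv vS.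
have It : itg P setT (tail u v) by apply: (itg_le measurableT mt J) => w _; exact: B.
split => //; apply: le_trans.
  by apply: (le_Rint_bound measurableT It J) => w _; exact: B.
rewrite (RintegralZl _ measurableT J123) (RintegralD measurableT J12 I3) (RintegralD measurableT J1 J2).
rewrite (RintegralZl _ measurableT I1) (RintegralZl _ measurableT I2) E1.
apply: ler_wpM2l; first by rewrite mulr_ge0// addr_ge0.
apply: lerD => //; rewrite lerD2l; apply: ler_wpM2l => //.
by apply: addr_ge0 => //; apply: addr_ge0 => //; rewrite invr_ge0 ltW.
Qed.

Let fub (f : R * Om -> R) (Kf u v : R) : measurable_fun setT f -> 0 <= Kf -> 0 <= u -> v <= S ->
  (forall r w, u <= r <= v -> `|f (r, w)| <= Kf * envelope r w) ->
  [/\ forall r, u <= r <= v -> itg P setT (fun w => f (r, w)),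
      itg leb `[u, v] (fun r => \int[P]_w f (r, w)),
      itg P setT (fun w => \int[leb]_(r in `[u, v]) f (r, w)) &
      \int[leb]_(r in `[u, v]) \int[P]_w f (r, w) = \int[P]_w \int[leb]_(r in `[u, v]) f (r, w)].
Proof.
move=> mf Kf0 u0 vS fK.
have rS r : u <= r <= v -> 0 <= r <= S by move=> /andP[ur rv]; rewrite (le_trans u0 ur) (le_trans rv vS).
have mfr r : measurable_fun setT (fun w : Om => f (r, w)) by exact: (measurableT_comp mf (@pair1_measurable _ _ _ _ r)).
have IE r : u <= r <= v -> itg P setT (envelope r) /\ \int[P]_w envelope r w <= 1 + envelope2.
  move=> ur; have [I B] := envelope_sq (rS _ ur).
  have Ic := itg_cst P 1; have Is := itgD measurableT Ic I.
  have I1 : itg P setT (envelope r).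
    apply: (itg_le measurableT _ Is); first exact: (measurableT_comp measurable_envelope (@pair1_measurable _ _ _ _ r)).
    by move=> w _; exact: abs_le_sq.
  split => //; apply: (@le_trans _ _ (\int[P]_w (1 + envelope r w ^+ 2))).
    apply: le_Rintegral; [exact: measurableT|exact: I1|exact: Is|move=> w _].
    exact: le_trans (ler_norm _) (abs_le_sq _).
  by rewrite (RintegralD measurableT Ic I) Rint_cst_prob lerD2l.
have If r : u <= r <= v -> itg P setT (fun w => f (r, w)).
  move=> ur; apply: (itg_le measurableT (mfr r) (itgZ Kf measurableT (IE r ur).1)) => w _; exact: fK.
have Ffin : (\int[leb]_(r in `[u, v]) \int[P]_w (`|f (r, w)|)%:E < +oo)%E.
  apply: (@le_lt_trans _ _ (\int[leb]_(r in `[u, v]) (Kf * (1 + envelope2))%:E)%E); last first.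
    by rewrite -(leb_itg_fin R _ _ (mI u v) (itg_cst_itv u v _)) ltry.
  apply: ge0_le_integral => //.
  - by move=> r _; apply: integral_ge0 => w _; rewrite lee_fin.
  - by apply: measurable_funTS; apply: (@measurable_integral_ge0 _ _ R P (fun p => `|f p|)) => //; exact: measurableT_comp.
  - move=> r; rewrite /= in_itv/= => ur; have [I1 B1] := IE r ur.
    rewrite -(itg_fin measurableT (itg_norm (If r ur))) lee_fin.
    apply: (@le_trans _ _ (\int[P]_w (Kf * envelope r w))).
      apply: le_Rintegral; [exact: measurableT|exact: itg_norm (If r ur)|exact: itgZ|by move=> w _; exact: fK].
    by rewrite (RintegralZl _ measurableT I1); exact: ler_wpM2l.
by have [? ? ?] := fubini_path mf Ffin.
Qed.

Lemma drift_fubini u v : 0 <= u -> u < v -> v <= S ->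
  [/\ forall r, u <= r <= v -> itg P setT (fun w : Om => phi (w r) * nonlocal P ps H j (r, w r)),
      itg leb `[u, v] (fun r => \int[P]_w (phi (w r) * nonlocal P ps H j (r, w r))),
      itg P setT (fun w : Om => phi (w u) * (drift_int P ps H j v w - drift_int P ps H j u w)) &
  forall e, 0 < e -> `|\int[P]_w (phi (w u) * (drift_int P ps H j v w - drift_int P ps H j u w)) -
    \int[leb]_(r in `[u, v]) \int[P]_w (phi (w r) * nonlocal P ps H j (r, w r))| <=
  (v - u) * (e * envelope2 + e^-1 * (Lphi ^+ 2 * (d%:R * (2 * (1 + energyT P b) * (v - u)))))].
Proof.
move=> u0 uv vS; have vT := le_trans vS (ltW ST).
have rS r : u <= r <= v -> 0 <= r <= S by move=> /andP[ur rv]; rewrite (le_trans u0 ur) (le_trans rv vS).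
pose al (p : R * Om) := nonlocal P ps H j (p.1, p.2 p.1).
have mal : measurable_fun setT al by exact: measurable_nonlocal.
pose f1 (p : R * Om) := phi (p.2 u) * al p; pose f2 (p : R * Om) := phi (p.2 p.1) * al p.
have m1 : measurable_fun setT f1.
  by apply: measurable_funM => //; exact: (measurableT_comp (mphi u) measurable_snd).
have m2 : measurable_fun setT f2.
  apply: measurable_funM => //; apply: (@measurable_along_path R d T (fun p => phi p.2)) => p.
  exact: (continuous_snd cphi).
have B1 r w : u <= r <= v -> `|f1 (r, w)| <= Kphi * envelope r w.
  by move=> ur; rewrite /f1 normrM; apply: ler_pM => //; exact: nonlocal_envelope (rS r ur).
have B2 r w : u <= r <= v -> `|f2 (r, w)| <= Kphi * envelope r w.
  by move=> ur; rewrite /f2 normrM; apply: ler_pM => //; exact: nonlocal_envelope (rS r ur).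
have [I1 I1a I1b E1] := fub m1 Kphi0 u0 vS B1.
have [I2 I2a I2b E2] := fub m2 Kphi0 u0 vS B2.
have Ed (w : Om) : phi (w u) * (drift_int P ps H j v w - drift_int P ps H j u w) = \int[leb]_(r in `[u, v]) f1 (r, w).
  rewrite drift_increment//; last exact: ltW.
  have [In _] := itg_nonlocal T0 cps cH HC Hps j w u0 vT.
  by rewrite /f1 /al /= (leb_RintegralZl R _ _ _ (mI u v) In).
split=> [| | |e e0]; [exact: I2|exact: I2a|by apply: (itg_eq measurableT I1b) => w _; rewrite Ed|].
under eq_Rintegral do rewrite Ed.
rewrite -E1 (leb_RintB R _ _ _ (mI u v) I1a I2a).
have I12 := leb_itgB R _ _ _ (mI u v) I1a I2a.
set c := e * _ + _.
apply: (@le_trans _ _ (\int[leb]_(r in `[u, v]) `|\int[P]_w f1 (r, w) - \int[P]_w f2 (r, w)|)).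
  by apply: (leb_le_normr_Rintegral R).
apply: (@le_trans _ _ (\int[leb]_(r in `[u, v]) c)); last by rewrite Rint_cst_itv ?(ltW uv)// mulrC.
apply: (leb_le_Rintegral R); [exact: mI|exact: (leb_itg_norm R _ _ I12)|exact: itg_cst_itv|].
move=> r; rewrite /= in_itv/= => ur; have /andP[ur1 ur2] := ur.
have [Ie Be] := envelope_sq (rS r ur).
have Dk k := displacement_sq cb indep Hb k u0 ur1 (le_trans ur2 vT).
have Is : itg P setT (fun w : Om => \sum_k (w r ord0 k - w u ord0 k) ^+ 2) by apply: itg_sum => // k; have [] := Dk k.
have e'0 : 0 < e^-1 by rewrite invr_gt0.
have J1 := itgZ e measurableT Ie; have J2 := itgZ (e^-1 * Lphi ^+ 2) measurableT Is.
have J := itgD measurableT J1 J2.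
rewrite (RintB measurableT (I1 r ur) (I2 r ur)).
have Bd (w : Om) : `|f1 (r, w) - f2 (r, w)| <= e * envelope r w ^+ 2 + e^-1 * Lphi ^+ 2 * \sum_k (w r ord0 k - w u ord0 k) ^+ 2.
  rewrite /f1 /f2 -mulrBl /=.
  have h1 : `|phi (w u) - phi (w r)| ^+ 2 <= Lphi ^+ 2 * \sum_k (w r ord0 k - w u ord0 k) ^+ 2.
    apply: (@le_trans _ _ ((Lphi * `|w u - w r|) ^+ 2)).
      by rewrite lerXn2r ?nnegrE// mulr_ge0.
    rewrite exprMn; apply: ler_wpM2l; first exact: sqr_ge0.
    rewrite distrC; apply: (le_trans (norm_sqs _)); apply: ler_sum => k _; by rewrite !mxE.
  have h2 := nonlocal_envelope j w (rS r ur).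
  rewrite normrM; set x := `|_ - _| in h1 *; set y := `|al (r, w)|.
  have y2 : y ^+ 2 <= envelope r w ^+ 2.
    by rewrite lerXn2r ?nnegrE//; [exact: normr_ge0|exact: le_trans h2].
  by apply: young_le => //; exact: normr_ge0.
apply: le_trans.
  by apply: (le_Rint_bound measurableT (itgB measurableT (I1 r ur) (I2 r ur)) J) => w _; exact: Bd.
rewrite (RintegralD measurableT J1 J2) (RintegralZl _ measurableT Ie) (RintegralZl _ measurableT Is) /c.
apply: lerD; first by rewrite ler_wpM2l// ltW.
rewrite -[e^-1 * Lphi ^+ 2 * _]mulrA; apply: ler_wpM2l; first exact: ltW.
apply: ler_wpM2l; first exact: sqr_ge0.
rewrite Rint_sum//; last by move=> k; have [] := Dk k.
rewrite -[d in d%:R]card_ord -sum1_card natr_sum mulr_suml; apply: ler_sum => k _.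
have [_ hk] := Dk k; rewrite mul1r; apply: (le_trans hk).
apply: ler_wpM2l; last by rewrite lerD2r.
by rewrite mulr_ge0// addr_ge0// /energyT; apply: Rintegral_ge0 => w _; exact: energy_ge0.
Qed.

Definition residual (t : R) (x : 'rV[R]_d) : R := dt `[0, T] (psi j) t x + 2^-1 * laplacian (psi j t) x +
  \sum_i b i (t, x) * partial i (psi j t) x - nonlocal P ps H j (t, x).

(** On the support of [phi] the cutoff is 1 in a neighbourhood, so all derivatives of [g] there are
    those of the uncut component [psi j]. *)
Lemma generator_residual t x : 0 <= t <= T ->
  ito_generator (T := T) b g phi (t, x) - phi x * nonlocal P ps H j (t, x) = phi x * residual t x.
Proof.
move=> tT; rewrite generatorE /clamped /= (clamp_id tT).
have [xN|xN] := leP `|x| N; last first.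
  by rewrite phiN// !mul0r subr0 add0r big1// => i _; rewrite !mul0r mulr0.
have N1 : N < N + 1 by rewrite ltrDl.
have gE y : `|y| < N + 1 -> g t y = psi j t y by move=> h; rewrite /g chi1 ?mulr1// ltW.
have -> : dt `[0, T] g t x = dt `[0, T] (psi j) t x.
  rewrite /dt (_ : time_quot g t x = time_quot (psi j) t x)//; apply/funext => s.
  by rewrite /time_quot /g chi1 ?mulr1// ltW// (le_lt_trans xN).
have p1 i y : `|y| < N + 1 -> partial i (g t) y = partial i (psi j t) y by exact: partial_local.
have p2 i : partial i (partial i (g t)) x = partial i (partial i (psi j t)) x.
  by apply: (partial_local (N := N + 1)); [exact: p1|exact: le_lt_trans N1].
under eq_bigr do rewrite p2.
under [X in _ + X - _]eq_bigr do rewrite p1 ?(le_lt_trans xN)// mulrCA.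
by rewrite -mulr_sumr /residual -/(laplacian _ _) !mulrDr mulrN.
Qed.

Let itg_gen r : 0 <= r <= T -> itg P setT (fun w : Om => ito_generator (T := T) b g phi (r, w r)).
Proof.
move=> rT; have [Cg _ HCg] := generator_bounded T0 cb gC gN cphi.
apply: (itg_le measurableT _ (itg_cst P Cg)) => [|w _]; last exact: HCg.
apply: (@measurable_at R d T (fun y => ito_generator (T := T) b g phi (r, y))); apply: continuous_measurable_rV.
exact: (@continuous_slice2 R d _ r (continuous_generator T0 cb gC gN cphi)).
Qed.

Let LR (u v : R) : R := \int[leb]_(r in `[u, v]) \int[P]_w (phi (w r) * residual r (w r)).

Let split_residual u v : 0 <= u -> u < v -> v <= S ->
  itg leb `[u, v] (fun r => \int[P]_w (phi (w r) * residual r (w r))) /\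
  LR u v = \int[leb]_(r in `[u, v]) \int[P]_w ito_generator (T := T) b g phi (r, w r)
    - \int[leb]_(r in `[u, v]) \int[P]_w (phi (w r) * nonlocal P ps H j (r, w r)).
Proof.
move=> u0 uv vS; have vT := le_trans vS (ltW ST).
have [I1 _ _] := generator_fubini P T0 cb gC gN cphi u0 (ltW uv) vT.
have [I0 I2 _ _] := drift_fubini u0 uv vS.
have E r : `[u, v]%classic r -> \int[P]_w ito_generator (T := T) b g phi (r, w r) - \int[P]_w (phi (w r) * nonlocal P ps H j (r, w r)) =
    \int[P]_w (phi (w r) * residual r (w r)).
  rewrite /= in_itv/= => ur; have /andP[ur1 ur2] := ur.
  have rT : 0 <= r <= T by rewrite (le_trans u0 ur1) (le_trans ur2 vT).
  rewrite (RintB measurableT (itg_gen rT) (I0 r ur)); apply: eq_Rintegral => w _; exact: generator_residual.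
split; first exact: (leb_itg_eq R _ _ _ (mI u v) (leb_itgB R _ _ _ (mI u v) I1 I2) E).
rewrite (leb_RintB R _ _ _ (mI u v) I1 I2) /LR; apply: eq_Rintegral => r.
by rewrite inE => /E.
Qed.

Let itg_residual u v : 0 <= u -> v <= S -> itg leb `[u, v] (fun r => \int[P]_w (phi (w r) * residual r (w r))).
Proof.
move=> u0 vS; have [I _] := split_residual (lexx 0) S0 (lexx S).
apply: (leb_integrableS R `[0, S]%classic _ _ (mI 0 S) (mI u v) _ I).
by move=> r /=; rewrite !in_itv/= => /andP[ur rv]; rewrite (le_trans u0 ur) (le_trans rv vS).
Qed.

Let phichi x : phi x * chi x = phi x.
Proof.
have [xN|xN] := leP `|x| N; last by rewrite phiN// mul0r.
by rewrite chi1 ?mulr1// (le_trans xN)// lerDl.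
Qed.

(** The martingale property tested with [phi (w u)], after writing the martingale as the corrector
    minus its drift and splitting the corrector at time [v] into its cut-off part and the tail. At
    time [u] there is no tail, because [phi * chi = phi]. *)
Let martingale_zero u v : 0 <= u -> u < v -> v <= S ->
  \int[P]_w (phi (w u) * (g v (w v) - g u (w u))) + \int[P]_w tail u v w
   - \int[P]_w (phi (w u) * (drift_int P ps H j v w - drift_int P ps H j u w)) = 0.
Proof.
move=> u0 uv vS; have vT := le_lt_trans vS ST.
have uS := le_trans (ltW uv) vS.
have v0 : 0 <= v := le_trans u0 (ltW uv).
have [CN CN0 HCN] := bounded_on_box T N (@cps j).
have [It _] := tail_expect CN0 HCN ltr01 u0 uv vS.
have [_ _ Id _] := drift_fubini u0 uv vS.
have I1 := @itg_bdM _ _ _ _ _ _ _ Kphi measurableT (mphi u) (IMs v0 vS) (fun w _ => bphi (w u)).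
have I2 := @itg_bdM _ _ _ _ _ _ _ Kphi measurableT (mphi u) (IMs u0 uS) (fun w _ => bphi (w u)).
have EM := mart_transfer_at FX iM martP (continuous_measurable_rV cphi) u0 (ltW uv) vT I1 I2.
have I12 := itgB measurableT I1 I2; have I3 := itgB measurableT I12 It; have I4 := itgD measurableT I3 Id.
have cE t x : 0 <= t <= T -> ps j (t, x) = psi j t x by move=> tT; rewrite /ps /clamped /= clamp_id.
have E (w : Om) : phi (w u) * MM v w - phi (w u) * MM u w - tail u v w + phi (w u) * (drift_int P ps H j v w - drift_int P ps H j u w)
    = phi (w u) * (g v (w v) - g u (w u)).
  rewrite /MM /mart /tail /g !cE; [|by rewrite u0 (le_trans uS (ltW ST))|by rewrite v0 ltW].
  have Pc := phichi (w u).
  have alg (f pv pu dv du cv cu : R) : f * cu = f ->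
      f * (pv - dv) - f * (pu - du) - f * (pv * (1 - cv)) + f * (dv - du) = f * (pv * cv - pu * cu).
    by move=> fc; rewrite -[in RHS]fc; ring: fc.
  exact: alg.
have := RintegralD measurableT I3 Id; rewrite -(RintB measurableT I12 It) -(RintB measurableT I1 I2) EM.
under eq_Rintegral do rewrite E.
have alg (x a t k : R) : x = a - a - t + k -> x + t - k = 0 by move=> ->; ring.
exact: alg.
Qed.

Lemma local_residual e : 0 < e -> exists2 del : R, 0 < del & forall u v, 0 <= u -> u < v -> v <= S -> v - u < del ->
  `|LR u v| <= e * ((v - u) + \int[leb]_(r in `[u, v]) power P b r + (\int[P]_w (MM v w ^+ 2) - \int[P]_w (MM u w ^+ 2))).
Proof.
move=> e0; have [CN CN0 HCN] := bounded_on_box T N (@cps j).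
pose e4 := e / 4; have e40 : 0 < e4 by rewrite divr_gt0.
have [del1 del10 Hito] := local_ito T0 cb indep Hb gC gN cphi cphi2 e40.
pose KK := Kphi * (1 + Kchi); have KK0 : 0 <= KK by rewrite /KK mulr_ge0// addr_ge0.
pose dl := e4 / (envelope2 + 1); have dl0 : 0 < dl by rewrite divr_gt0// ltr_wpDl.
have dlE : dl * envelope2 <= e4.
  by rewrite /dl mulrAC ler_pdivrMr ?ltr_wpDl// ler_wpM2l ?(ltW e40)// lerDl.
pose ep := e4 / (KK + 1); have ep0 : 0 < ep by rewrite divr_gt0// ltr_wpDl.
have epK : KK * ep <= e4.
  by rewrite mulrC /ep mulrAC ler_pdivrMr ?ltr_wpDl// ler_wpM2l ?(ltW e40)// lerDl.
have enT : 0 <= energyT P b by rewrite /energyT; apply: Rintegral_ge0 => w _; exact: energy_ge0.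
pose A := dl^-1 * (Lphi ^+ 2 * (d%:R * (2 * (1 + energyT P b)))).
have A0 : 0 <= A.
  by rewrite /A; apply: mulr_ge0; [rewrite invr_ge0 ltW|apply: mulr_ge0; [exact: sqr_ge0|apply: mulr_ge0 => //; apply: mulr_ge0 => //; exact: addr_ge0]].
pose B := KK * (CN + ep^-1 + 1) * d%:R.
have B0 : 0 <= B.
  by rewrite /B; apply: mulr_ge0 => //; apply: mulr_ge0 => //; apply: addr_ge0 => //; apply: addr_ge0 => //; rewrite invr_ge0 ltW.
pose D := KK * envelope2; have D0 : 0 <= D by rewrite /D mulr_ge0.
pose Z := A + 48 * B + 4 * B + D; have Z0 : 0 <= Z by rewrite /Z !addr_ge0// mulr_ge0.
have d20 : 0 < e4 / (Z + 1) by rewrite divr_gt0// ltr_wpDl.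
exists (Num.min del1 (e4 / (Z + 1))); first by rewrite lt_min del10.
move=> u v u0 uv vS; rewrite lt_min => /andP[h1 h2]; have vT := le_lt_trans vS ST.
set p := \int[leb]_(r in `[u, v]) power P b r; set m := \int[P]_w (MM v w ^+ 2) - _.
have p0 : 0 <= p.
  by apply: Rintegral_ge0 => r _; apply: sumr_ge0 => i _; apply: Rintegral_ge0 => w _; exact: sqr_ge0.
have m0 : 0 <= m.
  have [_ E] := mart_increment_sq T0 cps cH HC Hps FM iM martP j u0 (ltW uv) vT.
  by rewrite /m /MM -E; apply: Rintegral_ge0 => w _; exact: sqr_ge0.
have h0 : 0 < v - u by rewrite subr_gt0.
have Zh : Z * (v - u) <= e4.
  have := ltW h2; rewrite ler_pdivlMr ?ltr_wpDl// => hz; apply: le_trans hz.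
  by rewrite mulrC ler_wpM2l ?(ltW h0)// lerDl.
have [_ ->] := split_residual u0 uv vS.
have X1 := Hito u v u0 uv (ltW vT) h1.
have [_ _ _ /(_ dl dl0) X2] := drift_fubini u0 uv vS.
have [_ X3] := tail_expect CN0 HCN ep0 u0 uv vS.
have Z3 := martingale_zero u0 uv vS.
set G := \int[leb]_(r in _) _ in X1 *; set Al := \int[leb]_(r in _) _ in X2 *.
set Ex := \int[P]_w _ in X1 Z3; set Dr := \int[P]_w _ in X2 Z3; set Tl := \int[P]_w _ in X3 Z3.
rewrite -/p in X1 X3; rewrite -/m -/KK in X3.
have EQ : Lphi ^+ 2 * (d%:R * (2 * (1 + energyT P b) * (v - u))) = Lphi ^+ 2 * (d%:R * (2 * (1 + energyT P b))) * (v - u).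
  by rewrite !mulrA.
rewrite EQ in X2.
exact: (@residual_bound_arith _ e (v - u) p m G Al Ex Dr Tl dl envelope2 (Lphi ^+ 2 * (d%:R * (2 * (1 + energyT P b)))) KK ep (CN + ep^-1 + 1) d%:R
  h0 p0 m0 dlE epK Zh A0 B0 D0 Z3 X1 X2 X3).
Qed.

Lemma weak_residual u v : 0 <= u -> u <= v -> v <= S -> LR u v = 0.
Proof.
apply: (@chaining R S LR (fun u v => (v - u) + \int[leb]_(r in `[u, v]) power P b r + (\int[P]_w (MM v w ^+ 2) - \int[P]_w (MM u w ^+ 2)))).
- by move=> u0 k v0 u00 uk kv vS; rewrite /LR (Rint_split uk kv (itg_residual u00 vS)).
- move=> u0 k v0 u00 uk kv vS; have [Ip _ _] := energy_fubini cb Hb u00 (le_trans vS (ltW ST)).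
  have alg (a c k' q q1 q2 x y z : R) : q = q1 + q2 -> (c - a) + q + (x - y) = (k' - a + q1 + (z - y)) + (c - k' + q2 + (x - z)).
    by move=> ->; ring.
  exact: alg (Rint_split uk kv Ip).
- exact: local_residual.
Qed.

End local.
End upto.

Variable mu : R -> 'rV[R]_d -> R.
Hypotheses (mu_dens : forall t : R, 0 <= t <= T -> has_density (marg P t) (mu t))
  (mu_gt0 : forall t x, 0 <= t <= T -> 0 < mu t x) (mu_cont : continuous (clamped T mu)).
Hypothesis Irun : itg P setT (@runmax R d T).

(** At times before [T] the two halves are separately integrable, and each is continuous in
    [(t, x)]: the first by [convP_continuous], the second by [continuous_weighted]. *)
Lemma nonlocal_split j t x : 0 <= t < T -> nonlocal P ps H j (t, x) =
  \sum_i (psi i t x * convP P (H i j) t x - \int[P]_w (H i j (x - w t) * ps i (t, w t))).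
Proof.
move=> /andP[t0 tT]; have gt := good_lt T0 cps cH HC Hps FM iM martP t0 tT.
have cE i y : ps i (t, y) = psi i t y by rewrite /ps /clamped /= clamp_id// t0 ltW.
have mk i := @measurable_path_shift R d T (H i j) x t (@cH i j).
have Ik i : itg P setT (fun w : Om => H i j (x - w t)).
  apply: (itg_le measurableT (mk i) (itg_cst P C)) => w _; exact: HC.
have I1 i := itgZ (psi i t x) measurableT (Ik i).
have I2 i := @itg_bdM _ _ _ _ _ _ _ C measurableT (mk i) (itg_ps_good cps i gt).2 (fun w _ => HC i j (x - w t)).
have I i := itgB measurableT (I1 i) (I2 i).
transitivity (\int[P]_w \sum_i (psi i t x * H i j (x - w t) - H i j (x - w t) * ps i (t, w t))).
  apply: eq_Rintegral => w _; apply: eq_bigr => i _ /=.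
  by rewrite cE mulrBl [X in _ - X]mulrC.
rewrite Rint_sum//; apply: eq_bigr => i _.
by rewrite -(RintB measurableT (I1 i) (I2 i)) (RintegralZl _ measurableT (Ik i)).
Qed.

Lemma continuous_residual j S : 0 < S -> S < T -> continuous (clamped S (residual j)).
Proof.
move=> S0 ST; have S0' := ltW S0; have ST' := ltW ST.
have cl t : 0 <= clamp S t <= S by exact: clamp_itv.
have clT t : 0 <= clamp S t <= T by have /andP[-> h] := cl t; exact: le_trans ST'.
have sub f : continuous_tx `[0, T] f -> continuous (clamped S f).
  move=> cf; apply: clamped_continuous => //; apply/continuous_txP => t x It e e0.
  have sS r : `[0, S]%classic r -> `[0, T]%classic r by rewrite /= !in_itv/= => /andP[-> h]; exact: le_trans ST'.
  have [del del0 h] := (continuous_txP _ _).1 cf t x (sS _ It) e e0.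
  by exists del => // s y Is; apply: h; exact: sS.
have [_ [c0 cd] c1 c2] := psiC j.
have cc (f : R * 'rV[R]_d -> R) : continuous f -> continuous (fun p => f (clamp S p.1, p.2)).
  move=> cf p; apply/cts_txP => e e0; have [del del0 h] := (cts_txP f (clamp S p.1, p.2)).1 (cf _) e e0.
  by exists del => // s y sp yp; apply: (h (clamp S s) y); [exact: le_lt_trans (clamp_lip _ _ _) sp|exact: yp].
have cB i : continuous (fun p : R * 'rV[R]_d => b i (clamp S p.1, p.2)).
  exact: cc (@cb i).
have cV i : continuous (fun p : R * 'rV[R]_d => convP P (H i j) (clamp S p.1) p.2).
  have kb z : `|H i j z| <= C + 0 * `|z| by rewrite mul0r addr0.
  exact: (cc _ (convP_continuous (ltW T0) Irun (lexx 0) kb (@cH i j))).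
have -> : clamped S (residual j) = fun p => clamped S (dt `[0, T] (psi j)) p +
    2^-1 * \sum_i clamped S (fun t => partial i (partial i (psi j t))) p +
    \sum_i b i (clamp S p.1, p.2) * clamped S (fun t => partial i (psi j t)) p -
    \sum_i (clamped S (psi i) p * convP P (H i j) (clamp S p.1) p.2 -
      clamped S (fun t x => \int[P]_w (H i j (x - w t) * ps i (t, w t))) p).
  apply/funext => p; rewrite {1}/clamped /residual nonlocal_split//.
  by have /andP[-> h] := cl p.1; exact: le_lt_trans ST.
move=> p.
apply: cvgB_fun; last first.
  apply: cvg_sum_fin => i; apply: cvgB_fun.
    by apply: cvgM_fun; [apply: sub; have [_ []] := psiC i|exact: cV].
  have := continuous_weighted (j := i) T0 cps cH HC Hps FX FM iM martP (@cH i j) (HC i j) S0' ST.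
  exact.
apply: cvgD_fun; last first.
  apply: cvg_sum_fin => i; apply: cvgM_fun; first exact: cB.
  by apply: sub; exact: c1.
apply: cvgD_fun; first exact: sub.
apply: cvgM_fun; first exact: cvg_cst.
by apply: cvg_sum_fin => i; apply: sub; exact: c2.
Qed.

Theorem corrector_pde j t x : 0 <= t < T -> residual j t x = 0.
Proof.
(* The moment bounds are uniform only away from [T], so the argument runs on [[0, S]] with [S]
   strictly between [t] and [T]. *)
move=> /andP[t0 tT]; pose S := (t + T) / 2.
have tS : t < S by rewrite /S; lra.
have ST : S < T by rewrite /S; lra.
have S0 : 0 < S := le_lt_trans t0 tS.
have [Ks Ks0 HKs] := ps_sq_bound T0 cps cH HC Hps FM iM martP (ltW S0) ST.
have tS' : 0 <= t <= S by rewrite t0 ltW.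
apply: (@null_in_law R d T P mu mu_dens mu_gt0 mu_cont S (residual j) S0 (ltW ST) (@continuous_residual j S S0 ST)) => // u v eta N u0 uv vS [Ce Ce'] eN.
(* The support radius [N] of a test function may be negative, whereas the plateau needs a
   nonnegative radius. *)
have N0 : 0 <= Num.max N 0 by rewrite le_max lexx orbT.
have eN' y : Num.max N 0 < `|y| -> eta y = 0 by move=> h; apply: eN; apply: le_lt_trans h; rewrite le_max lexx.
have [chi [M [chiC chi1 chi0]]] := @plateau_exists R d (Num.max N 0 + 1) (addr_ge0 N0 ler01).
have [Kc Kc0 HKc] := bounded_supp (pC1_continuous chiC.1) chi0.
have [Ke Ke0 HKe] := bounded_supp (pC1_continuous Ce) eN'.
have /choice[Lp HLp] : forall i, exists Li : R, 0 <= Li /\ forall y, `|partial i eta y| <= Li.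
  move=> i; have [Li Li0 h] := bounded_supp (Ce.2 i) (fun y h => partial_eq0 i eN' h).
  by exists Li.
have Lp0 : 0 <= \sum_i Lp i by apply: sumr_ge0 => i _; have [] := HLp i.
have bp i y : `|partial i eta y| <= \sum_i Lp i.
  have [_ h] := HLp i; apply: (le_trans (h y)); rewrite (bigD1 i)//= lerDl.
  by apply: sumr_ge0 => k _; have [] := HLp k.
have lip := pC1_lipschitz Ce bp.
exact: (@weak_residual S Ks S0 ST Ks0 HKs j eta chi (Num.max N 0) M Ke ((\sum_i Lp i) * d%:R) Kc (pC1_continuous Ce) HKe lip eN'
  (mulr_ge0 Lp0 (ler0n R d)) chiC HKc chi1 chi0 u v u0 (ltW uv) vS).
Qed.

End corrector_equation.

(** * Potentials of curl-free fields *)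

Section potential.
Context {R : realType} {d : nat}.
Local Notation leb := (@lebesgue_measure R).
Local Notation e_ i := (delta_mx ord0 i : 'rV[R]_d).

Let mI (u v : R) : measurable (`[u, v]%classic : set R). Proof. exact: measurable_itv. Qed.

Lemma is_derive_increment (F : R -> R) (t l : R) :
  (forall e : R, 0 < e -> exists2 del : R, 0 < del & forall s, `|s - t| < del -> `|F s - F t - (s - t) * l| <= e * `|s - t|) ->
  is_derive t 1 F l.
Proof.
move=> H; have C : (fun h : R => h^-1 *: (F (h *: (1 : R) + t) - F t)) @ 0^' --> l.
  apply/cvgrPdist_le => e e0; have [del del0 {}H] := H e e0.
  apply: (proj2 (nbhs_ballP 0 _)); exists del => //= h; rewrite -ball_normE /= sub0r normrN => hd h0.
  have := H (h + t); rewrite addrK [h%:A]mulr1 => /(_ hd) h1.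
  have h2 : 0 < `|h| by rewrite normr_gt0.
  have E : F (h + t) - F t - h * l = h * (h^-1 * (F (h + t) - F t) - l) by field.
  rewrite E normrM mulrC ler_pM2r// in h1.
  by rewrite distrC; exact: h1.
by apply: DeriveDef; [apply/cvg_ex; exists l|exact/cvg_lim].
Qed.

Lemma Rint_near_cst (f : R -> R) (u v l e : R) : u <= v -> itg leb `[u, v] f -> (forall r, u <= r <= v -> `|f r - l| <= e) ->
  `|\int[leb]_(r in `[u, v]) f r - (v - u) * l| <= e * (v - u).
Proof.
move=> uv If fe; have Il := itg_cst_itv u v l; have Ie := itg_cst_itv u v e.
rewrite -[(v - u) * l]mulrC -(Rint_cst_itv l uv) (leb_RintB R _ _ _ (mI u v) If Il) -(Rint_cst_itv e uv).
apply: (leb_le_Rint_bound R _ _ _ (mI u v) _ Ie).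
  exact: (leb_itgB R _ _ _ (mI u v) If Il).
by move=> r; rewrite /= in_itv/=; exact: fe.
Qed.

Lemma partial_integral (f : R -> 'rV[R]_d -> R) (D : R * 'rV[R]_d -> R) j x : continuous D ->
  (forall y, continuous (f ^~ y)) -> (forall r y, pderivable j (f r) y /\ partial j (f r) y = D (r, y)) ->
  pderivable j (fun y => \int[leb]_(r in `[0, 1]) f r y) x /\
  partial j (fun y => \int[leb]_(r in `[0, 1]) f r y) x = \int[leb]_(r in `[0, 1]) D (r, x).
Proof.
move=> cD cf df; apply: derive_of_line; apply: is_derive_increment => e e0.
have [del del0 H] := unif_on_box 1 `|x| cD e0.
exists del => // s; rewrite subr0 => sd.
have D0 r : continuous (fun r => D (r, x)) by apply: continuous_slice.
have I1 y : itg leb `[0, 1] (f ^~ y) by apply: itg_cts_itv; exact: cf.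
have I2 : itg leb `[0, 1] (fun r => D (r, x)) by apply: itg_cts_itv; exact: D0.
have I3 := leb_itgB R _ _ _ (mI 0 1) (I1 (x + s *: e_ j)) (I1 (x + 0 *: e_ j)).
have I4 := leb_itgZ R _ _ s (mI 0 1) I2.
rewrite (leb_RintB R _ _ _ (mI 0 1) (I1 _) (I1 _)).
rewrite -(leb_RintegralZl R _ _ s (mI 0 1) I2) (leb_RintB R _ _ _ (mI 0 1) I3 I4).
have -> : e * `|s| = \int[leb]_(r in `[0, 1]) (e * `|s|) by rewrite Rint_cst_itv// subr0 mulr1.
apply: (leb_le_Rint_bound R _ _ _ (mI 0 1) (leb_itgB R _ _ _ (mI 0 1) I3 I4) (itg_cst_itv 0 1 _)).
move=> r; rewrite /= in_itv/= => r01.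
have dl (h : R) : is_derive h 1 (fun h : R => f r (x + h *: e_ j)) (D (r, x + h *: e_ j)).
  by rewrite -(df r _).2; apply: is_derive_line => y; exact: (df r y).1.
have [c cs E] := mvt_scaled s dl.
rewrite E [s * _]mulrC -mulrBl normrM ler_wpM2r//; apply: H => //; first by rewrite subrr normr0.
rewrite [X in `|X - x|]addrC addrK normrZ; apply: le_lt_trans sd.
by apply: (@le_trans _ _ `|c|) => //; rewrite -[leRHS]mulr1 ler_wpM2l// norm_delta.
Qed.

Variable T : R.
Hypothesis T0 : 0 < T.
Variable psi : 'I_d -> R -> 'rV[R]_d -> R.
Hypothesis psiC : forall i, C12 `[0, T] (psi i).
Hypothesis curl : forall t x i j, 0 <= t <= T -> partial j (psi i t) x = partial i (psi j t) x.

Let in0T t : 0 <= t <= T -> `[0, T]%classic t. Proof. by rewrite /= in_itv. Qed.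

Definition potential (t : R) (x : 'rV[R]_d) : R := \int[leb]_(r in `[0, 1]) \sum_i psi i t (r *: x) * x ord0 i.
Definition potential_rate (t : R) (x : 'rV[R]_d) : R :=
  \int[leb]_(r in `[0, 1]) \sum_i dt `[0, T] (psi i) t (r *: x) * x ord0 i.

Let c0 i : continuous (clamped T (psi i)).
Proof. by have [_ [c _] _ _] := psiC i; apply: clamped_continuous => //; exact: ltW. Qed.
Let cd i : continuous (clamped T (dt `[0, T] (psi i))).
Proof. by have [_ [_ c] _ _] := psiC i; apply: clamped_continuous => //; exact: ltW. Qed.
Let c1 i j : continuous (clamped T (fun t => partial j (psi i t))).
Proof. by have [_ _ c _] := psiC i; apply: clamped_continuous => //; exact: ltW. Qed.

Let pC t i : 0 <= t <= T -> pC1 (psi i t). Proof. by move=> /(C12_pC2 (psiC i))[]. Qed.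

Let continuous_dilation : continuous (fun p : R * 'rV[R]_d => p.1 *: p.2).
Proof. by move=> p; apply: cvgZ; [exact: cvg_fst|exact: cvg_snd]. Qed.

Let coordc i : continuous (fun p : R * 'rV[R]_d => p.2 ord0 i).
Proof. exact: continuous_snd_coord. Qed.

(** As the field is curl-free, the derivative in direction [j] of the integrand
    [\sum_i psi i t (r *: x) * x ord0 i] equals the derivative in [r] of [r * psi j t (r *: x)],
    whose increment over [[0, 1]] is [psi j t x]. *)
Lemma potential_grad t x j : 0 <= t <= T -> pderivable j (potential t) x /\ partial j (potential t) x = psi j t x.
Proof.
move=> tT; pose D (p : R * 'rV[R]_d) := \sum_i p.1 * partial i (psi j t) (p.1 *: p.2) * p.2 ord0 i + psi j t (p.1 *: p.2).
have cps i : continuous (psi i t) by exact: clamped_slice (@c0 i).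
have cpd i k : continuous (partial k (psi i t)) by exact: clamped_slice (@c1 i k).
have cD : continuous D.
  move=> p; apply: (@continuousD _ _ _ (fun p => \sum_i _)); last first.
    by apply: (@continuous_comp _ _ _ _ (psi j t)); [exact: continuous_dilation|exact: cps].
  apply: cvg_sum_fin => i; apply: cvgM_fun; last exact: coordc.
  apply: (@continuousM _ _ (fun p : R * 'rV[R]_d => p.1) (fun p => partial i (psi j t) (p.1 *: p.2))); first exact: cvg_fst.
  by apply: (@continuous_comp _ _ _ _ (partial i (psi j t))); [exact: continuous_dilation|exact: cpd].
pose f (r : R) (y : 'rV[R]_d) := \sum_i psi i t (r *: y) * y ord0 i.
have cf y : continuous (f ^~ y).
  move=> r; apply: cvg_sum_fin => i; apply: cvgM_fun; last exact: cvg_cst.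
  apply: (@continuous_comp _ _ _ (fun r : R => r *: y) (psi i t)); last exact: cps.
  exact: scalel_continuous.
have df r y : pderivable j (f r) y /\ partial j (f r) y = D (r, y).
  have dil i : pderivable j (fun y => psi i t (r *: y)) y /\ partial j (fun y => psi i t (r *: y)) y = r * partial j (psi i t) (r *: y).
    apply: derive_of_line; have := @pC1_is_derive_line R d (psi i t) (r *: y) (r *: e_ j) 0 (pC i tT).
    rewrite scale0r addr0; have -> : (fun h : R => psi i t (r *: y + h *: (r *: e_ j))) = fun h : R => psi i t (r *: (y + h *: e_ j)).
      by apply/funext => h; rewrite scalerDr !scalerA mulrC.
    move=> h; apply: (is_derive_eq h); rewrite (bigD1 j)//= big1 => [|k kj].
      by rewrite !mxE !eqxx mulr1 addr0.
    by rewrite !mxE eqxx (negbTE kj) mulr0 mul0r.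
  have term i : pderivable j (fun y => psi i t (r *: y) * y ord0 i) y /\
     partial j (fun y => psi i t (r *: y) * y ord0 i) y = r * partial i (psi j t) (r *: y) * y ord0 i + psi i t (r *: y) * (i == j)%:R.
    have [a1 a2] := dil i; have [b1 b2] := partial_coord i j y.
    have [m1 m2] := partialM a1 b1; split; first exact: m1.
    by rewrite m2 a2 b2 (curl _ _ _ tT) addrC mulrC.
  have [s1 s2] := partial_sum (index_enum 'I_d) (fun i => (term i).1); split; first exact: s1.
  rewrite /f s2; under eq_bigr do rewrite (term _).2.
  rewrite big_split /= /D /=; congr (_ + _).
  rewrite (bigD1 j)//= eqxx mulr1 big1 ?addr0// => k kj; by rewrite (negbTE kj) mulr0.
have [p1 p2] := partial_integral x cD cf df; split; first exact: p1.
rewrite [LHS]p2.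
have dF (r : R) : is_derive r 1 (fun r : R => r * psi j t (r *: x)) (D (r, x)).
  have h := @pC1_is_derive_line R d (psi j t) 0 x r (pC j tT).
  have E0 : (fun h : R => psi j t (0 + h *: x)) = fun h : R => psi j t (h *: x) by apply/funext => s; rewrite add0r.
  rewrite E0 add0r in h; have h2 := is_deriveM (is_derive_id r 1) h.
  have -> : (fun r : R => r * psi j t (r *: x)) = id * (fun h : R => psi j t (h *: x)) by [].
  apply: (is_derive_eq h2); rewrite /D /= /GRing.scale /= mulr1; congr (_ + _); rewrite mulr_sumr.
  by apply: eq_bigr => i _; rewrite -mulrA; congr (_ * _); rewrite mulrC.
rewrite (FTC_is_derive ler01 dF); last by apply: continuous_slice.
by rewrite mul1r scale1r mul0r subr0.
Qed.

Let continuous_segment (f : 'I_d -> R -> 'rV[R]_d -> R) : (forall i, continuous (clamped T (f i))) ->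
  continuous (clamped T (fun t x => \int[leb]_(r in `[0, 1]) \sum_i f i t (r *: x) * x ord0 i)).
Proof.
move=> cf p; pose F (q : R * 'rV[R]_d) (r : R) := \sum_i clamped T (f i) (q.1, r *: q.2) * q.2 ord0 i.
have cF (r : R) : continuous (F ^~ r).
  move=> q; apply: cvg_sum_fin => i; apply: (@continuousM _ _ (fun q => clamped T (f i) (q.1, r *: q.2))); last exact: coordc.
  apply/cts_txP => e e0; have [del del0 h] := (cts_txP (clamped T (f i)) (q.1, r *: q.2)).1 (@cf i _) e e0.
  have n0 : 0 < `|r| + 1 by rewrite ltr_wpDl.
  exists (Num.min del (del / (`|r| + 1))); first by rewrite lt_min del0 divr_gt0.
  move=> s y; rewrite !lt_min => /andP[s1 _] /andP[_ y2]; apply: h => //=.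
  rewrite -scalerBr normrZ; apply: (@le_lt_trans _ _ ((`|r| + 1) * `|y - q.2|)); first by rewrite ler_wpM2r// lerDl.
  by rewrite mulrC -ltr_pdivlMr.
have cFr q : continuous (F q).
  move=> r; apply: cvg_sum_fin => i; apply: cvgM_fun; last exact: cvg_cst.
  apply: (@continuous_comp _ _ _ (fun r : R => r *: q.2) (fun y => clamped T (f i) (q.1, y))); first exact: scalel_continuous.
  by apply: continuous_slice2.
have /choice[K HK] : forall i, exists Ki : R, 0 <= Ki /\ forall t x, 0 <= t <= T -> `|x| <= `|p.2| + 1 -> `|clamped T (f i) (t, x)| <= Ki.
  by move=> i; have [Ki K0 h] := bounded_on_box T (`|p.2| + 1) (@cf i); exists Ki.
pose g (r : R) : R := \sum_i K i * (`|p.2| + 1).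
apply: (@continuity_param R _ (measurableTypeR R) leb (R * 'rV[R]_d)%type `[0, 1]%classic F p 1 g).
- exact: mI.
- exact: ltr01.
- by move=> q _; apply: measurable_funTS; exact: continuous_measurable_fun.
- by move=> r _; exact: cF.
- exact: itg_cst_itv.
- move=> q r [_ pq] r01; apply: (le_trans (ler_norm_sum _ _ _)); apply: ler_sum => i _.
  have q2 : `|q.2| <= `|p.2| + 1.
    move: pq; rewrite -ball_normE /= => pq; have := ler_normB p.2 (p.2 - q.2).
    by rewrite opprB addrC subrK => /le_trans; apply; rewrite lerD2l ltW.
  move: r01; rewrite /= in_itv/= => /andP[r0 r1]; have [K0 hK] := HK i.
  rewrite normrM; apply: ler_pM => //; last by apply: (le_trans (coord_norm _ _)).
  rewrite /clamped /= -[clamp T q.1](clamp_id (clamp_itv q.1 (ltW T0))); apply: hK; first by apply: clamp_itv; exact: ltW.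
  by rewrite normrZ ger0_norm//; apply: le_trans q2; rewrite ler_piMl.
Qed.

Lemma continuous_potential : continuous (clamped T potential). Proof. exact: (continuous_segment c0). Qed.
Lemma continuous_potential_rate : continuous (clamped T potential_rate). Proof. exact: (continuous_segment cd). Qed.

Lemma C12_increment (f : R -> 'rV[R]_d -> R) (s t e : R) y : C12 `[0, T] f -> 0 <= s <= T -> 0 <= t <= T ->
  (forall c, 0 <= c <= T -> `|c - t| <= `|s - t| -> `|dt `[0, T] f c y - dt `[0, T] f t y| <= e) ->
  `|f s y - f t y - (s - t) * dt `[0, T] f t y| <= e * `|s - t|.
Proof.
move=> fC /andP[s0 sT] /andP[t0 tT] H; have [st|ts] := leP s t.
  have [c /andP[c1' c2'] E] := C12_mvt y fC s0 st tT.
  have -> : f s y - f t y - (s - t) * dt `[0, T] f t y = (dt `[0, T] f c y - dt `[0, T] f t y) * (s - t).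
    by rewrite -[f s y - f t y]opprB E; ring.
  rewrite normrM ler_wpM2r//; apply: H; first by rewrite (le_trans s0)// (le_trans c2').
  by rewrite [`|s - t|]distrC [`|c - t|]distrC !ger0_norm ?subr_ge0// lerD2l lerN2.
have [c /andP[c1' c2'] E] := C12_mvt y fC t0 (ltW ts) sT.
rewrite E [(s - t) * _]mulrC -mulrBl normrM ler_wpM2r//; apply: H; first by rewrite (le_trans t0)// (le_trans c2').
by rewrite !ger0_norm ?subr_ge0// ?(ltW ts)// lerD2r.
Qed.

Let itg_segment (f : 'I_d -> 'rV[R]_d -> R) x : (forall i, continuous (f i)) -> itg leb `[0, 1] (fun r : R => \sum_i f i (r *: x) * x ord0 i).
Proof.
move=> cf; apply: itg_cts_itv => r; apply: cvg_sum_fin => i.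
apply: cvgM_fun; last exact: cvg_cst.
by apply: (@continuous_comp _ _ _ (fun r : R => r *: x) (f i)); [exact: scalel_continuous|exact: cf].
Qed.

Lemma potential_increment t x (e : R) : 0 <= t <= T -> 0 < e -> exists2 del : R, 0 < del & forall s, 0 <= s <= T -> `|s - t| < del ->
  `|potential s x - potential t x - (s - t) * potential_rate t x| <= e * `|s - t|.
Proof.
(* Each component is multiplied by a coordinate of [x], so the tolerance is divided by the sum of
   their absolute values; the added 1 covers [x = 0]. *)
move=> tT e0; pose e' := e / (\sum_i `|x ord0 i| + 1).
have n0 : 0 < \sum_i `|x ord0 i| + 1 by rewrite ltr_wpDl// sumr_ge0.
have e'0 : 0 < e' by rewrite divr_gt0.
have /choice[del Hdel] : forall i, exists del : R, 0 < del /\ forall t y s z, 0 <= t <= T -> `|y| <= `|x| -> `|s - t| < del -> `|z - y| < del ->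
    `|clamped T (dt `[0, T] (psi i)) (s, z) - clamped T (dt `[0, T] (psi i)) (t, y)| <= e'.
  by move=> i; have [dl dl0 h] := unif_on_box T `|x| (@cd i) e'0; exists dl.
exists (\big[Num.min/1]_i del i); first by apply/bigmin_gtP; split => // i _; have [] := Hdel i.
move=> s sT /bigmin_gtP[_ hs].
have I1 u : 0 <= u <= T -> itg leb `[0, 1] (fun r : R => \sum_i psi i u (r *: x) * x ord0 i).
  by move=> uT; apply: (@itg_segment (fun i => psi i u)) => i; exact: clamped_slice (@c0 i).
have I2 : itg leb `[0, 1] (fun r : R => \sum_i dt `[0, T] (psi i) t (r *: x) * x ord0 i).
  by apply: (@itg_segment (fun i => dt `[0, T] (psi i) t)) => i; exact: clamped_slice (@cd i).
have I3 := leb_itgB R _ _ _ (mI 0 1) (I1 s sT) (I1 t tT).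
have I4 := leb_itgZ R _ _ (s - t) (mI 0 1) I2.
rewrite /potential /potential_rate (leb_RintB R _ _ _ (mI 0 1) (I1 s sT) (I1 t tT)).
rewrite -(leb_RintegralZl R _ _ (s - t) (mI 0 1) I2) (leb_RintB R _ _ _ (mI 0 1) I3 I4).
have -> : e * `|s - t| = \int[leb]_(r in `[0, 1]) (e * `|s - t|) by rewrite Rint_cst_itv// subr0 mulr1.
apply: (leb_le_Rint_bound R _ _ _ (mI 0 1) (leb_itgB R _ _ _ (mI 0 1) I3 I4) (itg_cst_itv 0 1 _)).
move=> r; rewrite /= in_itv/= => /andP[r0 r1].
rewrite mulr_sumr -!sumrB; apply: (le_trans (ler_norm_sum _ _ _)).
apply: (@le_trans _ _ (\sum_i e' * `|s - t| * `|x ord0 i|)).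
  apply: ler_sum => i _.
  have alg (a a' c k h : R) : a * k - a' * k - h * (c * k) = (a - a' - h * c) * k by ring.
  rewrite alg normrM ler_wpM2r//; apply: C12_increment => // c cT cs; have [del0 h] := Hdel i.
  have := h t (r *: x) c (r *: x) tT; rewrite /clamped /= !clamp_id// subrr normr0 => h'; apply: h' => //.
    by rewrite normrZ ger0_norm// ler_piMl.
  exact: le_lt_trans cs (hs i isT).
rewrite -mulr_sumr mulrAC ler_wpM2r// /e' mulrAC ler_pdivrMr// ler_wpM2l ?(ltW e0)// lerDl ler01//.
Qed.

Variable th : R -> R.
Hypothesis Ith : itg leb `[0, T] th.
Hypothesis cth : forall S, 0 < S -> S < T -> continuous (fun t => th (clamp S t)).

(** [th] will be [Theta] at the origin. It is integrable on [[0, T]] but continuous only before [T];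
    hence [action] is continuous up to [T] and differentiable on [[0, T[], which is the regularity
    claimed for the potential. *)
Definition action (t : R) : R := \int[leb]_(r in `[0, t]) th r.
Definition full_potential (t : R) (x : 'rV[R]_d) : R := potential t x + action t.

Let action_increment t (e : R) : 0 <= t < T -> 0 < e -> exists2 del : R, 0 < del & forall s, 0 <= s < T -> `|s - t| < del ->
  `|action s - action t - (s - t) * th t| <= e * `|s - t|.
Proof.
move=> /andP[t0 tT] e0; pose S := (t + T) / 2.
have tS : t < S by rewrite /S; lra.
have ST : S < T by rewrite /S; lra.
have S0 : 0 < S := le_lt_trans t0 tS.
have := cth S0 ST => /(_ t) /cvgrPdist_le /(_ e e0) /nbhs_ballP[del /= del0 H].
have HS r : 0 <= r <= S -> `|r - t| < del -> `|th r - th t| <= e.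
  move=> rS rt; have := H r; rewrite -ball_normE /= distrC => /(_ rt).
  by rewrite !clamp_id// ?t0 ?(ltW tS)// distrC.
have Isub u v : 0 <= u -> v <= S -> itg leb `[u, v] th.
  move=> u0 vS; apply: (leb_integrableS R `[0, T]%classic _ _ (mI 0 T) (mI u v) _ Ith).
  by move=> r /=; rewrite !in_itv/= => /andP[ur rv]; rewrite (le_trans u0 ur) (le_trans rv (le_trans vS (ltW ST))).
exists (Num.min del (S - t)); first by rewrite lt_min del0 subr_gt0.
move=> s /andP[s0 sT]; rewrite lt_min => /andP[sd sS'].
have sS : s <= S by have := ler_norm (s - t); lra.
have [st|ts] := leP s t.
  rewrite /action (Rint_split s0 st (Isub 0 t (lexx 0) (ltW tS))).
  have alg (a q h k : R) : a - (a + q) - (- h) * k = - (q - h * k) by ring.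
  rewrite -[s - t]opprB alg normrN normrN [`|t - s|]ger0_norm ?subr_ge0//.
  apply: Rint_near_cst => //; first exact: (Isub s t s0 (ltW tS)).
  move=> r /andP[sr rt]; apply: HS; first by rewrite (le_trans s0 sr) (le_trans rt (ltW tS)).
  by apply: le_lt_trans sd; rewrite [`|s - t|]distrC [`|r - t|]distrC !ger0_norm ?subr_ge0// lerD2l lerN2.
rewrite /action (Rint_split t0 (ltW ts) (Isub 0 s (lexx 0) sS)).
have alg (a q k : R) : a + q - a - k = q - k by ring.
rewrite alg [`|s - t|]ger0_norm ?subr_ge0 ?(ltW ts)//.
apply: Rint_near_cst; [exact: ltW|exact: (Isub t s t0 sS)|].
move=> r /andP[tr rs]; apply: HS; first by rewrite (le_trans t0 tr) (le_trans rs sS).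
by apply: le_lt_trans sd; rewrite !ger0_norm ?subr_ge0 ?(ltW ts)// lerD2r.
Qed.

Lemma full_potential_time t x : 0 <= t < T ->
  time_quot full_potential t x @ within `[0, T[%classic t^' --> potential_rate t x + th t.
Proof.
move=> tT; have tT' : 0 <= t <= T by have /andP[-> /ltW] := tT.
apply/time_quotP => e e0; have e20 : 0 < e / 2 by rewrite divr_gt0.
have [d1 d10 H1] := potential_increment x tT' e20; have [d2 d20 H2] := action_increment tT e20.
exists (Num.min d1 d2); first by rewrite lt_min d10.
move=> s; rewrite /= in_itv/= => sT st; rewrite lt_min => /andP[s1 s2].
have sT' : 0 <= s <= T by have /andP[-> /ltW] := sT.
have n0 : 0 < `|s - t| by rewrite normr_gt0 subr_eq0.
rewrite -(ler_pM2l n0) -normrM /time_quot /full_potential.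
have alg (p p' a a' q k : R) (h : R) : h != 0 -> h * (h^-1 * (p + a - (p' + a')) - (q + k)) = (p - p' - h * q) + (a - a' - h * k).
  by move=> h0; field.
rewrite alg ?subr_eq0//; apply: (le_trans (ler_normD _ _)).
by apply: (le_trans (lerD (H1 s sT' s1) (H2 s sT s2))); rewrite -mulrDl -splitr mulrC.
Qed.

Lemma full_potential_grad t x j : 0 <= t <= T -> pderivable j (full_potential t) x /\ partial j (full_potential t) x = psi j t x.
Proof.
move=> tT; have [p1 p2] := potential_grad x j tT.
have [q1 q2] := partialD p1 (derivable_cst (action t) x (e_ j) : pderivable j (fun=> action t) x); split; first exact: q1.
by rewrite [LHS]q2 p2 partial_cst addr0.
Qed.

Lemma full_potential_continuous : continuous_tx `[0, T] full_potential.
Proof.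
apply/continuous_txP => t x tT e e0; have e20 : 0 < e / 2 by rewrite divr_gt0.
have [d1 d10 H1] := (cts_txP _ _).1 (@continuous_potential (t, x)) _ e20.
have ca : {within `[0, T], continuous action} by apply: parameterized_integral_continuous => //; exact: ltW.
have /subspace_continuousP /(_ t tT) /cvgrPdist_le /(_ _ e20) := ca.
rewrite near_withinE => /nbhs_ballP[d2 /= d20 H2].
exists (Num.min d1 d2); first by rewrite lt_min d10.
move=> s y sT; rewrite !lt_min => /andP[s1 s2] /andP[y1 _].
have h1 := H1 s y s1 y1.
have h2 : `|action t - action s| <= e / 2 by apply: H2 => //; rewrite -ball_normE /= distrC.
move: sT tT h1; rewrite /= !in_itv/= => sT tT; rewrite /clamped /= !clamp_id// => h1.
have alg (p p' a a' : R) : p + a - (p' + a') = (p - p') - (a' - a) by ring.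
by rewrite /full_potential alg (splitr e); apply: (le_trans (ler_normB _ _)); exact: lerD.
Qed.

(** Both time sets occur in [classical_solution]: class [C12] refers to [[0, T[], the equation to
    [[0, T]]. Near a time before [T] they coincide, hence so do the derivatives. *)
Lemma full_potential_dt t x : 0 <= t < T -> dt `[0, T[ full_potential t x = potential_rate t x + th t /\
  dt `[0, T] full_potential t x = potential_rate t x + th t.
Proof.
move=> tT; have H := @full_potential_time t x tT; split; first by apply: (dt_unique (limit_time_co tT) H).
have tT' : 0 <= t <= T by have /andP[-> /ltW] := tT.
apply: dt_unique; first exact: limit_time_cc.
apply: (time_quotS _ H); have /andP[t0 t1] := tT.
exists (T - t); first by rewrite subr_gt0.
move=> s; rewrite /= !in_itv/= => /andP[-> _] h; have := ler_norm (s - t); lra.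
Qed.

Lemma full_potential_C12 : C12 `[0, T[ full_potential.
Proof.
have le t : `[0, T[%classic t -> 0 <= t <= T by rewrite /= in_itv/= => /andP[-> /ltW].
have sub (f g : R -> 'rV[R]_d -> R) : continuous (clamped T f) -> (forall t x, 0 <= t < T -> f t x = g t x) -> continuous_tx `[0, T[ g.
  move=> cf fg; apply/continuous_txP => t x It e e0; have [dl dl0 h] := (cts_txP _ _).1 (cf (t, x)) e e0.
  exists dl => // s y Is s1 y1; have := h s y s1 y1; rewrite /clamped /= !clamp_id ?le// !fg//; by rewrite -[_ <= _]/(_ \in `[0, T[) .
have E1 t i : 0 <= t <= T -> partial i (full_potential t) = psi i t.
  by move=> tT; apply/funext => x; have [] := full_potential_grad x i tT.
split.
- move=> t x tT; split=> [|i|i j].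
  + by apply/cvg_ex; eexists; apply: full_potential_time; move: tT; rewrite /= in_itv.
  + by have [] := full_potential_grad x i (le _ tT).
  + by rewrite (E1 _ _ (le _ tT)); have [Hd _ _ _] := psiC i; have [_ h _] := Hd t x (in0T (le _ tT)).
- split.
    apply/continuous_txP => t x It e e0; have [dl dl0 h] := (continuous_txP _ _).1 full_potential_continuous t x (in0T (le _ It)) e e0.
    by exists dl => // s y Is; apply: h; exact: in0T (le _ Is).
  apply/continuous_txP => t x; rewrite /= in_itv/= => It e e0; have e20 : 0 < e / 2 by rewrite divr_gt0.
  have [d1 d10 H1] := (cts_txP _ _).1 (@continuous_potential_rate (t, x)) _ e20.
  have /andP[t0 tT] := It; pose S := (t + T) / 2.
  have tS : t < S by rewrite /S; lra.
  have ST : S < T by rewrite /S; lra.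
  have S0 : 0 < S := le_lt_trans t0 tS.
  have := cth S0 ST => /(_ t) /cvgrPdist_le /(_ _ e20) /nbhs_ballP[d2 /= d20 H2].
  exists (Num.min (Num.min d1 d2) (S - t)); first by rewrite !lt_min d10 d20 subr_gt0.
  move=> s y; rewrite /= in_itv/= => Is; rewrite !lt_min => /andP[/andP[s1 s2] s3] /andP[/andP[y1 _] _].
  rewrite (full_potential_dt y Is).1 (full_potential_dt x It).1.
  have sT : 0 <= s <= T by have /andP[-> /ltW] := Is.
  have tT' : 0 <= t <= T by have /andP[-> /ltW] := It.
  have h1 := H1 s y s1 y1; rewrite /clamped /= !clamp_id// in h1.
  have sS : s <= S by have := ler_norm (s - t); lra.
  have h2 := H2 s; rewrite -ball_normE /= distrC in h2; have {}h2 := h2 s2.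
  have s0 : 0 <= s by have /andP[] := Is.
  rewrite !clamp_id ?t0 ?s0 ?(ltW tS)// in h2.
  have alg (p p' a a' : R) : p + a - (p' + a') = (p - p') - (a' - a) by ring.
  by rewrite alg (splitr e); apply: (le_trans (ler_normB _ _)); exact: lerD.
- move=> i; apply: (sub (psi i)); first exact: c0.
  by move=> t x tT; rewrite E1//; have /andP[-> /ltW] := tT.
- move=> i j; apply: (sub (fun t => partial j (psi i t))); first exact: c1.
  by move=> t x tT; rewrite E1//; have /andP[-> /ltW] := tT.
Qed.

End potential.

(** * The potential solves the system *)

Section solution.
Context {R : realType} {d : nat} {T : R} (P : probability (path_space R d T) R).
Local Notation Om := (path_space R d T).
Local Notation leb := (@lebesgue_measure R).
Variables (W : 'rV[R]_d -> R) (Psi : R -> 'rV[R]_d -> 'rV[R]_d) (mu : R -> 'rV[R]_d -> R) (nu : set 'rV[R]_d -> \bar R) (C : R).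
Hypotheses (T0 : 0 < T) (W2 : pC2 W) (W_sym : forall z, W z = W (- z)) (C0 : 0 <= C) (W_hess : forall z i j, `|hess W z i j| <= C).
Hypotheses (P_P1 : P1 P) (init_sq : forall i, itg P setT (fun w : Om => w 0 ord0 i ^+ 2)).
Hypothesis Psi_H1 : H_minus1 (T := T) (marg P) Psi.
Hypothesis Psi_BM : brownian_motion P (natural_filtration coordp) T nu
        (fun t w => coordp t w - vint leb `[0, t]
           (fun s => - convgrad W (marg P s) (coordp s w) + Psi s (coordp s w))).
Let M (t : R) (w : Om) := Psi t (coordp t w) - vint leb `[0, t]
           (fun s => vint P setT (fun w' : Om =>
              (Psi s (coordp s w) - Psi s (coordp s w')) *m hess W (coordp s w - coordp s w'))).
Hypothesis Psi_M : continuous_martingale P (natural_filtration coordp) `[0, T[%classic M.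
Hypotheses (mu_dens : forall t : R, 0 <= t <= T -> has_density (marg P t) (mu t))
  (mu_gt0 : forall (t : R) x, 0 <= t <= T -> 0 < mu t x) (mu_C12 : C12 `[0, T] mu).
Hypothesis Psi_C12 : forall i, C12 `[0, T] (fun t x => Psi t x ord0 i).

Let T0' : 0 <= T. Proof. exact: ltW. Qed.
Let mI (u v : R) : measurable (`[u, v]%classic : set R). Proof. exact: measurable_itv. Qed.
Let psi i (t : R) (x : 'rV[R]_d) : R := Psi t x ord0 i.
Let ps i := clamped T (psi i).
Let H i j (z : 'rV[R]_d) : R := partial i (partial j W) z.
Let V i := @convP R d T P (partial i W).
Let b i (p : R * 'rV[R]_d) : R := - V i p.1 p.2 + ps i p.
Let L := C * d%:R.

Let L0 : 0 <= L. Proof. exact: mulr_ge0. Qed.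
Let HC i j z : `|H i j z| <= C. Proof. by have := W_hess z i j; rewrite !mxE. Qed.
Let cH i j : continuous (H i j). Proof. exact: (W2.2 j).2. Qed.
Let Hsym i j : partial j (partial i W) = H i j. Proof. by apply/funext => z; exact: schwarz. Qed.
Let W_lip i y z : `|partial i W y - partial i W z| <= L * `|y - z|.
Proof. by apply: (pC1_lipschitz (W2.2 i)) => j x; exact: HC. Qed.
Let kb i z : `|partial i W z| <= 0 + L * `|z|.
Proof. by have := W_lip i z 0; rewrite (even_partial0 i W2.1 W_sym) !subr0 add0r. Qed.
Let cW i : continuous (partial i W). Proof. exact: W2.1.2. Qed.
Let Irun : itg P setT (@runmax R d T). Proof. exact: itg_runmax. Qed.

Let cV i : continuous (fun p => V i p.1 p.2).
Proof. exact: (convP_continuous T0' Irun L0 (kb i) (@cW i)). Qed.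
Let cps i : continuous (ps i).
Proof. by have [_ [c _] _ _] := Psi_C12 i; exact: clamped_continuous. Qed.
Let cb i : continuous (b i).
Proof. by move=> p; exact: (@continuousD _ _ _ (fun p => - V i p.1 p.2) (ps i) p (@continuousN _ _ _ (fun p => V i p.1 p.2) p (@cV i p)) (@cps i p)). Qed.
Let psE i t x : 0 <= t <= T -> ps i (t, x) = Psi t x ord0 i.
Proof. by move=> tT; rewrite /ps /clamped /= clamp_id. Qed.

Let itgV i t x : itg P setT (fun w : Om => partial i W (x - w t)).
Proof. exact: (itg_path_shift T0' Irun L0 (kb i)). Qed.

Let measurable_gradW i x : measurable_fun setT (fun y : 'rV[R]_d => partial i W (x - y)).
Proof.
apply: continuous_measurable_rV => y; apply/cts_rVP => e e0; have /cts_rVP /(_ e e0)[del del0 h] := @cW i (x - y).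
by exists del => // z zy; apply: h; rewrite subrBB distrC.
Qed.

Let convgradE t x i : convgrad W (marg P t) x ord0 i = V i t x.
Proof.
rewrite /convgrad /vint mxE; under eq_Rintegral do rewrite mxE.
exact: (Rint_marg (measurable_gradW i x) (itgV i t x)).
Qed.

Let driftE t x i : 0 <= t <= T -> (- convgrad W (marg P t) x + Psi t x) ord0 i = b i (t, x).
Proof. by move=> tT; rewrite mxE [X in X + _]mxE convgradE /b psE. Qed.

(** The increment over [[u, v]] of the compensated process is [noise], because the drift integrals
    over [[0, u]] cancel; events of [X_u] belong to the natural filtration at [u]. *)
Let indep : independent_noise P b.
Proof.
move=> u v A B u0 uv vT mA mB; have [_ _ _ incr] := Psi_BM.
have FA : natural_filtration (@coordp R d T) u (coordp u @^-1` A).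
  apply: sub_sigma_algebra; exists u; first by rewrite /= in_itv/= u0 lexx.
  by exists A => //; rewrite setTI.
rewrite -(incr u v _ B u0 uv vT FA mB); congr (fine (P (_ `&` _))).
have int t (w : Om) i : t <= T -> vint leb `[0, t] (fun s => - convgrad W (marg P s) (coordp s w) + Psi s (coordp s w)) ord0 i =
    driftint b 0 t w i.
  move=> tT; rewrite /vint mxE; apply: eq_Rintegral => s; rewrite inE /= in_itv/= => /andP[s0 st].
  by rewrite driftE// s0 (le_trans st).
have E (w : Om) i : noise b u v w ord0 i = (coordp v w - vint leb `[0, v] (fun s => - convgrad W (marg P s) (coordp s w) + Psi s (coordp s w))
    - (coordp u w - vint leb `[0, u] (fun s => - convgrad W (marg P s) (coordp s w) + Psi s (coordp s w)))) ord0 i.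
  have uT := le_trans (ltW uv) vT.
  rewrite /noise mxE [RHS]mxE [X in _ = X + _]mxE [X in _ = _ + X]mxE [X in _ = _ + - X]mxE.
  rewrite [X in _ = _ + X + _]mxE [X in _ = _ - (_ + X)]mxE !int//.
  have I := itg_b cb w i 0 v; rewrite /driftint (Rint_split u0 (ltW uv) I) /coordp.
  have alg (a c p q : R) : a - c - q = a - (p + q) - (c - p) by ring.
  exact: alg.
by apply/seteqP; split => w /= h i; have := h i; rewrite E.
Qed.

Let Hps i : (\int[leb]_(t in `[0%R, T]) \int[P]_w (ps i (t, w t) ^+ 2)%:E < +oo)%E.
Proof.
have [_ Ffin _] := Psi_H1.
rewrite (L2_distP P cps (G := fun _ _ => 0)) in Ffin; last by move=> t x k tT; rewrite psE// subr0.
apply: le_lt_trans Ffin.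
have mp k : measurable_fun setT (fun p : R * Om => ps k (p.1, p.2 p.1) ^+ 2).
  by apply: (measurableT_comp (exprn_measurable 2)); exact: measurable_along_path.
have mr k r : measurable_fun setT (fun w : Om => ps k (r, w r) ^+ 2).
  exact: (measurableT_comp (mp k) (@pair1_measurable _ _ _ _ r)).
apply: ge0_le_integral.
- exact: mI.
- by move=> t _; apply: integral_ge0 => w _; rewrite lee_fin sqr_ge0.
- apply: measurable_funTS; apply: (@measurable_integral_ge0 _ _ R P (fun p => ps i (p.1, p.2 p.1) ^+ 2)).
    exact: mp.
  by move=> p; exact: sqr_ge0.
- apply: measurable_funTS; apply: (@measurable_integral_ge0 _ _ R P (fun p => \sum_k ps k (p.1, p.2 p.1) ^+ 2)).
    exact: measurable_sum.
  by move=> p; apply: sumr_ge0 => k _; exact: sqr_ge0.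
- move=> t _; apply: ge0_le_integral => //.
  + by move=> w _; rewrite lee_fin sqr_ge0.
  + by apply/measurable_EFinP; exact: mr.
  + by apply/measurable_EFinP; exact: measurable_sum.
  + by move=> w _; rewrite lee_fin (bigD1 i)//= lerDl; apply: sumr_ge0 => k _; exact: sqr_ge0.
Qed.

(** The convolution part of the drift grows at most linearly, with constant term [L] times the mean
    of [runmax]; the remaining part is the corrector, of finite energy by [H_minus1]. *)
Let energies : (\int[leb]_(t in `[0%R, T]) \int[P]_w (`|w t| ^+ 2)%:E < +oo)%E /\
  finite_energy P b.
Proof.
have run0 : 0 <= \int[P]_w (@runmax R d T) w by apply: Rintegral_ge0 => w _; exact: runmax_ge0.
apply: (@position_drift_energy R d T P b ps (L * \int[P]_w (@runmax R d T) w) L T0 cb cps) => //; first exact: mulr_ge0.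
move=> i t x; apply: (le_trans (ler_normD _ _)); rewrite lerD2r normrN.
have := convP_le T0' Irun L0 (kb i) x t (@cW i); rewrite add0r addrC; exact.
Qed.
Let Hb := energies.2.

Let martE j t w : 0 <= t < T -> M t w ord0 j = mart P ps H j t w.
Proof.
move=> /andP[t0 tT]; rewrite /M mxE [X in _ + X]mxE /vint [X in _ - X]mxE /mart psE; last by rewrite t0 ltW.
congr (_ - _); apply: eq_Rintegral => s; rewrite inE /= in_itv/= => /andP[s0 st].
have sT : 0 <= s <= T by rewrite s0 (le_trans st)// ltW.
rewrite mxE; apply: eq_Rintegral => w' _; rewrite mxE; apply: eq_bigr => i _.
by rewrite !psE// mxE [X in _ + X]mxE mxE.
Qed.

Let F := natural_filtration (@coordp R d T).
Let FX t B : 0 <= t < T -> measurable B -> F t (coordp t @^-1` B).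
Proof.
move=> /andP[t0 tT] mB; apply: sub_sigma_algebra; exists t; first by rewrite /= in_itv/= t0 lexx.
by exists B => //; rewrite setTI.
Qed.
Let FM t j (B : set R) : 0 <= t < T -> measurable B -> F t (mart P ps H j t @^-1` B).
Proof.
move=> tT mB; have [ad _ _ _] := Psi_M.
have It : `[0, T[%classic t by rewrite /= in_itv.
have mj : measurable ((fun x : 'rV[R]_d => x ord0 j) @^-1` B).
  by rewrite -[X in measurable X]setTI; exact: (measurable_coord j).
have := ad t It _ mj; rewrite (_ : M t @^-1` _ = mart P ps H j t @^-1` B)//.
by apply/seteqP; split => w /=; rewrite martE.
Qed.
Let iM t j : 0 <= t < T -> itg P setT (mart P ps H j t).
Proof.
move=> tT; have [_ _ im _] := Psi_M; have It : `[0, T[%classic t by rewrite /= in_itv.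
by apply: (itg_eq measurableT (im t j It)) => w _; exact: martE.
Qed.
Let martP s t A j : 0 <= s -> s <= t -> t < T -> F s A ->
  \int[P]_(w in A) mart P ps H j t w = \int[P]_(w in A) mart P ps H j s w.
Proof.
move=> s0 st tT FA; have [_ _ _ mm] := Psi_M.
have sT : 0 <= s < T by rewrite s0 (le_lt_trans st).
have tT' : 0 <= t < T by rewrite (le_trans s0).
have := mm s t A j; rewrite /= !in_itv/= => /(_ sT tT' st FA) E.
transitivity (\int[P]_(w in A) M t w ord0 j); first by apply: eq_Rintegral => w _; rewrite martE.
by rewrite E; apply: eq_Rintegral => w _; rewrite martE.
Qed.

Let cmu : continuous (clamped T mu).
Proof. by have [_ [c _] _ _] := mu_C12; exact: clamped_continuous. Qed.

Let pde j t x : 0 <= t < T -> residual P b psi H j t x = 0.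
Proof. exact: (corrector_pde T0 cb indep Hb Psi_C12 cH HC Hps FX FM iM martP mu_dens mu_gt0 cmu Irun j x). Qed.

Let curl t x i j : 0 <= t <= T -> partial j (psi i t) x = partial i (psi j t) x.
Proof. exact: (curl_free T0 mu_dens mu_gt0 cmu Psi_H1 Psi_C12 x i j). Qed.

Let good_t t : 0 <= t < T -> good P ps t.
Proof. by move=> /andP[t0 tT]; exact: (good_lt T0 cps cH HC Hps FM iM martP t0 tT). Qed.

Let gradW_sq i t x : itg P setT (fun w : Om => partial i W (x - w t) ^+ 2).
Proof.
have [K _ HK] := position_sq T0 cb indep Hb init_sq.
have Is : itg P setT (fun w : Om => \sum_k w t ord0 k ^+ 2) by apply: itg_sum => // k; have [] := HK t k.
have I := itgD measurableT (itg_cst P (L ^+ 2 * (2 * `|x| ^+ 2))) (itgZ (L ^+ 2 * 2) measurableT Is).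
apply: (itg_le measurableT _ I).
  apply: (measurableT_comp (exprn_measurable 2)); exact: (measurable_at t (measurable_gradW i x)).
move=> w _; rewrite normrX /=; have h := kb i (x - w t); rewrite add0r in h.
apply: (@le_trans _ _ ((L * (`|x| + `|w t|)) ^+ 2)).
  rewrite lerXn2r ?nnegrE ?mulr_ge0 ?addr_ge0//; apply: (le_trans h); rewrite ler_wpM2l//; exact: ler_normB.
have alg (l z y s : R) : y ^+ 2 <= s -> (l * (z + y)) ^+ 2 <= l ^+ 2 * (2 * z ^+ 2) + l ^+ 2 * 2 * s.
  move=> h1; have h2 : 0 <= l ^+ 2 * (s - y ^+ 2) by rewrite mulr_ge0 ?sqr_ge0// subr_ge0.
  by have := sqr_ge0 (l * (z - y)); rewrite !exprMn !sqrrD sqrrN; nra.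
by apply: alg; exact: norm_sqs.
Qed.

(** The kernel [partial i W] is unbounded, unlike the kernels of [continuous_weighted]; [J] exists
    because both factors have second moments at times before [T]. *)
Let J i (t : R) (x : 'rV[R]_d) : R := \int[P]_w (partial i W (x - w t) * ps i (t, w t)).

Let mps i t : measurable_fun setT (fun w : Om => ps i (t, w t)).
Proof.
apply: (@measurable_at R d T (fun y => ps i (t, y))); apply: continuous_measurable_rV.
exact: (@continuous_slice2 R d (ps i) t (@cps i)).
Qed.

Let itgJ i t x : 0 <= t < T -> itg P setT (fun w : Om => partial i W (x - w t) * ps i (t, w t)).
Proof.
move=> tT; apply: itg_mul; [exact: (measurable_at t (measurable_gradW i x))|exact: mps|exact: gradW_sq|].
by have [] := itg_ps_good cps i (good_t tT).
Qed.

Let Inter (t : R) (x : 'rV[R]_d) : R := \sum_i (psi i t x * V i t x - J i t x).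
(** The first equation solved for the time derivative of the potential, with its gradient and
    Laplacian expressed through the corrector; [Inter] is the nonlocal right-hand side. *)
Let Theta (t : R) (x : 'rV[R]_d) : R :=
  Inter t x - 2^-1 * (\sum_i partial i (psi i t) x) - 2^-1 * (\sum_i psi i t x ^+ 2).

Let displacement s t : 0 <= s <= T -> 0 <= t <= T -> itg P setT (fun w : Om => \sum_k (w s ord0 k - w t ord0 k) ^+ 2) /\
  \int[P]_w \sum_k (w s ord0 k - w t ord0 k) ^+ 2 <= d%:R * (2 * (1 + energyT P b)) * `|s - t|.
Proof.
wlog st : s t / t <= s => [hw sT tT|sT tT].
  have [/hw h|/ltW/hw h] := leP t s; first exact: h.
  have [I B] := h tT sT.
  have E (w : Om) : \sum_k (w t ord0 k - w s ord0 k) ^+ 2 = \sum_k (w s ord0 k - w t ord0 k) ^+ 2.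
    by apply: eq_bigr => k _; rewrite -sqrrN opprB.
  split; first by apply: (itg_eq measurableT I) => w _; exact: E.
  by rewrite distrC; apply: le_trans B; rewrite le_eqVlt; apply/orP; left; apply/eqP; apply: eq_Rintegral => w _; rewrite E.
have /andP[t0 _] := tT; have /andP[_ s1] := sT.
have D k := displacement_sq cb indep Hb k t0 st s1.
split; first by apply: itg_sum => // k; have [] := D k.
rewrite Rint_sum//; last by move=> k; have [] := D k.
rewrite ger0_norm ?subr_ge0// -mulrA -[d in d%:R]card_ord -sum1_card natr_sum mulr_suml; apply: ler_sum => k _.
by rewrite mul1r; have [] := D k.
Qed.

(* [E (k(X_t) Psi_t(X_t)) = E (k(X_t) (M_S + A_t))] for [t <= S], which is continuous in [t] since [X] is continuous in L^2. *)
Let continuous_J i S : 0 < S -> S < T -> continuous (fun t => J i (clamp S t) 0).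
Proof.
move=> S0 ST; pose MS := mart P ps H i S; pose Y (t : R) (w : Om) := MS w + drift_int P ps H i t w.
have cS t : 0 <= clamp S t <= S by apply: clamp_itv; exact: ltW.
have S0T : 0 <= S < T by rewrite ltW.
have lS t : 0 <= t <= S -> 0 <= t < T by move=> /andP[-> h]; exact: le_lt_trans ST.
have lT t : 0 <= t <= S -> 0 <= t <= T by move=> /lS/andP[-> /ltW].
pose k (t : R) (w : Om) := partial i W (0 - w t).
have mk t : measurable_fun setT (k t) by exact: (measurable_at t (measurable_gradW i 0)).
have IM t : 0 <= t <= S -> itg P setT (fun w => mart P ps H i t w ^+ 2).
  by move=> /lS/andP[t0 tT]; exact: (mart_sq T0 cps cH HC Hps FM iM martP i t0 tT).
have mm t := measurable_mart P cps cH i t : measurable_fun setT (mart P ps H i t).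
have md t := measurable_drift_int P cps cH i t : measurable_fun setT (drift_int P ps H i t).
have ID2 := @drift_bound_sq R d T P ps C T0 cps Hps.
have Dle t (w : Om) : t <= T -> `|drift_int P ps H i t w| <= drift_bound P ps C w.
  by move=> tT; exact: (drift_int_bound T0 cps cH HC Hps i w tT).
have IS2 := IM S (introT andP (conj (ltW S0) (lexx S))).
have B2 := itgD measurableT (itgZ 2 measurableT IS2) (itgZ 2 measurableT ID2).
have mY t : measurable_fun setT (Y t) by exact: measurable_funD (mm S) (md t).
have Yle t (w : Om) : t <= T -> Y t w ^+ 2 <= 2 * MS w ^+ 2 + 2 * drift_bound P ps C w ^+ 2.
  move=> tT; exact: sqrD_le (Dle t w tT).
have IY t : t <= T -> itg P setT (fun w => Y t w ^+ 2).
  move=> tT; apply: (itg_le measurableT _ B2); first exact: (measurableT_comp (exprn_measurable 2) (mY t)).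
  by move=> w _; rewrite ger0_norm ?sqr_ge0//; exact: Yle.
pose K2 := \int[P]_w (2 * MS w ^+ 2 + 2 * drift_bound P ps C w ^+ 2).
have K20 : 0 <= K2 by apply: Rintegral_ge0 => w _; rewrite addr_ge0// mulr_ge0// sqr_ge0.
have YK t : t <= T -> \int[P]_w (Y t w ^+ 2) <= K2.
  by move=> tT; apply: le_Rintegral; [exact: measurableT|exact: IY|exact: B2|move=> w _; exact: Yle].
have IkY s t : t <= T -> itg P setT (fun w => k s w * Y t w).
  by move=> tT; apply: itg_mul; [exact: mk|exact: mY|exact: gradW_sq|exact: IY].
have EJ t : 0 <= t <= S -> J i t 0 = \int[P]_w (k t w * Y t w).
  move=> tS; have /andP[t0 tT] := lS t tS.
  have I1 := itg_mul (mk t) (mm S) (gradW_sq i t 0) IS2.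
  have I2 := itg_mul (mk t) (mm t) (gradW_sq i t 0) (IM t tS).
  have E := mart_transfer_at FX iM martP (measurable_gradW i 0) t0 (andP tS).2 ST I1 I2.
  have IJ := itgJ i 0 (lS t tS).
  have I3 : itg P setT (fun w => k t w * drift_int P ps H i t w).
    apply: (itg_eq measurableT (itgB measurableT IJ I2)) => w _.
    by rewrite -mulrBr; congr (_ * _); rewrite /mart opprB addrC subrK.
  transitivity (\int[P]_w (k t w * mart P ps H i t w) + \int[P]_w (k t w * drift_int P ps H i t w)).
    rewrite -(RintegralD measurableT I2 I3); apply: eq_Rintegral => w _; rewrite -mulrDr; congr (_ * _).
    by rewrite /mart subrK.
  by rewrite -E -(RintegralD measurableT I1 I3); apply: eq_Rintegral => w _; rewrite -mulrDr.
move=> s; apply/cvgrPdist_le => e e0; set s0 := clamp S s.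
have e20 : 0 < e / 2 by rewrite divr_gt0.
have e40 : 0 < e / 4 by rewrite divr_gt0.
(* Weight for Young's inequality: it makes the share of [Y] at most [e / 4], and the added 1 avoids
   a zero denominator. *)
pose del := e / 4 / (K2 + 1); have del0 : 0 < del by rewrite divr_gt0// ltr_wpDl.
have delK : del * K2 <= e / 4.
  by rewrite /del mulrAC ler_pdivrMr ?ltr_wpDl// ler_wpM2l ?(ltW e40)// lerDl.
pose Q := del^-1 * L ^+ 2 * (d%:R * (2 * (1 + energyT P b))).
have enT : 0 <= energyT P b by rewrite /energyT; apply: Rintegral_ge0 => w _; exact: energy_ge0.
have Q0 : 0 <= Q.
  by rewrite /Q; apply: mulr_ge0; [apply: mulr_ge0; [rewrite invr_ge0 ltW|exact: sqr_ge0]|apply: mulr_ge0 => //; apply: mulr_ge0 => //; exact: addr_ge0].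
have Ig : itg P setT (fun w => `|k s0 w| * (`|MS w| + drift_bound P ps C w)).
  have mB : measurable_fun setT (drift_bound P ps C).
    exact: (measurable_drift_bound P C cps).
  have n1 : itg P setT (fun w => `|k s0 w * MS w|) by exact: itg_norm (itg_mul (mk s0) (mm S) (gradW_sq i s0 0) IS2).
  have n2 : itg P setT (fun w => `|k s0 w * drift_bound P ps C w|) by exact: itg_norm (itg_mul (mk s0) mB (gradW_sq i s0 0) ID2).
  apply: (itg_eq measurableT (itgD measurableT n1 n2)) => w _; rewrite !normrM -mulrDr [`|drift_bound _ _ _ _|]ger0_norm//.
  exact: le_trans (normr_ge0 _) (Dle 0 w T0').
(* The two factors are moved one at a time. Here the kernel stays at [s0] and only the drift in [Y]
   moves, so dominated convergence applies although the kernel is unbounded. *)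
have c2 : {for s, continuous (fun t => \int[P]_w (k s0 w * Y (clamp S t) w))}.
  apply: (@continuity_param R _ Om P R setT (fun t w => k s0 w * Y (clamp S t) w) s 1 (fun w => `|k s0 w| * (`|MS w| + drift_bound P ps C w))) => //.
  - by move=> t _; exact: measurable_funM (mk s0) (mY _).
  - move=> w _; apply: cvgM_fun; first exact: cvg_cst.
    apply: cvgD_fun; first exact: cvg_cst.
    apply/cvgrPdist_le => e' e'0.
    have /subspace_continuousP /(_ s0) := @continuous_drift_int _ _ _ P ps H C T0 cps cH HC Hps i w.
    have cT : `[0, T]%classic s0 by rewrite /= in_itv/=; exact: (lT _ (cS s)).
    move=> /(_ cT) /cvgrPdist_le /(_ e' e'0); rewrite near_withinE => /nbhs_ballP[dl /= dl0 h].
    apply/nbhs_ballP; exists dl => // t /= st; apply: h; last by rewrite /= in_itv/=; exact: (lT _ (cS t)).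
    by move: st; rewrite -!ball_normE /= => st; apply: le_lt_trans st; rewrite distrC [`|s - t|]distrC; exact: clamp_lip.
  - move=> t w _ _; rewrite normrM ler_wpM2l//; apply: (le_trans (ler_normD _ _)); rewrite lerD2l; apply: Dle.
    by have /andP[_ h] := lT _ (cS t).
move: c2 => /cvgrPdist_le /(_ _ e20) /nbhs_ballP[d1 /= d10 H1].
have d20 : 0 < e / 4 / (Q + 1) by rewrite divr_gt0// ltr_wpDl.
apply/nbhs_ballP; exists (Num.min d1 (e / 4 / (Q + 1))) => /=; first by rewrite lt_min d10.
move=> t /=; rewrite lt_min => /andP[t1 t2]; set t' := clamp S t.
have [/andP[_ t'T] /andP[_ s0T]] := (lT _ (cS t), lT _ (cS s)).
rewrite !EJ; [|exact: cS|exact: cS].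
have h1 : `|\int[P]_w (k s0 w * Y s0 w) - \int[P]_w (k s0 w * Y t' w)| <= e / 2 by apply: H1; rewrite -ball_normE.
(* Now only the kernel moves: it is Lipschitz in the position, and the mean square displacement is
   at most a multiple of the elapsed time. *)
have h2 : `|\int[P]_w (k s0 w * Y t' w) - \int[P]_w (k t' w * Y t' w)| <= e / 2.
  have I12 := itgB measurableT (IkY s0 t' t'T) (IkY t' t' t'T).
  rewrite (RintB measurableT (IkY s0 t' t'T) (IkY t' t' t'T)).
  have [ID BD] := displacement (lT _ (cS t)) (lT _ (cS s)).
  have J1 := itgZ (del^-1 * L ^+ 2) measurableT ID; have J2 := itgZ del measurableT (IY t' t'T).
  have JB := itgD measurableT J1 J2.
  apply: le_trans.
    apply: (le_Rint_bound measurableT I12 JB) => w _; rewrite -mulrBl normrM.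
    have h3 : `|k s0 w - k t' w| ^+ 2 <= L ^+ 2 * \sum_q (w t' ord0 q - w s0 ord0 q) ^+ 2.
      apply: (@le_trans _ _ ((L * `|w t' - w s0|) ^+ 2)).
        rewrite lerXn2r ?nnegrE ?mulr_ge0//; have := W_lip i (0 - w s0) (0 - w t').
        have -> : 0 - w s0 - (0 - w t') = w t' - w s0 by apply/rowP => q; rewrite !mxE; ring.
        exact.
      rewrite exprMn; apply: ler_wpM2l; first exact: sqr_ge0.
      by apply: (le_trans (norm_sqs _)); apply: ler_sum => q _; rewrite !mxE.
    by rewrite [leRHS]addrC; apply: young_le => //; rewrite real_normK ?num_real.
  rewrite (RintegralD measurableT J1 J2) (RintegralZl _ measurableT ID) (RintegralZl _ measurableT (IY t' t'T)).
  have ts : `|t' - s0| <= `|s - t| by rewrite [`|s - t|]distrC; exact: clamp_lip.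
  have p1 : del^-1 * L ^+ 2 * \int[P]_w (\sum_q (w t' ord0 q - w s0 ord0 q) ^+ 2) <= e / 4.
    apply: (@le_trans _ _ (Q * `|s - t|)).
      rewrite /Q -[leRHS]mulrA; apply: ler_wpM2l; first by apply: mulr_ge0; [rewrite invr_ge0 ltW|exact: sqr_ge0].
      by apply: (le_trans BD); apply: ler_wpM2l => //; apply: mulr_ge0 => //; apply: mulr_ge0 => //; exact: addr_ge0.
    have := ltW t2; rewrite ler_pdivlMr ?ltr_wpDl// => hz; apply: le_trans hz.
    by rewrite mulrC ler_wpM2l// lerDl.
  have p2 : del * \int[P]_w (Y t' w ^+ 2) <= e / 4 by apply: le_trans delK; rewrite ler_wpM2l ?(ltW del0)//; exact: YK.
  by apply: (le_trans (lerD p1 p2)); rewrite -mulrDr; lra.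
have tri (x y z : R) : `|x - y| <= e / 2 -> `|y - z| <= e / 2 -> `|x - z| <= e.
  by move=> xy yz; rewrite (splitr e) -(subrK y x) -addrA; apply: (le_trans (ler_normD _ _)); exact: lerD.
exact: tri h1 h2.
Qed.

Let partial_V i j t x : pderivable j (V i t) x /\ partial j (V i t) x = convP P (H i j) t x.
Proof.
have E : V i t = fun y => \int[P]_w (partial i W (y - w t) * 1).
  by apply/funext => y; apply: eq_Rintegral => w _; rewrite mulr1.
have kC z : `|partial j (partial i W) z| <= C by rewrite Hsym.
have ik y : itg P setT (fun w : Om => partial i W (y - w t) * 1).
  by apply: (itg_eq measurableT (itgV i t y)) => w _; rewrite mulr1.
have [p1 p2] := @partial_weighted R d T P (partial i W) j C (fun=> 1) t x (W2.2 i) kC (itg_cst P 1) ik.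
by rewrite E; split => //; rewrite p2; apply: eq_Rintegral => w _; rewrite mulr1 Hsym.
Qed.

Let partial_J i j t x : 0 <= t < T -> pderivable j (J i t) x /\
  partial j (J i t) x = \int[P]_w (H i j (x - w t) * ps i (t, w t)).
Proof.
move=> tT; have kC z : `|partial j (partial i W) z| <= C by rewrite Hsym.
have [p1 p2] := @partial_weighted R d T P (partial i W) j C (fun w : Om => ps i (t, w t)) t x (W2.2 i) kC
  (itg_ps_good cps i (good_t tT)).2 (fun y => itgJ i y tT).
by split; [exact: p1|rewrite -(Hsym i j); exact: p2].
Qed.

Let partialZ (k : R) f i x : pderivable i f x -> pderivable i (fun y : 'rV[R]_d => k * f y) x /\ partial i (fun y => k * f y) x = k * partial i f x.
Proof.
move=> df; have [p1 p2] := partialM (derivable_cst k x (delta_mx ord0 i) : pderivable i (fun=> k) x) df.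
by split => //; rewrite p2 partial_cst mulr0 addr0.
Qed.

Let in0T t : 0 <= t <= T -> `[0, T]%classic t. Proof. by rewrite /= in_itv. Qed.

Let psi_pC2 i t : 0 <= t <= T -> pC2 (psi i t). Proof. exact: C12_pC2 (Psi_C12 i). Qed.

(* The equation of the corrector reads [d/dt Psi^j = d/dx_j Theta], as [Psi] is curl-free. *)
Let partial_Theta j t x : 0 <= t < T -> pderivable j (Theta t) x /\ partial j (Theta t) x = dt `[0, T] (psi j) t x.
Proof.
move=> tT; have tT' : 0 <= t <= T by have /andP[-> /ltW] := tT.
have dp i k : pderivable k (psi i t) x by exact: (psi_pC2 i tT').1.1.
have dp2 i k l : pderivable l (partial k (psi i t)) x by exact: ((psi_pC2 i tT').2 k).1.
have t1 i : pderivable j (fun y => psi i t y * V i t y - J i t y) x /\ partial j (fun y => psi i t y * V i t y - J i t y) x =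
   psi i t x * convP P (H i j) t x + V i t x * partial i (psi j t) x - \int[P]_w (H i j (x - w t) * ps i (t, w t)).
  have [v1 v2] := partial_V i j t x; have [j1 j2] := partial_J i j x tT.
  have [m1 m2] := partialM (dp i j) v1; have [n1 n2] := partialB m1 j1.
  by split; [exact: n1|rewrite n2 m2 v2 j2 (curl _ _ _ tT')].
have t3 i : pderivable j (fun y => psi i t y ^+ 2) x /\ partial j (fun y => psi i t y ^+ 2) x = psi i t x * partial i (psi j t) x + psi i t x * partial i (psi j t) x.
  have [m1 m2] := partialM (dp i j) (dp i j); rewrite (curl _ _ _ tT') in m2.
  by have E : (fun y => psi i t y ^+ 2) = fun y => psi i t y * psi i t y by apply/funext => y; rewrite expr2.
have [s1 s1'] := partial_sum (index_enum 'I_d) (fun i => (t1 i).1).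
have [s2 s2'] := partial_sum (index_enum 'I_d) (fun i => dp2 i i j).
have [s3 s3'] := partial_sum (index_enum 'I_d) (fun i => (t3 i).1).
have [z2 z2'] := partialZ 2^-1 s2; have [z3 z3'] := partialZ 2^-1 s3.
have [b1 b1'] := partialB s1 z2; have [b2 b2'] := partialB b1 z3.
split; first exact: b2.
rewrite [LHS]b2' b1' z2' z3' s1' s2' s3'.
under eq_bigr do rewrite (t1 _).2.
(* Schwarz and the symmetry of the first derivatives turn the derivative in direction [j] of the
   divergence into the Laplacian of the [j]-th component. *)
under [X in _ - _ * X - _]eq_bigr => i _.
  rewrite (schwarz x i j (psi_pC2 i tT')) (_ : partial j (psi i t) = partial i (psi j t)); last by apply/funext => y; exact: curl.
  over.
under [X in _ - _ - _ * X]eq_bigr do rewrite (t3 _).2.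
have := pde j x tT; rewrite /residual (nonlocal_split T0 Psi_C12 cH HC Hps FM iM martP j x tT) -/(laplacian _ _).
have -> : \sum_i b i (t, x) * partial i (psi j t) x = \sum_i psi i t x * partial i (psi j t) x - \sum_i V i t x * partial i (psi j t) x.
  by rewrite -sumrB; apply: eq_bigr => i _; rewrite /b psE// mulrDl mulNr addrC.
rewrite !sumrB !big_split /=.
have alg (dd Dd E B A Cc : R) : dd + 2^-1 * Dd + (E - B) - (A - Cc) = 0 -> A + B - Cc - 2^-1 * Dd - 2^-1 * (E + E) = dd by lra.
by move=> h; exact: alg h.
Qed.

(** The part of [Theta] at the origin that is continuous at all times, by clamping; only the
    continuity of [J] is restricted to times before [T]. *)
Let Gc (t : R) : R := \sum_i ps i (t, 0) * V i t 0 - 2^-1 * (\sum_i clamped T (fun t => partial i (psi i t)) (t, 0)) - 2^-1 * (\sum_i ps i (t, 0) ^+ 2).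

Let ThetaE t : 0 <= t <= T -> Theta t 0 = Gc t - \sum_i J i t 0.
Proof.
move=> tT; rewrite /Theta /Inter /Gc sumrB.
under [X in _ = X - _ - _ - _]eq_bigr do rewrite psE//.
under [X in _ = _ - _ * X - _ - _]eq_bigr do rewrite /clamped /= clamp_id//.
under [X in _ = _ - _ * X - _]eq_bigr do rewrite psE//.
have alg (a j' c e : R) : a - j' - c - e = a - c - e - j' by ring.
exact: alg.
Qed.

Let cGc : continuous Gc.
Proof.
have c1 i : continuous (fun t => ps i (t, 0)) by apply: continuous_slice.
have c2 i : continuous (fun t => V i t 0) by exact: (@continuous_slice R d (fun p => V i p.1 p.2) 0 (@cV i)).
have c3 i : continuous (fun t => clamped T (fun t => partial i (psi i t)) (t, 0)).
  by apply: continuous_slice; have [_ _ c _] := Psi_C12 i; exact: clamped_continuous.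
move=> t; apply: cvgB_fun.
  apply: cvgB_fun.
    by apply: cvg_sum_fin => i; exact: (continuousM (@c1 i t) (@c2 i t)).
  apply: cvgM_fun; first exact: cvg_cst.
  by apply: cvg_sum_fin => i; exact: c3.
apply: cvgM_fun; first exact: cvg_cst.
apply: cvg_sum_fin => i; apply: (@continuous_comp _ _ _ (fun t : R => ps i (t, 0)) (fun x => x ^+ 2)); [exact: c1|exact: exprn_continuous].
Qed.

(** Integrability up to [T] does not come from continuity, which may be lost there: the integrand is
    bounded by [L^2] times the squared position plus the squared corrector, both integrable over
    time and paths. *)
Let itg_J i : itg leb `[0, T] (fun t => J i t 0).
Proof.
pose f (p : R * Om) := partial i W (0 - p.2 p.1) * ps i (p.1, p.2 p.1).
have ck : continuous (fun p : R * 'rV[R]_d => partial i W (0 - p.2)).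
  move=> p; apply/cts_txP => e e0; have /cts_rVP /(_ e e0)[del del0 h] := @cW i (0 - p.2).
  by exists del => // s y _ yp; apply: h; rewrite subrBB distrC.
have cf : continuous (fun p : R * 'rV[R]_d => partial i W (0 - p.2) * ps i p).
  by move=> p; exact: (continuousM (@ck p) (@cps i p)).
have mf : measurable_fun setT f by exact: (@measurable_along_path R d T (fun p => partial i W (0 - p.2) * ps i p)).
have mn : measurable_fun setT (fun p : R * Om => `|f p|) by exact: measurableT_comp.
have cn2 : continuous (fun p : R * 'rV[R]_d => `|p.2| ^+ 2).
  move=> p; apply: cvg_sqr.
  exact: (continuous_snd (f := fun x : 'rV[R]_d => `|x|) norm_continuous).
have cp2 : continuous (fun p => ps i p ^+ 2).
  by move=> p; apply: (@continuous_comp _ _ _ (ps i) (fun x => x ^+ 2)); [exact: cps|exact: exprn_continuous].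
have sq (g : R * 'rV[R]_d -> R) : continuous g -> (forall p, 0 <= g p) -> (\int[leb]_(t in `[0%R, T]) \int[P]_w (g (t, w t))%:E < +oo)%E ->
    itg P setT (fun w : Om => \int[leb]_(r in `[0, T]) g (r, w r)).
  move=> cg g0 Ffin.
  have Fabs : (\int[leb]_(t in `[0%R, T]) \int[P]_w (`|g (t, w t)|)%:E < +oo)%E.
    apply: le_lt_trans Ffin; rewrite le_eqVlt; apply/orP; left; apply/eqP.
    by apply: eq_integral => t _; apply: eq_integral => w _; rewrite ger0_norm.
  by have [_ I _] := fubini_path (measurable_along_path cg) Fabs.
have I1 := sq _ cn2 (fun p => sqr_ge0 _) energies.1; have I2 := sq _ cp2 (fun p => sqr_ge0 _) (Hps i).
have Ffin : (\int[leb]_(t in `[0%R, T]) \int[P]_w (`|f (t, w)|)%:E < +oo)%E.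
  have pn (w : Om) : continuous (fun r => `|f (r, w)|).
    move=> r; apply: (@cvg_norm _ _ _ _ _ (fun r => f (r, w))).
    exact: (@continuous_along_path R d T (fun p => partial i W (0 - p.2) * ps i p) w cf r).
  apply: (tonelli_path_fin mn) => [p|w|]; [exact: normr_ge0|by apply: itg_cts_itv; exact: pn|].
  apply: (itg_le measurableT (measurable_Rint_path 0 T mn) (itgD measurableT (itgZ (L ^+ 2) measurableT I1) I2)) => w _.
  rewrite ger0_norm; last by apply: Rintegral_ge0 => r _; exact: normr_ge0.
  have K1 : itg leb `[0, T] (fun r => `|w r| ^+ 2).
    by apply: itg_cts_itv; exact: (@continuous_along_path R d T (fun p => `|p.2| ^+ 2) w cn2).
  have K2 : itg leb `[0, T] (fun r => ps i (r, w r) ^+ 2).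
    by apply: itg_cts_itv; exact: (@continuous_along_path R d T (fun p => ps i p ^+ 2) w cp2).
  have K3 := leb_itgZ R _ _ (L ^+ 2) (mI 0 T) K1.
  rewrite -(leb_RintegralZl R _ _ (L ^+ 2) (mI 0 T) K1).
  rewrite -(leb_RintegralD R _ _ _ (mI 0 T) K3 K2).
  apply: (leb_le_Rintegral R); [exact: mI|by apply: itg_cts_itv; exact: pn|exact: (leb_itgD R _ _ _ (mI 0 T) K3 K2)|].
  move=> r _; rewrite /f /= normrM -[ps i _ ^+ 2]real_normK ?num_real// -exprMn.
  have h := kb i (0 - w r); rewrite sub0r normrN add0r in h.
  have alg (a c l : R) : 0 <= a -> 0 <= c -> a <= l -> a * c <= l ^+ 2 + c ^+ 2 by move=> a0 c0 al; have := sqr_ge0 (l - c); nra.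
  by apply: alg => //; rewrite sub0r.
by have [] := fubini_path mf Ffin.
Qed.

Let itg_Theta : itg leb `[0, T] (fun t => Theta t 0).
Proof.
have I1 := itg_cts_itv 0 T cGc.
have I2 := leb_itg_sum R _ _ (index_enum 'I_d) _ (mI 0 T) itg_J.
apply: (leb_itg_eq R _ _ _ (mI 0 T) (leb_itgB R _ _ _ (mI 0 T) I1 I2)) => t.
by rewrite /= in_itv/= => tT; rewrite ThetaE.
Qed.

Let continuous_Theta S : 0 < S -> S < T -> continuous (fun t => Theta (clamp S t) 0).
Proof.
move=> S0 ST; have -> : (fun t => Theta (clamp S t) 0) = fun t => Gc (clamp S t) - \sum_i J i (clamp S t) 0.
  apply/funext => t; rewrite ThetaE//; have /andP[-> h] := clamp_itv t (ltW S0); exact: le_trans h (ltW ST).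
have cc : continuous (clamp S).
  move=> t; apply/cvgrPdist_le => e e0; have /cvgrPdist_le /(_ e e0) : (fun s : R => s) @ t --> t by exact: cvg_id.
  by apply: filterS => s; exact: le_trans (clamp_lip _ _ _).
move=> t; apply: cvgB_fun.
  by apply: (@continuous_comp _ _ _ (clamp S) Gc); [exact: cc|exact: cGc].
by apply: cvg_sum_fin => i; exact: continuous_J.
Qed.

Let pot := full_potential psi (fun t => Theta t 0).

Let grad_pot t : 0 <= t <= T -> grad (pot t) = Psi t.
Proof.
move=> tT; apply/funext => x; apply/rowP => i; rewrite mxE.
by have [] := full_potential_grad T0 Psi_C12 curl (fun t => Theta t 0) x i tT.
Qed.

Let pot_pC1 t : 0 <= t <= T -> pC1 (pot t).
Proof.
move=> tT; apply: (@pC1_ext _ _ _ (fun i => psi i t)) => [i x|i].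
  exact: (full_potential_grad T0 Psi_C12 curl (fun t => Theta t 0) x i tT).
exact: pC1_continuous (psi_pC2 i tT).1.
Qed.

(** The fundamental theorem along the ray from 0 to [x] gives [potential_rate] as
    [Theta t x - Theta t 0]; this is why [Theta] at the origin was added to the time derivative
    through [action]. *)
Let rate_Theta t x : 0 <= t < T -> potential_rate T psi t x + Theta t 0 = Theta t x.
Proof.
move=> tT; have tT' : 0 <= t <= T by have /andP[-> /ltW] := tT.
have cd i : continuous (dt `[0, T] (psi i) t).
  have [_ [_ c] _ _] := Psi_C12 i.
  exact: clamped_slice tT' (clamped_continuous T0' c).
have TC : pC1 (Theta t) by apply: (@pC1_ext _ _ _ (fun j => dt `[0, T] (psi j) t)) => // i y; exact: partial_Theta.
have dF (r : R) : is_derive r 1 (fun r : R => Theta t (r *: x)) (\sum_i dt `[0, T] (psi i) t (r *: x) * x ord0 i).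
  have h := @pC1_is_derive_line R d (Theta t) 0 x r TC.
  have E0 : (fun h : R => Theta t (0 + h *: x)) = fun h : R => Theta t (h *: x) by apply/funext => s; rewrite add0r.
  rewrite E0 add0r in h; apply: (is_derive_eq h); apply: eq_bigr => i _.
  by rewrite mulrC (partial_Theta i (r *: x) tT).2.
rewrite /potential_rate (FTC_is_derive ler01 dF).
  by rewrite scale1r scale0r subrK.
move=> r; apply: cvg_sum_fin => i.
apply: cvgM_fun; last exact: cvg_cst.
by apply: (@continuous_comp _ _ _ (fun r : R => r *: x) (dt `[0, T] (psi i) t)); [exact: scalel_continuous|exact: cd].
Qed.

Lemma classical_solution_exists (mu_in mu_fin : probability 'rV[R]_d R) :
  (forall A, measurable A -> marg P 0 A = mu_in A) -> (forall A, measurable A -> marg P T A = mu_fin A) ->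
  exists psi : R -> 'rV[R]_d -> R,
    (forall (t : R) x, 0 <= t <= T -> differentiable (psi t) x /\ Psi t x = grad (psi t) x) /\
    classical_solution T W mu_in mu_fin (marg P) psi mu.
Proof.
move=> E_in E_fin; exists pot; split.
  by move=> t x tT; split; [have [] := pC1_is_diff x (pot_pC1 tT)|rewrite grad_pot].
split.
- split; first exact: (full_potential_C12 T0 Psi_C12 curl itg_Theta continuous_Theta).
  exact: (full_potential_continuous T0 Psi_C12 itg_Theta).
- exact: mu_C12.
- move=> t x tT; have tT' : 0 <= t <= T by have /andP[-> /ltW] := tT.
  rewrite grad_pot//; pose vf (y : 'rV[R]_d) := \sum_i partial i W (x - y) * (psi i t x - psi i t y).
  have E y : dotv (grad W (x - y)) (Psi t x - Psi t y) = vf y.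
    by apply: eq_bigr => i _; rewrite /psi !mxE.
  have mvf : measurable_fun setT vf.
    apply: measurable_sum => i; apply: measurable_funM; first exact: measurable_gradW.
    by apply: measurable_funB => //; apply: continuous_measurable_rV; exact: pC1_continuous (psi_pC2 i tT').1.
  have Ii i := itgB measurableT (itgZ (psi i t x) measurableT (itgV i t x)) (itgJ i x tT).
  have Ev (w : Om) : \sum_i (psi i t x * partial i W (x - w t) - partial i W (x - w t) * ps i (t, w t)) = vf (w t).
    by apply: eq_bigr => i _; rewrite psE// mulrBr [psi i t x * _]mulrC.
  have Iv : itg P setT (fun w : Om => vf (w t)).
    by apply: (itg_eq measurableT (itg_sum (index_enum 'I_d) measurableT Ii)) => w _; exact: Ev.
  have Int : \int[P]_w vf (w t) = Inter t x.
    under eq_Rintegral do rewrite -Ev.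
    rewrite Rint_sum//; apply: eq_bigr => i _.
    by rewrite -(RintB measurableT (itgZ (psi i t x) measurableT (itgV i t x)) (itgJ i x tT)) (RintegralZl _ measurableT (itgV i t x)).
  split; first by apply: (itg_eq measurableT (itg_marg mvf Iv)) => y _; rewrite /= E.
  under eq_Rintegral do rewrite E.
  rewrite (Rint_marg mvf Iv) Int (full_potential_dt T0 Psi_C12 itg_Theta continuous_Theta x tT).2 rate_Theta//.
  have -> : laplacian (pot t) x = \sum_i partial i (psi i t) x.
    apply: eq_bigr => i _; congr (partial i _ x); apply/funext => y.
    by have [] := full_potential_grad T0 Psi_C12 curl (fun t => Theta t 0) y i tT'.
  rewrite enorm_sq /Theta -/(psi _ _ _).
  have alg (a c e : R) : a - 2^-1 * c - 2^-1 * e + 2^-1 * c + 2^-1 * e = a by ring.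
  exact: alg.
- move=> t x tT; rewrite grad_pot//.
  have Ef i : (fun y => (mu t y *: (- convgrad W (marg P t) y + Psi t y)) ord0 i) = fun y => mu t y * b i (t, y).
    by apply/funext => y; rewrite mxE driftE.
  have c1 i : continuous (clamped T (fun t => partial i (psi i t))) by have [_ _ c _] := Psi_C12 i; exact: clamped_continuous.
  have cl s : 0 <= clamp T s <= T by exact: clamp_itv.
  (* [b] is defined at all times, with its corrector part clamped, so the derivative is computed
     without restriction on [s]. *)
  have db i s y : pderivable i (fun y => b i (s, y)) y /\ partial i (fun y => b i (s, y)) y = - convP P (H i i) s y + partial i (psi i (clamp T s)) y.
    have [v1 v2] := partial_V i i s y; have [n1 n2] := partialZ (-1) v1.
    have dpsi : pderivable i (psi i (clamp T s)) y by exact: (psi_pC2 i (cl s)).1.1.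
    have [m1 m2] := partialD n1 dpsi.
    have Eb : (fun y => b i (s, y)) = fun y => -1 * V i s y + psi i (clamp T s) y by apply/funext => z; rewrite /b mulN1r.
    by rewrite Eb; split => //; rewrite m2 n2 v2 mulN1r.
  have kH i z : `|H i i z| <= C + 0 * `|z| by rewrite mul0r addr0.
  have cdb i : continuous (clamped T (fun t => partial i (fun y => b i (t, y)))).
    have cVH := convP_continuous T0' Irun (lexx 0) (kH i) (@cH i i).
    have -> : clamped T (fun t => partial i (fun y => b i (t, y))) = fun p => - convP P (H i i) (clamp T p.1) p.2 + clamped T (fun t => partial i (psi i t)) p.
      by apply/funext => p; rewrite /clamped /= (db i _ _).2 (clamp_id (cl _)).
    move=> p; apply: cvgD_fun; last exact: c1.
    apply: (@continuousN _ _ _ (fun p => convP P (H i i) (clamp T p.1) p.2)).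
    apply/cts_txP => e e0; have [del del0 h] := (cts_txP _ (clamp T p.1, p.2)).1 (cVH _) e e0.
    by exists del => // s y sp yp; apply: (h (clamp T s) y); [exact: le_lt_trans (clamp_lip _ _ _) sp|exact: yp].
  have [f1 f2] := fokker_planck T0 cb indep Hb mu_dens mu_gt0 mu_C12 (fun s i y _ => (db i s y).1) cdb x tT.
  split.
  + move=> i; apply: (itg_eq measurableT (itg_marg (measurable_gradW i x) (itgV i t x))) => y _.
    by rewrite /grad mxE.
  + by move=> i; rewrite Ef.
  + have Ed : divergence (fun y => mu t y *: (- convgrad W (marg P t) y + Psi t y)) x = \sum_i partial i (fun y => mu t y * b i (t, y)) x.
      by apply: eq_bigr => i _; rewrite Ef.
    by rewrite Ed.
- have [m0 d0] := mu_dens (introT andP (conj (lexx 0) T0')).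
  have [m1 d1] := mu_dens (introT andP (conj T0' (lexx T))).
  by split; split => // A mA; [rewrite -E_in// d0|rewrite -E_fin// d1].
Qed.

End solution.

(** A unit vector exists because [d >= 1], and the bound dominates an absolute value. *)
Lemma quadratic_bound_ge0 (R : realType) (d : nat) (W : 'rV[R]_d -> R) (C : R) : (1 <= d)%N ->
  (forall z v : 'rV[R]_d, enorm v = 1 -> `|dotv v (v *m hess W z)| <= C) -> 0 <= C.
Proof.
move=> d1 H; pose v : 'rV[R]_d := delta_mx ord0 (Ordinal d1).
have v1 : enorm v = 1.
  rewrite /enorm /dotv (bigD1 (Ordinal d1))//= big1 => [|i ni]; last by rewrite !mxE (negbTE ni) andbF mul0r.
  by rewrite !mxE !eqxx mulr1 addr0 sqrtr1.
exact: le_trans (normr_ge0 _) (H 0 v v1).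
Qed.

Lemma initial_square_integrable (R : realType) (d : nat) (T : R) (mu_in : probability 'rV[R]_d R)
    (P : probability (path_space R d T) R) : finite_second_moment mu_in ->
  (forall A, measurable A -> marg P 0 A = mu_in A) ->
  forall i, P.-integrable setT (EFin \o (fun w : path_space R d T => w 0 ord0 i ^+ 2)).
Proof.
move=> Ffin E i.
have cn : measurable_fun setT (fun x : 'rV[R]_d => enorm x ^+ 2).
  under eq_fun do rewrite enorm_sq.
  by apply: measurable_sum => k; apply: (measurableT_comp (exprn_measurable 2)); exact: measurable_coord.
have FfinP : (\int[P]_w (enorm ((w : path_space R d T) 0) ^+ 2)%:E < +oo)%E.
  rewrite -(@ge0_integral_marg R d T P 0 (fun x => (enorm x ^+ 2)%:E)); last 2 first.
  - exact/measurable_EFinP.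
  - by move=> x; rewrite lee_fin sqr_ge0.
  apply: le_lt_trans Ffin; rewrite le_eqVlt; apply/orP; left; apply/eqP.
  by apply: eq_measure_integral => A mA _; exact: E.
have mi : measurable_fun setT (fun w : path_space R d T => w 0 ord0 i ^+ 2).
  apply: (@measurable_at R d T (fun x => x ord0 i ^+ 2) 0).
  by apply: (measurableT_comp (exprn_measurable 2)); exact: measurable_coord.
apply: itg_ge0P => //; first by move=> w _; exact: sqr_ge0.
apply: le_lt_trans FfinP; apply: ge0_le_integral => //.
- by move=> w _; rewrite lee_fin sqr_ge0.
- exact/measurable_EFinP.
- by apply/measurable_EFinP; exact: (@measurable_at R d T (fun x => enorm x ^+ 2) 0).
- move=> w _; rewrite lee_fin enorm_sq (bigD1 i)//= lerDl; apply: sumr_ge0 => k _; exact: sqr_ge0.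
Qed.

Theorem corollary1p1 (R : realType) (d : nat) (T : R) (W : 'rV[R]_d -> R)
    (mu_in mu_fin : probability 'rV[R]_d R)
    (P : probability (path_space R d T) R)
    (Psi : R -> 'rV[R]_d -> 'rV[R]_d) (mu : R -> 'rV[R]_d -> R)
    (d_ge1 : (1 <= d)%N) (T_gt0 : 0 < T)
    (W_C2 : class_C 2 W)
    (W_sym : forall z, W z = W (- z))
    (W_hess : exists C : R, forall z v : 'rV[R]_d, enorm v = 1 ->
       `|dotv v (v *m hess W z)| <= C)
    (mu_in_P2 : finite_second_moment mu_in)
    (mu_fin_P2 : finite_second_moment mu_fin)
    (mu_in_F : (free_energy W mu_in < +oo)%E)
    (mu_fin_F : (free_energy W mu_fin < +oo)%E)
    (P_opt : MFSP_optimizer W mu_in mu_fin P)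
    (Psi_corr : corrector W mu_in P Psi)
    (mu_dens : forall t : R, 0 <= t <= T -> has_density (marg P t) (mu t))
    (mu_gt0 : forall (t : R) x, 0 <= t <= T -> 0 < mu t x)
    (mu_C12 : C12 `[0, T] mu)
    (Psi_C12 : forall i, C12 `[0, T] (fun t x => Psi t x ord0 i)) :
  exists psi : R -> 'rV[R]_d -> R,
    (forall (t : R) x, 0 <= t <= T ->
       differentiable (psi t) x /\ Psi t x = grad (psi t) x) /\
    classical_solution T W mu_in mu_fin (marg P) psi mu.
Proof.
have [C HC] := W_hess; have C0 := quadratic_bound_ge0 d_ge1 HC.
have W2 := class_C2_pC2 W_C2.
have [[P_P1 E_in E_fin] _] := P_opt.
have [Psi_H1 Psi_BM Psi_M] := Psi_corr.
have C20 : 0 <= 2 * C by rewrite mulr_ge0.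
exact: (classical_solution_exists T_gt0 W2 W_sym C20 (hess_bounded W2 HC) P_P1
  (initial_square_integrable mu_in_P2 E_in) Psi_H1 Psi_BM Psi_M mu_dens mu_gt0 mu_C12 Psi_C12 E_in E_fin).
Qed.
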